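(* Suppose that $n$ is even. Let $\chi$ be a character of $F^*$, $\psi$ a non-trivial character of $F$, and $\phi\in S(F)$. For every integer $k$ with $0\le k<n$ one has, as meromorphic functions of $s$, $$\zeta_{n,k}(s,\chi,\widetilde\phi)=\sum_{m=0}^{n-1}\widetilde\theta_m(s,\chi,\psi)\,\zeta_{n,\,m+e(\psi,\chi^2)-k}(1-s,\chi^{-1},\phi),$$ where $\widetilde\theta_m(s,\chi,\psi)$ $(0\le m\le n-1)$ is defined as follows. If $\chi$ is unramified, then $$\widetilde\theta_m(s,\chi,\psi)=\gamma_F^{-1}(\psi_{-1})\,\epsilon^{-1}(2s,\chi^2,\psi_2)\,\epsilon(s+\tfrac12,\chi,\psi)\times\begin{cases}q^{-\frac12}q^{s}\chi^{-1}(\varpi) & m=n-1,\\ (1-q^{-1})\bigl(q^{-s}\chi(\varpi)\bigr)^m L(ns,\chi^n) & m\in2\mathbb Z,\\ 0&\text{otherwise.}\end{cases}$$ If $\chi$ is ramified but $\chi^2$ is unramified, then $$\widetilde\theta_m(s,\chi,\psi)=\gamma_F^{-1}(\psi_{-1})\,\chi(-1)\,\epsilon^{-1}(2s,\chi^2,\psi_2)\,\epsilon(s+\tfrac12,\chi,\psi)\,\bigl(q^{-s}\chi(\varpi)\bigr)^{m-1}L(ns,\chi^n)\times\begin{cases}L^{-1}(1-ns,\chi^{-n}) & m=n-1,\\ 1-q^{-1} & m\in1+2\mathbb Z,\ m\ne n-1,\\ 0&\text{otherwise.}\end{cases}$$ If $\chi^2$ is ramified, then $$\widetilde\theta_m(s,\chi,\psi)=\begin{cases}\gamma_F^{-1}(\psi_{-1})\,\chi(-1)\,\epsilon^{-1}(2s,\chi^2,\psi_2)\,\epsilon(s+\tfrac12,\chi,\psi)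 & m=0,\\ 0 & m\ne0.\end{cases}$$
   Context: $n\ge 1$ is an integer, $F$ is a $p$-adic field of residual characteristic $p$ with $\gcd(p,n)=1$, and $F^*$ contains the full group of $n$-th roots of unity (for $n$ even, $p$ is therefore odd). $\mathbb O_F$ is the ring of integers, $\mathbb P_F$ its maximal ideal, $\varpi$ a fixed generator of $\mathbb P_F$, $q$ the cardinality of the residue field, $\|\varpi\|=q^{-1}$. $e(\psi)$ is the conductor of $\psi$ (smallest integer $m$ with $\psi$ trivial on $\mathbb P_F^m$); $e(\chi)$ is the conductor of $\chi$ ($0$ if $\chi$ is unramified, otherwise the least $m\ge 1$ with $\chi$ trivial on $1+\mathbb P_F^m$); $e(\psi,\chi)=e(\psi)-e(\chi)$. For $a\in F^*$, $\psi_a(x)=\psi(ax)$. Characters of $F^*$ need not be unitary. $S(F)$ is the space of Schwartz (locally constant, compactly supported) functions on $F$. $d_\psi x$ is the Haar measure on $F$ self dual with respect to $\psi$, $d_\psi^*x=\|x\|^{-1}d_\psi x$. The Weil index is $\gamma_F(\psi)=\lim_{r\to\infty}\int_{\mathbb P_F^{-r}}\psi(x^2)\,d_\psi x$, and $\gamma_\psi(a)=\gamma_F(\psi_a)/\gamma_F(\psi)$ for $a\in F^*$. For $\phi\in S(F)$ define $\widetilde\phi:F^*\to\mathbb C$ by $$\widetilde\phi(x)=\int_{F^*}\phi(y)\,\gamma_\psi^{-1}(xy)\,\psi(xy)\,d_\psi y.$$ For an integer $k$, $F^*_{n,k}$ is the set of elements of $F^*$ whose valuation lies in $k+n\mathbb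 Z$, and $\beta_{n,k}$ is its characteristic function. For a function $f$ on $F^*$, $\zeta(s,\chi,f)$ is the meromorphic continuation of $\int_{F^*}f(x)\|x\|^s\chi(x)\,d_\psi^*x$; for $\phi\in S(F)$, $\zeta_{n,k}(s,\chi,\phi)=\zeta(s,\chi,\phi\,\beta_{n,k})$ and $\zeta_{n,k}(s,\chi,\widetilde\phi)=\zeta(s,\chi,\widetilde\phi\,\beta_{n,k})$. (The integral for $\widetilde\phi$ converges absolutely in some strip $a<\mathrm{Re}(s)<a+1$ and is a rational function of $q^{-s}$.) $L(s,\chi)=(1-\chi(\varpi)q^{-s})^{-1}$ if $\chi$ is unramified and $L(s,\chi)=1$ otherwise. $\epsilon(s,\chi,\psi)$ is the Tate epsilon factor, defined by $\gamma(s,\chi,\psi)=\epsilon(s,\chi,\psi)\dfrac{L(1-s,\chi^{-1})}{L(s,\chi)}$, where the Tate gamma factor satisfies $\zeta(1-s,\chi^{-1},\widehat\phi)=\gamma(s,\chi,\psi)\zeta(s,\chi,\phi)$ for all $\phi\in S(F)$, with $\widehat\phi(x)=\int_F\phi(y)\psi(xy)\,d_\psi y$. *)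

(* Defs.v *)
From HB Require Import structures.
From mathcomp Require Import all_boot all_order all_algebra.
From mathcomp Require Import complex.
From mathcomp Require Import all_classical all_reals all_analysis.

Set Implicit Arguments.
Unset Strict Implicit.
Unset Printing Implicit Defensive.

Import Order.TTheory GRing.Theory Num.Theory.
Import numFieldNormedType.Exports.

Local Open Scope classical_set_scope.
Local Open Scope ring_scope.
Local Open Scope complex_scope.

(* R[i] carries the topology and the norm of the field structure, exactly as
   numFieldNormedType does for the abstract numFieldType's; with it, derivable
   for maps R[i] -> R[i] is complex differentiability. *)
HB.instance Definition _ (R : realType) := PseudoPointedMetric.copy R[i] R[i]^o.
HB.instance Definition _ (R : realType) := GRing.ComAlgebra.copy R[i] R[i]^o.
HB.instance Definition _ (R : realType) := Vector.copy R[i] R[i]^o.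
HB.instance Definition _ (R : realType) := NormedModule.copy R[i] R[i]^o.

(* {x | v x >= m} for a valuation v whose value at 0 is read as infinity,
   whatever v 0 is. *)
Definition valuation_ideal (F : fieldType) (v : F -> int) (m : int) : set F :=
  [set x | x = 0 \/ m <= v x].

(* A p-adic field: a field of characteristic 0, complete for a normalized
   discrete valuation whose residue field is finite. The value of pval at 0 is
   irrelevant. residue_card is the number of cosets of the maximal ideal in the
   ring of integers. *)
HB.mixin Record isPadicField F & GRing.Field F & Uniform F := {
  pval : F -> int;
  residue_card : nat;
  padic_pchar0 : [pchar F] =i pred0;
  pvalM : forall x y : F, x != 0 -> y != 0 -> pval (x * y) = pval x + pval y;
  pvalD : forall x y : F, x != 0 -> y != 0 -> x + y != 0 ->
    Order.min (pval x) (pval y) <= pval (x + y);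
  pval_normalized : exists2 x : F, x != 0 & pval x = 1;
  card_residue :
    ([set [set y : F | valuation_ideal pval 1 (y - x)]
      | x in valuation_ideal pval 0] #= `I_residue_card)%card;
  padic_entourage : entourage =
    filter_from setT
      (fun m : int => [set xy : F * F | valuation_ideal pval m (xy.2 - xy.1)]);
  padic_complete : forall G : set_system F, ProperFilter G ->
    cauchy G -> exists l : F, G --> l
}.

#[short(type="padicFieldType")]
HB.structure Definition PadicField :=
  {F of GRing.Field F & Uniform F & isPadicField F}.

#[non_forgetful_inheritance]
HB.instance Definition _ (F : padicFieldType) := isPointed.Build F 0.

Definition borel (F : padicFieldType) := g_sigma_algebraType (@open F).

Section PadicField.
Context {F : padicFieldType}.

(* PF 0 is the ring of integers, PF m the m-th power of the maximal ideal. *)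
Definition PF (m : int) : set F := valuation_ideal pval m.

Definition Fstar : set F := [set x | x != 0].

Definition unitsF : set F := [set x | x != 0 /\ pval x = 0].

Definition residual_char (p : nat) := prime p /\ PF 1 p%:R.

Definition uniformizer (w : F) := PF 1 = [set w * x | x in PF 0].

Definition Fstar_nk (n : nat) (k : int) : set F :=
  [set x | x != 0 /\ (pval x = k %[mod n])%Z].

End PadicField.

Section Complex.
Context {R : realType}.
Local Notation C := R[i].

(* a ^ z for a positive real base a and a complex exponent z *)
Definition cpow (a : R) (z : C) : C :=
  (expR (complex.Re z * ln a))%:C *
  (cos (complex.Im z * ln a) +i* sin (complex.Im z * ln a)).

(* A meromorphic function is represented by a total function whose values on a
   closed discrete set (containing the poles) are irrelevant; mero_eq is
   equality of meromorphic functions. *)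
Definition meromorphic (f : C -> C) := forall s0 : C,
  exists (k : nat) (g : C -> C),
    (\forall s \near s0, derivable g s 1) /\
    (\forall s \near s0^', (s - s0) ^+ k * f s = g s).

Definition mero_eq (f g : C -> C) := forall s0 : C, \forall s \near s0^', f s = g s.

Context {d : measure_display} {T : measurableType d}.
Implicit Types (mu : {measure set T -> \bar R}) (D : set T) (f : T -> C).

Definition cintegral mu D f : C :=
  (\int[mu]_(x in D) complex.Re (f x)) +i* (\int[mu]_(x in D) complex.Im (f x)).

Definition cintegrable mu D f :=
  mu.-integrable D (fun x => (complex.Re (f x))%:E) /\
  mu.-integrable D (fun x => (complex.Im (f x))%:E).

End Complex.

Section Tate.
Context {R : realType} {F : padicFieldType}.
Local Notation C := R[i].
Local Notation measureF := {measure set (borel F) -> \bar R}.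
Implicit Types (psi chi phi : F -> C) (nu : measureF) (s : C).

Local Notation q := ((@residue_card F)%:R : R).

Definition normF (x : F) : R := if x == 0 then 0 else q ^ (- pval x).

Definition is_addchar psi :=
  [/\ forall x y, psi (x + y) = psi x * psi y,
      forall x, `|psi x| = 1 & continuous psi].

Definition nontrivial_addchar psi := is_addchar psi /\ exists x, psi x != 1.

(* Characters of F^* are functions on F of which only the values on F^* matter;
   they need not be unitary. *)
Definition is_mulchar chi :=
  [/\ forall x y, x != 0 -> y != 0 -> chi (x * y) = chi x * chi y,
      forall x, x != 0 -> chi x != 0 &
      forall x, x != 0 -> {for x, continuous chi}].

Definition twist (a : F) psi : F -> C := fun x => psi (a * x).

Definition chexp chi (j : int) : F -> C := fun x => chi x ^ j.

Definition schwartz phi :=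
  (forall x, \forall y \near x, phi y = phi x) /\
  compact (closure [set x | phi x != 0]).

Definition addtriv psi (m : int) := forall x, PF m x -> psi x = 1.

Definition addcond psi : int :=
  xget 0 [set m | addtriv psi m /\ forall m', addtriv psi m' -> m <= m'].

Definition unramified chi := forall x, unitsF x -> chi x = 1.

Definition multriv chi (m : nat) := forall x, PF m%:Z x -> chi (1 + x) = 1.

Definition mulcond chi : nat :=
  if `[< unramified chi >] then 0%N else
  xget 0%N [set m | [/\ (1 <= m)%N, multriv chi m &
    forall m', (1 <= m')%N -> multriv chi m' -> (m <= m')%N]].

Definition cond psi chi : int := addcond psi - (mulcond chi)%:Z.

Definition is_haar nu :=
  [/\ forall (a : F) (A : set (borel F)), measurable A ->
        nu [set a + x | x in A] = nu A,
      forall K : set F, compact K -> (nu K < +oo)%E &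
      (0 < nu setT)%E].

Definition fourier nu psi phi : F -> C :=
  fun x => cintegral nu setT (fun y : F => phi y * psi (x * y)).

Definition self_dual_haar psi nu := is_haar nu /\
  forall phi, schwartz phi ->
    forall x, fourier nu psi (fourier nu psi phi) x = phi (- x).

(* The integrand of the zeta integral against d^*x = |x|^-1 dx. *)
Definition zeta_integrand chi (f : F -> C) s : F -> C :=
  fun x => f x * cpow (normF x) s * chi x * (normF x)^-1%:C.

(* Z is a meromorphic continuation of the integral, which converges absolutely
   on some vertical strip. The abscissas of absolute convergence form an
   interval, so Z is unique up to mero_eq and the choice of the strip, or of the
   representative picked by zeta below, does not matter. *)
Definition is_zeta nu chi (f : F -> C) (Z : C -> C) :=
  meromorphic Z /\ exists a b : R, a < b /\
    forall s, a < complex.Re s < b ->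
      cintegrable nu Fstar (zeta_integrand chi f s) /\
      Z s = cintegral nu Fstar (zeta_integrand chi f s).

Definition zeta nu s chi (f : F -> C) : C :=
  xget (fun=> 0) [set Z | is_zeta nu chi f Z] s.

Definition zeta_nk nu (n : nat) (k : int) s chi (f : F -> C) : C :=
  zeta nu s chi (fun x => f x * \1_(Fstar_nk n k) x).

Definition tateL (w : F) s chi : C :=
  if `[< unramified chi >] then (1 - chi w * cpow q (- s))^-1 else 1.

(* mu psi stands for the Haar measure self-dual with respect to psi. *)
Variable mu : (F -> C) -> measureF.

Definition weil_index psi : C :=
  lim ((fun r : nat =>
    cintegral (mu psi) (PF (- r%:Z)) (fun x : F => psi (x ^+ 2))) @ \oo).

Definition weil_ratio psi (a : F) : C :=
  weil_index (twist a psi) / weil_index psi.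

Definition tilde psi phi : F -> C := fun x =>
  cintegral (mu psi) Fstar
    (fun y : F => phi y * (weil_ratio psi (x * y))^-1 * psi (x * y)).

Definition tate_gamma s chi psi : C :=
  xget (fun=> 0) [set g | meromorphic g /\ forall phi, schwartz phi ->
    mero_eq
      (fun s => zeta (mu psi) (1 - s) (chexp chi (-1)) (fourier (mu psi) psi phi))
      (fun s => g s * zeta (mu psi) s chi phi)] s.

Definition tate_epsilon (w : F) s chi psi : C :=
  tate_gamma s chi psi * tateL w s chi / tateL w (1 - s) (chexp chi (-1)).

Definition theta (w : F) (n m : nat) s chi psi : C :=
  let chi2 := chexp chi 2 in
  let c := (weil_index (twist (-1) psi))^-1 *
    (tate_epsilon w (2 * s) chi2 (twist 2 psi))^-1 *
    tate_epsilon w (s + 2^-1) chi psi in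
  let X := cpow q (- s) * chi w in
  let Ln := tateL w (n%:R * s) (chexp chi n%:Z) in
  if `[< unramified chi >] then
    c * (if m == n.-1 then cpow q (- 2^-1) * cpow q s * (chi w)^-1
         else if ~~ odd m then (1 - q^-1%:C) * X ^+ m * Ln
         else 0)
  else if `[< unramified chi2 >] then
    c * chi (-1) * X ^ (m%:Z - 1) * Ln *
        (if m == n.-1 then
           (tateL w (1 - n%:R * s) (chexp chi (- n%:Z)))^-1
         else if odd m then 1 - q^-1%:C
         else 0)
  else if m == 0%N then c * chi (-1) else 0.

End Tate.

(* Main.v *)
(* For a kernel K(xy) = kap(xy) psi(xy), with kap invariant under 1 + P and
   periodic under w^n, the part of K on large |xy| does not contribute, and the
   differences K(z) - K(w^-n z) and phi(y) - phi(w^-n y) are compactly supported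
   in F^*. Hence (1 - X^n)(1 - (qX)^-n) times the zeta integral of T_K phi on a
   class of valuations mod n, X = chi(w) q^-s, is a finite sum of products of
   Laurent polynomials in q^-s. This gives the Tate functional equation (kap = 1,
   n = 1) and the one of the theorem (kap = 1 / weil_ratio), with coefficients
   the integrals A_j of kap psi chi |z|^-1 over the shells v(z) = j. The identity
   gam(psi_z) gam(psi_-z) = 1 turns A_j into a double integral of
   chi(z) psi(z (1 - y^2)), that is, into Gauss sums and a Jacobi sum, and
   G(chi^-1)^2 = chi(4) J(chi^-1) G(chi^-2) + error compares it with the epsilon
   factors. An identity theorem for meromorphic functions, obtained from
   Goursat's lemma and the maximum principle, makes the continuations unique. *)
Require Import Defs.
From mathcomp Require Import all_boot all_order all_algebra.
From mathcomp Require Import complex.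
From mathcomp Require Import all_classical all_reals all_analysis.
From mathcomp Require Import measurable_realfun.
From mathcomp Require Import ring lra zify.

Set Implicit Arguments.
Unset Strict Implicit.
Unset Printing Implicit Defensive.

Import Order.TTheory GRing.Theory Num.Theory.
Import numFieldNormedType.Exports.
Import Normc.

Local Open Scope classical_set_scope.
Local Open Scope ring_scope.
Local Open Scope complex_scope.
Local Notation Re := complex.Re.
Local Notation Im := complex.Im.

(** * Differentiability in epsilon-delta form *)

Section GenericDerivative.
Context {K : numFieldType}.

(** The obstacle is that [zeta] and [tate_gamma] are chosen functions, known only off a discrete
    set. Identities are therefore kept in the form D * zeta = P with D entire, and denominators are
    cancelled on punctured neighbourhoods only.

    What has to be known are the numbers A_j: multiplying their generating series by 1 - X^n leaves
    the coefficients A_j - chi(w)^n A_(j-n), and theta_m collects those with j = m + a mod n, where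
    a = e(psi, chi^2). The A_j vanish for j < a - 1 and are periodic up to the factor chi(w)^n for j
    > a. So class m sees A_(a+m), corrected by the isolated shell a - 1, which lies in class n - 1
    and explains the exceptional entry m = n - 1, and by the shell a + n in class 0.

    Evenness of n enters three times. It makes 2 a unit, so that the Weil index of psi_z depends on
    z only modulo 1 + P and squares; it makes w^n a square, so that the kernel is periodic; and a
    shift by n preserves the parity of e(psi) - j, on which A_j depends when chi^2 is unramified. *)

Lemma near_ballP (P : K -> Prop) (s : K) :
  (\forall x \near (s : K^o), P x) <->
  exists2 d : K, 0 < d & forall x, `|x - s| < d -> P x.
Proof.
split.
  move/nbhs_ballP => [d d0 H]; exists d => // x xs.
  by apply: H; rewrite -ball_normE /= distrC.
move=> [d d0 H]; apply/nbhs_ballP; exists d => // x.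
by rewrite -ball_normE /= distrC => /H.
Qed.

Lemma dnear_ballP (P : K -> Prop) (s : K) :
  (\forall x \near (s : K^o)^', P x) <->
  exists2 d : K, 0 < d & forall x, x != s -> `|x - s| < d -> P x.
Proof.
rewrite near_withinE; split.
  by move=> /near_ballP[d d0 H]; exists d => // x xs /H; apply.
by move=> [d d0 H]; apply/near_ballP; exists d => // x /H xP xs; apply: xP.
Qed.

(** Multiplying the difference quotient by [h] removes the exclusion of [h = 0]. The field stays
    abstract because the criterion serves the real functions exp, cos, sin as well as complex
    ones. *)
Lemma deriv_epsP (f : K -> K) (s l : K) :
  ((fun h : K => h^-1 *: ((f \o shift (s : K^o)) (h *: (1 : K^o)) - f s)) @
     (0 : K^o)^' --> (l : K^o)) <->
  forall e : K, 0 < e -> exists2 d, 0 < d &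
    forall h, `|h| < d -> `|f (s + h) - f s - l * h| <= e * `|h|.
Proof.
have key h : h != 0 -> `|f (s + h) - f s - l * h| =
    `|l - h^-1 *: ((f \o shift (s : K^o)) (h *: (1 : K^o)) - f s)| * `|h|.
  move=> h0; rewrite -normrM mulrBl /= -[_ *: (_ - _)]/(_ * _).
  rewrite -[h *: _]/(h * 1) mulr1 (addrC h s) mulrAC mulVf // mul1r.
  by rewrite distrC.
split.
  move=> /cvgrPdist_le H e e0; have /dnear_ballP[d d0 Hd] := H e e0.
  exists d => // h hd; have [->|h0] := eqVneq h 0.
    by rewrite addr0 subrr mulr0 subr0 !normr0 mulr0.
  rewrite key // ler_wpM2r //; apply: Hd => //.
  by rewrite subr0.
move=> H; apply/cvgrPdist_le => e e0; have [d d0 Hd] := H e e0.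
apply/dnear_ballP; exists d => // h h0; rewrite subr0 => hd.
have := Hd h hd; rewrite key // ler_pM2r ?normr_gt0 //.
Qed.

End GenericDerivative.

Section ComplexDerivative.
Context {R : realType}.
Local Notation C := R[i].
Implicit Types (f g : C -> C) (s z w : C).

Lemma normcE z : `|z| = (normc z)%:C.
Proof. by []. Qed.

Lemma normc_ge0 z : 0 <= normc z.
Proof. by case: z => a b /=; exact: sqrtr_ge0. Qed.

Lemma normc_gt0 z : (0 < normc z) = (z != 0).
Proof. by rewrite -ltcR -normcE normr_gt0. Qed.

Lemma normcD z w : normc (z + w) <= normc z + normc w.
Proof. exact: le_normcD. Qed.

Lemma normcB z w : normc (z - w) <= normc z + normc w.
Proof. by rewrite -(normcN w); exact: normcD. Qed.

Lemma normc_sub z w : normc (z - w) = normc (w - z).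
Proof. by rewrite -normcN opprB. Qed.

Lemma normcX z n : normc (z ^+ n) = normc z ^+ n.
Proof.
by elim: n => [|n IH]; rewrite ?expr0 ?normc1 // !exprS normcM IH.
Qed.

Lemma normcR (x : R) : normc x%:C = `|x|.
Proof. by rewrite /= expr0n addr0 sqrtr_sqr. Qed.

Lemma normc_Re z : `|Re z| <= normc z.
Proof. by rewrite -lecR; exact: normc_ge_Re. Qed.

Lemma normc_Im z : `|Im z| <= normc z.
Proof.
have -> : Im z = - Re (z * 'i) by case: z => a b /=; ring.
rewrite normrN; apply: le_trans (normc_Re _) _.
by rewrite normcM /= expr0n expr1n add0r sqrtr1 mulr1.
Qed.

Lemma normc_le_ReIm z : normc z <= `|Re z| + `|Im z|.
Proof.
rewrite {1}(complexE z); apply: le_trans (normcD _ _) _.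
by rewrite normcM !normcR /= expr0n expr1n add0r sqrtr1 mul1r.
Qed.

Lemma gt0_complexP z : 0 < z -> exists2 r : R, 0 < r & z = r%:C.
Proof. by case: z => a b; rewrite ltcE /= => /andP[/eqP -> a0]; exists a. Qed.

Lemma normc_lt z (d : R) : (`|z| < d%:C) = (normc z < d).
Proof. exact: ltcR. Qed.

Lemma nearCP (P : C -> Prop) s :
  (\forall x \near s, P x) <->
  exists2 d : R, 0 < d & forall x, normc (x - s) < d -> P x.
Proof.
have -> : (\forall x \near s, P x) <->
  exists2 d : C, 0 < d & forall x, `|x - s| < d -> P x by exact: near_ballP.
split=> [[_ /gt0_complexP[d d0 ->] H]|[d d0 H]].
  by exists d => // x xs; apply: H; exact: etrans (normc_lt _ _) xs.
exists d%:C => [|x xs]; first by rewrite ltcR.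
by apply: H; exact: etrans (esym (normc_lt _ _)) xs.
Qed.

Lemma dnearCP (P : C -> Prop) s :
  (\forall x \near s^', P x) <->
  exists2 d : R, 0 < d & forall x, x != s -> normc (x - s) < d -> P x.
Proof.
have -> : (\forall x \near s^', P x) <->
  exists2 d : C, 0 < d & forall x, x != s -> `|x - s| < d -> P x
  by exact: dnear_ballP.
split=> [[_ /gt0_complexP[d d0 ->] H]|[d d0 H]].
  by exists d => // x xs xd; apply: H => //; exact: etrans (normc_lt _ _) xd.
exists d%:C => [|x xs xd]; first by rewrite ltcR.
by apply: H => //; exact: etrans (esym (normc_lt _ _)) xd.
Qed.

(** Complex differentiability with a named derivative, in which radii, moduli and errors are real
    numbers, so that estimates become linear arithmetic over [R]. *)
Definition cdiff f s (l : C) := forall e : R, 0 < e -> exists2 d : R, 0 < d &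
  forall h, normc h < d -> normc (f (s + h) - f s - l * h) <= e * normc h.

Lemma derivableCP f s : derivable f s 1 <-> exists l, cdiff f s l.
Proof.
have aux l : cdiff f s l <-> forall e : C, 0 < e -> exists2 d, 0 < d &
    forall h, `|h| < d -> `|f (s + h) - f s - l * h| <= e * `|h|.
  split=> H => [_ /gt0_complexP[e e0 ->]|e e0].
    have [d d0 Hd] := H e e0; exists d%:C; rewrite ?ltcR // => h.
    by rewrite !normcE -rmorphM /= ltcR lecR => /Hd.
  have [|_ /gt0_complexP[d d0 ->] Hd] := H e%:C; first by rewrite ltcR.
  exists d => // h hd; have := Hd h; rewrite !normcE -rmorphM /= ltcR lecR.
  exact.
split=> [H|[l /aux/deriv_epsP H]]; last by apply: (cvgP l); exact: H.
by have /cvg_ex[l Hl] := H; exists l; apply/aux/deriv_epsP; exact: Hl.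
Qed.

End ComplexDerivative.

(** * Rules of derivation, over an abstract field and then over [R[i]] *)

Section GenericCalculus.
Context {K : numFieldType}.
Implicit Types (f g : K -> K) (s : K).
Local Notation der f s := (derivable (f : K^o -> K^o) s 1).

Lemma gen_derivableD f g s : der f s -> der g s -> der (fun x => f x + g x) s.
Proof. by move=> df dg; exact: (@derivableD K K^o K^o). Qed.

Lemma gen_derivableM f g s : der f s -> der g s -> der (fun x => f x * g x) s.
Proof. by move=> df dg; exact: (@derivableM K K^o). Qed.

Lemma gen_derivableV f s : f s != 0 -> der f s -> der (fun x => (f x)^-1) s.
Proof. by move=> f0 df; exact: (@derivableV K K^o). Qed.

Lemma gen_derivable_comp f g s : der f (g s) -> der g s -> der (f \o g) s.
Proof.
move=> /derivable1_diffP df /derivable1_diffP dg; apply/derivable1_diffP.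
exact: differentiable_comp.
Qed.

Lemma gen_derivable_cst (c : K) s : der (fun=> c) s.
Proof. exact: derivable_cst. Qed.

Lemma gen_derivable_id s : der id s.
Proof. exact: derivable_id. Qed.

Lemma gen_derivable_continuous f s : der f s -> 
  forall e, 0 < e -> exists2 d, 0 < d & forall x, `|x - s| < d -> `|f x - f s| < e.
Proof.
move=> /derivable1_diffP /differentiable_continuous /cvgrPdist_lt H e /H.
move=> /near_ballP[d d0 Hd]; exists d => // x /Hd; by rewrite distrC.
Qed.

Lemma gen_derivable_near f g s :
  (\forall x \near (s : K^o), f x = g x) -> der f s -> der g s.
Proof.
move=> fg.
exact: (@near_eq_derivable K K^o K^o).
Qed.

End GenericCalculus.
Section ComplexCalculus.
Context {R : realType}.
Local Notation C := R[i].
Implicit Types (f g : C -> C) (s : C).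

Lemma cderivableD f g s : derivable f s 1 -> derivable g s 1 -> derivable (fun x => f x + g x) s 1.
Proof. exact: gen_derivableD. Qed.

Lemma cderivableM f g s : derivable f s 1 -> derivable g s 1 -> derivable (fun x => f x * g x) s 1.
Proof. exact: gen_derivableM. Qed.

Lemma cderivableV f s : f s != 0 -> derivable f s 1 -> derivable (fun x => (f x)^-1) s 1.
Proof. exact: gen_derivableV. Qed.

Lemma cderivable_comp f g s : derivable f (g s) 1 -> derivable g s 1 ->
  derivable (fun x => f (g x)) s 1.
Proof. exact: gen_derivable_comp. Qed.

Lemma cderivableX f s n : derivable f s 1 -> derivable (fun x => f x ^+ n) s 1.
Proof.
move=> df; elim: n => [|n IH]; first last.
  have -> : (fun x => f x ^+ n.+1) = (fun x => f x * f x ^+ n).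
    by apply/funext => x; rewrite exprS.
  exact: (@cderivableM f (fun x => f x ^+ n)).
have -> : (fun x => f x ^+ 0) = (fun=> 1) by apply/funext => x; rewrite expr0.
exact: gen_derivable_cst.
Qed.

Lemma cderivable_cst (c : C) s : derivable (fun=> c) s 1.
Proof. exact: gen_derivable_cst. Qed.

Lemma cderivable_id s : derivable (fun x : C => x) s 1.
Proof. exact: gen_derivable_id. Qed.

Lemma cderivable_continuous f s : derivable f s 1 ->
  forall e : R, 0 < e ->
  exists2 d : R, 0 < d & forall x, normc (x - s) < d -> normc (f x - f s) < e.
Proof.
move=> df e e0; have e0C : 0 < e%:C by rewrite ltcR.
have [_ /gt0_complexP[d d0 ->] H] := gen_derivable_continuous df e0C.
by exists d => // x xs; rewrite -normc_lt; apply: H; rewrite normc_lt.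
Qed.

Lemma cderivable_near f g s :
  (exists2 d : R, 0 < d & forall x, normc (x - s) < d -> f x = g x) ->
  derivable f s 1 -> derivable g s 1.
Proof. move=> H; apply: gen_derivable_near; exact/nearCP. Qed.

End ComplexCalculus.

(** * The complex exponential *)

Section ComplexExponential.
Context {R : realType}.
Local Notation C := R[i].
Implicit Types (s z w : C).

Definition cexp z : C := (expR (Re z))%:C * (cos (Im z) +i* sin (Im z)).

Lemma is_derive_eps (f : R -> R) (x l : R) : is_derive x 1 f l ->
  forall e : R, 0 < e -> exists2 d : R, 0 < d &
    forall h, `|h| < d -> `|f (x + h) - f x - l * h| <= e * `|h|.
Proof.
move=> [df <-].
have /deriv_epsP := df; exact.
Qed.

Lemma cexpD z w : cexp (z + w) = cexp z * cexp w.
Proof.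
case: z w => a b [c d]; rewrite /cexp /= expRD cosD sinD.
by apply/eqP; rewrite eq_complex /=; apply/andP; split; apply/eqP; ring.
Qed.

Lemma cexp0 : cexp 0 = 1.
Proof.
rewrite /cexp /= expR0 cos0 sin0.
by apply/eqP; rewrite eq_complex /= !(mulr1, mulr0, mul0r, subr0, addr0) !eqxx.
Qed.

Lemma cexpN z : cexp (- z) = (cexp z)^-1.
Proof.
have h : cexp (- z) * cexp z = 1 by rewrite -cexpD addNr cexp0.
have n0 : cexp z != 0 by apply/eqP => e; move: h; rewrite e mulr0 => /esym/eqP; rewrite oner_eq0.
by apply: (mulIf n0); rewrite h mulVf.
Qed.

Lemma cexp_neq0 z : cexp z != 0.
Proof.
apply/eqP => e; have := cexpD z (- z).
by rewrite e mul0r subrr cexp0 => /eqP; rewrite oner_eq0.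
Qed.

Lemma cexpX z n : cexp z ^+ n = cexp (n%:R * z).
Proof.
elim: n => [|n IH]; first by rewrite expr0 mul0r cexp0.
by rewrite exprS IH -cexpD -[n.+1]addn1 natrD mulrDl mul1r addrC.
Qed.

Lemma cexpXz z (n : int) : cexp z ^ n = cexp (n%:~R * z).
Proof.
case: n => n; first exact: cexpX.
by rewrite NegzE -exprnN -exprVn -cexpN cexpX mulrN rmorphN mulNr.
Qed.

Lemma normc_cexp z : normc (cexp z) = expR (Re z).
Proof.
rewrite /cexp normcM normcR ger0_norm ?expR_ge0 //=.
by rewrite cos2Dsin2 sqrtr1 mulr1.
Qed.

Lemma cexpR (x : R) : cexp x%:C = (expR x)%:C.
Proof. by rewrite /cexp /= cos0 sin0 mulr1. Qed.

Lemma cexp_diff0 : cdiff cexp 0 1.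
Proof.
(* The four error terms bounded below add up to at most 8 * e * |h|, which [e0 / 9] absorbs; the cap
   1 keeps 1 + x below 2 and the error of exp below e. *)
move=> e0 e0_gt0; pose e := Num.min (e0 / 9) 1.
have e_gt0 : 0 < e by rewrite lt_min ltr01 andbT; lra.
have e_le1 : e <= 1 by rewrite /e ge_min lexx orbT.
have e_le : e <= e0 / 9 by rewrite /e ge_min lexx.
clearbody e.
have [d1 d1_gt0 H1] := is_derive_eps (is_derive_expR (0 : R)) e_gt0.
have [d2 d2_gt0 H2] := is_derive_eps (is_derive_cos (0 : R)) e_gt0.
have [d3 d3_gt0 H3] := is_derive_eps (is_derive_sin (0 : R)) e_gt0.
exists (Num.min (Num.min d1 d2) (Num.min d3 e)).
  by rewrite !lt_min d1_gt0 d2_gt0 d3_gt0 e_gt0.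
move=> [x y]; set h := x +i* y; rewrite !lt_min => /andP[/andP[hd1 hd2] /andP[hd3 hde]].
have hx : `|x| <= normc h by exact: (normc_Re h).
have hy : `|y| <= normc h by exact: (normc_Im h).
have := H1 x (le_lt_trans hx hd1); rewrite add0r expR0 mul1r => {}H1.
have := H2 y (le_lt_trans hy hd2); rewrite add0r cos0 sin0 oppr0 mul0r subr0 => {}H2.
have := H3 y (le_lt_trans hy hd3); rewrite add0r sin0 cos0 mul1r subr0 => {}H3.
set n := normc h in hx hy hd1 hd2 hd3 hde *.
have n0 : 0 <= n := normc_ge0 _.
rewrite add0r cexp0 mul1r.
have -> : cexp h - 1 - h = (expR x * cos y - 1 - x) +i* (expR x * sin y - y).
  rewrite /cexp /h /=; apply/eqP; rewrite eq_complex /=.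
  by apply/andP; split; apply/eqP; ring.
apply: le_trans (normc_le_ReIm _) _ => /=.
have c1 : `|cos y| <= 1 by rewrite ler_norml cos_geN1 cos_le1.
set E := expR x - 1 - x in H1.
have ex : expR x = E + 1 + x by rewrite /E; ring.
set Co := cos y - 1 in H2.
have cy : cos y = Co + 1 by rewrite /Co; ring.
set Si := sin y - y in H3.
have sy : sin y = Si + y by rewrite /Si; ring.
have -> : expR x * cos y - 1 - x = E * cos y + (1 + x) * Co by rewrite ex /Co; ring.
have -> : expR x * sin y - y = (E + x) * (Si + y) + Si by rewrite ex sy; ring.
have ax : 0 <= `|x| := normr_ge0 _.
have ay : 0 <= `|y| := normr_ge0 _.
have b1 : `|E * cos y| <= e * n.
  rewrite normrM -[leRHS]mulr1; apply: ler_pM => //.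
  by apply: le_trans H1 _; rewrite ler_wpM2l // ltW.
have b2 : `|(1 + x) * Co| <= 2 * (e * n).
  rewrite normrM; apply: ler_pM => //.
    apply: le_trans (ler_normD _ _) _; rewrite normr1; lra.
  by apply: le_trans H2 _; rewrite ler_wpM2l // ltW.
have b3 : `|(E + x) * (Si + y)| <= (2 * e) * (2 * n).
  rewrite normrM; apply: ler_pM => //.
    apply: le_trans (ler_normD _ _) _.
    suff : `|E| <= e by lra.
    apply: le_trans H1 _; rewrite -[leRHS]mulr1 ler_wpM2l //; lra.
  apply: le_trans (ler_normD _ _) _.
  suff : `|Si| <= n by lra.
  apply: le_trans H3 _; rewrite -[leRHS]mul1r ler_pM //; lra.
have b4 : `|Si| <= e * n.
  by apply: le_trans H3 _; rewrite ler_wpM2l // ltW.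
have := ler_normD (E * cos y) ((1 + x) * Co).
have := ler_normD ((E + x) * (Si + y)) Si.
move=> b5 b6.
have en : e * n <= e0 / 9 * n by rewrite ler_wpM2r.
have e0n : 0 <= e0 / 9 * n by rewrite mulr_ge0 // divr_ge0 // ltW.
have -> : e0 * n = 9 * (e0 / 9 * n) by field.
lra.
Qed.

Lemma cexp_diff z : cdiff cexp z (cexp z).
Proof.
move=> e e0.
have k0 : 0 < normc (cexp z) by rewrite normc_gt0 cexp_neq0.
have [d d0 H] := cexp_diff0 (divr_gt0 e0 k0).
exists d => // h /H; rewrite add0r cexp0 mul1r cexpD => {}H.
have -> : cexp z * cexp h - cexp z - cexp z * h = cexp z * (cexp h - 1 - h) by ring.
rewrite normcM; have := ler_wpM2l (ltW k0) H.
by rewrite mulrA (mulrC _ (e / _)) divfK ?gt_eqF.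
Qed.

Lemma derivable_cexp z : derivable cexp z 1.
Proof. by apply/derivableCP; exists (cexp z); exact: cexp_diff. Qed.

Lemma cpowE (a : R) z : cpow a z = cexp (z * (ln a)%:C).
Proof.
by case: z => x y; rewrite /cpow /cexp /= !mulr0 subr0 add0r.
Qed.

End ComplexExponential.

(** * Integrals of complex-valued functions *)

Section ComplexIntegral.
Context {R : realType} {d : measure_display} {T : measurableType d}.
Local Notation C := R[i].
Variables (mu : {measure set T -> \bar R}) (D : set T).
Hypothesis mD : measurable D.
Implicit Types (f g : T -> C) (c : C).

Lemma ReD (z w : C) : Re (z + w) = Re z + Re w. Proof. by case: z w => a b []. Qed.
Lemma ImD (z w : C) : Im (z + w) = Im z + Im w. Proof. by case: z w => a b []. Qed.
Lemma ReM (z w : C) : Re (z * w) = Re z * Re w - Im z * Im w.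
Proof. by case: z w => a b []. Qed.
Lemma ImM (z w : C) : Im (z * w) = Re z * Im w + Im z * Re w.
Proof. by case: z w => a b []. Qed.

Lemma complex_eqP (z w : C) : Re z = Re w -> Im z = Im w -> z = w.
Proof. by case: z w => a b [a' b'] /= -> ->. Qed.

Lemma eq_cintegral f g : (forall x, D x -> f x = g x) ->
  cintegral mu D f = cintegral mu D g.
Proof.
move=> fg; rewrite /cintegral; congr (_ +i* _); apply: eq_Rintegral => x /set_mem Dx;
by rewrite fg.
Qed.

Lemma eq_cintegrable f g : (forall x, D x -> f x = g x) ->
  cintegrable mu D f -> cintegrable mu D g.
Proof.
move=> fg [h1 h2]; split.
  by apply: eq_integrable h1 => // x /set_mem Dx /=; rewrite fg.
by apply: eq_integrable h2 => // x /set_mem Dx /=; rewrite fg.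
Qed.

Lemma cintegrableD f g : cintegrable mu D f -> cintegrable mu D g ->
  cintegrable mu D (fun x => f x + g x).
Proof.
move=> [f1 f2] [g1 g2]; split.
  by apply: eq_integrable (integrableD mD f1 g1) => // x _ /=; rewrite ReD.
by apply: eq_integrable (integrableD mD f2 g2) => // x _ /=; rewrite ImD.
Qed.

Lemma cintegrableZ c f : cintegrable mu D f -> cintegrable mu D (fun x => c * f x).
Proof.
move=> [f1 f2]; split.
  apply: eq_integrable (integrableB mD (integrableZl mD (Re c) f1) (integrableZl mD (Im c) f2)) => //.
  by move=> x _ /=; rewrite ReM EFinB !EFinM.
apply: eq_integrable (integrableD mD (integrableZl mD (Re c) f2) (integrableZl mD (Im c) f1)) => //.
by move=> x _ /=; rewrite ImM EFinD !EFinM.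
Qed.

Lemma cintegralD f g : cintegrable mu D f -> cintegrable mu D g ->
  cintegral mu D (fun x => f x + g x) = cintegral mu D f + cintegral mu D g.
Proof.
move=> [f1 f2] [g1 g2]; apply: complex_eqP; rewrite ?ReD ?ImD /=.
  rewrite -(RintegralD mD f1 g1).
  by apply: eq_Rintegral => x _; rewrite ReD.
rewrite -(RintegralD mD f2 g2).
by apply: eq_Rintegral => x _; rewrite ImD.
Qed.

Lemma cintegralZ c f : cintegrable mu D f ->
  cintegral mu D (fun x => c * f x) = c * cintegral mu D f.
Proof.
move=> [f1 f2]; apply: complex_eqP; rewrite ?ReM ?ImM /=.
  rewrite -(RintegralZl (Re c) mD f1) -(RintegralZl (Im c) mD f2).
  rewrite -(RintegralB mD (integrableZl mD (Re c) f1) (integrableZl mD (Im c) f2)).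
  by apply: eq_Rintegral => x _; rewrite ReM.
rewrite -(RintegralZl (Re c) mD f2) -(RintegralZl (Im c) mD f1).
rewrite -(RintegralD mD (integrableZl mD (Re c) f2) (integrableZl mD (Im c) f1)).
by apply: eq_Rintegral => x _; rewrite ImM.
Qed.

Lemma cintegrable0 : cintegrable mu D (fun=> 0).
Proof. by split; exact: integrable0. Qed.

Lemma cintegral0 : cintegral mu D (fun=> 0) = 0.
Proof.
rewrite -[RHS](mul0r (cintegral mu D (fun=> 0))) -(cintegralZ _ cintegrable0).
by apply: eq_cintegral => x _; rewrite mul0r.
Qed.

Lemma cintegrableB f g : cintegrable mu D f -> cintegrable mu D g ->
  cintegrable mu D (fun x => f x - g x).
Proof.
move=> hf hg; have := cintegrableD hf (cintegrableZ (-1) hg).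
by apply: eq_cintegrable => x _; rewrite mulN1r.
Qed.

Lemma cintegralB f g : cintegrable mu D f -> cintegrable mu D g ->
  cintegral mu D (fun x => f x - g x) = cintegral mu D f - cintegral mu D g.
Proof.
move=> hf hg; rewrite -mulN1r -cintegralZ // -cintegralD //.
  by apply: eq_cintegral => x _; rewrite mulN1r.
exact: cintegrableZ.
Qed.

Lemma cintegrable_sum (I : eqType) (r : seq I) (F : I -> T -> C) :
  (forall i, i \in r -> cintegrable mu D (F i)) ->
  cintegrable mu D (fun x => \sum_(i <- r) F i x).
Proof.
elim: r => [|i r IH] H.
  by apply: eq_cintegrable cintegrable0 => x _; rewrite big_nil.
have h1 := H i (mem_head _ _).
have h2 : cintegrable mu D (fun x => \sum_(i <- r) F i x).
  by apply: IH => j jr; apply: H; rewrite inE jr orbT.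
by apply: eq_cintegrable (cintegrableD h1 h2) => x _; rewrite big_cons.
Qed.

Lemma cintegral_sum (I : eqType) (r : seq I) (F : I -> T -> C) :
  (forall i, i \in r -> cintegrable mu D (F i)) ->
  cintegral mu D (fun x => \sum_(i <- r) F i x) =
  \sum_(i <- r) cintegral mu D (F i).
Proof.
elim: r => [|i r IH] H.
  by rewrite big_nil -[RHS]cintegral0; apply: eq_cintegral => x _; rewrite big_nil.
have h1 := H i (mem_head _ _).
have h2 j : j \in r -> cintegrable mu D (F j).
  by move=> jr; apply: H; rewrite inE jr orbT.
rewrite big_cons -IH // -cintegralD //; last exact: cintegrable_sum.
by apply: eq_cintegral => x _; rewrite big_cons.
Qed.

(** Real and imaginary parts are bounded separately, whence the factor 2; later uses depend only on
    the order of magnitude. *)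
Lemma normc_cintegral_le (f : T -> C) (M : R) : (mu D < +oo)%E -> 0 <= M ->
  cintegrable mu D f -> (forall x, D x -> normc (f x) <= M) ->
  normc (cintegral mu D f) <= 2 * (M * fine (mu D)).
Proof.
move=> muD M0 [f1 f2] fM; apply: le_trans (normc_le_ReIm _) _ => /=.
have aux (u : T -> R) : mu.-integrable D (EFin \o u) ->
    (forall x, D x -> `|u x| <= M) -> `|\int[mu]_(x in D) u x| <= M * fine (mu D).
  move=> iu uM; apply: le_trans (le_normr_Rintegral mD iu) _.
  rewrite -Rintegral_cst //; apply: le_Rintegral => //.
    exact: (integrable_norm iu).
  apply/integrableP; split; first exact: measurable_cst.
  by rewrite (eq_integral (cst `|M|%:E)) // integral_cst // lte_mul_pinfty.
have := aux _ f1 (fun x Dx => le_trans (normc_Re _) (fM x Dx)).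
have := aux _ f2 (fun x Dx => le_trans (normc_Im _) (fM x Dx)).
move=> *; lra.
Qed.

End ComplexIntegral.

(** * Integrals over real segments *)

Section SegmentIntegral.
Context {R : realType}.
Local Notation C := R[i].
Implicit Types (g : R -> C) (a b c t : R).

Definition ccont_at g t := forall e : R, 0 < e -> exists2 d : R, 0 < d &
  forall u, `|u - t| < d -> normc (g u - g t) < e.

Definition cont_on g a b := forall t, a <= t <= b -> ccont_at g t.

Definition sint a b g : C := cintegral (@lebesgue_measure R) `[a, b] g.

Local Notation sintegrable a b g := (cintegrable (@lebesgue_measure R) `[a, b] g).

Lemma ccont_integrable a b g : cont_on g a b -> sintegrable a b g.
Proof.
move=> cg.
have aux (p : C -> R) : (forall z w, `|p z - p w| <= normc (z - w)) ->
    (@lebesgue_measure R).-integrable `[a, b] (fun t => (p (g t))%:E).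
  move=> pl; apply: (@continuous_compact_integrable R (fun t => p (g t))).
    exact: segment_compact.
  apply: continuous_in_subspaceT => t /set_mem /= tab.
  apply/cvgrPdist_lt => e e0.
  have [|d d0 H] := cg t _ e e0; first by move: tab; rewrite in_itv.
  apply/nbhs_ballP; exists d => // u; rewrite /ball /= => ut.
  apply: le_lt_trans (pl _ _) _; rewrite normc_sub; apply: H.
  by rewrite distrC.
split; apply: aux => z w.
  by rewrite -[Re z - Re w]/(Re z + - Re w); have := normc_Re (z - w); rewrite ReD; case: w.
by have := normc_Im (z - w); rewrite ImD; case: w.
Qed.

Lemma sint_split a b c g : a <= b -> b <= c -> cont_on g a c ->
  sint a c g = sint a b g + sint b c g.
Proof.
move=> ab bc cg; have [i1 i2] := ccont_integrable cg.
have aux (u : R -> R) : (@lebesgue_measure R).-integrable `[a, c] (EFin \o u) ->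
   (\int[@lebesgue_measure R]_(x in `[a, c]) u x = \int[@lebesgue_measure R]_(x in `[a, b]) u x
    + \int[@lebesgue_measure R]_(x in `[b, c]) u x).
  move=> iu; have := @Rintegral_itvB R u (BLeft a) (BRight c) b iu.
  rewrite !bnd_simp => /(_ ab bc).
  rewrite Rintegral_itv_obnd_cbnd; last first.
    apply: integrableS iu => //; apply: subset_itvr.
    by rewrite bnd_simp.
  by move=> <-; ring.
by apply: complex_eqP; rewrite ?ReD ?ImD; exact: aux.
Qed.

Lemma sint_bound a b g (M : R) : a <= b -> 0 <= M -> cont_on g a b ->
  (forall t, a <= t <= b -> normc (g t) <= M) -> normc (sint a b g) <= 2 * (M * (b - a)).
Proof.
move=> ab M0 cg gM.
have muab : (@lebesgue_measure R `[a, b] = (b - a)%:E)%E.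
  rewrite lebesgue_measure_itv /= lte_fin; case: ltP => // ba.
  by congr EFin; apply/eqP; rewrite eq_sym subr_eq0 eq_le ba ab.
have -> : b - a = fine (@lebesgue_measure R `[a, b]) by rewrite muab.
apply: normc_cintegral_le => //.
- by have := ltry (b - a); rewrite -muab.
- exact: ccont_integrable.

Qed.

Lemma sint_cst a b z : a <= b -> sint a b (fun=> z) = (b - a)%:C * z.
Proof.
move=> ab.
have muab : (@lebesgue_measure R `[a, b] = (b - a)%:E)%E.
  rewrite lebesgue_measure_itv /= lte_fin; case: ltP => // ba.
  by congr EFin; apply/eqP; rewrite eq_sym subr_eq0 eq_le ba ab.
apply: complex_eqP; rewrite ?ReM ?ImM /= Rintegral_cst // (_ : fine _ = b - a);
by rewrite -?[RHS]/(fine (b - a)%:E) -?muab //; ring.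
Qed.

(** A sharp one-sided bound on the real part. The mean value argument needs a strict sign, which a
    bound on the modulus loses. *)
Lemma sint_Re_le a b g (M : R) : a <= b -> cont_on g a b ->
  (forall t, a <= t <= b -> Re (g t) <= M) -> Re (sint a b g) <= M * (b - a).
Proof.
move=> ab cg gM; have [i1 i2] := ccont_integrable cg.
have := sint_cst M%:C ab => /(congr1 (fun z : C => Re z)).
rewrite ReM /= mul0r subr0 mulrC => <-.
apply: le_Rintegral => //.
  have cc : cont_on (fun=> M%:C) a b.
    move=> t _ e e0; exists 1 => // u _.
    by rewrite subrr normc0.
  by have [] := ccont_integrable cc.
Qed.

Lemma cont_onD g h a b : cont_on g a b -> cont_on h a b -> cont_on (fun t => g t + h t) a b.
Proof.
move=> cg ch t tab e e0; have e20 : 0 < e / 2 by rewrite divr_gt0.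
have [d1 d10 H1] := cg t tab _ e20; have [d2 d20 H2] := ch t tab _ e20.
exists (Num.min d1 d2); first by rewrite lt_min d10.
move=> u; rewrite lt_min => /andP[/H1 h1 /H2 h2].
have -> : g u + h u - (g t + h t) = (g u - g t) + (h u - h t) by ring.
by apply: le_lt_trans (normcD _ _) _; lra.
Qed.

Lemma cont_onZ z g a b : cont_on g a b -> cont_on (fun t => z * g t) a b.
Proof.
move=> cg t tab e e0.
have k0 : 0 < normc z + 1 by rewrite ltr_wpDl // normc_ge0.
have [d1 d10 H1] := cg t tab _ (divr_gt0 e0 k0).
exists d1 => // u /H1; rewrite -mulrBr normcM ltr_pdivlMr // => h.
apply: le_lt_trans h; rewrite mulrC ler_wpM2l ?normc_ge0 // lerDl ler01 //.
Qed.

Lemma cont_onB g h a b : cont_on g a b -> cont_on h a b -> cont_on (fun t => g t - h t) a b.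
Proof.
move=> cg /(cont_onZ (-1)) ch t tab e /(cont_onD cg ch tab) [d d0 H].
by exists d => // u /H; rewrite !mulN1r.
Qed.

Lemma cont_on_cst z a b : cont_on (fun=> z) a b.
Proof. by move=> t _ e e0; exists 1 => // u _; rewrite subrr normc0. Qed.

Lemma sintD a b g h : cont_on g a b -> cont_on h a b ->
  sint a b (fun t => g t + h t) = sint a b g + sint a b h.
Proof. by move=> cg ch; apply: cintegralD => //; exact: ccont_integrable. Qed.

Lemma sintB a b g h : cont_on g a b -> cont_on h a b ->
  sint a b (fun t => g t - h t) = sint a b g - sint a b h.
Proof. by move=> cg ch; apply: cintegralB => //; exact: ccont_integrable. Qed.

Lemma eq_sint a b g h : (forall t, a <= t <= b -> g t = h t) -> sint a b g = sint a b h.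
Proof. by move=> gh; apply: eq_cintegral => t /=; rewrite in_itv; exact: gh. Qed.

End SegmentIntegral.

(** * Goursat's lemma on rectangles *)

Section Goursat.
Context {R : realType}.
Local Notation C := R[i].
Implicit Types (F : C -> C) (x y a b : R).

Definition holo_rect F x y a b := forall X Y, x <= X <= x + a -> y <= Y <= y + b ->
  derivable F (X +i* Y) 1.

(** The counterclockwise contour integral with opposite sides paired: under a subdivision along one
    axis one of the two integrals splits and the other telescopes. *)
Definition rect_int F x y a b : C :=
  'i * sint y (y + b) (fun t => F ((x + a) +i* t) - F (x +i* t)) -
  sint x (x + a) (fun t => F (t +i* (y + b)) - F (t +i* y)).

Lemma cont_vert F x y a b X : holo_rect F x y a b -> x <= X <= x + a ->
  cont_on (fun t => F (X +i* t)) y (y + b).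
Proof.
move=> dF Xx t ty e e0.
have [d d0 H] := cderivable_continuous (dF X t Xx ty) e0.
exists d => // u ut; apply: H.
suff -> : X +i* u - (X +i* t) = 'i * (u - t)%:C.
  by rewrite normcM normcR /= expr0n expr1n add0r sqrtr1 mul1r.
by apply: complex_eqP => /=; ring.
Qed.

Lemma cont_horiz F x y a b Y : holo_rect F x y a b -> y <= Y <= y + b ->
  cont_on (fun t => F (t +i* Y)) x (x + a).
Proof.
move=> dF Yy t tx e e0.
have [d d0 H] := cderivable_continuous (dF t Y tx Yy) e0.
exists d => // u ut; apply: H.
suff -> : u +i* Y - (t +i* Y) = (u - t)%:C by rewrite normcR.
by apply: complex_eqP => /=; ring.
Qed.

Lemma rect_int_splitx F x y a b : 0 <= a -> 0 <= b -> holo_rect F x y a b ->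
  rect_int F x y a b = rect_int F x y (a / 2) b + rect_int F (x + a / 2) y (a / 2) b.
Proof.
move=> a0 b0 dF; rewrite /rect_int.
have -> : x + a / 2 + a / 2 = x + a by rewrite -addrA -splitr.
have h0 : x <= x <= x + a by rewrite lexx lerDl.
have h1 : x <= x + a <= x + a by rewrite lexx lerDl a0.
have h2 : x <= x + a / 2 <= x + a by apply/andP; split; lra.
have k0 : y <= y <= y + b by rewrite lexx lerDl.
have k1 : y <= y + b <= y + b by rewrite lexx lerDl b0.
have c0 := cont_vert dF h0; have c1 := cont_vert dF h1; have c2 := cont_vert dF h2.
have m1 : x <= x + a / 2 by lra.
have m2 : x + a / 2 <= x + a by lra.
rewrite !(@sintB _ y) //.
rewrite (sint_split m1 m2 (cont_onB (cont_horiz dF k1) (cont_horiz dF k0))).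
by ring.
Qed.

Lemma rect_int_splity F x y a b : 0 <= a -> 0 <= b -> holo_rect F x y a b ->
  rect_int F x y a b = rect_int F x y a (b / 2) + rect_int F x (y + b / 2) a (b / 2).
Proof.
move=> a0 b0 dF; rewrite /rect_int.
have -> : y + b / 2 + b / 2 = y + b by rewrite -addrA -splitr.
have h0 : y <= y <= y + b by rewrite lexx lerDl.
have h1 : y <= y + b <= y + b by rewrite lexx lerDl b0.
have h2 : y <= y + b / 2 <= y + b by apply/andP; split; lra.
have k0 : x <= x <= x + a by rewrite lexx lerDl.
have k1 : x <= x + a <= x + a by rewrite lexx lerDl a0.
have c0 := cont_horiz dF h0; have c1 := cont_horiz dF h1; have c2 := cont_horiz dF h2.
have m1 : y <= y + b / 2 by lra.
have m2 : y + b / 2 <= y + b by lra.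
rewrite (sint_split m1 m2 (cont_onB (cont_vert dF k1) (cont_vert dF k0))).
rewrite !(@sintB _ x) //; ring.
Qed.

Lemma holo_rectS F x y a b x' y' a' b' : holo_rect F x y a b ->
  x <= x' -> x' + a' <= x + a -> y <= y' -> y' + b' <= y + b -> holo_rect F x' y' a' b'.
Proof.
move=> dF h1 h2 h3 h4 X Y /andP[X1 X2] /andP[Y1 Y2].
by apply: dF; apply/andP; split; lra.
Qed.

(** Halving in one direction and then in the other, each time keeping the half with the larger
    integral, replaces the comparison of four quarters. *)
Lemma rect_int_quarter F x y a b : 0 <= a -> 0 <= b -> holo_rect F x y a b ->
  exists x' y', [/\ x <= x', x' + a / 2 <= x + a, y <= y' , y' + b / 2 <= y + b &
    normc (rect_int F x y a b) / 4 <= normc (rect_int F x' y' (a / 2) (b / 2))].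
Proof.
move=> a0 b0 dF.
have [x' [hx1 hx2 hx]] : exists x', [/\ x <= x', x' + a / 2 <= x + a &
    normc (rect_int F x y a b) / 2 <= normc (rect_int F x' y (a / 2) b)].
  have := normcD (rect_int F x y (a / 2) b) (rect_int F (x + a / 2) y (a / 2) b).
  rewrite -rect_int_splitx // => h.
  have [h1|h1] := lerP (normc (rect_int F x y a b) / 2) (normc (rect_int F x y (a / 2) b)).
    by exists x; split => //; lra.
  by exists (x + a / 2); split; [clear h h1; lra | clear h h1; lra | lra].
have a20 : 0 <= a / 2 by lra.
have dF' : holo_rect F x' y (a / 2) b by apply: (holo_rectS dF).
have := normcD (rect_int F x' y (a / 2) (b / 2)) (rect_int F x' (y + b / 2) (a / 2) (b / 2)).
rewrite -rect_int_splity // => h.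
have [h1|h1] := lerP (normc (rect_int F x y a b) / 4) (normc (rect_int F x' y (a / 2) (b / 2))).
  by exists x', y; split => //; lra.
by exists x', (y + b / 2); split; [exact: hx1 | exact: hx2 | clear h h1 hx; lra | clear h h1 hx; lra | lra].
Qed.

Lemma nested_point (u : nat -> R) (l : nat -> R) :
  (forall n, u n <= u n.+1) -> (forall n, u n.+1 + l n.+1 <= u n + l n) ->
  (forall n, 0 <= l n) -> exists z, forall n, u n <= z <= u n + l n.
Proof.
move=> u1 u2 l0.
have mono m k : u m <= u (m + k)%N /\ u (m + k)%N + l (m + k)%N <= u m + l m.
  elim: k => [|k [IH1 IH2]]; first by rewrite addn0.
  by rewrite addnS; split; [exact: le_trans IH1 _|exact: le_trans (u2 _) IH2].
have key m n : u m <= u n + l n.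
  have [mn|nm] := leqP m n.
    have [h1 _] := mono m (n - m)%N; rewrite subnKC // in h1.
    by have := l0 n; lra.
  have [_ h2] := mono n (m - n)%N; rewrite subnKC ?(ltnW nm) // in h2.
  by have := l0 m; lra.
have hs : has_sup (range u).
  split; first by exists (u 0%N); exists 0%N.
  by exists (u 0%N + l 0%N) => _ [m _ <-].
exists (sup (range u)) => n; apply/andP; split.
  by apply: ub_le_sup; [case: hs|exists n].
apply: ge_sup; first by case: hs.
by move=> _ [m _ <-].
Qed.

(** An affine function contributes nothing: its differences across opposite sides are the constants
    l * a and l * i * b, and the two side integrals cancel. Only the remainder, at most m on each
    side, is left. *)
Lemma rect_int_small F x y a b (al l z : C) (m : R) : 0 <= a -> 0 <= b ->
  0 <= m -> holo_rect F x y a b ->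
  (forall X Y, x <= X <= x + a -> y <= Y <= y + b ->
     normc (F (X +i* Y) - (al + l * (X +i* Y))) <= m) ->
  normc (rect_int F x y a b) <= 4 * m * (a + b).
Proof.
move=> a0 b0 m0 dF H.
pose G := fun z : C => F z - (al + l * z).
have dG : holo_rect G x y a b.
  move=> X Y hX hY; rewrite /G.
  have -> : (fun z : C => F z - (al + l * z)) = (fun z : C => F z + (- al + (- l) * z)).
    by apply/funext => u; ring.
  apply: cderivableD; first exact: dF.
  apply: cderivableD; first exact: cderivable_cst.
  by apply: cderivableM; [exact: cderivable_cst|exact: cderivable_id].
have h0 : x <= x <= x + a by rewrite lexx lerDl.
have h1 : x <= x + a <= x + a by rewrite lexx lerDl a0.
have k0 : y <= y <= y + b by rewrite lexx lerDl.
have k1 : y <= y + b <= y + b by rewrite lexx lerDl b0.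
have -> : rect_int F x y a b = rect_int G x y a b.
  rewrite /rect_int.
  have -> : sint y (y + b) (fun t => F ((x + a) +i* t) - F (x +i* t)) =
     sint y (y + b) (fun t => (G ((x + a) +i* t) - G (x +i* t)) + l * a%:C).
    apply: eq_sint => t _; rewrite /G.
    have -> : (x + a) +i* t = x +i* t + a%:C by apply: complex_eqP => /=; ring.
    by ring.
  have -> : sint x (x + a) (fun t => F (t +i* (y + b)) - F (t +i* y)) =
     sint x (x + a) (fun t => (G (t +i* (y + b)) - G (t +i* y)) + l * ('i * b%:C)).
    apply: eq_sint => t _; rewrite /G.
    have -> : t +i* (y + b) = t +i* y + 'i * b%:C by apply: complex_eqP => /=; ring.
    by ring.
  rewrite (sintD (cont_onB (cont_vert dG h1) (cont_vert dG h0)) (@cont_on_cst _ _ _ _)).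
  rewrite (sintD (cont_onB (cont_horiz dG k1) (cont_horiz dG k0)) (@cont_on_cst _ _ _ _)).
  rewrite !sint_cst ?lerDl //.
  have -> : y + b - y = b by ring.
  have -> : x + a - x = a by ring.
  by ring.
have v1 : normc (sint y (y + b) (fun t => G ((x + a) +i* t) - G (x +i* t))) <= 2 * ((2 * m) * (y + b - y)).
  apply: sint_bound; rewrite ?lerDl ?mulr_ge0 //.
    by apply: cont_onB; [exact: (cont_vert dG h1)|exact: (cont_vert dG h0)].
  move=> t ty; apply: le_trans (normcB _ _) _.
  by have := H _ t h1 ty; have := H _ t h0 ty; rewrite /G; lra.
have v2 : normc (sint x (x + a) (fun t => G (t +i* (y + b)) - G (t +i* y))) <= 2 * ((2 * m) * (x + a - x)).
  apply: sint_bound; rewrite ?lerDl ?mulr_ge0 //.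
    by apply: cont_onB; [exact: (cont_horiz dG k1)|exact: (cont_horiz dG k0)].
  move=> t tx; apply: le_trans (normcB _ _) _.
  by have := H t _ tx k1; have := H t _ tx k0; rewrite /G; lra.
apply: le_trans (normcB _ _) _; rewrite normcM.
have -> : normc ('i : C) = 1 by rewrite /= expr0n expr1n add0r sqrtr1.
rewrite mul1r; apply: le_trans (lerD v1 v2) _.
rewrite le_eqVlt; apply/orP; left; apply/eqP; ring.
Qed.

(** Repeated quartering shrinks to a point where F has a derivative. There [rect_int_small] bounds
    the n-th integral by 4 * e times the square of a half-perimeter (a + b) / 2^n, which compensates
    the loss 4^n, and e is arbitrary. *)
Lemma goursat F x y a b : 0 <= a -> 0 <= b -> holo_rect F x y a b -> rect_int F x y a b = 0.
Proof.
move=> a0 b0 dF.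
pose an n : R := a / 2 ^+ n; pose bn n : R := b / 2 ^+ n.
have p2 n : 0 < 2 ^+ n :> R by rewrite exprn_gt0.
have an0 n : 0 <= an n by rewrite /an divr_ge0 // ltW.
have bn0 n : 0 <= bn n by rewrite /bn divr_ge0 // ltW.
have anS n : an n.+1 = an n / 2 by rewrite /an exprSr invfM; ring.
have bnS n : bn n.+1 = bn n / 2 by rewrite /bn exprSr invfM; ring.
pose P n (p : R * R) := [/\ x <= p.1, p.1 + an n <= x + a, y <= p.2 & p.2 + bn n <= y + b].
have step n (p : R * R) : exists p' : R * R, P n p ->
   [/\ P n.+1 p', p.1 <= p'.1 /\ p'.1 + an n.+1 <= p.1 + an n,
       p.2 <= p'.2 /\ p'.2 + bn n.+1 <= p.2 + bn n &
    normc (rect_int F p.1 p.2 (an n) (bn n)) / 4 <=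
    normc (rect_int F p'.1 p'.2 (an n.+1) (bn n.+1))].
  have [Pp|nP] := pselect (P n p); last by exists p.
  have [h1 h2 h3 h4] := Pp.
  have [x' [y' [g1 g2 g3 g4 g5]]] := @rect_int_quarter F p.1 p.2 (an n) (bn n) (an0 n) (bn0 n)
     (holo_rectS dF h1 h2 h3 h4).
  by exists (x', y') => _; rewrite anS bnS; split => //=; split => /=; rewrite ?anS ?bnS; lra.
have [nxt Hnxt] : exists nxt : nat -> R * R -> R * R, forall n p, P n p ->
   [/\ P n.+1 (nxt n p), p.1 <= (nxt n p).1 /\ (nxt n p).1 + an n.+1 <= p.1 + an n,
       p.2 <= (nxt n p).2 /\ (nxt n p).2 + bn n.+1 <= p.2 + bn n &
    normc (rect_int F p.1 p.2 (an n) (bn n)) / 4 <=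
    normc (rect_int F (nxt n p).1 (nxt n p).2 (an n.+1) (bn n.+1))].
  have /choice[nxt Hnxt] : forall np : nat * (R * R), exists p', P np.1 np.2 ->
     [/\ P np.1.+1 p', np.2.1 <= p'.1 /\ p'.1 + an np.1.+1 <= np.2.1 + an np.1,
       np.2.2 <= p'.2 /\ p'.2 + bn np.1.+1 <= np.2.2 + bn np.1 &
    normc (rect_int F np.2.1 np.2.2 (an np.1) (bn np.1)) / 4 <=
    normc (rect_int F p'.1 p'.2 (an np.1.+1) (bn np.1.+1))] by move=> [n p]; exact: step.
  by exists (fun n p => nxt (n, p)) => n p; exact: (Hnxt (n, p)).
pose fix p n : R * R := if n is m.+1 then nxt m (p m) else (x, y).
have Pp n : P n (p n).
  elim: n => [|n /Hnxt[]//]; rewrite /P /= /an /bn expr0 !divr1.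
  by split.
have [zx Hzx] : exists z, forall n, (p n).1 <= z <= (p n).1 + an n.
  by apply: nested_point => // n; have [_ [] ] := Hnxt n _ (Pp n).
have [zy Hzy] : exists z, forall n, (p n).2 <= z <= (p n).2 + bn n.
  by apply: nested_point => // n; have [_ _ [] ] := Hnxt n _ (Pp n).
have an_0 : an 0%N = a by rewrite /an expr0 divr1.
have bn_0 : bn 0%N = b by rewrite /bn expr0 divr1.
have big n : normc (rect_int F x y a b) / 4 ^+ n <=
   normc (rect_int F (p n).1 (p n).2 (an n) (bn n)).
  elim: n => [|n IH]; first by rewrite an_0 bn_0 expr0 divr1.
  have [_ _ _ h] := Hnxt n _ (Pp n); apply: le_trans h.
  rewrite exprSr invfM; lra.
have zin : derivable F (zx +i* zy) 1.
  apply: dF; first by have := Hzx 0%N; rewrite an_0.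
  by have := Hzy 0%N; rewrite bn_0.
have /derivableCP[l Hl] := zin.
set w := normc (rect_int F x y a b) in big *.
have w0 : 0 <= w := normc_ge0 _.
suff we (e : R) : 0 < e -> w <= 4 * e * (a + b) ^+ 2.
  apply: eq0_normc; apply/eqP; rewrite eq_le normc_ge0 andbT leNgt; apply/negP => wgt.
  have ab1 : 0 < 8 * ((a + b) ^+ 2 + 1).
    by have := sqr_ge0 (a + b); lra.
  have := we _ (divr_gt0 wgt ab1); rewrite -/w; set A := (a + b) ^+ 2 in ab1 *.
  have A0 : 0 <= A by exact: sqr_ge0.
  have -> : 4 * (w / (8 * (A + 1))) * A = w * (A / (2 * (A + 1))) by field; rewrite ?gt_eqF //; lra.
  have A1 : A / (2 * (A + 1)) < 1 by rewrite ltr_pdivrMr; lra.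
  by rewrite leNgt; move/negP; apply; rewrite -[ltRHS]mulr1 ltr_pM2l.
move=> e0; have [d d0 Hd] := Hl _ e0.
have [n Hn] : exists n, an n + bn n < d.
  have ab0 : 0 <= a + b by rewrite addr_ge0.
  have [n hn] : exists n : nat, (a + b) / d < n%:R.
    exists (Num.truncn ((a + b) / d)).+1.
    by rewrite truncnS_gt.
  exists n; rewrite /an /bn -mulrDl ltr_pdivrMr //.
  rewrite ltr_pdivrMr // in hn; apply: lt_trans hn _.
  rewrite mulrC ltr_pM2l // -natrX ltr_nat; exact: ltn_expl.
have [h1 h2 h3 h4] := Pp n.
have := @rect_int_small F (p n).1 (p n).2 (an n) (bn n) (F (zx +i* zy) - l * (zx +i* zy)) l 0
  (e * (an n + bn n)) (an0 n) (bn0 n).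
have m0 : 0 <= e * (an n + bn n) by apply: mulr_ge0; [exact: ltW|exact: addr_ge0].
move=> /(_ m0 (holo_rectS dF h1 h2 h3 h4)).
have /[swap] /[apply] : forall X Y, (p n).1 <= X <= (p n).1 + an n ->
  (p n).2 <= Y <= (p n).2 + bn n ->
  normc (F (X +i* Y) - (F (zx +i* zy) - l * (zx +i* zy) + l * (X +i* Y))) <= e * (an n + bn n).
  move=> X Y /andP[X1 X2] /andP[Y1 Y2].
  have hh : normc (X +i* Y - (zx +i* zy)) <= an n + bn n.
    apply: le_trans (normc_le_ReIm _) _ => /=.
    have /andP[? ?] := Hzx n; have /andP[? ?] := Hzy n.
    by apply: lerD; rewrite ler_norml; apply/andP; split; lra.
  have := Hd _ (le_lt_trans hh Hn).
  have -> : zx +i* zy + (X +i* Y - (zx +i* zy)) = X +i* Y by ring.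
  have -> : F (X +i* Y) - F (zx +i* zy) - l * (X +i* Y - (zx +i* zy)) =
     F (X +i* Y) - (F (zx +i* zy) - l * (zx +i* zy) + l * (X +i* Y)) by ring.
  move=> h; apply: le_trans h _; rewrite ler_wpM2l // ltW //.
move=> h; have := le_trans (big n) h.
rewrite ler_pdivrMr ?exprn_gt0 // => /le_trans; apply.
rewrite /an /bn -mulrDl.
have -> : (4 : R) ^+ n = 2 ^+ n * 2 ^+ n by rewrite -exprMn; congr (_ ^+ _); lra.
rewrite le_eqVlt; apply/orP; left; apply/eqP; field.
by rewrite gt_eqF.
Qed.

End Goursat.

(** * Mean values and the maximum principle *)

Section MaximumPrinciple.
Context {R : realType}.
Local Notation C := R[i].
Implicit Types (f g : C -> C) (c z : C) (r rho : R).

Definition holo_disc f c rho := forall z, normc (z - c) < rho -> derivable f z 1.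

Lemma ReB (z w : C) : Re (z - w) = Re z - Re w.
Proof. by case: z w => a b []. Qed.

Lemma ImB (z w : C) : Im (z - w) = Im z - Im w.
Proof. by case: z w => a b []. Qed.

Lemma cexpD2pi z : cexp (z + 'i * (pi *+ 2)%:C) = cexp z :> C.
Proof.
case: z => a b; rewrite /cexp /=.
have -> : a + (0 * (pi *+ 2) - 1 * 0) = a by ring.
have -> : b + (0 * 0 + 1 * (pi *+ 2)) = b + pi *+ 2 by ring.
by rewrite cosD2pi sinD2pi.
Qed.

(** The substitution z = c + exp w turns an annulus into a rectangle of height 2 pi whose horizontal
    sides cancel by periodicity. Goursat's lemma then equates the mean over the circle with the mean
    over an arbitrarily small one, where f is close to f c. No Cauchy formula is involved. *)
Lemma mean_value_weak_max f c r rho (B : R) : 0 < r < rho -> holo_disc f c rho ->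
  (forall t, Re (f (c + r%:C * (cos t +i* sin t))) <= B) -> Re (f c) <= B.
Proof.
move=> /andP[r0 rr] df fB; rewrite leNgt; apply/negP => Bf.
have dfc : derivable f c 1 by apply: df; rewrite subrr normc0 (lt_trans r0).
have e20 : 0 < (Re (f c) - B) / 2 by lra.
have [d d0 Hd] := cderivable_continuous dfc e20.
set e := Re (f c) - B in e20 Hd.
(* The left side of the rectangle is the small circle of radius exp x1 < d, on which f differs from
   f c by less than half of the supposed excess; the right side is the given circle. *)
pose L := ln r; pose x1 := Num.min L (ln (d / 2)).
have x1L : x1 <= L by rewrite ge_min lexx.
have ex1 : expR x1 < d.
  apply: (@le_lt_trans _ _ (d / 2)); last by lra.
  have <- : expR (ln (d / 2)) = d / 2 by rewrite lnK // posrE; lra.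
  by rewrite ler_expR ge_min lexx orbT.
have eL : expR L = r by rewrite lnK.
pose F w := f (c + cexp w).
have dF : holo_rect F x1 0 (L - x1) (pi *+ 2).
  move=> X Y /andP[_ X2] _; rewrite /F.
  apply: (@cderivable_comp R f (fun w => c + cexp w)).
    apply: df; rewrite addrC addKr normc_cexp /=.
    by apply: le_lt_trans rr; rewrite -eL ler_expR; lra.
  by apply: cderivableD; [exact: cderivable_cst|exact: derivable_cexp].
have a0 : 0 <= L - x1 by lra.
have pi2 : 0 < pi *+ 2 :> R by rewrite mulrn_wgt0 // pi_gt0.
have := goursat a0 (ltW pi2) dF; rewrite /rect_int add0r.
rewrite [X in _ - X](_ : _ = 0); last first.
  rewrite (@eq_sint _ _ _ _ (fun=> 0)) ?sint_cst ?lerDl ?mulr0 // => t _.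
  rewrite /F; suff -> : cexp (t +i* (pi *+ 2)) = cexp (t +i* 0) by rewrite subrr.
  by rewrite -[RHS]cexpD2pi; congr cexp; apply: complex_eqP => /=; ring.
rewrite subr0 => /eqP; rewrite mulf_eq0 => /orP[/eqP[/eqP]|/eqP s0]; first by rewrite oner_eq0.
have hx1 : x1 <= x1 <= x1 + (L - x1) by apply/andP; split; lra.
have hL : x1 <= x1 + (L - x1) <= x1 + (L - x1) by apply/andP; split; lra.
have c1 := cont_vert dF hx1; have c2 := cont_vert dF hL; rewrite add0r in c1 c2.
have := @sint_Re_le R 0 (pi *+ 2) _ (- (e / 2)) (ltW pi2) (cont_onB c2 c1).
rewrite s0 /= subr0; suff h : forall t : R, 0 <= t <= pi *+ 2 ->
    Re (F ((x1 + (L - x1)) +i* t) - F (x1 +i* t)) <= - (e / 2).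
  by move=> /(_ h); rewrite leNgt => /negP; apply; rewrite mulNr oppr_lt0 mulr_gt0.
move=> t _.
have -> : x1 + (L - x1) = L by ring.
have h1 : Re (F (L +i* t)) <= B by have := fB t; rewrite /F /cexp /= eL.
have h2 : normc (F (x1 +i* t) - f c) < e / 2.
  by apply: Hd; rewrite addrC addKr normc_cexp.
have := le_lt_trans (normc_Re _) h2; rewrite ltr_norml !ReB.
by rewrite /e => /andP[? ?]; lra.
Qed.

Lemma normc2 z : normc z ^+ 2 = Re z ^+ 2 + Im z ^+ 2.
Proof. by case: z => a b /=; rewrite sqr_sqrtr // addr_ge0 ?sqr_ge0. Qed.

Definition mkc (p : R * R) : C := p.1 +i* p.2.

Lemma continuous_mkc (v : C -> R) p :
  (forall e : R, 0 < e -> exists2 d : R, 0 < d &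
     forall z, normc (z - mkc p) < d -> `|v z - v (mkc p)| < e) ->
  {for p, continuous (v \o mkc)}.
Proof.
move=> cv; apply/cvgrPdist_lt => e /cv[d d0 Hd].
have d20 : 0 < d / 2 by lra.
have nb : nbhs p [set x : R * R | `|p.1 - x.1| < d / 2 /\ `|p.2 - x.2| < d / 2].
  exists (ball p.1 (d / 2), ball p.2 (d / 2)).
    by split; exact: nbhsx_ballx.
  by move=> x [].
apply: filterS nb => x [/= x1 x2]; rewrite distrC; apply: Hd.
apply: le_lt_trans (normc_le_ReIm _) _ => /=.
by rewrite (distrC x.1) (distrC x.2); lra.
Qed.

Lemma normc_mkcB p c : normc (mkc p - c) ^+ 2 = (p.1 - Re c) ^+ 2 + (p.2 - Im c) ^+ 2.
Proof. by rewrite normc2 ReB ImB. Qed.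

Lemma continuous_normc_mkc c : continuous (fun p => normc (mkc p - c) ^+ 2).
Proof.
have -> : (fun p => normc (mkc p - c) ^+ 2) =
  (fun p => (p.1 - Re c) ^+ 2 + (p.2 - Im c) ^+ 2).
  by apply/funext => p; exact: normc_mkcB.
move=> p; apply: cvgD.
  by apply: cvgM; (apply: cvgB; [exact: cvg_fst|exact: cvg_cst]).
by apply: cvgM; (apply: cvgB; [exact: cvg_snd|exact: cvg_cst]).
Qed.

(** The disc is carried to pairs of reals, where it is a closed subset of a product of two segments
    and hence compact. *)
Lemma disc_max (u : C -> R) c r : 0 <= r ->
  (forall p, normc (mkc p - c) <= r -> {for p, continuous (u \o mkc)}) ->
  exists2 z1, normc (z1 - c) <= r & forall z, normc (z - c) <= r -> u z <= u z1.
Proof.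
move=> r0 cu; pose K : set (R * R) := [set p | normc (mkc p - c) ^+ 2 <= r ^+ 2].
have KP p : K p <-> normc (mkc p - c) <= r.
  by rewrite /K /= ler_sqr ?nnegrE ?normc_ge0.
have mkE z : mkc (Re z, Im z) = z by case: z.
have K0 : K !=set0 by exists (Re c, Im c); apply/KP; rewrite mkE subrr normc0.
have cK : compact K.
  apply: (@subclosed_compact _ _ (`[Re c - r, Re c + r]%classic `*` `[Im c - r, Im c + r]%classic)).
  - by apply: (@closed_comp _ _ _ [set x | x <= r ^+ 2]); [move=> p _; exact: continuous_normc_mkc|exact: closed_le].
  - by apply: compact_setX; exact: segment_compact.
  - move=> p /KP h; have := le_trans (normc_Re _) h; have := le_trans (normc_Im _) h.
    rewrite ReB ImB !ler_norml /= !in_itv /=; case: (c) => x y /=.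
    by move=> /andP[? ?] /andP[? ?]; split; apply/andP; split; lra.
have cuK : {within K, continuous (u \o mkc)}.
  by apply: continuous_in_subspaceT => p /set_mem /KP; exact: cu.
have [p /set_mem /KP Kp pmax] := compact_EVT_max K0 cK cuK.
exists (mkc p) => // z zr; have := pmax (Re z, Im z); rewrite /= mkE; apply.
by apply/mem_set/KP; rewrite mkE.
Qed.

(** The perturbation u = Re(lam f) + ep |z - c|^2, with lam rotating f a to a positive number,
    attains its maximum over the closed disc at an interior point z1 if f a exceeds M. Around z1 the
    square expands as |w|^2 + tau^2 + 2 Re(conj w (z - z1)), w = z1 - c; absorbing the last term
    into the holomorphic function [H] leaves Re H below Re H(z1) - ep tau^2 on a small circle,
    against the mean value bound. *)
Lemma max_principle f c r rho (M : R) : 0 < r < rho -> holo_disc f c rho ->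
  (forall z, normc (z - c) = r -> normc (f z) <= M) ->
  forall a, normc (a - c) <= r -> normc (f a) <= M.
Proof.
move=> /andP[r0 rr] df fM a ac; rewrite leNgt; apply/negP => Mfa.
have M0 : 0 <= M.
  apply: le_trans (normc_ge0 _) (fM (c + r%:C) _).
  by rewrite addrC addKr normcR gtr0_norm.
pose lam : C := (normc (f a))%:C / f a.
have fa0 : f a != 0 by rewrite -normc_gt0 (le_lt_trans M0).
have lamfa : Re (lam * f a) = normc (f a) by rewrite /lam divfK.
have nlam : normc lam = 1.
  by rewrite /lam normcM normcV normcR ger0_norm ?normc_ge0 // divff // gt_eqF // normc_gt0.
pose ep : R := (normc (f a) - M) / (2 * r ^+ 2).
have r20 : 0 < r ^+ 2 by rewrite exprn_gt0.
have ep0 : 0 < ep by rewrite divr_gt0 //; lra.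
have epr : ep * r ^+ 2 < normc (f a) - M.
  have -> : ep * r ^+ 2 = (normc (f a) - M) / 2 by rewrite /ep; field; rewrite gt_eqF.
  lra.
pose u z := Re (lam * f z) + ep * normc (z - c) ^+ 2.
have [z1 z1r umax] : exists2 z1, normc (z1 - c) <= r &
    forall z, normc (z - c) <= r -> u z <= u z1.
  apply: disc_max => [|p hp]; first exact: ltW.
  apply: (@cvgD _ _ _ _ _ (fun p => Re (lam * f (mkc p))) (fun p => ep * normc (mkc p - c) ^+ 2)).
    apply: (@continuous_mkc (fun z => Re (lam * f z))) => e e0.
    have [d d0 Hd] := cderivable_continuous (df _ (le_lt_trans hp rr)) e0.
    exists d => // z /Hd h; rewrite -ReB -mulrBr; apply: le_lt_trans h.
    by apply: le_trans (normc_Re _) _; rewrite normcM nlam mul1r.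
  by apply: cvgM; [exact: cvg_cst|exact: continuous_normc_mkc].
have ua : normc (f a) <= u z1.
  apply: le_trans (umax _ ac); rewrite /u lamfa lerDl mulr_ge0 ?sqr_ge0 // ltW //.
have z1lt : normc (z1 - c) < r.
  rewrite lt_neqAle z1r andbT; apply/eqP => zr.
  move: ua; rewrite /u zr; have := fM _ zr.
  have := le_trans (ler_norm _) (normc_Re (lam * f z1)); rewrite normcM nlam mul1r.
  by move=> *; lra.
pose w := z1 - c; pose tau := (r - normc w) / 2.
have tau0 : 0 < tau by rewrite /tau /w; lra.
pose H z := lam * f z + (2 * ep)%:C * w^* * (z - z1).
have dH : holo_disc H z1 (r - normc w).
  move=> z zz1; apply: cderivableD.
    apply: cderivableM; first exact: cderivable_cst.
    apply: df; have -> : z - c = (z - z1) + w by rewrite /w; ring.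
    by apply: le_lt_trans (normcD _ _) _; lra.
  apply: cderivableM; first exact: cderivable_cst.
  by apply: cderivableD; [exact: cderivable_id|exact: cderivable_cst].
have tau2 : 0 < tau < r - normc w by rewrite tau0 /tau /w; lra.
have := @mean_value_weak_max H z1 tau _ (Re (lam * f z1) - ep * tau ^+ 2) tau2 dH.
have HH : forall t, Re (H (z1 + tau%:C * (cos t +i* sin t))) <= Re (lam * f z1) - ep * tau ^+ 2.
  move=> t; set z := z1 + _.
  have zz : z - z1 = tau%:C * (cos t +i* sin t) by rewrite /z addrC addKr.
  have nz : normc (z - z1) = tau.
    by rewrite zz normcM normcR gtr0_norm //= cos2Dsin2 sqrtr1 mulr1.
  have zc : normc (z - c) <= r.
    have -> : z - c = (z - z1) + w by rewrite /w; ring.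
    by apply: le_trans (normcD _ _) _; rewrite nz /tau; lra.
  have := umax _ zc; rewrite /u.
  have -> : normc (z - c) ^+ 2 = normc (z1 - c) ^+ 2 + tau ^+ 2 + 2 * Re (w^* * (z - z1)).
    rewrite -nz !normc2 -/w.
    have -> : z - c = (z - z1) + w by rewrite /w; ring.
    by rewrite ReM ReD ImD; case: (w) => x y; case: (z - z1) => x' y' /=; ring.
  rewrite /H ReD -mulrA [Re (_%:C * _)]ReM /= mul0r subr0.
  by move=> h; lra.
move=> /(_ HH); rewrite /H subrr mulr0 addr0.
have : 0 < ep * tau ^+ 2 by rewrite mulr_gt0 ?exprn_gt0.
by move=> ? ?; lra.
Qed.

End MaximumPrinciple.

(** * The identity theorem for meromorphic functions *)

Section IdentityTheorem.
Context {R : realType}.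
Local Notation C := R[i].
Implicit Types (f g h : C -> C) (c z s : C) (r rho : R).

Lemma normc_lip z s : `|normc z - normc s| <= normc (z - s).
Proof.
rewrite ler_norml; apply/andP; split.
  have := normcD (s - z) z; rewrite subrK (normc_sub s) => ?; lra.
by have := normcD (z - s) s; rewrite subrK => ?; lra.
Qed.

Lemma holo_disc_bounded f c r rho : 0 <= r < rho -> holo_disc f c rho ->
  exists M, forall z, normc (z - c) <= r -> normc (f z) <= M.
Proof.
move=> /andP[r0 rr] df.
have [z1 _ h] : exists2 z1, normc (z1 - c) <= r &
    forall z, normc (z - c) <= r -> normc (f z) <= normc (f z1).
  apply: disc_max => // p hp.
  apply: (@continuous_mkc _ (fun z => normc (f z))) => e e0.
  have [d d0 Hd] := cderivable_continuous (df _ (le_lt_trans hp rr)) e0.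
  by exists d => // z /Hd; apply: le_lt_trans (normc_lip _ _).
by exists (normc (f z1)).
Qed.

Lemma bernoulli_le (x : R) n : 0 <= x -> 1 + n%:R * x <= (1 + x) ^+ n.
Proof.
move=> x0; elim: n => [|n IH]; first by rewrite mul0r addr0 expr0.
rewrite exprS; apply: (@le_trans _ _ ((1 + x) * (1 + n%:R * x))).
  have := mulr_ge0 (ler0n R n) (sqr_ge0 x).
  rewrite -natr1 expr2 => ?; lra.
by rewrite ler_wpM2l // addr_ge0.
Qed.

(** Since f vanishes near c, every quotient f / (z - c)^n is holomorphic on the disc. The maximum
    principle on a circle of radius r' > |a - c| bounds |f a| (r' / |a - c|)^n independently of n,
    which forces f a = 0; power series are avoided. *)
Lemma identity_disc f c r0 rho : 0 < r0 -> holo_disc f c rho ->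
  (forall z, normc (z - c) < r0 -> f z = 0) ->
  forall z, normc (z - c) < rho -> f z = 0.
Proof.
move=> r00 df f0 a arho; apply/eqP; apply: contraT => fa0.
pose r := normc (a - c).
have r0r : r0 <= r by rewrite leNgt; apply/negP => /f0 /eqP; rewrite (negPf fa0).
have rpos : 0 < r by apply: lt_le_trans r0r.
pose r' := (r + rho) / 2.
have rr' : r < r' by rewrite /r' /r; lra.
have r'rho : r' < rho by rewrite /r' /r; lra.
have [|M fM] := @holo_disc_bounded f c r' rho _ df; first by rewrite r'rho andbT ltW // (lt_trans rpos).
have key n : normc (f a) * (r' / r) ^+ n <= M.
  pose h z := f z / (z - c) ^+ n.
  have dh : holo_disc h c rho.
    move=> z zrho; have [zc|zc] := eqVneq z c.
      apply: (@cderivable_near _ (fun=> 0)); last exact: cderivable_cst.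
      by exists r0 => // x; rewrite zc => /f0; rewrite /h => ->; rewrite mul0r.
    apply: cderivableM; first exact: df.
    apply: cderivableV; first by rewrite expf_neq0 // subr_eq0.
    apply: (@cderivableX _ (fun x => x - c)).
    by apply: cderivableD; [exact: cderivable_id|exact: cderivable_cst].
  have := @max_principle _ h c r' rho (M / r' ^+ n) _ dh _ a (ltW rr').
  have r'0 : 0 < r' by apply: lt_trans rr'.
  rewrite r'0 r'rho => /(_ isT).
  have hb : forall z, normc (z - c) = r' -> normc (h z) <= M / r' ^+ n.
    move=> z zr; rewrite /h normcM normcV normcX zr ler_pM2r ?invr_gt0 ?exprn_gt0 //.
    by apply: fM; rewrite zr.
  move=> /(_ hb); rewrite /h normcM normcV normcX -/r ler_pdivlMr ?exprn_gt0 //.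
  by apply: le_trans; rewrite expr_div_n mulrAC mulrA.
pose x := r' / r - 1.
have x0 : 0 < x by rewrite /x subr_gt0 ltr_pdivlMr // mul1r.
have fapos : 0 < normc (f a) by rewrite normc_gt0.
pose n := (Num.truncn (M / normc (f a) / x)).+1.
have hn : M / normc (f a) / x < n%:R by rewrite truncnS_gt.
have := key n; have := bernoulli_le n (ltW x0).
have -> : 1 + x = r' / r by rewrite /x; ring.
rewrite !ltr_pdivrMr // in hn.
move=> h1 h2; have := ler_wpM2l (ltW fapos) h1.
by move=> h3; lra.
Qed.

(** A continuity argument along the segment from s1 to s0. At the supremum T of the parameters up to
    which h vanishes on punctured neighbourhoods, clearing the pole gives a holomorphic g that
    vanishes on a small disc near gm T; [identity_disc] spreads this to a disc around gm T, so T
    could be increased unless it is 1. *)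
Lemma mero_identity h s1 r : meromorphic h -> 0 < r ->
  (forall s, normc (s - s1) < r -> h s = 0) -> forall s0, \forall s \near s0^', h s = 0.
Proof.
move=> mh r0 h0 s0.
pose gm (t : R) : C := s1 + t%:C * (s0 - s1).
pose good (t : R) := \forall s \near (gm t)^', h s = 0.
pose E : set R := [set t | 0 <= t <= 1 /\ forall u, 0 <= u <= t -> good u].
(* The added 1 keeps D positive when s0 = s1. *)
pose D := normc (s0 - s1) + 1.
have D0 : 0 < D by rewrite /D ltr_wpDl // normc_ge0.
have gmB t u : normc (gm t - gm u) <= `|t - u| * D.
  have -> : gm t - gm u = (t - u)%:C * (s0 - s1).
    by rewrite /gm rmorphB /=; ring.
  by rewrite normcM normcR ler_wpM2l // /D lerDl.
have E0 : E 0.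
  split=> [|u]; first by rewrite lexx ler01.
  rewrite -eq_le => /eqP <-; apply/dnearCP; exists r => // s _.
  by rewrite /gm mul0r addr0 => /h0.
have hsE : has_sup E.
  by split; [exists 0|exists 1 => t [/andP[]]].
pose T := sup E.
have T0 : 0 <= T by apply: ub_le_sup; first by case: hsE.
have T1 : T <= 1 by apply: ge_sup; [exists 0|move=> t [/andP[]]].
have Elt t : 0 <= t < T -> good t.
  move=> /andP[t0 tT].
  have [|u [_ Eu] tu'] := @sup_adherent _ E (T - t) _ hsE; first by rewrite subr_gt0.
  by apply: Eu; rewrite t0 /=; move: tu'; rewrite /T; lra.
have [k [g [dg hg]]] := mh (gm T).
move/nearCP: dg => [d1 d10 dg]; move/dnearCP: hg => [d2 d20 hg].
pose d := Num.min d1 d2.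
have d0 : 0 < d by rewrite lt_min d10.
have dd1 : d <= d1 by rewrite ge_min lexx.
have dd2 : d <= d2 by rewrite ge_min lexx orbT.
have holog c : holo_disc g c (d - normc (c - gm T)).
  move=> z zc; apply: dg.
  have -> : z - gm T = (z - c) + (c - gm T) by ring.
  by apply: le_lt_trans (normcD _ _) _; lra.
have [t0 tT gt0] : exists2 t, `|t - T| * D < d / 8 & good t.
  have [->|Tn0] := eqVneq T 0.
    by exists 0; [rewrite subrr normr0 mul0r; lra|have [_ ] := E0; apply; rewrite lexx].
  have Tpos : 0 < T by rewrite lt_neqAle eq_sym Tn0.
  pose t := Num.max 0 (T - d / (16 * D)).
  have dD : 0 < d / (16 * D) by rewrite divr_gt0 // mulr_gt0.
  have tT : t < T by rewrite /t gt_max Tpos /=; lra.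
  exists t; last by apply: Elt; rewrite tT andbT le_max lexx.
  have : T - d / (16 * D) <= t by rewrite le_max lexx orbT.
  rewrite distrC gtr0_norm ?subr_gt0 // => h1.
  apply: (@le_lt_trans _ _ (d / (16 * D) * D)); first by rewrite ler_pM2r //; lra.
  have -> : d / (16 * D) * D = d / 16 by field; rewrite gt_eqF.
  lra.
move/dnearCP: gt0 => [d3 d30 h3].
have cT : normc (gm t0 - gm T) < d / 8 by apply: le_lt_trans tT.
pose eta0 := Num.min (d3 / 2) (d / 8).
have eta00 : 0 < eta0 by rewrite lt_min; apply/andP; split; lra.
have eta3 : eta0 <= d3 / 2 by rewrite ge_min lexx.
have eta8 : eta0 <= d / 8 by rewrite ge_min lexx orbT.
clearbody eta0.
(* Vanishing is known only off [gm t0], and g is related to h only off [gm T]. The new centre must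
   avoid both, and of two candidates at least one differs from [gm T]. *)
have [x [x0 xe xn]] : exists x : R, [/\ 0 < x, x <= eta0 & gm t0 + x%:C != gm T].
  have [e1|n1] := eqVneq (gm t0 + eta0%:C) (gm T); last by exists eta0.
  exists (eta0 / 2); split; [lra|lra|].
  apply/eqP => e2; have : (eta0 - eta0 / 2)%:C = 0 :> C.
    by rewrite rmorphB /=; apply/eqP; rewrite subr_eq0; apply/eqP/(addrI (gm t0)); rewrite e1 e2.
  by move=> /complexI ?; lra.
set c := gm t0 + x%:C in xn.
have ct : normc (c - gm t0) = x by rewrite addrC addKr normcR gtr0_norm.
have cgT : normc (c - gm T) < d / 4.
  have -> : c - gm T = (c - gm t0) + (gm t0 - gm T) by ring.
  by apply: le_lt_trans (normcD _ _) _; rewrite ct; lra.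
pose eta := Num.min x (normc (c - gm T)).
have etapos : 0 < eta by rewrite lt_min x0 normc_gt0 subr_eq0.
have etax : eta <= x by rewrite ge_min lexx.
have etaT : eta <= normc (c - gm T) by rewrite ge_min lexx orbT.
clearbody eta.
have gc z : normc (z - c) < eta -> g z = 0.
  move=> zc.
  have zt : normc (z - gm t0) < d3.
    have -> : z - gm t0 = (z - c) + (c - gm t0) by ring.
    by apply: le_lt_trans (normcD _ _) _; rewrite ct; lra.
  have znt : z != gm t0.
    by apply/eqP => e; move: zc; rewrite e normc_sub ct; lra.
  have znT : z != gm T.
    by apply/eqP => e; move: zc; rewrite e normc_sub; lra.
  have zT : normc (z - gm T) < d2.
    have -> : z - gm T = (z - c) + (c - gm T) by ring.
    by apply: le_lt_trans (normcD _ _) _; lra.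
  by rewrite -hg // h3 // mulr0.
have gT z : normc (z - gm T) < d / 2 -> g z = 0.
  move=> zT; apply: (identity_disc etapos (holog c) gc).
  have -> : z - c = (z - gm T) + (gm T - c) by ring.
  apply: le_lt_trans (normcD _ _) _; rewrite (normc_sub (gm T)).
  lra.
have hT z : z != gm T -> normc (z - gm T) < d / 2 -> h z = 0.
  move=> zn zT; have := hg z zn (lt_le_trans (_ : _ < d) dd2).
  rewrite gT // => /(_ ltac:(lra))/eqP; rewrite mulf_eq0 expf_eq0 subr_eq0 (negPf zn) andbF.
  by move/eqP.
have goodnear u : `|u - T| * D < d / 4 -> good u.
  move=> uT; have uT' := le_lt_trans (gmB u T) uT.
  rewrite /good; have [->|ne] := eqVneq (gm u) (gm T).
    by apply/dnearCP; exists (d / 2); [lra|exact: hT].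
  have n0 : 0 < normc (gm u - gm T) by rewrite normc_gt0 subr_eq0.
  apply/dnearCP; exists (Num.min (d / 4) (normc (gm u - gm T))).
    by rewrite lt_min n0 andbT; lra.
  move=> s _; rewrite lt_min => /andP[s1' s2]; apply: hT.
    by apply/eqP => e; move: s2; rewrite e normc_sub ltxx.
  have -> : s - gm T = (s - gm u) + (gm u - gm T) by ring.
  by apply: le_lt_trans (normcD _ _) _; lra.
pose dl := d / (8 * D).
have dl0 : 0 < dl by rewrite divr_gt0 // mulr_gt0.
have dlD : dl * D < d / 4.
  have -> : dl * D = d / 8 by rewrite /dl; field; rewrite gt_eqF.
  lra.
pose T' := Num.min 1 (T + dl).
have ET' : E T'.
  split; first by rewrite le_min ler01 /= ge_min lexx /= addr_ge0 // ltW.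
  move=> u /andP[u0 uT']; have [uT|Tu] := ltP u T; first by apply: Elt; rewrite u0.
  apply: goodnear; apply: le_lt_trans dlD; rewrite ler_pM2r // ger0_norm ?subr_ge0 //.
  by move: uT'; rewrite le_min => /andP[_]; lra.
have T'T : T' <= T by apply: ub_le_sup; [case: hsE|].
have T1' : T' = 1.
  have [h1|h1] := lerP 1 (T + dl); first by rewrite /T' min_l.
  by move: T'T; rewrite /T' (min_r (ltW h1)) => h2; lra.
have [_ /(_ 1)] := ET'; rewrite T1' lexx ler01 /good /gm mul1r => /(_ isT).
by rewrite addrC subrK.
Qed.

End IdentityTheorem.

(** * Meromorphic functions and reciprocals of functions with simple zeros *)

Section Meromorphic.
Context {R : realType}.
Local Notation C := R[i].
Implicit Types (f g h : C -> C) (c z s : C) (r rho : R).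

Definition entire f := forall s, derivable f s 1.

Lemma nearC_true (P : C -> Prop) s : (forall x, P x) -> \forall x \near s, P x.
Proof. by move=> H; apply/nearCP; exists 1. Qed.

Lemma dnearC_true (P : C -> Prop) s : (forall x, P x) -> \forall x \near s^', P x.
Proof. by move=> H; apply/dnearCP; exists 1. Qed.

Lemma nearC2 (P Q S : C -> Prop) s : (forall x, P x -> Q x -> S x) ->
  (\forall x \near s, P x) -> (\forall x \near s, Q x) -> \forall x \near s, S x.
Proof.
move=> H /nearCP[d d0 Hd] /nearCP[e e0 He]; apply/nearCP.
exists (Num.min d e); first by rewrite lt_min d0.
by move=> x; rewrite lt_min => /andP[xd xe]; apply: H; [exact: Hd|exact: He].
Qed.

Lemma dnearC2 (P Q S : C -> Prop) s : (forall x, P x -> Q x -> S x) ->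
  (\forall x \near s^', P x) -> (\forall x \near s^', Q x) -> \forall x \near s^', S x.
Proof.
move=> H /dnearCP[d d0 Hd] /dnearCP[e e0 He]; apply/dnearCP.
exists (Num.min d e); first by rewrite lt_min d0.
by move=> x xs; rewrite lt_min => /andP[xd xe]; apply: H; [exact: Hd|exact: He].
Qed.

Lemma meromorphic_entire f : entire f -> meromorphic f.
Proof.
move=> df s0; exists 0%N, f; split; first exact: nearC_true.
by apply: dnearC_true => s; rewrite expr0 mul1r.
Qed.

Lemma meromorphicM f g : meromorphic f -> meromorphic g -> meromorphic (fun s => f s * g s).
Proof.
move=> mf mg s0; have [k [F [dF hF]]] := mf s0; have [l [G [dG hG]]] := mg s0.
exists (k + l)%N, (fun s => F s * G s); split.
  by apply: nearC2 dF dG => x Fx Gx; exact: (@cderivableM _ F G).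
by apply: dnearC2 hF hG => x <- <-; rewrite exprD; ring.
Qed.

Lemma cderivable_subX c n s : derivable (fun x : C => (x - c) ^+ n) s 1.
Proof.
apply: (@cderivableX _ (fun x => x - c)).
by apply: cderivableD; [exact: cderivable_id|exact: cderivable_cst].
Qed.

Lemma meromorphicD f g : meromorphic f -> meromorphic g -> meromorphic (fun s => f s + g s).
Proof.
move=> mf mg s0; have [k [F [dF hF]]] := mf s0; have [l [G [dG hG]]] := mg s0.
exists (k + l)%N, (fun s => (s - s0) ^+ l * F s + (s - s0) ^+ k * G s); split.
  apply: nearC2 dF dG => x Fx Gx.
  exact: (@cderivableD _ (fun s => (s - s0) ^+ l * F s) (fun s => (s - s0) ^+ k * G s) x
    (@cderivableM _ (fun s => (s - s0) ^+ l) F _ (@cderivable_subX _ _ _) Fx)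
    (@cderivableM _ (fun s => (s - s0) ^+ k) G _ (@cderivable_subX _ _ _) Gx)).
by apply: dnearC2 hF hG => x <- <-; rewrite exprD; ring.
Qed.

Lemma entire_cst c : entire (fun=> c).
Proof. by move=> s; exact: cderivable_cst. Qed.

Lemma entireM f g : entire f -> entire g -> entire (fun s => f s * g s).
Proof. by move=> df dg s; exact: (@cderivableM _ f g s (df s) (dg s)). Qed.

Lemma entireD f g : entire f -> entire g -> entire (fun s => f s + g s).
Proof. by move=> df dg s; exact: (@cderivableD _ f g s (df s) (dg s)). Qed.

Lemma entire_sum (I : Type) (r : seq I) (F : I -> C -> C) :
  (forall i, entire (F i)) -> entire (fun s => \sum_(i <- r) F i s).
Proof.
move=> H; elim: r => [|i r IH].
  have -> : (fun s => \sum_(i <- [::]) F i s) = (fun=> 0) by apply/funext => s; rewrite big_nil.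
  by move=> s; exact: cderivable_cst.
have -> : (fun s => \sum_(j <- i :: r) F j s) = (fun s => F i s + \sum_(j <- r) F j s).
  by apply/funext => s; rewrite big_cons.
exact: (@entireD (F i) (fun s => \sum_(j <- r) F j s) (H i) IH).
Qed.

Lemma entire_affine (f : C -> C) a b : entire f -> entire (fun s => f (a * s + b)).
Proof.
move=> df s; apply: (@cderivable_comp _ f (fun s => a * s + b)); first exact: df.
apply: cderivableD; last exact: cderivable_cst.
by apply: cderivableM; [exact: cderivable_cst|exact: cderivable_id].
Qed.

Lemma entire_cexp : entire (@cexp R).
Proof. by move=> s; exact: derivable_cexp. Qed.

Lemma dnear_affine (P : C -> Prop) (a b : C) s0 : a != 0 ->
  (\forall s \near (a * s0 + b)^', P s) -> \forall s \near s0^', P (a * s + b).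
Proof.
move=> a0 /dnearCP[d d0 H]; have na : 0 < normc a by rewrite normc_gt0.
apply/dnearCP; exists (d / normc a); first by rewrite divr_gt0.
move=> s ss0 sd; apply: H.
  by rewrite -subr_eq0 opprD addrACA subrr addr0 -mulrBr mulf_neq0 // subr_eq0.
have -> : a * s + b - (a * s0 + b) = a * (s - s0) by ring.
by rewrite normcM mulrC -ltr_pdivlMr.
Qed.

Lemma mero_eq_affine f g a b : a != 0 -> mero_eq f g ->
  mero_eq (fun s => f (a * s + b)) (fun s => g (a * s + b)).
Proof. by move=> a0 fg s0; exact: (@dnear_affine (fun s => f s = g s)). Qed.

(* The poles of 1 / E are cleared with exponent 2 rather than 1, so that the
   extension by 0 at a zero of E is visibly differentiable. *)
Definition simple_zeros (E : C -> C) := entire E /\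
  forall s, E s = 0 -> exists2 l, l != 0 & cdiff E s l.

Lemma simple_zero_lower (E : C -> C) s0 (l : C) : E s0 = 0 -> l != 0 -> cdiff E s0 l ->
  forall e : R, 0 < e -> exists2 d : R, 0 < d & forall h : C, normc h < d ->
    normc (E (s0 + h) - l * h) <= e * normc h /\ normc l / 2 * normc h <= normc (E (s0 + h)).
Proof.
move=> E0 l0 dE e e0; have nl : 0 < normc l by rewrite normc_gt0.
have m0 : 0 < Num.min e (normc l / 2) by rewrite lt_min e0 /=; lra.
have [d d0 Hd] := dE _ m0; exists d => // h /Hd; rewrite E0 subr0 => H.
have nh := normc_ge0 h; split.
  by apply: le_trans H _; rewrite ler_wpM2r // ge_min lexx.
have H2 : normc (E (s0 + h) - l * h) <= normc l / 2 * normc h.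
  by apply: le_trans H _; rewrite ler_wpM2r // ge_min lexx orbT.
have := normcB (E (s0 + h)) (E (s0 + h) - l * h).
have -> : E (s0 + h) - (E (s0 + h) - l * h) = l * h by ring.
by rewrite normcM => ?; lra.
Qed.

Lemma simple_zeros_near (E : C -> C) s0 : simple_zeros E -> \forall s \near s0^', E s != 0.
Proof.
move=> [dE zE]; have [E0|E0] := eqVneq (E s0) 0.
  have [l l0 dl] := zE _ E0; have nl : 0 < normc l by rewrite normc_gt0.
  have [d d0 Hd] := simple_zero_lower E0 l0 dl ltr01.
  apply/dnearCP; exists d => // s ss0 /Hd[_]; have -> : s0 + (s - s0) = s by ring.
  move=> H.
  rewrite -normc_gt0; apply: lt_le_trans H; rewrite mulr_gt0 //; first by lra.
  by rewrite normc_gt0 subr_eq0.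
have n0 : 0 < normc (E s0) by rewrite normc_gt0.
have [d d0 Hd] := cderivable_continuous (dE s0) n0.
apply/dnearCP; exists d => // s _ /Hd H; apply/eqP => Es.
by move: H; rewrite Es sub0r normcN ltxx.
Qed.

Lemma meromorphicV (E : C -> C) : simple_zeros E -> meromorphic (fun s => (E s)^-1).
Proof.
move=> sE s0; have [dE zE] := sE.
have /dnearCP[d d0 Hd] := simple_zeros_near s0 sE.
exists 2%N, (fun s => if s == s0 then (if E s0 == 0 then 0 else 0) else (s - s0) ^+ 2 / E s).
split; last first.
  by apply/dnearCP; exists d => // s ss0 _; rewrite (negPf ss0).
apply/nearCP; exists d => // s sd; have [->{s sd}|ss0] := eqVneq s s0; last first.
  have n0 : 0 < normc (s - s0) by rewrite normc_gt0 subr_eq0.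
  apply: (@cderivable_near _ (fun s => (s - s0) ^+ 2 / E s)).
    exists (normc (s - s0)) => // x xs; case: eqP => // xs0.
    by move: xs; rewrite xs0 normc_sub ltxx.
  apply: (@cderivableM _ (fun s => (s - s0) ^+ 2)); first exact: cderivable_subX.
  by apply: cderivableV; [exact: Hd|exact: dE].
rewrite if_same.
have [E0|E0] := eqVneq (E s0) 0; last first.
  have n0 : 0 < normc (E s0) by rewrite normc_gt0.
  have [d1 d10 Hd1] := cderivable_continuous (dE s0) n0.
  apply: (@cderivable_near _ (fun s => (s - s0) ^+ 2 / E s)).
    exists d1 => // x _; case: eqP => // ->.
    by rewrite subrr expr2 !mul0r.
  apply: (@cderivableM _ (fun s => (s - s0) ^+ 2)); first exact: cderivable_subX.
  by apply: cderivableV; [|exact: dE].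
have [l l0 dl] := zE _ E0; have nl : 0 < normc l by rewrite normc_gt0.
(* Near a simple zero with derivative l the function (s - s0)^2 / E is (s - s0) / l to first
   order. *)
apply/derivableCP; exists l^-1 => e e0.
have e'0 : 0 < e * normc l ^+ 2 / 2 by rewrite divr_gt0 // mulr_gt0 // exprn_gt0.
have [d1 d10 H1] := simple_zero_lower E0 l0 dl e'0.
exists d1 => // h /H1[]; have [->|h0] := eqVneq h 0.
  by move=> _ _; rewrite addr0 eqxx mulr0 subrr subr0 normc0 mulr0.
have sh : s0 + h == s0 = false.
  by apply/negbTE/eqP => e1; move/eqP: h0; apply; apply: (addrI s0); rewrite e1 addr0.
rewrite sh eqxx subr0.
have -> : s0 + h - s0 = h by ring.
set Eh := E (s0 + h); have nh : 0 < normc h by rewrite normc_gt0.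
move=> h1 h2; have Eh0 : 0 < normc Eh.
  by apply: lt_le_trans h2; rewrite mulr_gt0 //; lra.
have Ehn0 : Eh != 0 by rewrite -normc_gt0.
have -> : h ^+ 2 / Eh - l^-1 * h = - (h * (Eh - l * h) / (l * Eh)) by field; rewrite Ehn0 l0.
rewrite normcN normcM normcV !normcM ler_pdivrMr ?mulr_gt0 //.
apply: (@le_trans _ _ (normc h * (e * normc l ^+ 2 / 2 * normc h))).
  by rewrite ler_wpM2l // ltW.
have -> : normc h * (e * normc l ^+ 2 / 2 * normc h) =
  e * normc h * (normc l * (normc l / 2 * normc h)) by field.
rewrite ler_wpM2l //; first by rewrite mulr_ge0 ?ltW.
by rewrite ler_wpM2l // ltW.
Qed.

(** At a zero A * cexp equals 1, so the derivative there is -al. The elementary denominators 1 - A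
    X^j, with X a power of q^-s, are all of this shape. *)
Lemma simple_zeros_cexp (A al be : C) : al != 0 ->
  simple_zeros (fun s => 1 - A * cexp (al * s + be)).
Proof.
move=> al0.
have dd s : cdiff (fun s => 1 - A * cexp (al * s + be)) s (- (A * al * cexp (al * s + be))).
  move=> e e0; have na : 0 < normc al by rewrite normc_gt0.
  have k0 : 0 < normc A * normc al + 1 by rewrite ltr_wpDl // mulr_ge0 // normc_ge0.
  have [d d0 Hd] := cexp_diff (al * s + be) (divr_gt0 e0 k0).
  exists (d / normc al); first by rewrite divr_gt0.
  move=> h hd; have : normc (al * h) < d by rewrite normcM mulrC -ltr_pdivlMr.
  move=> /Hd; have -> : al * s + be + al * h = al * (s + h) + be by ring.
  set X := cexp _; set Y := cexp _.
  have -> : 1 - A * X - (1 - A * Y) - - (A * al * Y) * h =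
    - (A * (X - Y - Y * (al * h))) by ring.
  rewrite normcN (normcM A) (normcM al) => H.
  move: (ler_wpM2l (normc_ge0 A) H) => /le_trans; apply.
  have -> : normc A * (e / (normc A * normc al + 1) * (normc al * normc h)) =
     e * ((normc A * normc al) / (normc A * normc al + 1)) * normc h.
    by field; rewrite gt_eqF.
  rewrite ler_wpM2r ?normc_ge0 //.
  rewrite -[leRHS]mulr1 ler_pM2l // ler_pdivrMr //; lra.
split.
  by move=> s; apply/derivableCP; exists (- (A * al * cexp (al * s + be))).
move=> s /eqP; rewrite subr_eq0 => /eqP e1.
exists (- (A * al * cexp (al * s + be))) => //.
rewrite oppr_eq0 mulrAC -e1 mul1r //.
Qed.

Lemma meromorphicN f : meromorphic f -> meromorphic (fun s => - f s).
Proof.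
move=> mf; have := meromorphicM (meromorphic_entire (@entire_cst (-1))) mf.
by have -> : (fun s => -1 * f s) = (fun s => - f s) by apply/funext => s; rewrite mulN1r.
Qed.

(** The form in which uniqueness is applied: two continuations are compared on a strip where both
    are given by the integral. *)
Lemma mero_identity_strip f g (a b : R) : a < b -> meromorphic f -> meromorphic g ->
  (forall s, a < Re s < b -> f s = g s) -> mero_eq f g.
Proof.
move=> ab mf mg fg s0.
have mh := meromorphicD mf (meromorphicN mg).
have r0 : 0 < (b - a) / 2 by lra.
have := @mero_identity _ _ ((a + b) / 2)%:C _ mh r0.
have h0 s : normc (s - ((a + b) / 2)%:C) < (b - a) / 2 -> f s - g s = 0.
  move=> sc; have := le_lt_trans (normc_Re _) sc; rewrite ReB /= ltr_norml.
  by move=> /andP[? ?]; rewrite fg ?subrr //; apply/andP; split; lra.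
move=> /(_ h0 s0) hs; apply: (dnearC2 _ hs hs) => x /eqP.
by rewrite subr_eq0 => /eqP.
Qed.

End Meromorphic.

(** * Valuation, finite quotients and compactness of the ideals *)

Section Valuation.
Context {F : padicFieldType}.
Local Notation v := (@pval F).
Implicit Types (x y z : F) (m n : int).

Lemma valM x y : x != 0 -> y != 0 -> v (x * y) = v x + v y.
Proof. exact: (pvalM x y). Qed.

Lemma valD x y : x != 0 -> y != 0 -> x + y != 0 -> Order.min (v x) (v y) <= v (x + y).
Proof. exact: (pvalD x y). Qed.

Lemma val1 : v 1 = 0.
Proof.
have := valM (oner_neq0 F) (oner_neq0 F); rewrite mulr1 => h.
by apply: (addrI (v 1)); rewrite addr0 -h.
Qed.

Lemma valV x : x != 0 -> v x^-1 = - v x.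
Proof.
move=> x0; have := valM x0 (_ : x^-1 != 0); rewrite invr_eq0 divff // val1 => /(_ x0) h.
lia.
Qed.

Lemma valN1 : v (-1) = 0.
Proof.
have n0 : (-1 : F) != 0 by rewrite oppr_eq0 oner_eq0.
have := valM n0 n0; rewrite mulrNN mulr1 val1; lia.
Qed.

Lemma valN x : v (- x) = v x.
Proof.
have [->|x0] := eqVneq x 0; first by rewrite oppr0.
by rewrite -mulN1r valM ?oppr_eq0 ?oner_eq0 // valN1 add0r.
Qed.

Lemma valX x n : x != 0 -> v (x ^ n) = n * v x.
Proof.
move=> x0; have key k : v (x ^+ k) = k%:Z * v x.
  elim: k => [|k IH]; first by rewrite expr0 val1; lia.
  by rewrite exprS valM ?expf_neq0 // IH; lia.
case: n => n; first exact: key.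
by rewrite NegzE -exprnN valV ?expf_neq0 // key; lia.
Qed.

Lemma PFE m x : x != 0 -> PF m x <-> m <= v x.
Proof.
move=> x0; split=> [[x00|//]|]; last by right.
by rewrite x00 eqxx in x0.
Qed.

Lemma PF0 m : PF m (0 : F). Proof. by left. Qed.

Lemma PFN m x : PF m x -> PF m (- x).
Proof. by case=> [->|h]; [rewrite oppr0; left|right; rewrite valN]. Qed.

Lemma PFD m x y : PF m x -> PF m y -> PF m (x + y).
Proof.
case=> [->|hx]; first by rewrite add0r.
case=> [->|hy]; first by rewrite addr0; right.
have [->|x0] := eqVneq x 0; first by rewrite add0r; right.
have [->|y0] := eqVneq y 0; first by rewrite addr0; right.
have [->|xy0] := eqVneq (x + y) 0; first exact: PF0.
by right; apply: le_trans (valD x0 y0 xy0); rewrite le_min hx.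
Qed.

Lemma PFB m x y : PF m x -> PF m y -> PF m (x - y).
Proof. by move=> hx /PFN; exact: PFD. Qed.

Lemma PFM m n x y : PF m x -> PF n y -> PF (m + n) (x * y).
Proof.
have [->|x0] := eqVneq x 0; first by rewrite mul0r; left.
have [->|y0] := eqVneq y 0; first by rewrite mulr0; left.
rewrite !PFE ?mulf_neq0 // valM // => h1 h2; lia.
Qed.

Lemma PFW m n x : m <= n -> PF n x -> PF m x.
Proof. by move=> mn [->|h]; [left|right; exact: le_trans h]. Qed.

Lemma PF_mulE m x y : x != 0 -> PF m (x * y) <-> PF (m - v x) y.
Proof.
move=> x0; have [->|y0] := eqVneq y 0.
  by rewrite mulr0; split => _; exact: PF0.
rewrite !PFE ?mulf_neq0 // valM //; split=> ?; lia.
Qed.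

Lemma PF_val x : PF (v x) x.
Proof. by right. Qed.

Lemma PF_nz m x : ~ PF m x -> x != 0 /\ v x < m.
Proof.
move=> h; have x0 : x != 0 by apply/eqP => e; apply: h; rewrite e; left.
by split=> //; rewrite ltNge; apply/negP => h'; apply: h; right.
Qed.

Lemma PF_sub_sym m x y : PF m (x - y) -> PF m (y - x).
Proof. by move/PFN; rewrite opprB. Qed.

Lemma PF_congr m x y : PF m (x - y) -> PF m x <-> PF m y.
Proof.
move=> h; split=> [hx|hy].
  by rewrite -(subKr x y); apply: PFB.
by rewrite -(subrK y x); apply: PFD.
Qed.

Lemma val_add_small x y : x != 0 -> PF (v x + 1) y -> x + y != 0 /\ v (x + y) = v x.
Proof.
move=> x0 hy.
have xy0 : x + y != 0.
  apply/eqP => e; have : PF (v x + 1) x.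
    by rewrite -[X in PF _ X](addrK y) e sub0r; exact: PFN.
  rewrite PFE //; lia.
split=> //.
have h1 : v x <= v (x + y).
  have : PF (v x) (x + y) by apply: PFD; [exact: PF_val|apply: PFW hy; lia].
  by rewrite PFE.
suff : ~ (v x + 1 <= v (x + y)) by lia.
move=> h; have : PF (v x + 1) x.
  rewrite -[X in PF _ X](addrK y); apply: PFB => //; by rewrite PFE.
rewrite PFE //; lia.
Qed.

Lemma val_1D y : PF 1 y -> 1 + y != 0 /\ v (1 + y) = 0.
Proof.
move=> hy; have := @val_add_small 1 y (oner_neq0 _); rewrite val1 add0r.
exact.
Qed.

Lemma PFnat k : PF 0 (k%:R : F).
Proof.
elim: k => [|k IH]; first exact: PF0.
by rewrite -natr1; apply: PFD => //; right; rewrite val1.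
Qed.

Lemma val_2 p : residual_char (F := F) p -> odd p -> (2 : F) != 0 /\ v 2 = 0.
Proof.
move=> [_ hp] op.
have h2 : ~ PF 1 (2 : F).
  move=> h2.
  have : PF 1 (1 : F).
    have -> : (1 : F) = p%:R - 2 * (p./2)%:R.
      by rewrite -{1}(odd_double_half p) op natrD -muln2 natrM /=; ring.
    apply: PFB => //; rewrite -[1]addr0; apply: PFM => //; exact: PFnat.
  by rewrite PFE ?oner_neq0 // val1.
have [n0 h] := PF_nz h2; split => //.
have := PFnat 2; rewrite PFE // => h3; lia.
Qed.

Lemma nbhsF x (A : set F) : nbhs x A <-> exists m, forall y, PF m (y - x) -> A y.
Proof.
rewrite -nbhs_entourageE; split.
  move=> [E]; rewrite padic_entourage => -[m _ hm] EA.
  by exists m => y hy; apply: EA; apply/xsectionP; exact: hm.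
move=> [m hm]; exists [set xy | PF m (xy.2 - xy.1)].
  by rewrite padic_entourage; exists m.
by move=> y /xsectionP; exact: hm.
Qed.

Lemma open_coset x m : open [set y : F | PF m (y - x)].
Proof.
rewrite openE => y /= hy; apply/nbhsF; exists m => z hz /=.
by rewrite -(subrK y z) -addrA; exact: PFD.
Qed.

Lemma open_PF m : open (@PF F m).
Proof.
have -> : @PF F m = [set y | PF m (y - 0)] by apply/funext => y; rewrite /= subr0.
exact: open_coset.
Qed.

Lemma closed_PF m : closed (@PF F m).
Proof.
move=> x hx; have [y [hy1 hy2]] : PF m `&` [set y | PF m (y - x)] !=set0.
  by apply: hx; apply/nbhsF; exists m.
exact: (PF_congr hy2).1.
Qed.

(** A finite system of representatives of P^m / P^M. It turns integrals of locally constant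
    functions into finite sums, on which linearity, substitution and Fubini are elementary. *)
Definition transversal m M (r : seq F) := [/\ uniq r, forall a, a \in r -> PF m a,
  forall x, PF m x -> exists2 a, a \in r & PF M (x - a) &
  forall a b, a \in r -> b \in r -> PF M (a - b) -> a = b].

Lemma exists_unif : exists w : F, w != 0 /\ v w = 1.
Proof. by have [w w0 w1] := @pval_normalized F; exists w. Qed.

Lemma residue_transversal : exists2 r, transversal 0 1 r & size r = @residue_card F.
Proof.
pose cl (x : F) := [set y : F | valuation_ideal v 1 (y - x)].
have clE x y : cl x = cl y <-> PF 1 (x - y).
  split=> [e|h].
    have : cl x x by rewrite /cl /= subrr; left.
    by rewrite e.
  apply/funext => z; apply/propext; rewrite /cl /= -[valuation_ideal _ _]/(PF 1).
  split=> hz.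
    by rewrite -(subrK x z) -addrA; exact: PFD.
  by rewrite -(subrK y z) -addrA; apply: PFD => //; exact: PF_sub_sym.
have cr : (`I_(@residue_card F) #= [set cl x | x in valuation_ideal v 0])%card.
  exact/card_esym/card_residue.
have [f] := pcard_eqP cr.
have hf i : (i < @residue_card F)%N -> exists x, PF 0 x /\ cl x = f i.
  move=> hi; have : [set cl x | x in valuation_ideal v 0] (f i).
    by apply: funS.
  by move=> [x hx <-]; exists x.
pose g i := xget (0 : F) [set x | PF 0 x /\ cl x = f i].
have hg i : (i < @residue_card F)%N -> PF 0 (g i) /\ cl (g i) = f i.
  by move=> /hf[x hx]; exact: (@xgetI _ 0 [set x | PF 0 x /\ cl x = f i] x).
exists [seq g i | i <- iota 0 (@residue_card F)]; last by rewrite size_map size_iota.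
have finj i j : (i < @residue_card F)%N -> (j < @residue_card F)%N -> f i = f j -> i = j.
  by move=> hi hj e; apply: (@inj _ _ _ f) => //; exact/mem_set.
split.
- rewrite map_inj_in_uniq ?iota_uniq // => i j; rewrite !mem_iota !add0n /= => hi hj e.
  by apply: finj => //; rewrite -(hg i hi).2 -(hg j hj).2 e.
- by move=> a ha; have [ i ] := elimT (@mapP _ _ _ _ _) ha; rewrite mem_iota add0n => /= hi ->; exact: (hg i hi).1.
- move=> x hx; have [i /= hi fi] : [set f i | i in `I_(@residue_card F)] (cl x).
    by rewrite image_eq; exists x.
  exists (g i).
    by apply: map_f; rewrite mem_iota add0n.
  by apply/clE; rewrite (hg i hi).2.
- move=> a b ha hb; have [ i ] := elimT (@mapP _ _ _ _ _) ha; have [j] := elimT (@mapP _ _ _ _ _) hb.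
  rewrite !mem_iota !add0n /= => hj -> hi -> /clE; rewrite (hg i hi).2 (hg j hj).2 => /finj -> //.
Qed.

(** Expansion in digits: a residue b is appended to a representative a as a + w^(m+k) b. *)
Lemma exists_transversal_nat m (k : nat) : exists2 r, transversal m (m + k%:Z) r &
   size r = (@residue_card F ^ k)%N.
Proof.
have [w [w0 w1]] := exists_unif.
have [r0 [u0 i0 s0 d0] sz0] := residue_transversal.
elim: k => [|k [r [u i s d] sz]].
  exists [:: 0]; last by rewrite expn0.
  split=> //.
  - by move=> a; rewrite inE => /eqP ->; exact: PF0.
  - move=> x hx; exists 0; [by rewrite inE|rewrite (subr0 x); apply: (PFW _ hx); lia].
  - by move=> a b; rewrite !inE => /eqP -> /eqP ->.
pose W := w ^ (m + k%:Z).
have W0 : W != 0 by rewrite expfz_neq0.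
have vW : v W = m + k%:Z by rewrite valX // w1 mulr1.
have key a b a' b' : a \in r -> a' \in r -> b \in r0 -> b' \in r0 ->
    PF (m + k.+1%:Z) (a + W * b - (a' + W * b')) -> a = a' /\ b = b'.
  move=> ha ha' hb hb' h.
  have e1 : a = a'.
    apply: d => //; have -> : a - a' = (a + W * b - (a' + W * b')) - W * (b - b') by ring.
    apply: PFB; first by apply: PFW h; lia.
    by rewrite -(addr0 (m + _)) -vW; apply: PFM; [exact: PF_val|apply: PFB; exact: i0].
  split=> //; apply: d0 => //; move: h.
  have -> : a + W * b - (a' + W * b') = W * (b - b') by rewrite e1; ring.
  rewrite PF_mulE // vW; apply: PFW; lia.
exists [seq a + W * b | a <- r, b <- r0].
  split.
  - apply: allpairs_uniq => // -[a b] [a' b'].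
    move=> /allpairsP[[x y] /= [hx hy [-> ->]]] /allpairsP[[x' y'] /= [hx' hy' [-> ->]]] e.
    have h0 : PF (m + k.+1%:Z) (x + W * y - (x' + W * y')) by rewrite e subrr; exact: PF0.
    by have [-> ->] := key x y x' y' hx hx' hy hy' h0.
  - move=> a /allpairsP[[x y] /= [hx hy ->]]; apply: (PFD (i _ hx)).
    by apply: PFW (PFM (PF_val W) (i0 _ hy)); rewrite vW; lia.
  - move=> x /s[a ha hxa].
    have : PF 0 (W^-1 * (x - a)).
      have W0' : W^-1 != 0 by rewrite invr_eq0.
      by rewrite PF_mulE // valV // vW opprK add0r.
    move=> /s0[b hb hb']; exists (a + W * b).
      by apply/allpairsP; exists (a, b).
    have -> : x - (a + W * b) = W * (W^-1 * (x - a) - b) by field.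
    rewrite PF_mulE // vW; apply: PFW hb'; lia.
  - move=> a b /allpairsP[[x y] /= [hx hy ->]] /allpairsP[[x' y'] /= [hx' hy' ->]].
    by move=> /(key _ _ _ _ hx hx' hy hy')[-> ->].
by rewrite size_allpairs sz sz0 expnSr.
Qed.

Lemma exists_transversal m M : m <= M -> exists r, transversal m M r.
Proof.
move=> mM; have [r hr _] := exists_transversal_nat m (absz (M - m)).
exists r; suff <- : m + (absz (M - m))%:Z = M by [].
lia.
Qed.

Lemma residue_card_gt1 : (1 < @residue_card F)%N.
Proof.
have [r [u i s d] <-] := residue_transversal.
have [a ha ha'] := s 0 (PF0 _).
have [|b hb hb'] := s 1; first by right; rewrite val1.
have ab : a != b.
  apply/eqP => e; have : PF 1 (1 : F).
    have -> : (1 : F) = (1 - b) - (0 - a) by rewrite e; ring.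
    exact: PFB.
  by rewrite PFE ?oner_neq0 // val1.
apply: (@leq_trans (size [:: a; b])) => //; apply: uniq_leq_size.
  by rewrite /= inE ab.
by move=> x; rewrite !inE => /orP[] /eqP ->.
Qed.

(** Each P^m is a finite union of cosets of P^M, so an ultrafilter on it contains one such coset for
    every M. It is therefore Cauchy, and completeness gives the limit. *)
Lemma compact_PF m : compact (@PF F m).
Proof.
rewrite compact_ultra => U ultraU Um.
have cU : cauchy U.
  move=> E; rewrite padic_entourage => -[M _ hM].
  have mM : m <= Num.max m M by rewrite le_max lexx.
  have [r [_ _ s _]] := exists_transversal mM.
  have [a Ua] : exists a, U [set y | PF (Num.max m M) (y - a)].
    apply: contrapT => hn.
    have hall : U [set x | forall a, a \in r -> ~ PF (Num.max m M) (x - a)].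
      elim: r {s} => [|a r IH]; first by apply: filterS Um => x _ a.
      have Ua : U (~` [set y | PF (Num.max m M) (y - a)]).
        have [h|//] := in_ultra_setVsetC [set y | PF (Num.max m M) (y - a)] ultraU.
        by exfalso; apply: hn; exists a.
      apply: filterS (filterI Ua IH) => x [/= h1 h2] b; rewrite inE => /orP[/eqP ->//|].
      exact: h2.
    have [x [/= h1 /s[a ar ha]]] : [set x | forall a, a \in r -> ~ PF (Num.max m M) (x - a)] `&` PF m !=set0.
      exact: filter_ex (filterI hall Um).
    exact: (h1 a ar).
  exists ([set y | PF (Num.max m M) (y - a)], [set y | PF (Num.max m M) (y - a)]) => //=.
  move=> [x y] [/= hx hy]; apply: hM => /=.
  have -> : y - x = (y - a) - (x - a) by ring.
  by apply: PFW (PFB hy hx); rewrite le_max lexx orbT.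
have [l Ul] := @padic_complete F U _ cU.
exists l; split=> //.
apply: closed_PF => A /Ul UA.
exact: (filter_ex (filterI Um UA)).
Qed.

End Valuation.

(** * Schwartz functions with explicit levels *)

Section LocallyConstant.
Context {R : realType} {F : padicFieldType}.
Local Notation C := R[i].
Local Notation v := (@pval F).
Implicit Types (f g : F -> C) (m M : int) (x y a b : F).

Definition supp m f := forall x, ~ PF m x -> f x = 0.
Definition pinv M f := forall x y, PF M y -> f (x + y) = f x.
(** An equivalent of [schwartz] in which compact support and local constancy are replaced by two
    integers: an ideal containing the support and an ideal of periods. *)
Definition lc f := exists m M, supp m f /\ pinv M f.

Lemma pinvE M f x y : pinv M f -> PF M (x - y) -> f x = f y.
Proof. by move=> pf h; rewrite -(subrK y x) addrC pf. Qed.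

Lemma suppW m m' f : m' <= m -> supp m f -> supp m' f.
Proof. by move=> mm sf x hx; apply: sf => h; apply: hx; exact: PFW h. Qed.

Lemma pinvW M M' f : M <= M' -> pinv M f -> pinv M' f.
Proof. by move=> mm pf x y hy; apply: pf; exact: PFW hy. Qed.

Lemma lcP f : lc f -> exists m M, [/\ m <= M, supp m f & pinv M f].
Proof.
move=> [m [M [sf pf]]]; exists m, (Num.max m M); split=> //.
  by rewrite le_max lexx.
by apply: pinvW pf; rewrite le_max lexx orbT.
Qed.

Lemma lc2P f g : lc f -> lc g ->
  exists m M, [/\ m <= M, supp m f, pinv M f, supp m g & pinv M g].
Proof.
move=> [m [M [sf pf]]] [m' [M' [sg pg]]].
exists (Num.min m m'), (Num.max (Num.max M M') (Num.min m m')); split.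
- by rewrite le_max lexx orbT.
- by apply: suppW sf; rewrite ge_min lexx.
- by apply: pinvW pf; rewrite !le_max lexx.
- by apply: suppW sg; rewrite ge_min lexx orbT.
- by apply: pinvW pg; rewrite !le_max lexx !orbT.
Qed.

Lemma pinvM M f g : pinv M f -> pinv M g -> pinv M (fun x => f x * g x).
Proof. by move=> pf pg x y h; rewrite pf // pg. Qed.

Lemma suppMl m f g : supp m f -> supp m (fun x => f x * g x).
Proof. by move=> sf x h; rewrite sf // mul0r. Qed.

Lemma suppMr m f g : supp m g -> supp m (fun x => f x * g x).
Proof. by move=> sf x h; rewrite sf // mulr0. Qed.

Lemma lc_ext f g : f =1 g -> lc f -> lc g.
Proof. by move=> /funext ->. Qed.

Lemma lcD f g : lc f -> lc g -> lc (fun x => f x + g x).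
Proof.
move=> hf hg; have [m [M [mM sf pf sg pg]]] := lc2P hf hg; exists m, M; split.
  by move=> x h; rewrite sf // sg // addr0.
by move=> x y h; rewrite pf // pg.
Qed.

Lemma lcZ c f : lc f -> lc (fun x => c * f x).
Proof.
move=> [m [M [sf pf]]]; exists m, M; split; first exact: suppMr.
by move=> x y h; rewrite pf.
Qed.

Lemma lc_shift b f : lc f -> lc (fun x => f (x + b)).
Proof.
move=> [m [M [sf pf]]]; have [bm|/PF_nz[b0 bm]] := pselect (PF m b).
  exists m, M; split.
    by move=> x h; apply: sf => h'; apply: h; rewrite -(addrK b x); exact: PFB.
  by move=> x y h; rewrite (addrAC x) (pf _ _ h).
exists (v b), M; split.
  move=> x h; apply: sf => h'; apply: h; rewrite -(addrK b x); apply: PFB.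
    by apply: PFW h'; exact: ltW.
  exact: PF_val.
by move=> x y h; rewrite (addrAC x) (pf _ _ h).
Qed.

Lemma lc_scale a f : a != 0 -> lc f -> lc (fun x => f (a * x)).
Proof.
move=> a0 [m [M [sf pf]]]; exists (m - v a), (M - v a); split.
  by move=> x h; apply: sf => h'; apply: h; apply/PF_mulE.
by move=> x y h; rewrite mulrDr pf //; apply/PF_mulE.
Qed.

Definition indF (A : set F) : F -> C := fun x => (\1_A x : R)%:C.

Lemma indF1 (A : set F) x : A x -> indF A x = 1.
Proof. by move=> h; rewrite /indF indicE mem_set. Qed.

Lemma indF0 (A : set F) x : ~ A x -> indF A x = 0.
Proof. by move=> h; rewrite /indF indicE memNset. Qed.

Lemma indFE (A : set F) x : indF A x = (x \in A)%:R.
Proof. by rewrite /indF indicE; case: (x \in A). Qed.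

Lemma pinv_PF m M : m <= M -> pinv M (indF (PF m)).
Proof.
move=> mM x y h; have hy : PF m y by exact: PFW h.
have [hx|hx] := pselect (PF m x).
  by rewrite (indF1 hx) (indF1 (PFD hx hy)).
by rewrite !indF0 // => h'; apply: hx; rewrite -(addrK y x); exact: PFB.
Qed.

Lemma supp_PF m : supp m (indF (PF m)).
Proof. by move=> x h; rewrite indF0. Qed.

Lemma lc_PF m : lc (indF (PF m)).
Proof. by exists m, m; split; [exact: supp_PF|exact: pinv_PF]. Qed.

Lemma lc_schwartz f : lc f -> schwartz f.
Proof.
move=> /lcP[m [M [mM sf pf]]]; split.
  by move=> x; apply/nbhsF; exists M => y h; exact: pinvE h.
apply: (@subclosed_compact _ _ (PF m)); [exact: closed_closure|exact: compact_PF|].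
have -> : PF m = closure (PF m) :> set F by apply/closure_id; exact: closed_PF.
apply: closure_subset => x /= fx; apply: contrapT => h.
by move: fx; rewrite sf // eqxx.
Qed.

(** Compactness makes the local levels uniform over the closure of the support. A point off the
    support that y would move into it is treated from its image, with -y. *)
Lemma schwartz_lc f : schwartz f -> lc f.
Proof.
move=> [lf /compact_near_coveringP nc].
have sub x : f x != 0 -> closure [set x | f x != 0] x.
  by move=> h; exact: subset_closure.
have [N _ hN] : \forall N \near \oo, closure [set x | f x != 0] `<=` PF (- (N%:Z)).
  apply: (nc nat \oo (fun N x => PF (- (N%:Z)) x)) => x _.
  pose N0 := absz (v x).
  exists ([set y | PF (- (N0%:Z)) (y - x)], [set N | (N0 <= N)%N]).
    split; first by apply/nbhsF; exists (- N0%:Z).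
    by exists N0.
  move=> [y N] [/= hy hN]; have hx : PF (- N0%:Z) x by right; rewrite /N0; lia.
  by apply: (@PFW _ _ (- N0%:Z)); [lia|exact: ((PF_congr hy).2 hx)].
have [L _ hL] : \forall L \near \oo, closure [set x | f x != 0] `<=`
    [set x | forall y, PF (L%:Z) y -> f (x + y) = f x].
  apply: (nc nat \oo (fun L x => forall y, PF (L%:Z) y -> f (x + y) = f x)) => x _.
  have /nbhsF[k hk] := lf x.
  exists ([set y | PF k (y - x)], [set N | (absz k <= N)%N]).
    split; first by apply/nbhsF; exists k.
    by exists (absz k).
  move=> [x' L] [/= hx' hL] y hy; rewrite (hk x') //; apply: hk.
  have -> : x' + y - x = (x' - x) + y by ring.
  by apply: PFD => //; apply: PFW hy; lia.
exists (- N%:Z), L%:Z; split.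
  move=> x hx; apply/eqP; apply: contraT => /sub h; exfalso; apply: hx.
  by apply: (hN N) => //=.
move=> x y hy; have [h|h] := eqVneq (f x) 0; last by apply: (hL L) => //=; exact: sub.
have [->//|h'] := eqVneq (f (x + y)) 0.
have := hL L (leqnn L) _ (sub _ h') (- y) (PFN hy).
by rewrite addrK h => e; move: h'; rewrite -e eqxx.
Qed.

End LocallyConstant.

(** * Haar integrals of locally constant functions *)

Section HaarIntegral.
Context {R : realType} {F : padicFieldType}.
Local Notation C := R[i].
Local Notation v := (@pval F).
Local Notation q := ((@residue_card F)%:R : R).
Variable nu : {measure set (borel F) -> \bar R}.
Hypothesis hnu : is_haar nu.
Implicit Types (f g : F -> C) (m M : int) (x y a b : F).

Lemma measurable_openF (A : set F) : open A -> measurable (A : set (borel F)).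
Proof. by move=> oA; exact: sub_sigma_algebra. Qed.

Lemma measurable_PF m : measurable (PF m : set (borel F)).
Proof. by apply: (@measurable_openF (PF m)); exact: open_PF. Qed.

Lemma measurable_coset a m : measurable ([set y | PF m (y - a)] : set (borel F)).
Proof. by apply: measurable_openF; exact: open_coset. Qed.

Lemma nu_PF_fin m : (nu (PF m) < +oo)%E.
Proof. by have [_ h _] := hnu; apply: h; exact: compact_PF. Qed.

Lemma nu_coset a m : nu [set y | PF m (y - a)] = nu (PF m).
Proof.
have [h _ _] := hnu; rewrite -(h a _ (measurable_PF m)); congr (nu _).
suff -> : [set y | PF m (y - a)] = [set a + x | x in (PF m : set F)] by [].
apply/seteqP; split=> [y /= hy|_ [x hx <-] /=]; last by rewrite addrC addKr.
by exists (y - a) => //; rewrite addrC subrK.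
Qed.

Definition vol m : R := fine (nu (PF m)).

Lemma nu_PF m : nu (PF m) = (vol m)%:E.
Proof. by rewrite fineK // ge0_fin_numE // nu_PF_fin. Qed.

Lemma cintegrable_ind (A : set (borel F)) : measurable A ->
  (nu A < +oo)%E -> cintegrable nu setT (indF A : borel F -> C).
Proof.
move=> mA fA; split; last by apply: (eq_integrable _ (cst 0%E)); last exact: integrable0.
apply/integrableP; split.
  by apply/measurable_EFinP => /=; exact: measurable_indic.
rewrite (eq_integral (fun t : borel F => (\1_A t)%:E)); last first.
  by move=> t _; rewrite gee0_abs// lee_fin.
by rewrite integral_indic // setIT.
Qed.

Lemma cintegral_ind (A : set (borel F)) : measurable A ->
  cintegral nu setT (indF A : borel F -> C) = (fine (nu A))%:C.
Proof.
move=> mA; apply: complex_eqP => /=.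
  by rewrite /Rintegral /= integral_indic // setIT.
by rewrite /Rintegral integral0_eq.
Qed.

Notation I f := (cintegral nu setT (f : borel F -> C)).

Lemma lc_sum_ind f m M r : m <= M -> supp m f -> pinv M f -> transversal m M r ->
  f =1 (fun x => \sum_(a <- r) f a * indF [set y | PF M (y - a)] x).
Proof.
move=> mM sf pf [ur ir sr dr] x; have [hx|hx] := pselect (PF m x).
  have [a ar hxa] := sr x hx.
  rewrite (big_rem a) //= indF1 // mulr1 big1_seq ?addr0; first exact: pinvE hxa.
  move=> b; rewrite mem_rem_uniq // inE => /andP[_ /andP[ba br]].
  rewrite indF0 ?mulr0 // => /= hxb; move/eqP: ba; apply.
  apply: dr => //; have -> : b - a = (x - a) - (x - b) by ring.
  exact: PFB.
rewrite sf // big1_seq // => a /andP[_ ar].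
rewrite indF0 ?mulr0 // => /= hxa; apply: hx.
by apply/(PF_congr (PFW mM hxa)); exact: ir.
Qed.

(** The bridge from measure theory to finite sums; translation, scaling and Fubini for [lc]
    functions are read off from it. *)
Lemma lc_integral_sum f m M r : m <= M -> supp m f -> pinv M f -> transversal m M r ->
  cintegrable nu setT (f : borel F -> C) /\ I f = (vol M)%:C * \sum_(a <- r) f a.
Proof.
move=> mM sf pf tr; have fE := lc_sum_ind mM sf pf tr.
have ci a : cintegrable nu setT (indF [set y | PF M (y - a)] : borel F -> C).
  by apply: cintegrable_ind; [exact: measurable_coset|rewrite nu_coset nu_PF_fin].
split.
  have h1 : cintegrable nu setT (fun x : borel F => \sum_(a <- r) f a * indF [set y | PF M (y - a)] x).
    by apply: cintegrable_sum => // a _; exact: cintegrableZ.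
  by apply: eq_cintegrable h1 => // x _; rewrite -fE.
have -> : I f = cintegral nu setT (fun x : borel F => \sum_(a <- r) f a * indF [set y | PF M (y - a)] x).
  by apply: eq_cintegral => x _; rewrite -fE.
rewrite cintegral_sum //; last by move=> a _; exact: cintegrableZ.
rewrite mulr_sumr; apply: eq_bigr => a _.
rewrite cintegralZ // cintegral_ind; last exact: measurable_coset.
by rewrite nu_coset mulrC.
Qed.

Lemma lc_integrable f : lc f -> cintegrable nu setT (f : borel F -> C).
Proof.
move=> /lcP[m [M [mM sf pf]]]; have [r tr] := @exists_transversal F _ _ mM.
by have [] := lc_integral_sum mM sf pf tr.
Qed.

Lemma ID f g : lc f -> lc g -> I (fun x => f x + g x) = I f + I g.
Proof. by move=> lf lg; apply: cintegralD => //; exact: lc_integrable. Qed.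

Lemma IB f g : lc f -> lc g -> I (fun x => f x - g x) = I f - I g.
Proof. by move=> lf lg; apply: cintegralB => //; exact: lc_integrable. Qed.

Lemma IZ c f : lc f -> I (fun x => c * f x) = c * I f.
Proof. by move=> lf; apply: cintegralZ => //; exact: lc_integrable. Qed.

Lemma eqI f g : f =1 g -> I f = I g.
Proof. by move=> /funext ->. Qed.

Lemma I_ind m : I (indF (PF m)) = (vol m)%:C.
Proof. by rewrite cintegral_ind //; exact: measurable_PF. Qed.

Lemma vol_exp m (k : nat) : vol m = q ^+ k * vol (m + k%:Z).
Proof.
have [r tr sr] := exists_transversal_nat (F := F) m k.
have mM : m <= m + k%:Z by lia.
have [_] := lc_integral_sum mM (@supp_PF R F m) (pinv_PF mM) tr.
rewrite I_ind (eq_big_seq (fun=> 1)); last first.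
  by move=> a ar; rewrite indF1 //; have [_ h _ _] := tr; exact: h.
rewrite big_const_seq count_predT iter_addr_0 sr => h.
apply: complexI; rewrite h rmorphM /= -mulr_natr mul1r mulrC natrX rmorphXn /=.
by rewrite rmorph_nat.
Qed.

Lemma q_gt1 : 1 < q.
Proof. by rewrite ltr1n residue_card_gt1. Qed.

Lemma q_gt0 : 0 < q.
Proof. by apply: lt_trans q_gt1. Qed.

Lemma volE m : vol m = q ^ (- m) * vol 0.
Proof.
have q0 : q != 0 by rewrite gt_eqF // q_gt0.
have [m0|m0] := lerP 0 m.
  rewrite (vol_exp 0 (absz m)) add0r gez0_abs //.
  rewrite mulrA -[q ^+ _]/(q ^ (absz m)%:Z) gez0_abs // -expfzDr // addNr expr0z mul1r //.
rewrite (vol_exp m (absz m)).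
have -> : m + (absz m)%:Z = 0 by lia.
by congr (_ * _); rewrite -[q ^+ _]/(q ^ (absz m)%:Z); congr (_ ^ _); lia.
Qed.

(** If P^0 were null, all P^(-k) would be by scaling, and so would their countable union F. *)
Lemma vol_gt0 m : 0 < vol m.
Proof.
have v0 : 0 <= vol 0 by exact: fine_ge0.
rewrite volE mulr_gt0 ?exprz_gt0 ?q_gt0 // lt_neqAle v0 andbT eq_sym.
apply/eqP => v00.
have [_ _] := hnu; rewrite -[X in (_ < nu X)%E]/([set: borel F]).
suff -> : nu [set: borel F] = 0%E by rewrite ltxx.
have -> : [set: borel F] = \bigcup_k (PF (- (k%:Z)) : set (borel F)).
  apply/seteqP; split=> // x _; exists (absz (v x)) => //=.
  by right; lia.
apply/eqP; rewrite -measure_le0.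
pose A (k : nat) : set (borel F) := PF (- (k%:Z)).
have mA k : measurable (A k) by exact: measurable_PF.
have := @measure_sigma_subadditive _ _ _ nu _ A mA (bigcup_measurable (fun k _ => mA k)) (@subset_refl _ _).
rewrite eseries0 // => k _ _; rewrite nu_PF volE v00 mulr0 //.
Qed.

Lemma I_shift b f : lc f -> I (fun x => f (x + b)) = I f.
Proof.
move=> /lcP[m0 [M0 [mM0 sf0 pf0]]].
have [m [M [mM sf pf hb]]] : exists m M, [/\ m <= M, supp m f, pinv M f & PF m b].
  exists (Num.min m0 (v b)), (Num.max M0 (Num.min m0 (v b))); split.
  - by rewrite le_max lexx orbT.
  - by apply: suppW sf0; rewrite ge_min lexx.
  - by apply: pinvW pf0; rewrite le_max lexx.
  - by right; rewrite ge_min lexx orbT.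
have [r tr] := @exists_transversal F _ _ mM.
have sf' : supp m (fun x => f (x + b)).
  by move=> x hx; apply: sf => h; apply: hx; rewrite -(addrK b x); exact: PFB.
have pf' : pinv M (fun x => f (x + b)).
  by move=> x y hy; rewrite (addrAC x) (pf _ _ hy).
have [ur ir sr dr] := tr.
have tr' : transversal m M [seq a + b | a <- r].
  split.
  - by rewrite map_inj_uniq // => x y /addIr.
  - by move=> _ /mapP[a ar ->]; apply: PFD => //; exact: ir.
  - move=> x hx; have [a ar ha] := sr (x - b) (PFB hx hb).
    exists (a + b); first by apply/mapP; exists a.
    by have -> : x - (a + b) = x - b - a by ring.
  - move=> _ _ /mapP[a ar ->] /mapP[a' ar' ->].
    have -> : a + b - (a' + b) = a - a' by ring.
    by move=> /(dr _ _ ar ar') ->.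
have [_ ->] := lc_integral_sum mM sf' pf' tr.
have [_ ->] := lc_integral_sum mM sf pf tr'.
by rewrite big_map.
Qed.

(** The factor is |a|^-1: dividing by a carries a transversal of P^m / P^M to one of P^(m - v a) /
    P^(M - v a). *)
Lemma I_scale a f : a != 0 -> lc f -> I (fun x => f (a * x)) = (q ^ v a)%:C * I f.
Proof.
move=> a0 /lcP[m [M [mM sf pf]]].
have [r tr] := @exists_transversal F _ _ mM; have [ur ir sr dr] := tr.
have sf' : supp (m - v a) (fun x => f (a * x)).
  by move=> x hx; apply: sf => h; apply: hx; apply/PF_mulE.
have pf' : pinv (M - v a) (fun x => f (a * x)).
  by move=> x y hy; rewrite mulrDr (pf _ _ _) //; apply/PF_mulE.
have tr' : transversal (m - v a) (M - v a) [seq a^-1 * x | x <- r].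
  have a'0 : a^-1 != 0 by rewrite invr_eq0.
  split.
  - by rewrite map_inj_uniq // => x y /(mulfI a'0).
  - move=> _ /mapP[x xr ->]; apply/(PF_mulE _ _ a'0); rewrite valV // opprK subrK; exact: ir.
  - move=> x hx; have [|b br hb] := sr (a * x); first exact/PF_mulE.
    exists (a^-1 * b); first by apply/mapP; exists b.
    by apply/(PF_mulE _ _ a0); rewrite mulrBr mulVKf.
  - move=> _ _ /mapP[x xr ->] /mapP[y yr ->]; rewrite -mulrBr.
    move=> /(PF_mulE _ _ a'0); rewrite valV // opprK subrK => /(dr _ _ xr yr) ->.
    by [].
have mM' : m - v a <= M - v a by lia.
have [_ ->] := lc_integral_sum mM' sf' pf' tr'.
have [_ ->] := lc_integral_sum mM sf pf tr.
rewrite big_map mulrA; congr (_ * _).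
  rewrite (volE M) volE -rmorphM; congr _%:C; rewrite mulrA -expfzDr; last by rewrite gt_eqF // q_gt0.
  by congr (_ ^ _ * _); ring.
by apply: eq_bigr => x _; rewrite mulVKf.
Qed.

(** The two-variable analogue of [lc], for which Fubini is an exchange of two finite sums and no
    product measure is formed. *)
Definition lc2 (h : F -> F -> C) := exists m M,
  (forall x y, ~ PF m x \/ ~ PF m y -> h x y = 0) /\
  (forall x y a b, PF M a -> PF M b -> h (x + a) (y + b) = h x y).

Lemma lc2_lcr h x : lc2 h -> lc (h x).
Proof.
move=> [m [M [sh ph]]]; exists m, M; split=> [y hy|y b hb]; first by apply: sh; right.
by rewrite -[x in LHS]addr0 ph //; exact: PF0.
Qed.

Lemma lc2_lcl h y : lc2 h -> lc (fun x => h x y).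
Proof.
move=> [m [M [sh ph]]]; exists m, M; split=> [x hx|x b hb]; first by apply: sh; left.
by rewrite -[y in LHS]addr0 ph //; exact: PF0.
Qed.

Lemma lc2_swap h : lc2 h -> lc2 (fun x y => h y x).
Proof.
move=> [m [M [sh ph]]]; exists m, M; split=> [x y hxy|x y a b ha hb].
  by apply: sh; tauto.
by rewrite ph.
Qed.

Lemma lc2_I h : lc2 h -> lc (fun x => I (h x)).
Proof.
move=> [m [M [sh ph]]]; exists m, M; split=> [x hx|x b hb].
  rewrite (@eqI _ (fun=> 0)) ?cintegral0 // => y; apply: sh; by left.
by apply: eqI => y; rewrite -[y in LHS]addr0 ph //; exact: PF0.
Qed.

Lemma I_fubini h : lc2 h -> I (fun x => I (h x)) = I (fun y => I (fun x => h x y)).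
Proof.
move=> hh; have [m [M0 [sh ph0]]] := hh.
pose M := Num.max m M0; have mM : m <= M by rewrite le_max lexx.
have ph x y a b : PF M a -> PF M b -> h (x + a) (y + b) = h x y.
  by move=> ha hb; apply: ph0; [apply: PFW ha|apply: PFW hb]; rewrite le_max lexx orbT.
have [r tr] := @exists_transversal F _ _ mM.
have sr x : supp m (h x) by move=> y hy; apply: sh; right.
have pr x : pinv M (h x) by move=> y b hb; rewrite -[x in LHS]addr0 ph //; exact: PF0.
have sl y : supp m (fun x => h x y) by move=> x hx; apply: sh; left.
have pl y : pinv M (fun x => h x y) by move=> x b hb; rewrite -[y in LHS]addr0 ph //; exact: PF0.
have sr' : supp m (fun x => I (h x)).
  by move=> x hx; rewrite (@eqI _ (fun=> 0)) ?cintegral0 // => y; apply: sh; left.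
have pr' : pinv M (fun x => I (h x)).
  by move=> x b hb; apply: eqI => y; exact: pl.
have sl' : supp m (fun y => I (fun x => h x y)).
  by move=> y hy; rewrite (@eqI _ (fun=> 0)) ?cintegral0 // => x; apply: sh; right.
have pl' : pinv M (fun y => I (fun x => h x y)).
  by move=> y b hb; apply: eqI => x; exact: pr.
have [_ ->] := lc_integral_sum mM sr' pr' tr.
have [_ ->] := lc_integral_sum mM sl' pl' tr.
congr (_ * _).
rewrite (eq_bigr (fun x => (vol M)%:C * \sum_(y <- r) h x y)); last first.
  by move=> x _; have [_ ->] := lc_integral_sum mM (sr x) (pr x) tr.
rewrite [RHS](eq_bigr (fun y => (vol M)%:C * \sum_(x <- r) h x y)); last first.
  by move=> y _; have [_ ->] := lc_integral_sum mM (sl y) (pl y) tr.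
by rewrite -!mulr_sumr exchange_big.
Qed.

End HaarIntegral.

(** * Functions on F^* invariant under 1 + P^m *)

Section UnitInvariant.
Context {R : realType} {F : padicFieldType}.
Local Notation C := R[i].
Local Notation v := (@pval F).
Implicit Types (f g : F -> C) (m M : int) (x y a b : F).

(** Invariance under multiplication by 1 + P^m, written additively as x + y = x (1 + y/x). The
    requirement m >= 1 keeps the valuation fixed. Unlike [pinv], the level is uniform on all of F^*,
    near 0 included. *)
Definition uinv m f := 1 <= m /\ forall x y, x != 0 -> PF (v x + m) y -> f (x + y) = f x.

Definition win (j k : int) : set F := [set x | x != 0 /\ j <= v x <= k].

Lemma val_uinv m x y : 1 <= m -> x != 0 -> PF (v x + m) y -> x + y != 0 /\ v (x + y) = v x.
Proof. by move=> m1 x0 h; apply: val_add_small => //; apply: PFW h; lia. Qed.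

Lemma uinv_ext m f g : (forall x, x != 0 -> f x = g x) -> uinv m f -> uinv m g.
Proof.
move=> fg [m1 uf]; split=> // x y x0 h.
by have [xy0 _] := val_uinv m1 x0 h; rewrite -!fg // uf.
Qed.

Lemma uinvW m M f : m <= M -> uinv m f -> uinv M f.
Proof.
move=> mM [m1 uf]; split; first by lia.
by move=> x y x0 h; apply: uf => //; apply: PFW h; lia.
Qed.

Lemma uinvM m f g : uinv m f -> uinv m g -> uinv m (fun x => f x * g x).
Proof. by move=> [m1 uf] [_ ug]; split=> // x y x0 h; rewrite uf // ug. Qed.

Lemma uinvD m f g : uinv m f -> uinv m g -> uinv m (fun x => f x + g x).
Proof. by move=> [m1 uf] [_ ug]; split=> // x y x0 h; rewrite uf // ug. Qed.

Lemma uinv_fun (p : C -> C) m f : uinv m f -> uinv m (fun x => p (f x)).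
Proof. by move=> [m1 uf]; split=> // x y x0 h; rewrite uf. Qed.

Lemma uinv_val (p : int -> C) m : 1 <= m -> uinv m (fun x => p (v x)).
Proof. by move=> m1; split=> // x y x0 h; have [_ ->] := val_uinv m1 x0 h. Qed.

Lemma uinv_scale m f a : a != 0 -> uinv m f -> uinv m (fun x => f (a * x)).
Proof.
move=> a0 [m1 uf]; split=> // x y x0 h; rewrite mulrDr uf ?mulf_neq0 //.
by rewrite valM // -addrA; apply: PFM => //; exact: PF_val.
Qed.

Lemma uinv_indV m (P : int -> Prop) : 1 <= m ->
  uinv m (indF [set x : F | x != 0 /\ P (v x)] : F -> C).
Proof.
move=> m1; split=> // x y x0 h; have [xy0 e] := val_uinv m1 x0 h.
rewrite !indFE; congr (_ %:R); congr nat_of_bool.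
by apply/idP/idP => /set_mem /= [_ hP]; apply/mem_set => /=; rewrite ?e // -e.
Qed.

(** On bounded valuations multiplicative invariance is additive: on v x <= k an element of P^(k+m)
    is a perturbation of relative level at least m. *)
Lemma lc_win m f j k : uinv m f -> lc (fun x => f x * indF (win j k) x).
Proof.
move=> [m1 uf]; exists j, (k + m); split.
  move=> x hx; rewrite indF0 ?mulr0 // => -[x0 /andP[h _]]; apply: hx.
  by right.
move=> x y h; have [hx|hx] := pselect (win j k x).
  have [x0 /andP[h1 h2]] := hx.
  have h' : PF (v x + m) y by apply: PFW h; lia.
  have [xy0 e] := val_uinv m1 x0 h'.
  have hxy : win j k (x + y) by split=> //; rewrite e h1 h2.
  by rewrite (uf _ _ x0 h') (indF1 hx) (indF1 hxy).
have [hxy|hxy] := pselect (win j k (x + y)); last by rewrite !indF0 // !mulr0.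
have [x0 /andP[h1 h2]] := hxy; exfalso; apply: hx.
have h' : PF (v (x + y) + m) (- y) by apply: PFN; apply: PFW h; lia.
have [xy0 e] := val_uinv m1 x0 h'.
by rewrite addrK in xy0 e; split=> //; rewrite e h1 h2.
Qed.

Lemma open_uinv m f (Y : set C) : uinv m f -> open [set x | x != 0 /\ Y (f x)].
Proof.
move=> [m1 uf]; rewrite openE => x [/= x0 hY]; apply/nbhsF; exists (v x + m) => y h.
have [] := val_uinv m1 x0 h; rewrite addrC subrK => y0 _; split=> //.
by rewrite -(subrK x y) addrC uf.
Qed.

Lemma open_win j k : open (win j k).
Proof.
rewrite openE => x [/= x0 hj]; apply/nbhsF; exists (v x + 1) => y h.
have [] := val_add_small x0 h; rewrite addrC subrK => y0 e; split=> //.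
by rewrite e.
Qed.

Lemma open_Fstar : open (Fstar : set F).
Proof.
rewrite openE => x /= x0; apply/nbhsF; exists (v x + 1) => y h.
by have [] := val_add_small x0 h; rewrite addrC subrK.
Qed.

End UnitInvariant.

(** * Integrals over F^* and their scaling *)

Section NonCompact.
Context {R : realType} {F : padicFieldType}.
Local Notation C := R[i].
Local Notation v := (@pval F).
Local Notation q := ((@residue_card F)%:R : R).
Variable nu : {measure set (borel F) -> \bar R}.
Hypothesis hnu : is_haar nu.
Implicit Types (f g : F -> C) (m M : int) (x y a b : F).
Local Notation I f := (cintegral nu setT (f : borel F -> C)).

Lemma ReRM (r : R) (z : C) : Re (r%:C * z) = r * Re z.
Proof. by case: z => c d /=; rewrite mul0r subr0. Qed.

Lemma ImRM (r : R) (z : C) : Im (r%:C * z) = r * Im z.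
Proof. by case: z => c d /=; rewrite mul0r addr0. Qed.

Lemma measurable_win j k : measurable (win j k : set (borel F)).
Proof. by apply: measurable_openF; exact: open_win. Qed.

Lemma measurable_Fstar : measurable (Fstar : set (borel F)).
Proof. by apply: measurable_openF; exact: open_Fstar. Qed.

Lemma measurable_uinv m f (p : C -> R) : uinv m f ->
  measurable_fun (Fstar : set (borel F)) (fun x : borel F => (p (f x))%:E).
Proof.
move=> uf; apply/measurable_EFinP => _ Y mY; apply: measurable_openF.
have -> : Fstar `&` [set x | Y (p (f x))] = [set x | x != 0 /\ [set z | Y (p z)] (f x)] by [].
exact: open_uinv uf.
Qed.

Lemma Fstar_Fall f : f 0 = 0 -> cintegral nu Fstar (f : borel F -> C) = I f.
Proof.
move=> f0; rewrite /cintegral; congr (_ +i* _);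
  rewrite [LHS]Rintegral_mkcond; congr (Rintegral _ _ _); apply/funext => x;
  rewrite /patch; case: ifPn => // /negP h;
  (have -> : x = 0 :> F by apply/eqP; apply: contraT => x0; exfalso; apply: h; exact: mem_set);
  by rewrite f0.
Qed.

Definition winn (c : int) (n : nat) : set (borel F) := win (c - n%:Z) (c + n%:Z).

Lemma winn_nd c : nondecreasing_seq (winn c).
Proof.
move=> k l kl; apply/subsetPset => x [x0 /andP[h1 h2]]; split=> //.
by apply/andP; split; lia.
Qed.

Lemma winn_cover c : \bigcup_n winn c n = Fstar.
Proof.
apply/seteqP; split=> [x [n _ [x0 _]] //|x x0].
by exists (absz (v x - c)) => //; split=> //; apply/andP; split; lia.
Qed.

Lemma integral_win_lc m f (p : C -> R) j k : (forall z, 0 <= p z) -> uinv m f ->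
  (\int[nu]_(x in (win j k : set (borel F))) (p (f x))%:E =
   (Re (I (fun x => (p (f x))%:C * indF (win j k) x)))%:E)%E.
Proof.
move=> p0 uf.
have uf' : uinv m (fun x => (p (f x))%:C) by exact: (uinv_fun (fun z => (p z)%:C) uf).
have [h _] := lc_integrable hnu (lc_win j k uf').
rewrite /= fineK; last first.
  by apply: integrable_fin_num.
rewrite [LHS]integral_mkcond; apply: eq_integral => x _.
rewrite mul0r subr0 /patch indicE.
by case: (x \in _); rewrite ?mulr1 ?mulr0.
Qed.

Lemma measurable_uinvS m f (p : C -> R) j k : uinv m f ->
  measurable_fun (win j k : set (borel F)) (fun x : borel F => (p (f x))%:E).
Proof.
move=> uf; apply: measurable_funS (measurable_uinv p uf); first exact: measurable_Fstar.
by move=> x [].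
Qed.

Lemma integral_winn_cvg m f (p : C -> R) c : (forall z, 0 <= p z) -> uinv m f ->
  (\int[nu]_(x in winn c n) (p (f x))%:E @[n --> \oo] -->
   \int[nu]_(x in (Fstar : set (borel F))) (p (f x))%:E)%E.
Proof.
move=> p0 uf; rewrite -(winn_cover c).
apply: ge0_nondecreasing_set_cvg_integral.
- exact: winn_nd.
- by move=> i; exact: measurable_win.
- by move=> i; exact: measurable_uinvS uf.
- by move=> i x _; rewrite lee_fin.
Qed.

(** Monotone convergence along an exhaustion of F^* by windows of valuations extends the scaling
    formula from compactly supported functions to nonnegative ones. *)
Lemma ge0_scale m f (p : C -> R) a : a != 0 -> (forall z, 0 <= p z) -> uinv m f ->
  (\int[nu]_(x in (Fstar : set (borel F))) (p (f (a * (x : F))))%:E =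
   (q ^ v a)%:E * \int[nu]_(x in (Fstar : set (borel F))) (p (f x))%:E)%E.
Proof.
move=> a0 p0 uf.
have ufa := uinv_scale a0 uf.
(* Windows centred at -v a are the preimages under multiplication by a of windows centred at 0. *)
have h1 := integral_winn_cvg (- v a) p0 ufa.
have h2 := integral_winn_cvg 0 p0 uf.
have qa : 0 < q ^ v a by rewrite exprz_gt0 // q_gt0.
have h3 := cvgeZl (_ : (q ^ v a)%:E \is a fin_num) h2.
apply: (cvg_unique _ h1); first exact: ereal_hausdorff.
move: (h3 isT); apply: cvg_trans; apply: near_eq_cvg; apply: nearW => n.
rewrite (integral_win_lc _ _ p0 uf) (integral_win_lc _ _ p0 ufa) -EFinM; congr EFin.
have uf' : uinv m (fun x => (p (f x))%:C) by exact: (uinv_fun (fun z => (p z)%:C) uf).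
have := I_scale hnu a0 (lc_win (0 - n%:Z) (0 + n%:Z) uf').
move=> /(congr1 (@complex.Re R)); rewrite ReRM => <-.
congr (Re _); apply: eqI => x; congr (_ * _); rewrite !indFE; congr (_ %:R); congr nat_of_bool.
have [->|x0] := eqVneq x 0; first by rewrite mulr0; apply/idP/idP => /set_mem [/eqP].
apply/idP/idP => /set_mem [h /andP[h4 h5]]; apply/mem_set; split=> //;
  rewrite ?mulf_neq0 // ?valM // in h4 h5 *; apply/andP; split; lia.
Qed.

Lemma cintegrable_scale m f a : a != 0 -> uinv m f ->
  cintegrable nu Fstar (f : borel F -> C) -> cintegrable nu Fstar (fun x : borel F => f (a * (x : F))).
Proof.
move=> a0 uf [i1 i2].
have aux (p : C -> R) : nu.-integrable (Fstar : set (borel F)) (fun x : borel F => (p (f x))%:E) ->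
    nu.-integrable (Fstar : set (borel F)) (fun x : borel F => (p (f (a * (x : F))))%:E).
  move=> /integrableP[_ h]; apply/integrableP; split.
    by apply: (measurable_uinv p); exact: uinv_scale uf.
  have p0 : forall z : C, 0 <= `|p z| by [].
  have := ge0_scale a0 p0 uf; rewrite [X in X = _ -> _](_ : _ = \int[nu]_(x in (Fstar : set (borel F))) `|(p (f (a * (x : F))))%:E|%E)%E // => ->.
  by rewrite lte_mul_pinfty // lee_fin ltW // exprz_gt0 // q_gt0.
split; exact: aux.
Qed.

Lemma cintegral_scale m f a : a != 0 -> uinv m f ->
  cintegrable nu Fstar (f : borel F -> C) ->
  cintegral nu Fstar (fun x : borel F => f (a * (x : F))) =
  (q ^ v a)%:C * cintegral nu Fstar (f : borel F -> C).
Proof.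
move=> a0 uf [i1 i2].
have aux (p : C -> R) : nu.-integrable (Fstar : set (borel F)) (fun x : borel F => (p (f x))%:E) ->
    \int[nu]_(x in (Fstar : set (borel F))) p (f (a * (x : F))) =
    q ^ v a * \int[nu]_(x in (Fstar : set (borel F))) p (f x).
  move=> ip; rewrite /Rintegral integralE [in RHS]integralE.
  have := ge0_scale a0 (_ : forall z : C, 0 <= Num.max (p z) 0) uf.
  have := ge0_scale a0 (_ : forall z : C, 0 <= Num.max (- p z) 0) uf.
  have t1 : forall z : C, 0 <= Num.max (p z) 0 by move=> z; rewrite le_max lexx orbT.
  have t2 : forall z : C, 0 <= Num.max (- p z) 0 by move=> z; rewrite le_max lexx orbT.
  move=> /(_ t2) s2 /(_ t1) s1.
  have f1 := integrable_funepos measurable_Fstar ip.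
  have f2 := integrable_funeneg measurable_Fstar ip.
  have e1 (g : F -> C) : (fun x : borel F => (p (g x))%:E)^\+%E = (fun x : borel F => (Num.max (p (g x)) 0)%:E).
    by apply/funext => x; rewrite funeposE EFin_max.
  have e2 (g : F -> C) : (fun x : borel F => (p (g x))%:E)^\-%E = (fun x : borel F => (Num.max (- p (g x)) 0)%:E).
    by apply/funext => x; rewrite funenegE EFin_max.
  rewrite (e1 (fun x => f (a * x))) (e2 (fun x => f (a * x))) (e1 f) (e2 f).
  rewrite (e1 f) in f1; rewrite (e2 f) in f2.
  rewrite s1 s2.
  have g1 := integrable_fin_num measurable_Fstar f1.
  have g2 := integrable_fin_num measurable_Fstar f2.
  by rewrite -(fineK g1) -(fineK g2) /= mulrBr.
by apply: complex_eqP; rewrite ?ReRM ?ImRM /= aux.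
Qed.

End NonCompact.

(** * A criterion for integrability on F^* *)

Section Integrability.
Context {R : realType} {F : padicFieldType}.
Local Notation C := R[i].
Local Notation v := (@pval F).
Local Notation q := ((@residue_card F)%:R : R).
Variable nu : {measure set (borel F) -> \bar R}.
Hypothesis hnu : is_haar nu.
Implicit Types (f g : F -> C) (m M : int) (x y a b : F).
Local Notation I f := (cintegral nu setT (f : borel F -> C)).

Lemma indF_win1 j x : indF (win j j) x = indF (PF j) x - indF (PF (j + 1)) x :> C.
Proof.
have [->|x0] := eqVneq x 0.
  rewrite indF0 => [|[/eqP]//]; rewrite !indF1; try exact: PF0.
  by rewrite subrr.
have [h|h] := pselect (win j j x).
  have [_ /andP[h1 h2]] := h; rewrite indF1 // indF1; last by apply/PFE.
  by rewrite indF0 ?subr0 // => /(PFE _ x0); lia.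
rewrite indF0 //; have [h1|h1] := pselect (PF j x).
  rewrite !indF1 ?subrr //; apply/PFE => //.
  move/(PFE _ x0): h1 => h1; rewrite leNgt; apply/negP => h2; apply: h; split=> //.
  apply/andP; split; lia.
by rewrite !indF0 ?subrr // => h2; apply: h1; apply: PFW h2; lia.
Qed.

Lemma lc_ind_win j k : lc (indF (win j k) : F -> C).
Proof.
have := lc_win j k (uinv_val (F := F) (fun=> 1 : C) (lexx 1)).
by apply: lc_ext => x; rewrite mul1r.
Qed.

Lemma I_win1 j : I (indF (win j j)) = (vol nu j - vol nu (j + 1))%:C.
Proof.
rewrite (@eqI _ _ nu _ (fun x => indF (PF j) x - indF (PF (j + 1)) x)); last exact: indF_win1.
by rewrite (IB hnu (lc_PF j) (lc_PF (j + 1))) !I_ind rmorphB.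
Qed.

Lemma win_split c n x : indF (win (c - n.+1%:Z) (c + n.+1%:Z)) x =
  indF (win (c - n%:Z) (c + n%:Z)) x + (indF (win (c + n.+1%:Z) (c + n.+1%:Z)) x
    + indF (win (c - n.+1%:Z) (c - n.+1%:Z)) x) :> C.
Proof.
rewrite !indFE.
have E j k : (x \in win j k) = [&& x != 0, j <= v x & v x <= k].
  apply/idP/idP => [/set_mem[-> /andP[-> ->]] //|/and3P[h1 h2 h3]].
  by apply/mem_set; split=> //; rewrite h2 h3.
rewrite !E; case: (x != 0) => /=; last by rewrite !addr0.
set a := (_ && _); set b := (_ && _); set d := (_ && _); set d' := (_ && _).
have : [/\ a = [|| b, d | d'], ~~ (b && d), ~~ (b && d') & ~~ (d && d')].
  by rewrite /a /b /d /d'; split; lia.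
by case: a b d d' => -[] [] [] [] //; rewrite ?addr0 ?add0r.
Qed.

(** The factor q^(v x) cancels the volume of the shell of x, which is proportional to q^(-v x); what
    remains is a geometric series in r over all integers, at both ends. *)
Lemma cintegrable_bound m f (A r : R) : uinv m f -> 0 <= A -> 0 < r < 1 ->
  (forall x, x != 0 -> normc (f x) <= A * (q ^ v x * r ^+ absz (v x))) ->
  cintegrable nu Fstar (f : borel F -> C).
Proof.
move=> uf A0 /andP[r0 r1] fb; have [m1 _] := uf.
have q0 := q_gt0 (R := R) (F := F).
pose gb (j : int) : R := A * (q ^ j * r ^+ absz j).
have gb0 j : 0 <= gb j by rewrite /gb !mulr_ge0 // ltW // ?exprz_gt0 ?exprn_gt0.
pose G : F -> C := fun x => (gb (v x))%:C.
have uG : uinv m G by exact: (uinv_val (fun j => (gb j)%:C)).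
pose p1 (z : C) : R := Num.max (Re z) 0.
have p10 z : 0 <= p1 z by rewrite le_max lexx orbT.
have p1G x : p1 (G x) = gb (v x) by rewrite /p1 /= max_l.
pose B := A * vol nu 0.
have B0 : 0 <= B by rewrite mulr_ge0 // ltW // vol_gt0.
have shell j : I (fun x => (p1 (G x))%:C * indF (win j j) x) = (gb j)%:C * (vol nu j - vol nu (j + 1))%:C.
  rewrite -I_win1 -(IZ hnu) //; last exact: lc_ind_win.
  apply: eqI => x; have [h|h] := pselect (win j j x); last by rewrite !indF0 // !mulr0.
  rewrite p1G; congr ((gb _)%:C * _); have [_ /andP[h1 h2]] := h; lia.
have shell_le j : Re (I (fun x => (p1 (G x))%:C * indF (win j j) x)) <= B * r ^+ absz j.
  rewrite shell -rmorphM /= /B.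
  have vj : gb j * (vol nu j) = A * vol nu 0 * r ^+ absz j.
    rewrite /gb (volE hnu j).
    have -> : A * (q ^ j * r ^+ absz j) * (q ^ (- j) * vol nu 0) =
      A * vol nu 0 * r ^+ absz j * (q ^ j * q ^ (- j)) by ring.
    by rewrite -expfzDr ?gt_eqF // subrr expr0z mulr1.
  by rewrite -vj ler_wpM2l // gerBl ltW // vol_gt0.
have uG' : uinv m (fun x => (p1 (G x))%:C) by exact: (uinv_fun (fun z => (p1 z)%:C) uG).
pose s n := Re (I (fun x => (p1 (G x))%:C * indF (winn (F := F) 0 n) x)).
have sS n : s n.+1 <= s n + 2 * (B * r ^+ n.+1).
  rewrite /s /winn.
  rewrite (@eqI _ _ nu _ (fun x => (p1 (G x))%:C * indF (win (0 - n%:Z) (0 + n%:Z)) x +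
    ((p1 (G x))%:C * indF (win (0 + n.+1%:Z) (0 + n.+1%:Z)) x +
     (p1 (G x))%:C * indF (win (0 - n.+1%:Z) (0 - n.+1%:Z)) x))); last first.
    by move=> x; rewrite win_split !mulrDr.
  rewrite (ID hnu) //; [|exact: lc_win uG'|by apply: lcD; exact: lc_win uG'].
  rewrite (ID hnu) //; [|exact: lc_win uG'|exact: lc_win uG'].
  rewrite !ReD lerD2l; have := shell_le (0 + n.+1%:Z); have := shell_le (0 - n.+1%:Z).
  have -> : absz (0 - n.+1%:Z) = n.+1 by lia.
  have -> : absz (0 + n.+1%:Z) = n.+1 by lia.
  by move=> *; lra.
have sb n : s n <= 2 * B / (1 - r) * (1 - r ^+ n.+1).
  elim: n => [|n IH].
    apply: (@le_trans _ _ B).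
      have := shell_le 0; rewrite expr0 mulr1 /s.
      by have -> : winn (F := F) 0 0 = win 0 0 by rewrite /winn; congr win; lia.
    rewrite expr1 divfK; first by lra.
    by rewrite gt_eqF // subr_gt0.
  apply: le_trans (sS n) _.
  have -> : 2 * B / (1 - r) * (1 - r ^+ n.+2) = 2 * B / (1 - r) * (1 - r ^+ n.+1) + 2 * (B * r ^+ n.+1).
    by rewrite exprS; field; rewrite gt_eqF // subr_gt0.
  by rewrite lerD2r.
have aux (p : C -> R) : (forall z, `|p z| <= normc z) ->
    nu.-integrable (Fstar : set (borel F)) (fun x : borel F => (p (f x))%:E).
  move=> pn; apply/integrableP; split; first exact: (measurable_uinv p uf).
  apply: (@le_lt_trans _ _ (2 * B / (1 - r))%:E); last exact: ltry.
  have p0 : forall z : C, 0 <= `|p z| by [].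
  have hc := integral_winn_cvg (nu := nu) 0 p0 uf.
  apply: (cvge_to_le hc); apply: nearW => n.
  apply: (@le_trans _ _ (\int[nu]_(x in winn 0 n) (p1 (G x))%:E)%E).
    apply: ge0_le_integral => //.
    - exact: measurable_win.
    - exact: (measurable_uinvS (fun z => `|p z|) uf).
    - exact: (measurable_uinvS p1 uG).
    - move=> x [x0 _]; rewrite lee_fin p1G.
      by apply: le_trans (pn _) _; exact: fb.
  rewrite /winn (integral_win_lc hnu _ _ p10 uG) lee_fin; apply: le_trans (sb n) _.
  rewrite -[leRHS]mulr1 ler_wpM2l //.
    by apply: divr_ge0; [exact: mulr_ge0|lra].
  by rewrite gerBl exprn_ge0 // ltW.
by split; apply: aux => z; [exact: normc_Re|exact: normc_Im].
Qed.

End Integrability.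

(** * Additive characters and orthogonality *)

Section Characters.
Context {R : realType} {F : padicFieldType}.
Local Notation C := R[i].
Local Notation v := (@pval F).
Implicit Types (psi chi : F -> C) (x y a b : F).

(** The group C^* has no small subgroups: as long as |z - 1| < 1/2, squaring multiplies |z - 1| by
    |z + 1| > 3/2. This makes both kinds of characters trivial on an open subgroup. *)
Lemma no_small_power (z : C) : (forall k, normc (z ^+ k - 1) < 1 / 2) -> z = 1.
Proof.
move=> hz; apply/eqP; rewrite -subr_eq0; apply: contraT => z1.
have d0 : 0 < normc (z - 1) by rewrite normc_gt0.
have grow k : (3 / 2) ^+ k * normc (z - 1) <= normc (z ^+ (2 ^ k) - 1).
  elim: k => [|k IH]; first by rewrite expr0 mul1r expn0 expr1.
  rewrite expnSr exprM exprS -mulrA; set w := z ^+ (2 ^ k) in IH *.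
  have -> : w ^+ 2 - 1 = (w + 1) * (w - 1) by ring.
  rewrite normcM; apply: ler_pM => //.
    by rewrite mulr_ge0 ?exprn_ge0 // normc_ge0.
  have := hz (2 ^ k)%N; rewrite -/w => h.
  have := normcB (w + 1) (w - 1).
  have -> : w + 1 - (w - 1) = 2%:R by ring.
  have -> : normc (2%:R : C) = 2.
    by rewrite -[2%:R]/((2%:R : C)) -(rmorph_nat (real_complex R)) normcR ger0_norm.
  by move=> h2; lra.
pose k := (Num.truncn (1 / normc (z - 1))).+1.
have hk : 1 / normc (z - 1) < k%:R by rewrite truncnS_gt.
have := grow k; have := hz (2 ^ k)%N.
have b0 : 0 <= 1 / 2 :> R by lra.
have := bernoulli_le k b0.
have -> : 1 + 1 / 2 = 3 / 2 :> R by lra.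
move=> h1 h2 h3; rewrite ltr_pdivrMr // in hk.
have := ler_wpM2r (ltW d0) h1; move=> h4; lra.
Qed.

Section AddChar.
Variable psi : F -> C.
Hypothesis hpsi : is_addchar psi.

Lemma psiD x y : psi (x + y) = psi x * psi y.
Proof. by have [h _ _] := hpsi. Qed.

Lemma normc_psi x : normc (psi x) = 1.
Proof. by have [_ h _] := hpsi; apply: complexI; rewrite -normcE h. Qed.

Lemma psi_neq0 x : psi x != 0.
Proof. by rewrite -normc_gt0 normc_psi. Qed.

Lemma psi0 : psi 0 = 1.
Proof. by apply: (mulfI (psi_neq0 0)); rewrite -psiD addr0 mulr1. Qed.

Lemma psi_mulrn x k : psi (x *+ k) = psi x ^+ k.
Proof.
elim: k => [|k IH]; first by rewrite mulr0n psi0 expr0.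
by rewrite mulrS psiD IH exprS.
Qed.

Lemma PFmulrn m x k : PF m x -> PF m (x *+ k).
Proof.
move=> h; elim: k => [|k IH]; first by rewrite mulr0n; exact: PF0.
by rewrite mulrS; exact: PFD.
Qed.

Lemma cont_eps (f : F -> C) x0 : {for x0, continuous f} -> forall e : R, 0 < e ->
  exists m, forall y, PF m (y - x0) -> normc (f y - f x0) < e.
Proof.
move=> cf e e0; have : \forall z \near f x0, normc (z - f x0) < e.
  by apply/nearCP; exists e.
by move=> /cf /nbhsF.
Qed.

Lemma addtriv_ex : exists m, addtriv psi m.
Proof.
have [_ _ cpsi] := hpsi; have h12 : 0 < 1 / 2 :> R by lra.
have [m hm] := cont_eps (cpsi 0) h12.
exists m => x hx; apply: no_small_power => k.
by rewrite -psi_mulrn -psi0; apply: hm; rewrite subr0; exact: PFmulrn.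
Qed.

Hypothesis npsi : exists x, psi x != 1.

(** A point x0 with psi x0 != 1 bounds the admissible levels below by v x0, so a least one exists
    and the default value in [addcond] is not taken. *)
Lemma addcondP : addtriv psi (addcond psi) /\ forall m, addtriv psi m -> addcond psi <= m.
Proof.
have [m0 h0] := addtriv_ex; have [x0 hx0] := npsi.
have lb m : addtriv psi m -> v x0 < m.
  move=> hm; rewrite ltNge; apply/negP => h; move/eqP: hx0; apply; apply: hm.
  by right.
pose P (k : nat) := `[< addtriv psi (v x0 + k%:Z) >].
have exP : exists k, P k.
  exists (absz (m0 - v x0)); apply/asboolP.
  have := lb _ h0 => hlt; suff -> : v x0 + (absz (m0 - v x0))%:Z = m0 by []; lia.
have [k /asboolP hk mk] := ex_minnP exP.
apply: (@xgetPex _ 0 [set m | addtriv psi m /\ forall m', addtriv psi m' -> m <= m']).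
exists (v x0 + k%:Z); split=> // m' hm'.
have := lb _ hm' => hlt; have : (k <= absz (m' - v x0))%N.
  apply: mk; apply/asboolP; suff -> : v x0 + (absz (m' - v x0))%:Z = m' by []; lia.
lia.
Qed.

Local Notation e := (addcond psi).

Lemma psi_triv x : PF e x -> psi x = 1.
Proof. by have [h _] := addcondP; exact: h. Qed.

Lemma psi_nontriv m : m < e -> exists2 x, PF m x & psi x != 1.
Proof.
move=> me; apply: contrapT => h; have [_ /(_ m) h2] := addcondP.
suff : addtriv psi m by move=> /h2; lia.
by move=> x hx; apply/eqP; apply: contraT => h3; exfalso; apply: h; exists x.
Qed.

Lemma psi_pinv a : pinv (e - v a) (fun t => psi (a * t)).
Proof.
move=> t y hy; rewrite mulrDr psiD [X in _ * X]psi_triv ?mulr1 //.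
by have [->|a0] := eqVneq a 0; [rewrite mul0r; exact: PF0|apply/PF_mulE].
Qed.

Lemma lc_psi f a : lc f -> lc (fun t => f t * psi (a * t)).
Proof.
move=> [m [M [sf pf]]]; exists m, (Num.max M (e - v a)); split; first exact: suppMl.
apply: pinvM.
  by apply: (pinvW _ pf); rewrite le_max lexx.
by apply: (pinvW _ (@psi_pinv a)); rewrite le_max lexx orbT.
Qed.

(** If a P^m is not inside P^e, translation by some t0 in P^m multiplies the integral by psi(a t0)
    != 1. *)
Lemma I_psi (nu : {measure set (borel F) -> \bar R}) (hnu : is_haar nu) m a :
  cintegral nu setT ((fun t => indF (PF m) t * psi (a * t)) : borel F -> C) =
  (vol nu m)%:C * indF (PF (e - m)) a.
Proof.
have [h|h] := pselect (PF (e - m) a).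
  rewrite indF1 // mulr1 -(I_ind nu); apply: eqI => t.
  have [ht|ht] := pselect (PF m t); last by rewrite indF0 // mul0r.
  rewrite psi_triv ?mulr1 //; have := PFM h ht; apply: PFW; lia.
rewrite indF0 // mulr0; have [a0 va] := PF_nz h.
have [t0 ht0 pt0] : exists2 t0, PF m t0 & psi (a * t0) != 1.
  have [|y hy py] := @psi_nontriv (v a + m); first by lia.
  exists (a^-1 * y); last by rewrite mulVKf.
  apply/(PF_mulE _ _ (_ : a^-1 != 0)); first by rewrite invr_eq0.
  by rewrite valV // opprK addrC.
have lf := lc_psi a (lc_PF m).
have := I_shift hnu t0 lf.
rewrite (@eqI _ _ nu _ (fun t => psi (a * t0) * (indF (PF m) t * psi (a * t)))); last first.
  move=> t; rewrite mulrDr psiD (pinv_PF (lexx m) _ ht0); ring.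
rewrite (IZ hnu) // => /eqP; rewrite -subr_eq0 -[X in _ - X]mul1r -mulrBl mulf_eq0 subr_eq0.
by rewrite (negPf pt0) /= => /eqP.
Qed.

End AddChar.
End Characters.

(** * Multiplicative convolution against a quasi-character *)

Section Abstract.
Context {R : realType} {F : padicFieldType}.
Local Notation C := R[i].
Local Notation v := (@pval F).
Local Notation q := ((@residue_card F)%:R : R).
Variable nu : {measure set (borel F) -> \bar R}.
Hypothesis hnu : is_haar nu.
Implicit Types (f g phi K : F -> C) (m M : int) (x y a b : F).
Local Notation I f := (cintegral nu setT (f : borel F -> C)).
Local Notation J f := (cintegral nu Fstar (f : borel F -> C)).
Local Notation integ f := (cintegrable nu Fstar (f : borel F -> C)).
Variables (w : F) (n : nat) (W : F -> C).
Hypotheses (w0 : w != 0) (vw : v w = 1) (n0 : (0 < n)%N).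
Hypothesis WM : forall x y, x != 0 -> y != 0 -> W (x * y) = W x * W y.
Hypothesis W0 : forall x, x != 0 -> W x != 0.
Hypothesis uW : exists m, uinv m W.

Definition bet (l : int) : F -> C := indF (Fstar_nk n l).

Lemma betE l x : x != 0 -> bet l x = (v x == l %[mod n%:Z])%Z%:R.
Proof.
move=> x0; rewrite /bet indFE; congr (_ %:R); congr nat_of_bool.
apply/idP/idP => [/set_mem[_ /eqP //]|/eqP h]; apply/mem_set; split=> //.
Qed.

Lemma bet0 l : bet l 0 = 0.
Proof. by rewrite /bet indF0 // => -[/eqP]. Qed.

Lemma uinv_bet m l : 1 <= m -> uinv m (bet l).
Proof. by move=> m1; exact: (@uinv_indV _ _ m (fun j => (j = l %[mod n])%Z) m1). Qed.

(** The shape shared by a Schwartz function and by the cut kernel, which can thus be treated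
    symmetrically: zero for v x < j, periodic under w^n for v x >= E, invariant at level m, bounded
    by B. *)
Definition nice m j E (B : R) f := [/\ uinv m f, forall x, x != 0 -> v x < j -> f x = 0,
  forall x, x != 0 -> E <= v x -> f (w ^+ n * x) = f x &
  0 <= B /\ forall x, x != 0 -> normc (f x) <= B].

(** The difference operator that annihilates the periodic tail near 0: on a [nice] function its
    result is supported on boundedly many valuations. *)
Definition diffn f : F -> C := fun x => f x - f ((w ^+ n)^-1 * x).

Let wn0 : w ^+ n != 0. Proof. by rewrite expf_neq0. Qed.
Let wV0 : (w ^+ n)^-1 != 0. Proof. by rewrite invr_eq0. Qed.
Let vwn : v (w ^+ n) = n%:Z. Proof. by rewrite -[w ^+ n]/(w ^ n%:Z) valX // vw mulr1. Qed.
Let vwV : v (w ^+ n)^-1 = - n%:Z. Proof. by rewrite valV // vwn. Qed.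

Lemma W1 : W 1 = 1.
Proof.
have h := oner_neq0 F; apply: (mulfI (W0 h)).
by rewrite -WM // !mulr1.
Qed.

Lemma WV x : x != 0 -> W x^-1 = (W x)^-1.
Proof.
move=> x0; have x0' : x^-1 != 0 by rewrite invr_eq0.
by apply: (mulfI (W0 x0)); rewrite -WM // !divff ?W0 // W1.
Qed.

Lemma bet_scale l x : bet l ((w ^+ n)^-1 * x) = bet l x.
Proof.
have [->|x0] := eqVneq x 0; first by rewrite mulr0.
rewrite !betE ?mulf_neq0 // valM // vwV.
suff -> : ((- n%:Z + v x) %% n%:Z)%Z = (v x %% n%:Z)%Z by [].
by rewrite -(modzDr (- n%:Z + v x)); congr modz; ring.
Qed.

Lemma bet_scale' l x : bet l (w ^+ n * x) = bet l x.
Proof. by rewrite -[in LHS]bet_scale mulKf. Qed.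

Lemma nice_diff m j E B f : nice m j E B f -> uinv m (diffn f) /\
  forall x, x != 0 -> ~~ (j <= v x < E + n%:Z) -> diffn f x = 0 .
Proof.
move=> [uf zf ef _]; split.
  have h := uinv_fun (fun z => - z) (uinv_scale wV0 uf).
  exact: uinvD uf h.
move=> x x0; rewrite negb_and -!ltNge => h.
have y0 : (w ^+ n)^-1 * x != 0 by rewrite mulf_neq0.
have vy : v ((w ^+ n)^-1 * x) = v x - n%:Z by rewrite valM // vwV addrC.
rewrite /diffn; move: h => /orP[h|h].
  by rewrite !zf ?subrr //; rewrite vy; lia.
by rewrite -(ef _ y0) ?vy; [rewrite mulVKf // subrr|lia].
Qed.

Lemma win_ind f j k : (forall x, x != 0 -> ~~ (j <= v x <= k) -> f x = 0) -> f 0 = 0 ->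
  f =1 (fun x => f x * indF (win j k) x).
Proof.
move=> zf f0 x; have [->|x0] := eqVneq x 0; first by rewrite f0 mul0r.
have [h|h] := boolP (j <= v x <= k); first by rewrite indF1 ?mulr1.
by rewrite zf // mul0r.
Qed.

Lemma lc_uinv_win m f j k : uinv m f -> (forall x, x != 0 -> ~~ (j <= v x <= k) -> f x = 0) ->
  f 0 = 0 -> lc f.
Proof.
move=> uf zf f0; have := lc_win j k uf; apply: lc_ext => x.
by rewrite -win_ind.
Qed.

(** Replacing x by w^-n x reproduces the integral up to the factor q^-n W(w^n), because the class
    mod n is unchanged. The difference is an integral with compact support in F^*. *)
Lemma AT1 m j E B f l : nice m j E B f ->
  integ (fun x => f x * bet l x * W x) ->
  (1 - (q ^- n)%:C * W (w ^+ n)) * J (fun x => f x * bet l x * W x) =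
  I (fun x => diffn f x * bet l x * W x).
Proof.
move=> nf hi; have [uf zf ef bf] := nf; have [mW uW'] := uW.
have m1 : 1 <= m by case: uf.
pose M := Num.max m mW.
have uM : uinv M (fun x => f x * bet l x * W x).
  apply: uinvM; last by apply: (uinvW _ uW'); rewrite le_max lexx orbT.
  apply: uinvM; first by apply: (uinvW _ uf); rewrite le_max lexx.
  by apply: uinv_bet; rewrite le_max m1.
have hs := cintegral_scale hnu wV0 uM hi.
have hi' := cintegrable_scale hnu wV0 uM hi.
rewrite -Fstar_Fall; last by rewrite bet0 mulr0 mul0r.
have e1 x : x != 0 -> f ((w ^+ n)^-1 * x) * bet l ((w ^+ n)^-1 * x) * W ((w ^+ n)^-1 * x) =
    (W (w ^+ n))^-1 * (f ((w ^+ n)^-1 * x) * bet l x * W x).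
  by move=> x0; rewrite bet_scale WM // WV //; ring.
have hi2 := cintegrableZ measurable_Fstar (W (w ^+ n)) hi'.
have eB := cintegralB measurable_Fstar hi hi2.
have eZ := cintegralZ measurable_Fstar (W (w ^+ n)) hi'.
apply: esym; apply: etrans; last first.
  apply: etrans (etrans eB _) _; last reflexivity.
  rewrite eZ hs vwV -exprnN; ring.
apply: eq_cintegral => x x0.
by rewrite e1 // mulVKf ?W0 // /diffn !mulrBl.
Qed.

Lemma bd_integ m j (B : R) f : uinv m f -> (forall x, x != 0 -> v x < j -> f x = 0) ->
  0 <= B -> (forall x, x != 0 -> normc (f x) <= B) -> integ f.
Proof.
move=> uf zf B0 bf; have q1 := q_gt1 (R := R) (F := F); have q0 := q_gt0 (R := R) (F := F).
(* The constant q^(2|j|) makes the exponent 2|j| + v x - |v x| nonnegative for every v x >= j. *)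
apply: (@cintegrable_bound _ _ nu hnu m f (B * q ^ (2 * `|j|)) q^-1) => //.
- by rewrite mulr_ge0 // exprz_ge0 // ltW.
- by rewrite invr_gt0 q0 invf_lt1.
move=> x x0; have [h|h] := ltP (v x) j.
  rewrite zf // normc0 !mulr_ge0 // ?exprz_ge0 ?exprn_ge0 ?invr_ge0 // ltW //.
apply: le_trans (bf _ x0) _; rewrite -mulrA ler_peMr //.
rewrite exprVn exprnN -!expfzDr ?gt_eqF //.
set k := (2 * _ + _); have k0 : 0 <= k by rewrite /k; lia.
by rewrite -(gez0_abs k0); apply: exprn_ege1; exact: ltW.
Qed.

Lemma J_bound m j (B : R) f : uinv m f -> (forall x, x != 0 -> v x < j -> f x = 0) ->
  0 <= B -> (forall x, x != 0 -> normc (f x) <= B) -> normc (J f) <= 2 * (B * vol nu j).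
Proof.
move=> uf zf B0 bf; pose D : set (borel F) := Fstar `&` PF j.
have mD : measurable D.
  by apply: measurableI; [exact: measurable_Fstar|exact: measurable_PF].
have nD : (nu D <= nu (PF j))%E.
  by apply: le_measure; rewrite ?inE //; [exact: measurable_PF|exact: subIsetr].
have -> : J f = cintegral nu D (f : borel F -> C).
  have eD (p : C -> R) : p 0 = 0 -> \int[nu]_(x in (Fstar : set (borel F))) p (f x) = \int[nu]_(x in D) p (f x).
    move=> p0; rewrite /D Rintegral_mkcondr; apply: eq_Rintegral => x /set_mem x0.
    rewrite /patch; case: ifPn => // /negP h; rewrite zf ?p0 //.
    by have [] := @PF_nz F j x (fun h' => h (mem_set h')).
  by congr (_ +i* _); exact: eD.
have vD : fine (nu D) <= vol nu j.
  by rewrite /vol fine_le // ge0_fin_numE // ?(le_lt_trans nD) // nu_PF_fin.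
apply: le_trans (normc_cintegral_le mD _ B0 _ _) _.
- by apply: le_lt_trans nD (nu_PF_fin hnu j).
- have [h1 h2] := bd_integ uf zf B0 bf.
  split; [exact: (integrableS measurable_Fstar mD (@subIsetl _ _ _) h1)|
    exact: (integrableS measurable_Fstar mD (@subIsetl _ _ _) h2)].
- by move=> x [x0 _]; exact: bf.
by rewrite ler_pM2l // ler_wpM2l.
Qed.

Lemma lc2_uinv (h : F -> F -> C) m (N : int) : 1 <= m ->
  (forall x y, h x y != 0 -> [/\ x != 0, y != 0, - N <= v x <= N & - N <= v y <= N]) ->
  (forall x y a, x != 0 -> y != 0 -> PF (v x + m) a -> h (x + a) y = h x y) ->
  (forall x y b, x != 0 -> y != 0 -> PF (v y + m) b -> h x (y + b) = h x y) -> lc2 h.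
Proof.
move=> m1 sh h1 h2; exists (- N), (N + m).
have zh x y : ~ [/\ x != 0, y != 0, - N <= v x <= N & - N <= v y <= N] -> h x y = 0.
  by move=> hn; apply/eqP; apply: contraT => /sh.
split=> [x y hxy|x y a b ha hb].
  apply: zh => -[x0 y0 /andP[hx _] /andP[hy _]].
  by case: hxy => hn; apply: hn; right.
have move1 x' y' a' b' : PF (N + m) a' -> PF (N + m) b' -> h x' y' != 0 ->
    [/\ x' + a' != 0, y' + b' != 0 & h (x' + a') (y' + b') = h x' y'].
  move=> ha' hb' /sh[x0 y0 /andP[hx1 hx2] /andP[hy1 hy2]].
  have ha2 : PF (v x' + m) a' by apply: PFW ha'; lia.
  have hb2 : PF (v y' + m) b' by apply: PFW hb'; lia.
  have [xa0 _] := val_uinv m1 x0 ha2; have [yb0 _] := val_uinv m1 y0 hb2.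
  by split=> //; rewrite h1 // h2.
have [e|hn] := eqVneq (h x y) 0; last by have [] := move1 _ _ _ _ ha hb hn.
rewrite e; apply/eqP; apply: contraT => hn.
have [_ _] := move1 _ _ _ _ (PFN ha) (PFN hb) hn.
by rewrite !addrK e => e2; move: hn; rewrite -e2 eqxx.
Qed.

Section Convolution.
Variables (m j1 E1 j2 E2 : int) (B1 B2 : R) (phi K : F -> C).
Hypotheses (nphi : nice m j1 E1 B1 phi) (nK : nice m j2 E2 B2 K).
Hypothesis uWm : uinv m W.

Definition conv x := J (fun y => phi y * K (x * y)).

Let m1 : 1 <= m. Proof. by case: uWm. Qed.

Lemma conv_facts a b x : a != 0 -> b != 0 -> x != 0 ->
  let f := fun y => phi (a * y) * K (b * (x * y)) in
  [/\ uinv m f, forall y, y != 0 -> v y < j1 - v a -> f y = 0,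
      forall y, y != 0 -> v y < j2 - v b - v x -> f y = 0 &
      forall y, y != 0 -> normc (f y) <= B1 * B2].
Proof.
move=> a0 b0 x0 f; have [u1 z1 _ [B10 b1]] := nphi; have [u2 z2 _ [B20 b2]] := nK.
split.
- apply: uinvM; first exact: uinv_scale.
  have -> : (fun y => K (b * (x * y))) = (fun y => K (b * x * y)).
    by apply/funext => y; rewrite mulrA.
  by apply: uinv_scale => //; rewrite mulf_neq0.
- by move=> y y0 h; rewrite /f z1 ?mul0r ?mulf_neq0 // valM //; lia.
- move=> y y0 h; rewrite /f z2 ?mulr0 ?mulf_neq0 // !valM ?mulf_neq0 //; lia.
- move=> y y0; rewrite /f normcM ler_pM ?normc_ge0 ?b1 ?b2 ?mulf_neq0 //.
Qed.

Let B120 : 0 <= B1 * B2.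
Proof. by have [_ _ _ [? _]] := nphi; have [_ _ _ [? _]] := nK; rewrite mulr_ge0. Qed.

Lemma conv_integ a b x : a != 0 -> b != 0 -> x != 0 ->
  integ (fun y => phi (a * y) * K (b * (x * y))).
Proof.
move=> a0 b0 x0; have [h1 h2 _ h4] := conv_facts a0 b0 x0.
exact: (bd_integ h1 h2 B120 h4).
Qed.

Lemma conv_scale a b x : a != 0 -> b != 0 -> x != 0 ->
  J (fun y => phi (a * y) * K (b * (x * y))) = (q ^ v a)%:C * conv (b / a * x).
Proof.
move=> a0 b0 x0; rewrite /conv.
have h0 : b / a != 0 by rewrite mulf_neq0 ?invr_eq0.
have [h1 h2 _ h4] := conv_facts (oner_neq0 F) h0 x0.
have hi := bd_integ h1 h2 B120 h4.
have := cintegral_scale hnu a0 h1 hi.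
have -> : cintegral nu Fstar (fun x1 : borel F => phi (1 * (a * (x1 : F))) * K (b / a * (x * (a * (x1 : F))))) =
  J (fun y => phi (a * y) * K (b * (x * y))).
  apply: eq_cintegral => y _; rewrite mul1r; congr (_ * K _); field.
  exact: a0.
move=> ->; congr (_ * _); apply: eq_cintegral => y _; rewrite mul1r; congr (_ * K _).
by rewrite !mulrA.
Qed.

Lemma conv_uinv : uinv m conv.
Proof.
split=> // x z x0 hz; have [xz0 _] := val_uinv m1 x0 hz.
pose u := (x + z) / x.
have u0 : u != 0 by rewrite mulf_neq0 ?invr_eq0.
have uE : u = 1 + z / x by rewrite /u mulrDl divff.
have vu : v u = 0.
  rewrite uE; have [|_ ->] := @val_1D F (z / x) => //.
  rewrite mulrC; apply/PF_mulE; rewrite ?invr_eq0 // valV // opprK.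
  by apply: PFW hz; lia.
have := conv_scale u0 (oner_neq0 F) xz0; rewrite vu expr0z mul1r.
have -> : 1 / u * (x + z) = x by rewrite /u; field; rewrite x0 xz0.
move=> <-; apply: eq_cintegral => y y0; rewrite mul1r; congr (_ * _).
have [[_ h] _ _ _] := nphi; rewrite uE mulrDl mul1r h //.
have hzx : PF m (z / x).
  by rewrite mulrC; apply/PF_mulE; rewrite ?invr_eq0 // valV // opprK addrC.
by rewrite addrC; apply: PFM hzx (PF_val y).
Qed.

Lemma conv_bound1 x : x != 0 -> normc (conv x) <= 2 * (B1 * B2 * vol nu j1).
Proof.
move=> x0; have [h1 h2 _ h4] := conv_facts (oner_neq0 F) (oner_neq0 F) x0.
have -> : conv x = J (fun y => phi (1 * y) * K (1 * (x * y))).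
  by apply: eq_cintegral => y _; rewrite !mul1r.
by have := J_bound h1 h2 B120 h4; rewrite val1 subr0.
Qed.

(** The support of K forces v y >= j2 - v x, so the bound decays as v x tends to minus infinity.
    With [conv_bound1] at the other end it leaves a strip of absolute convergence of width 1. *)
Lemma conv_bound2 x : x != 0 -> normc (conv x) <= 2 * (B1 * B2 * vol nu (j2 - v x)).
Proof.
move=> x0; have [h1 _ h3 h4] := conv_facts (oner_neq0 F) (oner_neq0 F) x0.
have -> : conv x = J (fun y => phi (1 * y) * K (1 * (x * y))).
  by apply: eq_cintegral => y _; rewrite !mul1r.
by have := J_bound h1 h3 B120 h4; rewrite val1 subr0.
Qed.

(** The product of two differences has four terms, each a scaled copy of [conv]. Shifting neither
    variable or both gives [conv x] twice, with weights 1 and q^-n; shifting one of them moves x by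
    w^n or by its inverse. *)
Lemma conv_diff x : x != 0 ->
  J (fun y => diffn phi y * diffn K (x * y)) =
  (1 + (q ^- n)%:C) * conv x - (q ^- n)%:C * conv (w ^+ n * x) - conv ((w ^+ n)^-1 * x).
Proof.
move=> x0; have o := oner_neq0 F.
have i1 := conv_integ o o x0; have i2 := conv_integ wV0 o x0.
have i3 := conv_integ o wV0 x0; have i4 := conv_integ wV0 wV0 x0.
have mS := measurable_Fstar (F := F).
have i12 := cintegrableB mS i1 i2; have i34 := cintegrableB mS i3 i4.
have := cintegralB mS i12 i34.
rewrite (cintegralB mS i1 i2) (cintegralB mS i3 i4) !conv_scale //.
rewrite vwV val1 expr0z -exprnN.
have -> : 1 / 1 * x = x by rewrite divff // mul1r.
have -> : 1 / (w ^+ n)^-1 * x = w ^+ n * x by rewrite div1r invrK.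
have -> : (w ^+ n)^-1 / 1 * x = (w ^+ n)^-1 * x by rewrite divr1.
have -> : (w ^+ n)^-1 / (w ^+ n)^-1 * x = x by rewrite divff // mul1r.
move=> e; apply: etrans (etrans _ e) _; last by rewrite !mul1r; ring.
by apply: eq_cintegral => y _; rewrite /diffn !mul1r; ring.
Qed.

Lemma bet_sum k y z : y != 0 -> z != 0 ->
  bet k (z / y) = \sum_(0 <= i < n) bet i%:Z z * bet (i%:Z - k) y.
Proof.
move=> y0 z0; have zy0 : z / y != 0 by rewrite mulf_neq0 ?invr_eq0.
have n0z : n%:Z != 0 by lia.
pose i0 := absz (v z %% n%:Z)%Z.
have i0E : i0%:Z = (v z %% n%:Z)%Z by rewrite /i0 gez0_abs // modz_ge0.
have i0n : (i0 < n)%N by rewrite -ltz_nat i0E ltz_pmod.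
rewrite big_mkord (bigD1 (Ordinal i0n)) //= big1 ?addr0; last first.
  move=> i ii0; rewrite betE // [(v z == _ %[mod _])%Z](_ : _ = false) ?mul0r //.
  apply/negbTE; apply: contra ii0 => /eqP h; apply/eqP/val_inj => /=.
  by apply/eqP; rewrite -eqz_nat i0E h modz_small // ltz_nat ltn_ord.
rewrite !betE // i0E modz_mod eqxx mul1r valM ?invr_eq0 // valV //.
congr (_ %:R); congr nat_of_bool.
rewrite !eqz_mod_dvd.
rewrite -[RHS]rpredN; set r := (v z %% n%:Z)%Z.
pose t := (v z %/ n%:Z)%Z * n%:Z.
have hd : (n%:Z %| t)%Z by exact: (dvdz_mull _ (dvdzz _)).
have -> : - (v y - (r - k)) = (v z - v y - k) - t.
  have := divz_eq (v z) n%:Z; rewrite -/r -/t; clearbody r t; lia.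
by apply/idP/idP => h; [exact: rpredB|rewrite -(subrK t (_ - k)); exact: rpredD].
Qed.

(** Once both functions are replaced by their differences, the double integral has compact support
    in both variables and Fubini is elementary. The variable z = x y then separates it, since W x =
    W z / W y, and the sum over i records the class of v z mod n. *)
Lemma AT2 k : integ (fun x => conv x * bet k x * W x) ->
  (1 - (q ^- n)%:C * W (w ^+ n)) * (1 - (W (w ^+ n))^-1) *
     J (fun x => conv x * bet k x * W x) =
  \sum_(0 <= i < n) I (fun z => diffn K z * bet i%:Z z * W z) *
     I (fun y => diffn phi y * bet (i%:Z - k) y * ((q ^ v y)%:C / W y)).
Proof.
move=> hi; have mS := measurable_Fstar (F := F).
have [uK zK] := nice_diff nK; have [up zp] := nice_diff nphi.
have dK0 : diffn K 0 = 0 by rewrite /diffn mulr0 subrr.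
have dp0 : diffn phi 0 = 0 by rewrite /diffn mulr0 subrr.
have ug : uinv m (fun x => conv x * bet k x * W x).
  by apply: uinvM => //; apply: uinvM; [exact: conv_uinv|exact: uinv_bet].
pose h x y := diffn phi y * diffn K (x * y) * (bet k x * W x).
have lh : lc2 h.
  pose N : int := `|j1| + `|E1| + `|j2| + `|E2| + n%:Z + n%:Z.
  apply: (@lc2_uinv h m N) => //.
  - move=> x y; rewrite /h => hn.
    have x0 : x != 0 by apply/eqP => e; move: hn; rewrite e bet0 !mul0r mulr0 eqxx.
    have y0 : y != 0 by apply/eqP => e; move: hn; rewrite e dp0 !mul0r eqxx.
    have xy0 : x * y != 0 by rewrite mulf_neq0.
    have hy : j1 <= v y < E1 + n%:Z by apply: contraT => /(zp _ y0) e; move: hn; rewrite e !mul0r eqxx.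
    have hxy : j2 <= v (x * y) < E2 + n%:Z.
      by apply: contraT => /(zK _ xy0) e; move: hn; rewrite e mulr0 mul0r eqxx.
    rewrite valM // in hxy; split=> //; rewrite /N; lia.
  - move=> x y a x0 y0 ha; rewrite /h; have [xa0 _] := val_uinv m1 x0 ha.
    have [_ hb] := uinv_bet k m1; have [_ hW] := uWm; have [_ hK] := uK.
    rewrite hb // hW // (mulrDl x a y) hK ?mulf_neq0 // valM //.
    by rewrite (addrAC (v x)); apply: PFM => //; exact: PF_val.
  - move=> x y b x0 y0 hb; rewrite /h; have [_ hp] := up; have [_ hK] := uK.
    rewrite hp // (mulrDr x y b) hK ?mulf_neq0 // valM // -addrA; apply: PFM => //; exact: PF_val.
have lcp i l : lc (fun y => diffn phi y * bet i y * ((q ^ v y)%:C / W y) * l).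
  have u : uinv m (fun y => diffn phi y * bet i y * ((q ^ v y)%:C / W y) * l).
    apply: uinvM; last by split.
    apply: uinvM; first by apply: uinvM => //; exact: uinv_bet.
    apply: uinvM; first exact: (uinv_val (fun j => (q ^ j)%:C)).
    exact: (uinv_fun (fun z => z^-1) uWm).
  apply: (lc_uinv_win (j := j1) (k := E1 + n%:Z) u); last by rewrite dp0 !mul0r.
  move=> x x0 hx; rewrite zp // ?mul0r //; apply: contra hx; lia.
have lcK i : lc (fun z => diffn K z * bet i z * W z).
  have u : uinv m (fun z => diffn K z * bet i z * W z).
    by apply: uinvM => //; apply: uinvM => //; exact: uinv_bet.
  apply: (lc_uinv_win (j := j2) (k := E2 + n%:Z) u); last by rewrite dK0 !mul0r.
  move=> x x0 hx; rewrite zK // ?mul0r //; apply: contra hx; lia.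
transitivity (I (fun x => I (h x))).
  rewrite -Fstar_Fall; last first.
    rewrite (@eqI _ _ nu _ (fun=> 0)) ?cintegral0 // => y.
    by rewrite /h bet0 !mul0r mulr0.
  have hI x : x != 0 -> I (h x) = ((1 + (q ^- n)%:C) * (conv x * bet k x * W x) -
      W (w ^+ n) ^-1 * (q ^- n)%:C * (conv (w ^+ n * x) * bet k (w ^+ n * x) * W (w ^+ n * x))) -
      W (w ^+ n) * (conv ((w ^+ n)^-1 * x) * bet k ((w ^+ n)^-1 * x) * W ((w ^+ n)^-1 * x)).
    move=> x0; rewrite bet_scale bet_scale' !WM // WV //.
    transitivity ((bet k x * W x) * J (fun y => diffn phi y * diffn K (x * y))).
      rewrite Fstar_Fall; last by rewrite dp0 mul0r.
      rewrite -(IZ hnu).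
        by apply: eqI => y; rewrite /h mulrC.
      have u : uinv m (fun y => diffn phi y * diffn K (x * y)).
        by apply: uinvM => //; exact: uinv_scale.
      apply: (lc_uinv_win (j := j1) (k := E1 + n%:Z) u); last by rewrite dp0 !mul0r.
      move=> y y0 hy; rewrite zp // ?mul0r //; apply: contra hy; lia.
    rewrite conv_diff //; have := W0 wn0; set Wn := W (w ^+ n) => Wn0.
    set a := (q ^- n)%:C; set c1 := conv x; set c2 := conv _; set c3 := conv _.
    by clearbody a c1 c2 c3 Wn; field.
  apply: esym; apply: etrans (eq_cintegral nu (hI : forall x : borel F, Fstar x -> _ = _)) _.
  have i1 := cintegrableZ mS (1 + (q ^- n)%:C) hi.
  have i2 := cintegrableZ mS (W (w ^+ n) ^-1 * (q ^- n)%:C) (cintegrable_scale hnu wn0 ug hi).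
  have i3 := cintegrableZ mS (W (w ^+ n)) (cintegrable_scale hnu wV0 ug hi).
  have i12 := cintegrableB mS i1 i2.
  apply: etrans (cintegralB mS i12 i3) _.
  rewrite (cintegralB mS i1 i2) (cintegralZ mS _ hi).
  rewrite (cintegralZ mS _ (cintegrable_scale hnu wn0 ug hi)).
  rewrite (cintegralZ mS _ (cintegrable_scale hnu wV0 ug hi)).
  rewrite (cintegral_scale hnu wn0 ug hi) (cintegral_scale hnu wV0 ug hi) vwV vwn.
  rewrite -exprnN (WV wn0); have := W0 wn0; set Wn := W (w ^+ n) => Wn0.
  have qn : ((q ^- n)%:C * (q ^ n%:Z)%:C = 1 :> C).
    by rewrite -rmorphM /= -[q ^ n%:Z]/(q ^+ n) mulVf // expf_neq0 // gt_eqF // q_gt0.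
  set JJ := cintegral _ _ _; set a := (q ^- n)%:C in qn *; set b := (q ^ n%:Z)%:C in qn *.
  have -> : Wn^-1 * a * (b * JJ) = Wn^-1 * ((a * b) * JJ) by ring.
  rewrite qn mul1r; clearbody a b JJ Wn.
  have -> : (1 - a * Wn) * (1 - Wn^-1) * JJ = (1 - Wn^-1 - a * Wn + a * (Wn / Wn)) * JJ by ring.
  by rewrite divff // mulr1; ring.
rewrite (I_fubini hnu lh).
rewrite (@eqI _ _ nu _ (fun y => \sum_(0 <= i < n)
  diffn phi y * bet (i%:Z - k) y * ((q ^ v y)%:C / W y) * I (fun z => diffn K z * bet i%:Z z * W z))).
  rewrite (cintegral_sum measurableT); last by move=> i _; exact: (lc_integrable hnu (lcp _ _)).
  apply: eq_bigr => i _; rewrite -(IZ hnu); last first.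
    by apply: lc_ext (lcp (i%:Z - k) 1) => y; rewrite mulr1.
  by apply: eqI => y; rewrite mulrC.
move=> y; have [->|y0] := eqVneq y 0.
  rewrite (@eqI _ _ nu _ (fun=> 0)) => [|x]; last by rewrite /h dp0 !mul0r.
  by rewrite cintegral0 // big1 // => i _; rewrite dp0 !mul0r.
pose G z := diffn K z * bet k (z / y) * W z.
have GE z : G z = \sum_(0 <= i < n) bet (i%:Z - k) y * (diffn K z * bet i%:Z z * W z).
  have [->|z0] := eqVneq z 0.
    by rewrite /G dK0 !mul0r big1 // => i _; rewrite bet0 mulr0 mul0r mulr0.
  rewrite /G bet_sum // mulr_sumr mulr_suml; apply: eq_bigr => i _; ring.
have lG : lc G.
  have -> : G = (fun z => \sum_(0 <= i < n) bet (i%:Z - k) y * (diffn K z * bet i%:Z z * W z)).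
    by apply/funext.
  elim: (index_iota 0 n) => [|i r IH].
    apply: (@lc_ext _ _ (fun=> 0)) => [z|]; first by rewrite big_nil.
    by exists 0, 0; split.
  apply: (@lc_ext _ _ (fun z => bet (i%:Z - k) y * (diffn K z * bet i%:Z z * W z) +
     \sum_(i <- r) bet (i%:Z - k) y * (diffn K z * bet i%:Z z * W z))) => [z|].
    by rewrite big_cons.
  by apply: lcD => //; apply: lcZ.
have IG : I G = \sum_(0 <= i < n) bet (i%:Z - k) y * I (fun z => diffn K z * bet i%:Z z * W z).
  rewrite (eqI nu GE) (cintegral_sum measurableT); last first.
    by move=> i _; apply: (lc_integrable hnu); exact: lcZ.
  by apply: eq_bigr => i _; rewrite (IZ hnu).
have := I_scale hnu y0 lG; rewrite IG => e.
(* The substitution z = y x replaces W x by W z / W y; its Jacobian |y|^-1 is the factor q^(v y) of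
   the second integral. *)
transitivity (diffn phi y / W y * I (fun x => G (y * x))).
  rewrite -(IZ hnu); last exact: lc_scale.
  apply: eqI => x; rewrite /h /G; have [->|x0] := eqVneq x 0.
    by rewrite !mulr0 mul0r bet0 dK0 !mul0r !mulr0.
  rewrite (mulrC y x) mulfK // WM //; have Wy := W0 y0; by field.
rewrite e !mulr_sumr; apply: eq_bigr => i _; have Wy := W0 y0; by field.
Qed.

End Convolution.

End Abstract.

(** * Multiplicative characters *)

Section MulChar.
Context {R : realType} {F : padicFieldType}.
Local Notation C := R[i].
Local Notation v := (@pval F).
Local Notation q := ((@residue_card F)%:R : R).
Implicit Types (psi chi f : F -> C) (x y a b : F).

Lemma uinv_continuous m f x : uinv m f -> x != 0 -> {for x, continuous f}.
Proof.
move=> [m1 uf] x0; apply: cvg_near_cst.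
apply/nbhsF; exists (v x + m) => y h; apply/eqP.
by rewrite -(subrK x y) addrC uf.
Qed.

Section Theory.
Variable chi : F -> C.
Hypothesis hchi : is_mulchar chi.

Lemma chiM x y : x != 0 -> y != 0 -> chi (x * y) = chi x * chi y.
Proof. by have [h _ _] := hchi; exact: h. Qed.

Lemma chi_neq0 x : x != 0 -> chi x != 0.
Proof. by have [_ h _] := hchi; exact: h. Qed.

Lemma chi1 : chi 1 = 1.
Proof.
have h := oner_neq0 F; apply: (mulfI (chi_neq0 h)).
by rewrite -chiM // !mulr1.
Qed.

Lemma chiV x : x != 0 -> chi x^-1 = (chi x)^-1.
Proof.
move=> x0; have x0' : x^-1 != 0 by rewrite invr_eq0.
by apply: (mulfI (chi_neq0 x0)); rewrite -chiM // !divff ?chi_neq0 // chi1.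
Qed.

Lemma chiX x k : x != 0 -> chi (x ^+ k) = chi x ^+ k.
Proof.
move=> x0; elim: k => [|k IH]; first by rewrite !expr0 chi1.
by rewrite !exprS chiM ?expf_neq0 // IH.
Qed.

Lemma chiXz x (k : int) : x != 0 -> chi (x ^ k) = chi x ^ k.
Proof.
move=> x0; case: k => k; first exact: chiX.
by rewrite !NegzE -!exprnN chiV ?expf_neq0 // chiX.
Qed.

Lemma PF_1X M (y : F) k : 1 <= M -> PF M y -> PF M ((1 + y) ^+ k - 1).
Proof.
move=> M1 hy; elim: k => [|k IH]; first by rewrite expr0 subrr; exact: PF0.
have -> : (1 + y) ^+ k.+1 - 1 = ((1 + y) ^+ k - 1) + y * ((1 + y) ^+ k - 1) + y.
  by rewrite exprS; ring.
by apply: PFD => //; apply: PFD => //; apply: PFW (PFM hy IH); lia.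
Qed.

(** All powers of an element of 1 + P^M stay in 1 + P^M, hence their values under chi stay close to
    1, and [no_small_power] applies. *)
Lemma multriv_ex : exists2 M : nat, (1 <= M)%N & multriv chi M.
Proof.
have [_ _ cchi] := hchi; have h12 : 0 < 1 / 2 :> R by lra.
have [m hm] := cont_eps (cchi _ (oner_neq0 F)) h12.
exists (absz m).+1 => // y hy.
have y10 : 1 + y != 0 by have [] := @val_1D F y (PFW (_ : (1 : int) <= (absz m).+1%:Z) hy).
apply: no_small_power => k.
rewrite -chiX // -chi1; apply: hm.
apply: (PFW (_ : m <= (absz m).+1%:Z)); first by lia.
by apply: PF_1X => //; lia.
Qed.

Lemma multriv_uinv (M : nat) : (1 <= M)%N -> multriv chi M -> uinv M%:Z chi.
Proof.
move=> M1 h; split=> // x y x0 hy.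
have hyx : PF M%:Z (y / x).
  by rewrite mulrC; apply/PF_mulE; rewrite ?invr_eq0 // valV // opprK addrC.
have [y10 _] : 1 + y / x != 0 /\ v (1 + y / x) = 0 by apply: val_1D; apply: PFW hyx.
have -> : x + y = x * (1 + y / x) by field.
by rewrite chiM // h // mulr1.
Qed.

Lemma uinv_chi : exists2 m, 1 <= m & uinv m chi.
Proof.
by have [M M1 h] := multriv_ex; exists M%:Z => //; exact: multriv_uinv.
Qed.

Lemma unit_decomp (w x : F) : w != 0 -> v w = 1 -> x != 0 ->
  exists2 u, u != 0 /\ v u = 0 & x = w ^ v x * u.
Proof.
move=> w0 vw x0; have w0' : w ^ v x != 0 by rewrite expfz_neq0.
exists (x / w ^ v x); last by rewrite mulrC divfK.
by rewrite mulf_neq0 ?invr_eq0 // valM ?invr_eq0 // valV // valX // vw mulr1 subrr.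
Qed.

(** On units chi takes finitely many values, one for each class modulo P^m, so its growth is that of
    chi(w)^(v x). *)
Lemma chi_bound (w : F) : w != 0 -> v w = 1 -> exists2 B : R, 0 <= B &
  forall x, x != 0 -> normc (chi x) <= B * normc (chi w) ^ v x.
Proof.
move=> w0 vw; have [m m1 um] := uinv_chi.
have [r [_ ir sr _]] := @exists_transversal F 0 m ltac:(lia).
exists (\sum_(a <- r) normc (chi a)).
  by rewrite sumr_ge0 // => a _; exact: normc_ge0.
move=> x x0; have [u [u0 vu] xE] := unit_decomp w0 vw x0.
rewrite xE chiM ?expfz_neq0 // chiXz // normcM.
have -> : v (w ^ v x * u) = v x by rewrite -xE.
have nX (k : int) : normc (chi w ^ k) = normc (chi w) ^ k.
  case: k => k; first exact: normcX.
  by rewrite !NegzE -!exprnN normcV normcX.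
rewrite nX mulrC ler_wpM2r ?exprz_ge0 ?normc_ge0 //.
have [|a' ar' ha'] := sr u; first by right; rewrite vu.
have -> : chi u = chi a'.
  have : PF (v u + m) (a' - u) by rewrite vu add0r; exact: PF_sub_sym.
  by move=> h; have [_ /(_ u _ u0 h)] := um; rewrite addrC subrK.
rewrite (big_rem a') //= lerDl sumr_ge0 // => b _; exact: normc_ge0.
Qed.

End Theory.

Lemma mulchar_intro chi m : (forall x y, x != 0 -> y != 0 -> chi (x * y) = chi x * chi y) ->
  (forall x, x != 0 -> chi x != 0) -> uinv m chi -> is_mulchar chi.
Proof. by move=> h1 h2 h3; split=> // x; exact: uinv_continuous h3. Qed.

Lemma mulchar_exp chi (j : int) : is_mulchar chi -> is_mulchar (chexp chi j).
Proof.
move=> hchi; have [m m1 um] := uinv_chi hchi.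
apply: (@mulchar_intro _ m).
- by move=> x y x0 y0; rewrite /chexp (chiM hchi) // expfzMl.
- by move=> x x0; rewrite /chexp expfz_neq0 // (chi_neq0 hchi).
- exact: (uinv_fun (fun z => z ^ j) um).
Qed.

End MulChar.

(** * Admissible denominators *)

Section MeromorphicQuotient.
Context {R : realType}.
Local Notation C := R[i].

Lemma meromorphic_eq (f g : C -> C) : mero_eq f g -> meromorphic f -> meromorphic g.
Proof.
move=> fg mf s0; have [k [h [dh hE]]] := mf s0.
exists k, h; split=> //; apply: dnearC2 (fg s0) hE => s /= <- //.
Qed.

(** Unlike [simple_zeros], this class is closed under products, as the denominator (1 - X^n)(1 -
    (qX)^-n) requires. *)
Definition admissible (D : C -> C) := [/\ entire D, meromorphic (fun s => (D s)^-1) &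
  forall s0, \forall s \near s0^', D s != 0].

Lemma simple_zeros_admissible D : simple_zeros D -> admissible D.
Proof.
move=> h; split; [by case: h | exact: meromorphicV | by move=> s0; exact: simple_zeros_near].
Qed.

Lemma admissibleM D E : admissible D -> admissible E -> admissible (fun s => D s * E s).
Proof.
move=> [eD mD nD] [eE mE nE]; split.
- exact: entireM.
- apply: meromorphic_eq (meromorphicM mD mE) => s0; apply: dnearC_true => s.
  by rewrite invfM.
- move=> s0; apply: dnearC2 (nD s0) (nE s0) => s /= h1 h2; exact: mulf_neq0.
Qed.

End MeromorphicQuotient.

(** * Powers of q^-s and characterization of zeta functions *)

Section ComplexPowersOfQ.
Context {R : realType} {F : padicFieldType}.
Local Notation C := R[i].
Local Notation v := (@pval F).
Local Notation q := ((@residue_card F)%:R : R).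
Implicit Types (s : C).

Definition Q s : C := cpow q (- s).

Lemma QE s : Q s = cexp (- (ln q)%:C * s).
Proof. by rewrite /Q cpowE; congr cexp; ring. Qed.

Lemma Q_neq0 s : Q s != 0.
Proof. by rewrite QE cexp_neq0. Qed.

Lemma QzE s (j : int) : Q s ^ j = cexp ((- (j%:~R * (ln q)%:C)) * s).
Proof. by rewrite QE cexpXz; congr cexp; ring. Qed.

Lemma lnq_gt0 : 0 < ln q.
Proof. by rewrite ln_gt0 // q_gt1. Qed.

Lemma lnq_neq0 : (ln q)%:C != 0.
Proof. by rewrite eq_complex /= eqxx andbT; have := lnq_gt0; case: ltgtP. Qed.

Lemma cexp_lnq : cexp (ln q)%:C = q%:C.
Proof. by rewrite cexpR lnK // posrE (@q_gt0 R F). Qed.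

Lemma Q_sub1 s : Q (1 - s) = (q%:C)^-1 * (Q s)^-1.
Proof.
rewrite !QE -cexp_lnq -!cexpN -cexpD; congr cexp; ring.
Qed.

Lemma entire_Qz (j : int) : entire (fun s => Q s ^ j).
Proof.
have -> : (fun s => Q s ^ j) = (fun s => cexp ((- (j%:~R * (ln q)%:C)) * s + 0)).
  by apply/funext => s; rewrite QzE addr0.
exact: entire_affine (@entire_cexp R).
Qed.

Lemma simple_zeros_Q (A : C) (j : int) : j != 0 -> simple_zeros (fun s => 1 - A * Q s ^ j).
Proof.
move=> j0.
have -> : (fun s => 1 - A * Q s ^ j) = (fun s => 1 - A * cexp ((- (j%:~R * (ln q)%:C)) * s + 0)).
  by apply/funext => s; rewrite QzE addr0.
apply: simple_zeros_cexp; rewrite oppr_eq0 mulf_neq0 ?lnq_neq0 //.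
by rewrite intr_eq0.
Qed.

Lemma normcQ s : normc (Q s) = expR (- Re s * ln q).
Proof.
by rewrite QE normc_cexp; congr expR; case: s => a b /=; ring.
Qed.

Lemma ln_qz (j : int) : ln (q ^ j) = j%:~R * ln q.
Proof.
have q0 := @q_gt0 R F; case: j => j; first by rewrite -exprnP lnXn // -[ln _ *+ _]mulr_natl -pmulrn.
by rewrite NegzE -exprnN lnV ?posrE ?exprn_gt0 // lnXn // -[ln _ *+ _]mulr_natl mulrNz mulNr -pmulrn.
Qed.

(** On F^* this is chi(x) |x|^(s-1): the factor q^(v x) is the density of d^*x with respect to
    dx. *)
Definition Wt (chi : F -> C) s (x : F) : C := chi x * Q s ^ v x * (q ^ v x)%:C.

Lemma normF_val (x : F) : x != 0 -> normF x = q ^ (- v x) :> R.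
Proof. by rewrite /normF => /negPf ->. Qed.

Lemma zeta_integrandE chi f s (x : F) : x != 0 -> zeta_integrand chi f s x = f x * Wt chi s x.
Proof.
move=> x0; rewrite /zeta_integrand /Wt normF_val // cpowE ln_qz QzE.
have -> : s * ((- v x)%:~R * ln q)%:C = - ((v x)%:~R * (ln q)%:C) * s.
  by rewrite mulrNz !mulNr rmorphN /= rmorphM /= rmorph_int; ring.
have -> : ((q ^ (- v x))^-1)%:C = (q ^ v x)%:C by rewrite -invr_expz invrK.
ring.
Qed.

Lemma zeta_ext (nu : {measure set (borel F) -> \bar R}) (chi chi' f g : F -> C) s :
  (forall x, x != 0 -> f x = g x) -> (forall x, x != 0 -> chi x = chi' x) ->
  zeta nu s chi f = zeta nu s chi' g.
Proof.
move=> fg ch; rewrite /zeta; congr (xget _ _ _); apply/seteqP.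
have E z x : x != 0 -> zeta_integrand chi f z x = zeta_integrand chi' g z x.
  by move=> x0; rewrite !zeta_integrandE // fg // /Wt ch.
have mS := @measurable_Fstar F.
split=> Z /= [mZ [a [b [ab H]]]]; split=> //; exists a, b; split=> // z /H [h1 h2]; split.
- by apply: eq_cintegrable h1 => // x /(E z).
- by rewrite h2; apply: eq_cintegral => x /(E z).
- by apply: eq_cintegrable h1 => // x /(E z).
- by rewrite h2; apply: eq_cintegral => x /(E z).
Qed.

(** Determines whichever continuation [zeta] selects. Existence comes from P / D, uniqueness from
    the identity theorem. The relation between the integral and P is assumed at every s of absolute
    convergence, because the strip of the selected continuation need not be the given one. *)
Lemma zeta_char (nu : {measure set (borel F) -> \bar R}) (chi f : F -> C) (D P : C -> C) (a b : R) :
  a < b -> admissible D -> entire P ->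
  (forall s, a < Re s < b -> cintegrable nu Fstar (zeta_integrand chi f s)) ->
  (forall s, cintegrable nu Fstar (zeta_integrand chi f s) ->
     D s * cintegral nu Fstar (zeta_integrand chi f s) = P s) ->
  mero_eq (fun s => D s * zeta nu s chi f) P.
Proof.
move=> ab [eD mD nD] eP hi hD.
pose Js s := cintegral nu Fstar (zeta_integrand chi f s).
(* Inside the strip the integral itself is taken: [is_zeta] asks for equality at every point there,
   including zeros of D, where P / D has a conventional value. *)
pose Z0 s := if a < Re s < b then Js s else P s * (D s)^-1.
have Z0E s : D s != 0 -> P s * (D s)^-1 = Z0 s.
  rewrite /Z0; case: ifP => // h d0.
  by rewrite -(hD s (hi s h)) mulrAC divff // mul1r.
have mZ0 : meromorphic Z0.
  apply: (@meromorphic_eq _ (fun s => P s * (D s)^-1)).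
    by move=> s0; apply: dnearC2 (nD s0) (nD s0) => s /= h _; exact: Z0E.
  exact: meromorphicM (meromorphic_entire eP) mD.
have ex : exists Z, is_zeta nu chi f Z.
  exists Z0; split=> //; exists a, b; split=> // s h; split; first exact: hi.
  by rewrite /Z0 h.
have [Z hZ] := ex.
have : is_zeta nu chi f (xget (fun=> 0) [set Z | is_zeta nu chi f Z]).
  exact: (@xgetPex _ (fun=> 0) [set Z | is_zeta nu chi f Z] ex).
move=> [mz [a' [b' [ab' hz]]]].
apply: (mero_identity_strip ab' (meromorphicM (meromorphic_entire eD) mz) (meromorphic_entire eP)).
by move=> s /hz [h1 ->]; exact: hD.
Qed.

End ComplexPowersOfQ.

(** * Finite sums over integers *)

Section Sums.
Context {C : pzRingType}.
Lemma sum_eq_mem (S : seq int) i : uniq S -> \sum_(j <- S) (i == j)%:R = (i \in S)%:R :> C.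
Proof.
elim: S => [|j S IH] /=; first by rewrite big_nil.
move=> /andP [jS uS]; rewrite big_cons IH // in_cons.
by case: eqP => [->|_] /=; [rewrite (negPf jS) addr0 | rewrite add0r].
Qed.

Lemma sum_same_support (S S' : seq int) (g : int -> C) : uniq S -> uniq S' ->
  (forall j, j \notin S -> g j = 0) -> (forall j, j \notin S' -> g j = 0) ->
  \sum_(j <- S) g j = \sum_(j <- S') g j.
Proof.
move=> uS uS' h h'.
have E (T : seq int) : \sum_(j <- T) g j = \sum_(j <- [seq j <- T | g j != 0]) g j.
  rewrite big_filter (bigID (fun j => g j != 0)) /= [X in _ + X]big1 ?addr0 //.
  by move=> j /negPn /eqP.
rewrite E [RHS]E; apply: perm_big; apply: uniq_perm; rewrite ?filter_uniq //.
move=> j; rewrite !mem_filter; have [_|g0] := eqVneq (g j) 0; first by [].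
have [jS|/h/eqP] := boolP (j \in S); last by rewrite (negPf g0).
by have [//|/h'/eqP] := boolP (j \in S'); rewrite (negPf g0).
Qed.
End Sums.

Definition iwin (a b : int) : seq int := [seq a + i%:Z | i <- iota 0 (absz (b - a))].

Lemma iwin_uniq a b : uniq (iwin a b).
Proof. by rewrite map_inj_uniq ?iota_uniq // => i j; lia. Qed.

Lemma mem_iwin a b j : a <= b -> (j \in iwin a b) = (a <= j < b).
Proof.
move=> ab; apply/mapP/idP => [[ i ]|h].
  by rewrite mem_iota => h ->; lia.
by exists (absz (j - a)); rewrite ?mem_iota; lia.
Qed.

(** * Decomposition into shells of constant valuation *)

Section Shells.
Context {R : realType} {F : padicFieldType}.
Local Notation C := R[i].
Local Notation v := (@pval F).
Local Notation q := ((@residue_card F)%:R : R).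
Local Notation Q := (@Q R F).
Variable nu : {measure set (borel F) -> \bar R}.
Hypothesis hnu : is_haar nu.
Local Notation I f := (cintegral nu setT (f : borel F -> C)).
Local Notation J f := (cintegral nu Fstar (f : borel F -> C)).
Local Notation integ f := (cintegrable nu Fstar (f : borel F -> C)).

Lemma lcM (f g : F -> C) : lc f -> lc g -> lc (fun x => f x * g x).
Proof.
move=> hf hg; have [m [M [_ sf pf sg pg]]] := lc2P hf hg.
by exists m, M; split; [exact: suppMl | exact: pinvM].
Qed.

Lemma ind_winE j (x : F) : x != 0 -> indF (win j j) x = (v x == j)%:R :> C.
Proof.
move=> x0; rewrite indFE; congr (_%:R); congr nat_of_bool; apply/idP/eqP.
  by rewrite inE => -[_]; lia.
by move=> <-; rewrite inE; split=> //; lia.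
Qed.

Lemma ind_win0 j k : indF (win j k) (0 : F) = 0 :> C.
Proof. by apply: indF0 => -[/eqP]. Qed.

Lemma I_shells (g : F -> C) (S : seq int) : lc g -> g 0 = 0 -> uniq S ->
  (forall x, x != 0 -> v x \notin S -> g x = 0) ->
  I g = \sum_(j <- S) I (fun x => g x * indF (win j j) x).
Proof.
move=> lg g0 uS h.
rewrite -cintegral_sum; first last.
- by move=> j _; apply: lc_integrable hnu _ _; apply: lcM lg (lc_ind_win _ _).
- exact: measurableT.
apply: eqI => x; have [->|x0] := eqVneq x 0.
  by rewrite g0 big1 // => j _; rewrite mul0r.
rewrite -mulr_sumr (eq_bigr (fun j => (v x == j)%:R)); last by move=> j _; rewrite ind_winE.
rewrite sum_eq_mem //; have [_|/(h x x0) ->] := boolP (v x \in S); by rewrite ?mulr1 ?mul0r.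
Qed.

Variables (w : F) (n : nat).
Hypotheses (w0 : w != 0) (vw : v w = 1) (n0 : (0 < n)%N).

Section Char.
Variable chi : F -> C.
Hypothesis hchi : is_mulchar chi.

(** The coefficient of q^(-js) in the zeta integral of f; [dshell] below is the corresponding
    coefficient after multiplication by 1 - X^n, and [Pz] the resulting Laurent polynomial. *)
Definition shell (f : F -> C) (j : int) : C :=
  (q ^ j)%:C * I (fun x => f x * chi x * indF (win j j) x).

Definition Pz f l s : C := I (fun x => diffn w n f x * bet n l x * Wt chi s x).

Definition dshell f j := shell f j - chi w ^+ n * shell f (j - n%:Z).

Lemma Wt_mul s x y : x != 0 -> y != 0 -> Wt chi s (x * y) = Wt chi s x * Wt chi s y.
Proof.
move=> x0 y0; rewrite /Wt (chiM hchi) // valM // !expfzDr ?Q_neq0 //; last first.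
  by rewrite gt_eqF // (@q_gt0 R F).
by rewrite rmorphM /=; ring.
Qed.

Lemma qz_neq0 (j : int) : (q ^ j)%:C != 0 :> C.
Proof.
rewrite (_ : 0 = 0%:C) // (inj_eq (@complexI R)) expfz_neq0 // gt_eqF //.
exact: (@q_gt0 R F).
Qed.

Lemma Wt_neq0 s x : x != 0 -> Wt chi s x != 0.
Proof.
move=> x0; rewrite /Wt !mulf_neq0 // ?qz_neq0 // ?expfz_neq0 ?Q_neq0 //.
exact: (chi_neq0 hchi).
Qed.

Lemma uinv_Wt s m : uinv m chi -> uinv m (Wt chi s).
Proof.
move=> um; have m1 : 1 <= m by case: um.
apply: uinvM (uinv_val (fun k => (q ^ k)%:C) m1).
exact: uinvM um (uinv_val (fun k => Q s ^ k) m1).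
Qed.

Lemma normcz (z : C) (j : int) : normc (z ^ j) = normc z ^ j.
Proof.
case: j => j; first exact: normcX.
by rewrite !NegzE -!exprnN normcV normcX.
Qed.

Lemma Wt_bound s : exists2 B : R, 0 <= B &
  forall x, x != 0 -> normc (Wt chi s x) <= B * (q ^ v x * (normc (chi w) * normc (Q s)) ^ v x).
Proof.
have [B B0 hB] := chi_bound hchi w0 vw; exists B => // x x0.
have qp : 0 <= q ^ v x by rewrite exprz_ge0 ?ltW ?(@q_gt0 R F).
rewrite /Wt; have := normcz (Q s) (v x); move: (Q s) => Qs nQ.
rewrite normcM (normcM (chi x)) nQ (normcR (q ^ v x)) ger0_norm // (expfzMl (normc (chi w))).
have := hB x x0.
have : 0 <= normc Qs ^ v x by rewrite exprz_ge0 ?normc_ge0.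
move: (normc Qs ^ v x) (q ^ v x) qp (normc (chi w) ^ v x) (normc (chi x)) => a b b0 c d a0 h.
rewrite (_ : B * _ = B * c * a * b); last by ring.
by rewrite !ler_wpM2r.
Qed.

Lemma W_wn s : (q ^- n)%:C * Wt chi s (w ^+ n) = (chi w * Q s) ^+ n.
Proof.
rewrite /Wt (chiX hchi) // -[w ^+ n]/(w ^ n%:Z) valX // vw mulr1.
have qn0 : (q ^+ n)%:C != 0 := qz_neq0 n.
rewrite (_ : (q ^- n)%:C = ((q ^+ n)%:C)^-1); last first.
  by rewrite rmorphV //= unitfE expf_neq0 // gt_eqF // (@q_gt0 R F).
move: (Q s) => Qs; rewrite -[Qs ^ n%:Z]/(Qs ^+ n) -[q ^ n%:Z]/(q ^+ n) (exprMn n (chi w)).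
by move: (q ^+ n)%:C (Qs ^+ n) (chi w ^+ n) qn0 => a b c a0; field.
Qed.

Lemma shell_scale f j m : uinv m f ->
  (q ^ j)%:C * I (fun x => f ((w ^+ n)^-1 * x) * chi x * indF (win j j) x) =
  chi w ^+ n * shell f (j - n%:Z).
Proof.
move=> uf; have [m2 m21 u2] := uinv_chi hchi.
have wn0 : w ^+ n != 0 by rewrite expf_neq0.
have wV0 : (w ^+ n)^-1 != 0 by rewrite invr_eq0.
have vwV : v (w ^+ n)^-1 = - n%:Z by rewrite valV // -[w ^+ n]/(w ^ n%:Z) valX // vw mulr1.
pose h x := chi w ^+ n * (f x * chi x * indF (win (j - n%:Z) (j - n%:Z)) x).
have lh : lc (fun x => f x * chi x * indF (win (j - n%:Z) (j - n%:Z)) x).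
  have le1 : m <= Num.max m m2 by rewrite le_max lexx.
  have le2 : m2 <= Num.max m m2 by rewrite le_max lexx orbT.
  exact: lc_win (uinvM (uinvW le1 uf) (uinvW le2 u2)).
rewrite (_ : I _ = I (fun x => h ((w ^+ n)^-1 * x))); last first.
  apply: eqI => x; rewrite /h; have [->|x0] := eqVneq x 0.
    by rewrite mulr0 !ind_win0 !mulr0.
  have z0 : (w ^+ n)^-1 * x != 0 by rewrite mulf_neq0.
  rewrite !ind_winE // valM // vwV.
  have -> : (- n%:Z + v x == j - n%:Z) = (v x == j) by lia.
  rewrite -{1}[x in chi x](mulVKf wn0) (chiM hchi) // (chiX hchi) //; ring.
rewrite (I_scale hnu wV0); last exact: lcZ.
rewrite IZ // /shell vwV.
have -> : (q ^ (j - n%:Z))%:C = (q ^ j)%:C * (q ^ (- n%:Z))%:C :> C.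
  by rewrite -rmorphM -expfzDr // gt_eqF // (@q_gt0 R F).
ring.
Qed.

Lemma dshellE f j m : uinv m f ->
  (q ^ j)%:C * I (fun x => diffn w n f x * chi x * indF (win j j) x) = dshell f j.
Proof.
move=> uf; have [m2 m21 u2] := uinv_chi hchi.
have wV0 : (w ^+ n)^-1 != 0 by rewrite invr_eq0 expf_neq0.
have le1 : m <= Num.max m m2 by rewrite le_max lexx.
have le2 : m2 <= Num.max m m2 by rewrite le_max lexx orbT.
rewrite /dshell -(shell_scale _ uf) /shell -mulrBr -IB //.
- by congr (_ * _); apply: eqI => x; rewrite /diffn; ring.
- exact: lc_win (uinvM (uinvW le1 uf) (uinvW le2 u2)).
- apply: lc_win (uinvM (uinvW le1 _) (uinvW le2 u2)); exact: uinv_scale.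
Qed.

(** The list S is free as long as the coefficients vanish outside it, so that short explicit lists
    can replace the support bound coming from [nice]. *)
Lemma Pz_shells m j E B f l s (S : seq int) : nice w n m j E B f -> uniq S ->
  (forall i, i \notin S -> dshell f i = 0) ->
  Pz f l s = \sum_(i <- S) (i == l %[mod n%:Z])%Z%:R * (Q s ^ i * dshell f i).
Proof.
move=> nf uS hS; have uf : uinv m f by case: nf.
have [ud dz] := nice_diff w0 vw n0 nf.
have [m2 m21 u2] := uinv_chi hchi.
pose mm := Num.max m m2.
have le1 : m <= mm by rewrite le_max lexx.
have le2 : m2 <= mm by rewrite le_max lexx orbT.
have mm1 : 1 <= mm by rewrite (le_trans m21).
pose E' := Num.max j (E + n%:Z).
have jE' : j <= E' by rewrite le_max lexx.
have EE' : E + n%:Z <= E' by rewrite le_max lexx orbT.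
have dz' x : x != 0 -> v x \notin iwin j E' -> diffn w n f x = 0.
  by move=> x0; rewrite mem_iwin // => h; apply: dz => //; lia.
have shl i : I (fun x => diffn w n f x * bet n l x * Wt chi s x * indF (win i i) x) =
   (i == l %[mod n%:Z])%Z%:R * (Q s ^ i * dshell f i).
  rewrite -(dshellE i uf).
  rewrite (_ : _ * (_ * (_ * I _)) = ((i == l %[mod n%:Z])%Z%:R * Q s ^ i * (q ^ i)%:C) *
    I (fun x => diffn w n f x * chi x * indF (win i i) x)); last by ring.
  rewrite -IZ //; last first.
    exact: lc_win (uinvM (uinvW le1 ud) (uinvW le2 u2)).
  apply: eqI => x; have [->|x0] := eqVneq x 0; first by rewrite !ind_win0 !mulr0.
  rewrite ind_winE //; case: eqP => [<-|_]; last by rewrite !mulr0.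
  by rewrite betE // /Wt; ring.
rewrite /Pz (I_shells (S := iwin j E')); first last.
- by move=> x x0 h; rewrite dz' // !mul0r.
- exact: iwin_uniq.
- by rewrite bet0 mulr0 mul0r.
- apply: (@lc_uinv_win _ _ mm _ j E').
  + apply: uinvM (uinvM (uinvW le1 ud) (uinv_bet n l mm1)) (uinvW le2 (uinv_Wt s u2)).
  + move=> x x0 h; rewrite dz' ?mul0r // mem_iwin //; lia.
  + by rewrite bet0 mulr0 mul0r.
rewrite (eq_bigr _ (fun i _ => shl i)); apply: sum_same_support (iwin_uniq _ _) uS _ _ => i.
  move=> hi; rewrite -shl; rewrite (@eqI _ _ nu _ (fun=> 0)); first exact: cintegral0.
  move=> x; have [->|x0] := eqVneq x 0; first by rewrite ind_win0 mulr0.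
  rewrite ind_winE //; case: eqP => [vi|_]; last by rewrite mulr0.
  by rewrite dz' ?mul0r // vi.
by move=> /hS ->; rewrite !mulr0.
Qed.

Lemma dshell_nice0 m j E B f i : nice w n m j E B f ->
  i \notin iwin j (Num.max j (E + n%:Z)) -> dshell f i = 0.
Proof.
move=> nf hi; have uf : uinv m f by case: nf.
have [ud dz] := nice_diff w0 vw n0 nf.
rewrite -(dshellE i uf) (@eqI _ _ nu _ (fun=> 0)) ?cintegral0 ?mulr0 //.
move=> x; have [->|x0] := eqVneq x 0; first by rewrite ind_win0 mulr0.
rewrite ind_winE //; case: eqP => [vi|_]; last by rewrite mulr0.
rewrite dz ?mul0r // vi; move: hi; rewrite mem_iwin; last by rewrite le_max lexx.
by rewrite lt_max; lia.
Qed.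

Lemma Pz_entire m j E B f l : nice w n m j E B f -> entire (Pz f l).
Proof.
move=> nf; set S := iwin j (Num.max j (E + n%:Z)).
have -> : Pz f l = fun s => \sum_(i <- S) (i == l %[mod n%:Z])%Z%:R * dshell f i * Q s ^ i.
  apply/funext => s; rewrite (Pz_shells l s nf (iwin_uniq _ _) (fun i => @dshell_nice0 _ _ _ _ _ i nf)).
  by apply: eq_bigr => i _; ring.
apply: entire_sum => i.
by move=> s; apply: (@cderivableM R (fun=> _) (fun s => Q s ^ i)); [exact: (@entire_cst R) | exact: (@entire_Qz R F)].
Qed.

End Char.
End Shells.

(** * Zeta functions of nice functions and of their convolutions *)

Section ZetaOfNice.
Context {R : realType} {F : padicFieldType}.
Local Notation C := R[i].
Local Notation v := (@pval F).
Local Notation q := ((@residue_card F)%:R : R).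
Local Notation Q := (@Q R F).
Variable nu : {measure set (borel F) -> \bar R}.
Hypothesis hnu : is_haar nu.
Local Notation I f := (cintegral nu setT (f : borel F -> C)).
Local Notation J f := (cintegral nu Fstar (f : borel F -> C)).
Local Notation integ f := (cintegrable nu Fstar (f : borel F -> C)).
Variables (w : F) (n : nat).
Hypotheses (w0 : w != 0) (vw : v w = 1) (n0 : (0 < n)%N).
Variable chi : F -> C.
Hypothesis hchi : is_mulchar chi.

Lemma decr_Xz (t : R) (k l : int) : 0 < t <= 1 -> l <= k -> t ^ k <= t ^ l.
Proof.
move=> /andP [t0 t1] lk.
have h1 : 1 <= t^-1 by rewrite invf_ge1.
have := ler_weXz2l h1 (_ : - k <= - l); rewrite lerN2 => /(_ lk).
by rewrite !exprz_inv !opprK.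
Qed.

Lemma absz_Xz (t : R) (k : int) : t ^+ absz k = t ^ `|k|.
Proof. by rewrite -abszE. Qed.

Let ratio s : R := normc (chi w) * normc (Q s).

Lemma ratio_strip : exists a : R, forall s, a < Re s < a + 1 -> q^-1 < ratio s < 1.
Proof.
have r0 : 0 < normc (chi w) by rewrite normc_gt0 (chi_neq0 hchi).
have q0 := @q_gt0 R F; have l0 := @lnq_gt0 R F.
(* At this abscissa |chi(w) q^-s| is 1, and one unit to the right it is q^-1. *)
exists (ln (normc (chi w)) / ln q) => s.
rewrite /ratio (@normcQ R F) => /andP [h1 h2].
have rE : normc (chi w) = expR (ln (normc (chi w))) by rewrite lnK.
rewrite [X in X * _]rE -expRD.
have -> : q^-1 = expR (- ln q) by rewrite expRN lnK.
rewrite ltr_expR expR_lt1.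
rewrite ltr_pdivrMr // in h1; rewrite -ltrBlDr ltr_pdivlMr // mulrBl mul1r in h2.
apply/andP; split; lra.
Qed.

Lemma integ_nice m j E B f l s : nice w n m j E B f -> 0 < ratio s < 1 ->
  integ (fun x => f x * bet n l x * Wt chi s x).
Proof.
move=> [uf zf pf [B0 bf]] /andP [t0 t1].
have [m2 m21 u2] := uinv_chi hchi.
pose mm := Num.max m m2.
have le1 : m <= mm by rewrite le_max lexx.
have le2 : m2 <= mm by rewrite le_max lexx orbT.
have mm1 : 1 <= mm by rewrite (le_trans m21).
have [Bw Bw0 hB] := Wt_bound w0 vw hchi s.
have qp (k : int) : 0 <= q ^ k by rewrite exprz_ge0 ?ltW ?(@q_gt0 R F).
apply: (@cintegrable_bound _ _ nu hnu mm _ (B * Bw * ratio s ^ (- (2 * `|j|))) (ratio s)).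
- exact: uinvM (uinvM (uinvW le1 uf) (uinv_bet n l mm1)) (uinvW le2 (uinv_Wt s u2)).
- by rewrite !mulr_ge0 // exprz_ge0 // ltW.
- by rewrite t0.
move=> x x0; have [h|h] := ltP (v x) j.
  rewrite zf // !mul0r normc0.
  by rewrite !mulr_ge0 // ?exprz_ge0 ?exprn_ge0 // ltW.
rewrite normcM.
have b1 : normc (f x * bet n l x) <= B.
  rewrite betE //; case: (_ == _); rewrite ?mulr1 ?mulr0 ?bf //.
  by rewrite normc0.
rewrite absz_Xz.
have tE : ratio s ^ v x <= ratio s ^ (- (2 * `|j|)) * ratio s ^ `|v x|.
  rewrite -expfzDr ?gt_eqF //; apply: decr_Xz; first by rewrite t0 ltW.
  by move: h; lia.
rewrite (_ : _ * _ * (_ * _) = B * (Bw * (q ^ v x * (ratio s ^ (- (2 * `|j|)) * ratio s ^ `|v x|)))); last by ring.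
apply: ler_pM => //; rewrite ?normc_ge0 //.
apply: le_trans (hB x x0) _; rewrite ler_wpM2l // ler_wpM2l //.
Qed.

Definition Dn s : C := 1 - (chi w * Q s) ^+ n.

Lemma Dn_admissible : admissible Dn.
Proof.
apply: simple_zeros_admissible.
have -> : Dn = (fun s => 1 - chi w ^+ n * Q s ^ n%:Z).
  by apply/funext => s; rewrite /Dn (exprMn n (chi w)).
by apply: simple_zeros_Q; lia.
Qed.

Theorem zeta_nice m j E B f l : nice w n m j E B f ->
  mero_eq (fun s => Dn s * zeta nu s chi (fun x => f x * bet n l x)) (Pz nu w n chi f l).
Proof.
move=> nf; have [a ha] := ratio_strip.
have [m2 m21 u2] := uinv_chi hchi.
have mS := @measurable_Fstar F.
have E1 s x : Fstar x -> zeta_integrand chi (fun x => f x * bet n l x) s x = f x * bet n l x * Wt chi s x.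
  by move=> x0; rewrite zeta_integrandE.
apply: (@zeta_char R F nu chi _ Dn (Pz nu w n chi f l) a (a + 1)).
- by rewrite ltrDl.
- exact: Dn_admissible.
- exact: Pz_entire nf.
- move=> s /ha /andP [h1 h2]; apply: (eq_cintegrable mS (fun x xs => esym (E1 s x xs))).
  apply: integ_nice nf _; rewrite h2 andbT (lt_trans _ h1) // invr_gt0.
  exact: (@q_gt0 R F).
- move=> s hi; have hi' := eq_cintegrable mS (E1 s) hi.
  rewrite (_ : cintegral _ _ _ = J (fun x => f x * bet n l x * Wt chi s x)); last by apply: eq_cintegral => x; exact: E1.
  rewrite /Dn -(W_wn n w0 vw hchi).
  apply: (AT1 hnu w0 vw _ _ _ nf hi').
  + by move=> x y; exact: Wt_mul.
  + by move=> x; exact: Wt_neq0.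
  + by exists m2; exact: uinv_Wt.
Qed.

Section Conv.
Variables (m j1 E1 j2 E2 : int) (B1 B2 : R) (phi K : F -> C).
Hypotheses (nphi : nice w n m j1 E1 B1 phi) (nK : nice w n m j2 E2 B2 K).
Hypothesis uc : uinv m chi.

Let uWm s : uinv m (Wt chi s). Proof. exact: uinv_Wt. Qed.

(** For v x >= 0 the uniform bound on [conv] leaves powers of |X| < 1. For v x < 0 the bound of
    order q^(v x) leaves powers of (q |X|)^-1 < 1. The ratio r is the larger of the two. *)
Lemma integ_conv k s : q^-1 < ratio s < 1 ->
  integ (fun x => conv nu phi K x * bet n k x * Wt chi s x).
Proof.
move=> /andP [t0' t1].
have q0 := @q_gt0 R F.
have t0 : 0 < ratio s by rewrite (lt_trans _ t0') // invr_gt0.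
have [_ _ _ [B10 _]] := nphi; have [_ _ _ [B20 _]] := nK.
have m1 : 1 <= m by case: uc.
have [Bw Bw0 hB] := Wt_bound w0 vw hchi s.
have qp (i : int) : 0 <= q ^ i by rewrite exprz_ge0 ?ltW.
pose C1 := 2 * (B1 * B2 * vol nu j1).
pose C2 := 2 * (B1 * B2 * (q ^ (- j2) * vol nu 0)).
have C10 : 0 <= C1 by rewrite !mulr_ge0 // ltW // (vol_gt0 hnu).
have C20 : 0 <= C2 by rewrite !mulr_ge0 // ltW // (vol_gt0 hnu).
pose r := Num.max (ratio s) (ratio s * q)^-1.
have tq : 1 < ratio s * q by rewrite -ltr_pdivrMr // div1r.
have r0 : 0 < r by rewrite lt_max t0.
apply: (@cintegrable_bound _ _ nu hnu m _ ((C1 + C2) * Bw) r).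
- by apply: uinvM (uinvM (conv_uinv hnu w0 vw n0 nphi nK (uWm s)) (uinv_bet n k m1)) (uWm s).
- by rewrite mulr_ge0 // addr_ge0.
- by rewrite r0 gt_max t1 invf_lt1 // (lt_trans ltr01).
move=> x x0; rewrite normcM absz_Xz.
have b1 (D : R) : 0 <= D -> normc (conv nu phi K x) <= D -> normc (conv nu phi K x * bet n k x) <= D.
  move=> D0; rewrite betE //; case: (_ == _); rewrite ?mulr1 ?mulr0 //.
  by rewrite normc0.
have hw := hB x x0.
have tv0 : 0 <= ratio s ^ v x by rewrite exprz_ge0 // ltW.
have rv0 : 0 <= r ^ `|v x| by rewrite exprz_ge0 // ltW.
have [h|h] := leP 0 (v x).
  have h1 := b1 _ C10 (conv_bound1 hnu w0 vw n0 nphi nK (uWm s) x0).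
  apply: (@le_trans _ _ (C1 * (Bw * (q ^ v x * ratio s ^ v x)))).
    by apply: ler_pM => //; rewrite normc_ge0.
  rewrite (_ : _ * Bw * _ = (C1 + C2) * (Bw * (q ^ v x * r ^ `|v x|))); last by ring.
  apply: ler_pM => //; rewrite ?mulr_ge0 ?lerDl // ler_wpM2l // ler_wpM2l //.
  by rewrite ger0_norm // ler_wpXz2r // ?nnegrE ?(ltW t0) ?(ltW r0) // /r le_max lexx.
have h2 : normc (conv nu phi K x * bet n k x) <= C2 * q ^ v x.
  apply: b1; first by rewrite mulr_ge0.
  apply: le_trans (conv_bound2 hnu w0 vw n0 nphi nK (uWm s) x0) _.
  rewrite (volE hnu) /C2 opprB expfzDr ?gt_eqF //.
  by rewrite le_eqVlt; apply/orP; left; apply/eqP; ring.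
apply: (@le_trans _ _ (C2 * q ^ v x * (Bw * (q ^ v x * ratio s ^ v x)))).
  by apply: ler_pM => //; rewrite normc_ge0.
rewrite (_ : C2 * _ * _ = C2 * (Bw * (q ^ v x * (q ^ v x * ratio s ^ v x)))); last by ring.
rewrite (_ : _ * Bw * _ = (C1 + C2) * (Bw * (q ^ v x * r ^ `|v x|))); last by ring.
apply: ler_pM => //; rewrite ?mulr_ge0 ?lerDr // ler_wpM2l // ler_wpM2l //.
have -> : q ^ v x * ratio s ^ v x = (ratio s * q)^-1 ^ `|v x|.
  by rewrite ltr0_norm // exprz_inv opprK mulrC -expfzMl.
have i0 : 0 <= (ratio s * q)^-1 by rewrite invr_ge0 mulr_ge0 // ltW.
by rewrite ler_wpXz2r // ?nnegrE ?i0 ?(ltW r0) // /r le_max lexx orbT.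
Qed.

(** The duality between s and 1 - s appears here: q^(v y) / Wt chi s y equals Wt chi^-1 (1 - s) y,
    so the second factor of [AT2] is the numerator attached to phi at 1 - s and the inverse
    character. *)
Theorem zeta_conv k :
  mero_eq (fun s => (Dn s * (1 - ((chexp chi (-1)) w * Q (1 - s)) ^+ n)) *
                    zeta nu s chi (fun x => conv nu phi K x * bet n k x))
    (fun s => \sum_(0 <= i < n) Pz nu w n chi K i%:Z s *
                   Pz nu w n (chexp chi (-1)) phi (i%:Z - k) (1 - s)).
Proof.
have [a ha] := ratio_strip.
have mS := @measurable_Fstar F.
have hchi' := mulchar_exp (-1) hchi.
pose f := conv nu phi K.
have E s x : Fstar x -> zeta_integrand chi (fun x => f x * bet n k x) s x = f x * bet n k x * Wt chi s x.
  by move=> x0; rewrite zeta_integrandE.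
have aff (s : C) : 1 - s = (-1) * s + 1 by ring.
apply: (@zeta_char R F nu chi _ _ _ a (a + 1)).
- by rewrite ltrDl.
- apply: admissibleM Dn_admissible _; apply: simple_zeros_admissible.
  have -> : (fun s => 1 - (chexp chi (-1) w * Q (1 - s)) ^+ n) =
     (fun s => 1 - (chexp chi (-1) w * q%:C^-1) ^+ n * Q s ^ (- n%:Z)).
    apply/funext => s; rewrite Q_sub1; move: (Q s) => Qs.
    rewrite -exprz_inv -[_ ^ n%:Z]/(_ ^+ n) -exprMn; congr (1 - _ ^+ n); ring.
  by apply: simple_zeros_Q; lia.
- pose G i s := Pz nu w n chi K i%:Z s * Pz nu w n (chexp chi (-1)) phi (i%:Z - k) (-1 * s + 1).
  have -> : (fun s => \sum_(0 <= i < n) Pz nu w n chi K i%:Z s *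
                   Pz nu w n (chexp chi (-1)) phi (i%:Z - k) (1 - s)) =
     (fun s => \sum_(i <- index_iota 0 n) G i s).
    by apply/funext => s; apply: eq_bigr => i _; rewrite /G -(aff s).
  apply: (@entire_sum R _ (index_iota 0 n) G) => i.
  have e1 : entire (Pz nu w n chi K i%:Z) by exact: Pz_entire nK.
  have e2 : entire (Pz nu w n (chexp chi (-1)) phi (i%:Z - k)) by exact: Pz_entire nphi.
  exact: (@entireM R _ _ e1 (@entire_affine R _ (-1) 1 e2)).
- move=> s /ha h; apply: (eq_cintegrable mS (fun x xs => esym (E s x xs))).
  exact: integ_conv.
- move=> s hi; have hi' := eq_cintegrable mS (E s) hi.
  rewrite (_ : cintegral _ _ _ = J (fun x => f x * bet n k x * Wt chi s x)); last by apply: eq_cintegral => x; exact: E.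
  have := AT2 hnu w0 vw n0 (Wt_mul hchi s) (@Wt_neq0 _ _ _ hchi s) nphi nK (uWm s) hi'.
  rewrite (W_wn n w0 vw hchi).
  have <- : (chexp chi (-1) w * Q (1 - s)) ^+ n = (Wt chi s (w ^+ n))^-1.
    have := W_wn n w0 vw hchi s.
    rewrite Q_sub1 /chexp exprN1; have := @Q_neq0 R F s; move: (Q s) => Qs Qs0 hW.
    have qn0 : (q ^+ n)%:C != 0 := qz_neq0 n%:Z.
    have -> : Wt chi s (w ^+ n) = (q ^+ n)%:C * (chi w * Qs) ^+ n.
      rewrite -hW (_ : (q ^- n)%:C = ((q ^+ n)%:C)^-1); first by rewrite mulVKf.
      by rewrite rmorphV //= unitfE expf_neq0 // gt_eqF // (@q_gt0 R F).
    by rewrite rmorphXn -exprMn -exprVn !invfM; congr (_ ^+ n); ring.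
  rewrite /Dn /f => ->; apply: eq_bigr => i _; congr (_ * _).
  apply: eqI => y; have [->|y0] := eqVneq y 0; first by rewrite bet0 !mulr0 !mul0r.
  congr (_ * _); rewrite /Wt /chexp Q_sub1 exprN1.
  have := @Q_neq0 R F s; move: (Q s) => Qs Qs0.
  have qv0 : (q ^ v y)%:C != 0 := qz_neq0 (v y).
  have -> : (q%:C^-1 * Qs^-1) ^ v y = ((q ^ v y)%:C)^-1 / Qs ^ v y.
    rewrite expfzMl !exprz_inv -!invr_expz; congr (_^-1 * _).
    case: (v y) => i'; first by rewrite -!exprnP rmorphXn.
    by rewrite !NegzE -!exprnN rmorphV ?rmorphXn //= unitfE expf_neq0 // gt_eqF // (@q_gt0 R F).
  have c0 : chi y != 0 by exact: (chi_neq0 hchi).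
  have Q0 : Qs ^ v y != 0 by rewrite expfz_neq0.
  by move: (Qs ^ v y) (q ^ v y)%:C (chi y) Q0 qv0 c0 => a1 a2 a3 h1 h2 h3; field; rewrite h1 h2.
Qed.

End Conv.
End ZetaOfNice.

(** * Cutting an oscillating kernel *)

Section Kernel.
Context {R : realType} {F : padicFieldType}.
Local Notation C := R[i].
Local Notation v := (@pval F).
Local Notation q := ((@residue_card F)%:R : R).
Variable nu : {measure set (borel F) -> \bar R}.
Hypothesis hnu : is_haar nu.
Local Notation I f := (cintegral nu setT (f : borel F -> C)).
Local Notation J f := (cintegral nu Fstar (f : borel F -> C)).
Local Notation integ f := (cintegrable nu Fstar (f : borel F -> C)).
Implicit Types (x y z : F).

Lemma nu_set0 : nu (~` (Fstar : set (borel F))) = 0%E.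
Proof.
have q0 := @q_gt0 R F; have v0 := vol_gt0 hnu 0.
have mc : measurable (~` (Fstar : set (borel F))) by apply: measurableC; exact: measurable_Fstar.
have le (N : nat) : (nu (~` (Fstar : set (borel F))) <= (q ^- N * vol nu 0)%:E)%E.
  have <- : (vol nu N)%:E = (q ^- N * vol nu 0)%:E by rewrite (volE hnu) -exprnN.
  rewrite -nu_PF //; apply: le_measure; rewrite ?inE //; first exact: measurable_PF.
  by move=> x; rewrite /Fstar /= => /negP; rewrite negbK => /eqP ->; left.
have fin : (nu (~` (Fstar : set (borel F))) < +oo)%E by apply: le_lt_trans (le 0%N) _; rewrite ltry.
have fE : nu (~` (Fstar : set (borel F))) = (fine (nu (~` (Fstar : set (borel F)))))%:E.
  by rewrite fineK // ge0_fin_numE.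
rewrite fE; congr (_%:E); apply/eqP; rewrite eq_le fine_ge0 // andbT leNgt; apply/negP => c0.
move: le; rewrite fE; set c := fine _ in c0 *; move=> le.
have [N hN] : exists N : nat, vol nu 0 / c < N%:R.
  by exists (Num.bound (vol nu 0 / c)); rewrite archi_boundP // divr_ge0 // ltW.
have := le N; rewrite lee_fin leNgt => /negP; apply.
rewrite mulrC ltr_pdivrMr ?exprn_gt0 //.
rewrite ltr_pdivrMr // in hN; apply: (lt_le_trans hN); rewrite mulrC ler_wpM2l ?ltW //.
have : (N%:R : R) < (@residue_card F ^ N)%:R by rewrite ltr_nat ltn_expl //; exact: residue_card_gt1.
by rewrite (natrX R (@residue_card F) N).
Qed.

(** The origin is a null set. This reconciles the Fourier transform, an integral over F, with
    kernels that live on F^*. *)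
Lemma I_J (f : F -> C) : lc f -> I f = J f.
Proof.
move=> /(lc_integrable hnu) [h1 h2].
have mc : measurable (~` (Fstar : set (borel F))) by apply: measurableC; exact: measurable_Fstar.
have E : Fstar = setT `\` ~` (Fstar : set (borel F)) by rewrite setTD setCK.
rewrite E; congr (fine _ +i* fine _).
  exact: (negligible_integral mc _ h1 nu_set0).
exact: (negligible_integral mc _ h2 nu_set0).
Qed.

Lemma lc_bounded (f : F -> C) : lc f -> exists2 B : R, 0 <= B & forall x, normc (f x) <= B.
Proof.
move=> /lcP [m [M [mM sf pf]]]; have [r [_ ir sr _]] := @exists_transversal F _ _ mM.
have B0 : 0 <= \sum_(a <- r) normc (f a) by rewrite sumr_ge0 // => a _; exact: normc_ge0.
exists (\sum_(a <- r) normc (f a)) => // x.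
have [/sr [a ar ha]|hx] := pselect (PF m x); last by rewrite sf // normc0.
rewrite (pinvE pf ha) (big_rem a) //= lerDl sumr_ge0 // => b _; exact: normc_ge0.
Qed.

(** All levels above a threshold are allowed, so that phi, the kernel and chi can be given a common
    one. *)
Lemma lc_nice (w : F) n (phi : F -> C) : w != 0 -> v w = 1 -> lc phi ->
  exists m0 j E B, forall m, m0 <= m -> nice w n m j E B phi.
Proof.
move=> w0 vw lf; have [B B0 hB] := lc_bounded lf.
have [j [M [jM sf pf]]] := lcP lf.
exists (Num.max 1 (M - j)), j, M, B => m; rewrite ge_max => /andP [m1 mM]; split=> //.
- split=> // x y x0 hy; have [xy0 e] := val_uinv m1 x0 hy.
  have [h|h] := leP j (v x); first by apply: pf; apply: PFW hy; lia.
  have n1 : ~ PF j x by move=> /(PFE _ x0); lia.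
  have n2 : ~ PF j (x + y) by move=> /(PFE _ xy0); rewrite e; lia.
  by rewrite !sf.
- by move=> x x0 h; apply: sf => /(PFE _ x0); lia.
- move=> x x0 h; have hx : PF M x by apply/(PFE _ x0).
  have hwx : PF M (w ^+ n * x).
    apply/PFE; first by rewrite mulf_neq0 // expf_neq0.
    rewrite valM ?expf_neq0 // -[w ^+ n]/(w ^ n%:Z) valX // vw; lia.
  by have := pf 0 _ hx; have := pf 0 _ hwx; rewrite !add0r => -> ->.
Qed.

Section Psi.
Variable psi : F -> C.
Hypothesis hpsi : is_addchar psi.
Hypothesis npsi : exists x, psi x != 1.
Local Notation e := (addcond psi).

(** The finite form of orthogonality, obtained from [I_psi] by dividing out the volume of P^M. *)
Lemma sum_psi m M r z : m <= M -> transversal m M r -> z != 0 -> v z < e - m -> e - v z <= M ->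
  \sum_(t <- r) psi (z * t) = 0.
Proof.
move=> mM tr z0 h1 h2.
pose f t := indF (PF m) t * psi (z * t).
have sf : supp m f by apply: suppMl; exact: supp_PF.
have p2 := pinvW h2 (@psi_pinv _ _ psi hpsi npsi z).
have pf : pinv M f by exact: (pinvM (pinv_PF mM) p2).
have [_] := lc_integral_sum hnu mM sf pf tr.
rewrite (I_psi hpsi npsi hnu) indF0; last by move=> /(PFE _ z0); lia.
rewrite mulr0 => /esym/eqP; rewrite mulf_eq0 => /orP [/eqP/complexI/eqP|/eqP S].
  by rewrite gt_eqF // (vol_gt0 hnu).
rewrite -[RHS]S; apply: eq_big_seq => t tr'; rewrite /f indF1 ?mul1r //.
by case: tr => _ /(_ t tr').
Qed.

Lemma uinv_psi mm j x : x != 0 -> 1 <= mm -> e - v x - j <= mm ->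
  uinv mm (fun y => psi (x * y) * indF [set y | y != 0 /\ j <= v y] y).
Proof.
move=> x0 m1 hm; split=> // y z y0 hz; have [yz0 evz] := val_uinv m1 y0 hz.
have [h|h] := leP j (v y).
  rewrite !indF1 /= ?evz // !mulr1 mulrDr (psiD hpsi) (_ : psi (x * z) = 1) ?mulr1 //.
  by apply: (psi_triv hpsi npsi); apply/(PF_mulE _ _ x0); apply: PFW hz; lia.
by rewrite !indF0 ?mulr0 //= => -[_]; rewrite ?evz; lia.
Qed.

(* Averaging over the substitutions y -> (1 + t) y with t in P^m. *)
Lemma I_psi_avg (h : F -> C) x m a b : uinv m h -> h 0 = 0 ->
  (forall y, y != 0 -> ~~ (a <= v y <= b) -> h y = 0) -> x != 0 -> b + v x < e - m ->
  I (fun y => h y * psi (x * y)) = 0.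
Proof.
move=> uh h0 zh x0 hb; have m1 : 1 <= m by case: uh.
pose M := Num.max m (e - v x - a).
have mM : m <= M by rewrite le_max lexx.
have hM : e - v x - a <= M by rewrite le_max lexx orbT.
have [r tr] := @exists_transversal F _ _ mM; have [ur ir sr _] := tr.
have lh : lc h by exact: lc_uinv_win uh zh h0.
have lf : lc (fun y => h y * psi (x * y)) by exact: lc_psi.
have scal t : t \in r -> I (fun y => h y * psi (x * y) * psi (x * y * t)) = I (fun y => h y * psi (x * y)).
  move=> /ir ht; have [t0 vt] := val_1D (PFW m1 ht).
  rewrite -[RHS]mul1r (_ : 1 = (q ^ v (1 + t))%:C); last by rewrite vt expr0z.
  rewrite -(I_scale hnu t0 lf); apply: eqI => y.
  have -> : h ((1 + t) * y) = h y.
    have [->|y0] := eqVneq y 0; first by rewrite mulr0.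
    rewrite mulrDl mul1r; case: uh => _; apply => //.
    by rewrite addrC; apply: PFM ht (PF_val _).
  by rewrite (_ : x * ((1 + t) * y) = x * y + x * y * t) ?(psiD hpsi) ?mulrA //; ring.
have sr0 : (size r)%:R != 0 :> C.
  rewrite pnatr_eq0 size_eq0; apply/negP => /eqP r0.
  by have [t] := sr 0 (PF0 _); rewrite r0.
apply: (mulfI sr0); rewrite mulr0.
have -> : (size r)%:R * I (fun y => h y * psi (x * y)) =
    \sum_(t <- r) I (fun y => h y * psi (x * y) * psi (x * y * t)).
  rewrite (eq_big_seq _ scal) big_const_seq count_predT -Monoid.iteropE /=.
  by rewrite mulr_natl; elim: (size r) => [|k IH] //=; rewrite mulrS IH.
rewrite -cintegral_sum; first last.
- move=> t tr'; apply: (lc_integrable hnu).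
  apply: (lc_ext (f := fun y => (h y * psi (x * y)) * psi (x * t * y))).
    by move=> y /=; congr (_ * psi _); ring.
  exact: lc_psi.
- exact: measurableT.
rewrite (@eqI _ _ nu _ (fun=> 0)) ?cintegral0 // => y.
rewrite -mulr_sumr; have [->|y0] := eqVneq y 0; first by rewrite h0 !mul0r.
have [hy|hy] := boolP (a <= v y <= b); last by rewrite zh // !mul0r.
by rewrite (sum_psi mM tr) ?mulr0 ?mulf_neq0 // valM //; lia.
Qed.

Section CutKernel.
Variables (w : F) (n : nat) (kap : F -> C) (m : int) (B : R).
Hypotheses (w0 : w != 0) (vw : v w = 1) (n0 : (0 < n)%N).
Hypotheses (uk : uinv m kap) (B0 : 0 <= B) (bk : forall z, z != 0 -> normc (kap z) <= B).
Hypothesis pk : forall z, z != 0 -> kap (w ^+ n * z) = kap z.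

(** The cut at e - m is where psi becomes invariant under 1 + P^m, since v z >= e - m puts z P^m
    inside P^e. From e on psi is 1, which leaves the periodicity of kap. *)
Definition cutk (z : F) : C := kap z * (psi z * indF [set z | z != 0 /\ e - m <= v z] z).

Lemma cutk_nice : nice w n m (e - m) e B cutk.
Proof.
have m1 : 1 <= m by case: uk.
have wn0 : w ^+ n != 0 by rewrite expf_neq0.
have vwn : v (w ^+ n) = n%:Z by rewrite -[w ^+ n]/(w ^ n%:Z) valX // vw mulr1.
split.
- apply: uinvM uk _.
  apply: (uinv_ext (f := fun z => psi (1 * z) * indF [set y | y != 0 /\ e - m <= v y] z)).
    by move=> z z0; rewrite mul1r.
  by apply: uinv_psi; rewrite ?oner_eq0 // val1; lia.
- by move=> z z0 h; rewrite /cutk indF0 ?mulr0 //= => -[_]; lia.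
- move=> z z0 h; have wz0 : w ^+ n * z != 0 by rewrite mulf_neq0.
  have vwz : v (w ^+ n * z) = n%:Z + v z by rewrite valM // vwn.
  rewrite /cutk pk // !indF1 /= ?vwz; try by split=> //; lia.
  by rewrite !(psi_triv hpsi npsi) //; apply/PFE; rewrite ?vwz //; lia.
- split=> // z z0; rewrite /cutk normcM -[leRHS]mulr1; apply: ler_pM; rewrite ?normc_ge0 ?bk //.
  rewrite normcM (normc_psi hpsi) mul1r indFE; case: (_ \in _); rewrite ?normc0 ?normc1 //.
Qed.

(** The discarded part is an integral of h y * psi (x * y) with h of level m supported on v (x y) <
    e - m. There psi oscillates on the cosets of 1 + P^m, and the average is 0. *)
Lemma conv_cutk (phi : F -> C) j E B' x : nice w n m j E B' phi -> x != 0 ->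
  J (fun y => phi y * (kap (x * y) * psi (x * y))) = conv nu phi cutk x.
Proof.
move=> [up zp _ [B'0 bp]] x0; have m1 : 1 <= m by case: uk.
pose M := Num.max m (e - v x - j).
have mM : m <= M by rewrite le_max lexx.
have hM : e - v x - j <= M by rewrite le_max lexx orbT.
have M1 : 1 <= M by exact: le_trans m1 mM.
have ukx : uinv m (fun y => kap (x * y)) by exact: uinv_scale.
have xy0 y : y != 0 -> x * y != 0 by move=> y0; rewrite mulf_neq0.
have in1 : integ (fun y => phi y * (kap (x * y) * psi (x * y))).
  apply: (@bd_integ _ _ nu hnu w n w0 vw n0 M j (B' * B) (fun y => phi y * (kap (x * y) * psi (x * y)))).
  - apply: (uinv_ext (f := fun y => phi y * kap (x * y) * (psi (x * y) * indF [set y | y != 0 /\ j <= v y] y))).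
      move=> y y0; have [h|h] := leP j (v y); first by rewrite indF1 //= mulr1 mulrA.
      by rewrite zp // !mul0r.
    by apply: uinvM (uinvM (uinvW mM up) (uinvW mM ukx)) _; exact: uinv_psi.
  - by move=> y y0 h; rewrite zp // mul0r.
  - exact: mulr_ge0.
  - move=> y y0; rewrite normcM normcM (normc_psi hpsi) mulr1.
    by apply: ler_pM; rewrite ?normc_ge0 ?bp ?bk ?xy0.
have [uck zck _ [_ bck]] := cutk_nice.
have in2 : integ (fun y => phi y * cutk (x * y)).
  apply: (@bd_integ _ _ nu hnu w n w0 vw n0 m j (B' * B) (fun y => phi y * cutk (x * y))).
  - by apply: uinvM up _; exact: uinv_scale.
  - by move=> y y0 h; rewrite zp // mul0r.
  - exact: mulr_ge0.
  - move=> y y0; rewrite normcM.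
    by apply: ler_pM; rewrite ?normc_ge0 ?bp ?bck ?xy0.
have mS := @measurable_Fstar F.
apply/eqP; rewrite -subr_eq0 /conv -(cintegralB mS in1 in2); apply/eqP.
pose h y := phi y * kap (x * y) * indF [set y | y != 0 /\ v y < e - m - v x] y.
have h0 : h 0 = 0 by rewrite /h indF0 ?mulr0 //= => -[/eqP].
rewrite -(@I_psi_avg h x m j (e - m - v x - 1)) //.
- rewrite -Fstar_Fall; last by rewrite h0 mul0r.
  apply: eq_cintegral => y y0; rewrite /h /cutk.
  have [hy|hy] := ltP (v y) (e - m - v x).
    have E1 : indF [set z | z != 0 /\ v z < e - m - v x] y = 1 :> C by rewrite indF1.
    have E2 : indF [set z | z != 0 /\ e - m <= v z] (x * y) = 0 :> C.
      by rewrite indF0 //= valM // => -[_]; lia.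
    rewrite E1 E2; ring.
  have E1 : indF [set z | z != 0 /\ v z < e - m - v x] y = 0 :> C.
    by rewrite indF0 //= => -[_]; lia.
  have E2 : indF [set z | z != 0 /\ e - m <= v z] (x * y) = 1 :> C.
    by rewrite indF1 //= valM //; split; [exact: xy0 | lia].
  rewrite E1 E2; ring.
- by apply: uinvM (uinvM up ukx) _; exact: (uinv_indV (fun k => k < e - m - v x)).
- move=> y y0 hy; rewrite /h; have [h1|h1] := ltP (v y) j; first by rewrite zp // !mul0r.
  by rewrite indF0 ?mulr0 //= => -[_]; lia.
- lia.
Qed.

End CutKernel.
End Psi.
End Kernel.

(** * Twisted additive characters *)

Section Twist.
Context {R : realType} {F : padicFieldType}.
Local Notation C := R[i].
Local Notation v := (@pval F).
Local Notation q := ((@residue_card F)%:R : R).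
Implicit Types (psi : F -> C) (x y z : F).

Lemma twist_nontriv psi z : z != 0 -> nontrivial_addchar psi -> nontrivial_addchar (twist z psi).
Proof.
move=> z0 [[hD hN hc] [x hx]]; split; last by exists (x / z); rewrite /twist mulrC divfK.
split; first by move=> a b; rewrite /twist mulrDr hD.
  by move=> a; exact: hN.
have h : nontrivial_addchar psi by split=> //; exists x.
move=> a; apply: cvg_near_cst; apply/nbhsF; exists (addcond psi - v z) => y hy.
apply/eqP; rewrite /twist -(subrK a y) mulrDr hD (_ : psi (z * (y - a)) = 1) ?mul1r //.
by case: h => h1 h2; apply: (psi_triv h1 h2); apply/(PF_mulE _ _ z0).
Qed.

Lemma addcond_uniq psi (m : int) : nontrivial_addchar psi -> addtriv psi m ->
  (forall m', addtriv psi m' -> m <= m') -> addcond psi = m.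
Proof.
move=> [h1 h2] h3 h4; have [h5 h6] := addcondP h1 h2.
by apply/eqP; rewrite eq_le h6 // h4.
Qed.

Lemma addcond_twist psi z : z != 0 -> nontrivial_addchar psi ->
  addcond (twist z psi) = addcond psi - v z.
Proof.
move=> z0 h; have [h1 h2] := h; have [h5 h6] := addcondP h1 h2.
apply: addcond_uniq; first exact: twist_nontriv.
  by move=> x hx; apply: h5; apply/(PF_mulE _ _ z0).
move=> m hm; rewrite lerBlDr; apply: h6 => x hx.
have := hm (z^-1 * x); rewrite /twist mulVKf //; apply.
by apply/(PF_mulE _ _ (_ : z^-1 != 0)); rewrite ?invr_eq0 // valV // opprK.
Qed.

End Twist.

(** * Self-dual measures *)

Section SelfDual.
Context {R : realType} {F : padicFieldType}.
Local Notation C := R[i].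
Local Notation v := (@pval F).
Local Notation q := ((@residue_card F)%:R : R).
Implicit Types (psi : F -> C) (x y z : F).
Local Notation I nu f := (cintegral nu setT (f : borel F -> C)).

(** Self-dual volumes are half-integral powers of q; as integral powers of its square root they are
    compared by comparing exponents. *)
Definition sq : R := Num.sqrt q.

Lemma sq2 : sq ^+ 2 = q.
Proof. by rewrite sqr_sqrtr // ltW // (@q_gt0 R F). Qed.

Lemma sq_gt0 : 0 < sq.
Proof. by rewrite sqrtr_gt0 (@q_gt0 R F). Qed.

Lemma sq_neq0 : sq != 0.
Proof. by rewrite gt_eqF // sq_gt0. Qed.

Lemma sqz2 (j : int) : sq ^ (2 * j) = q ^ j.
Proof. by rewrite -exprz_exp -[sq ^ 2%:Z]/(sq ^+ 2) sq2. Qed.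

Lemma sqzD (j k : int) : sq ^ (j + k) = sq ^ j * sq ^ k.
Proof. by rewrite expfzDr // sq_neq0. Qed.

(** Fourier inversion at 0 for the indicator of P^0, whose transform is vol(P^0) times the indicator
    of P^e, gives vol(P^0) vol(P^e) = 1, hence vol(P^0)^2 = q^e. *)
Lemma vol_self_dual psi (nu : {measure set (borel F) -> \bar R}) m :
  nontrivial_addchar psi -> self_dual_haar psi nu -> vol nu m = sq ^ (addcond psi - 2 * m).
Proof.
move=> [h1 h2] [hnu hf].
have v0 := vol_gt0 hnu 0.
have sp k : 0 < sq ^ k by rewrite exprz_gt0 // sq_gt0.
have : vol nu 0 * vol nu (addcond psi) = 1.
  have := hf _ (lc_schwartz (lc_PF 0)) 0; rewrite oppr0 indF1; last exact: PF0.
  have E x : fourier nu psi (indF (PF 0)) x = (vol nu 0)%:C * indF (PF (addcond psi)) x.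
    by rewrite /fourier (I_psi h1 h2 hnu) subr0.
  rewrite {1}/fourier.
  rewrite (_ : cintegral _ _ _ = I nu (fun y => (vol nu 0)%:C * indF (PF (addcond psi)) y)); last first.
    by apply: eqI => y; rewrite E mul0r (psi0 h1) mulr1.
  rewrite (IZ hnu); last exact: lc_PF.
  by rewrite (I_ind nu) -rmorphM => /complexI.
rewrite (volE hnu (addcond psi)) mulrCA => hV.
have {}hV : vol nu 0 ^+ 2 = (sq ^ addcond psi) ^+ 2.
  have qe : q ^ (addcond psi) != 0 by rewrite expfz_neq0 // gt_eqF // (@q_gt0 R F).
  rewrite -[RHS]/((sq ^ addcond psi) ^ 2%:Z) exprz_exp mulrC sqz2.
  by rewrite -[RHS]mulr1 -[X in _ = _ * X]hV -invr_expz mulVKf // expr2.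
rewrite (volE hnu) sqzD -mulrN sqz2 mulrC; congr (_ * _).
by apply/eqP; rewrite -(@eqrXn2 _ 2) ?hV // ?ltW.
Qed.

Lemma vol_ratio (nu nu' : {measure set (borel F) -> \bar R}) (f : F -> C) :
  is_haar nu -> is_haar nu' -> lc f ->
  I nu' f = (vol nu' 0 / vol nu 0)%:C * I nu f.
Proof.
move=> h h' /lcP [m [M [mM sf pf]]]; have [r tr] := @exists_transversal F _ _ mM.
have [_ ->] := lc_integral_sum h mM sf pf tr; have [_ ->] := lc_integral_sum h' mM sf pf tr.
rewrite mulrA -rmorphM; congr (_%:C * _).
rewrite (volE h M) (volE h' M).
by have := vol_gt0 h 0; move: (vol nu 0) (vol nu' 0) (q ^ _) => a b c a0; field; rewrite gt_eqF.
Qed.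

Lemma cintegral_setI (nu : {measure set (borel F) -> \bar R}) (A : set F) (f : F -> C) :
  cintegral nu (A : set (borel F)) (f : borel F -> C) = I nu (fun x => indF A x * f x).
Proof.
rewrite /cintegral; congr (_ +i* _);
  rewrite [LHS]Rintegral_mkcond; congr (Rintegral _ _ _); apply/funext => x;
  rewrite /patch indFE; case: (_ \in _); by rewrite ?mul1r ?mul0r.
Qed.

End SelfDual.

(** * The Weil index in odd residual characteristic *)

Section Weil.
Context {R : realType} {F : padicFieldType}.
Local Notation C := R[i].
Local Notation v := (@pval F).
Local Notation q := ((@residue_card F)%:R : R).
Local Notation sq := (@sq R F).
Implicit Types (psi : F -> C) (x y z : F).
Local Notation I nu f := (cintegral nu setT (f : borel F -> C)).
Hypothesis v2 : (2 : F) != 0 /\ v 2 = 0.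

Lemma lc_quad psi (m : int) z : nontrivial_addchar psi ->
  lc (fun x => indF (PF m) x * psi (z * x ^+ 2)).
Proof.
move=> [h1 h2]; pose N := Num.max m (addcond psi - v z - m).
pose N' := Num.max N (addcond psi - v z - N).
have [mN eN] : m <= N /\ addcond psi - v z - m <= N by rewrite !le_max !lexx orbT.
exists m, N'; split; first by apply: suppMl; exact: supp_PF.
have NN' : N <= N' by rewrite le_max lexx.
have eN' : addcond psi - v z - N <= N' by rewrite le_max lexx orbT.
move=> x y hy; rewrite (pinv_PF (le_trans mN NN') _ hy).
have [hx|hx] := pselect (PF m x); last by rewrite !indF0 // !mul0r.
congr (_ * _); rewrite (_ : z * (x + y) ^+ 2 = z * x ^+ 2 + z * (x * y *+ 2 + y * y)); last by ring.
rewrite (psiD h1) (_ : psi (z * (x * y *+ 2 + y * y)) = 1) ?mulr1 //.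
have [->|z0] := eqVneq z 0; first by rewrite mul0r (psi0 h1).
apply: (psi_triv h1 h2); apply/(PF_mulE _ _ z0); apply: PFD.
  by apply: PFmulrn; apply: PFW (PFM hx hy); lia.
by apply: PFW (PFM (PFW NN' hy) hy); lia.
Qed.

(** The partial integral over P^m whose limit, as m tends to minus infinity, defines the Weil index;
    the measure is kept fixed while z varies. *)
Definition quadI (nu : {measure set (borel F) -> \bar R}) psi m z : C :=
  I nu (fun x => indF (PF m) x * psi (z * x ^+ 2)).

(** The shell v x = m contributes nothing. Translation by u in P^k multiplies the integrand by psi(2
    z u x), because z u^2 lies in P^e, and summing over u mod P^(k+1) gives 0, 2 being a unit. *)
Lemma quadI_stable nu psi m z : is_haar nu -> nontrivial_addchar psi -> z != 0 ->
  2 * (m + 1) <= addcond psi - v z -> quadI nu psi m z = quadI nu psi (m + 1) z.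
Proof.
move=> hnu hp z0 hm; have [h1 h2] := hp.
have [t0 vt] := v2.
(* With this k the valuation of 2 z u x starts at e - 1, so psi is nontrivial on P^k and trivial on
   P^(k+1); the hypothesis on m is exactly 2 k + v z >= e. *)
pose k := addcond psi - 1 - m - v z.
have mk : m + 1 <= k by rewrite /k; lia.
pose g x := indF (win m m) x * psi (z * x ^+ 2).
have gE x : g x = indF (PF m) x * psi (z * x ^+ 2) - indF (PF (m + 1)) x * psi (z * x ^+ 2).
  by rewrite /g indF_win1 mulrBl.
have lg : lc g.
  apply: (lc_ext (f := fun x => indF (PF m) x * psi (z * x ^+ 2) + (-1) * (indF (PF (m + 1)) x * psi (z * x ^+ 2)))).
    by move=> x; rewrite gE; ring.
  by apply: lcD; [exact: lc_quad | apply: lcZ; exact: lc_quad].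
suff : I nu g = 0.
  rewrite (eqI nu gE) (IB hnu); [|exact: lc_quad|exact: lc_quad].
  by move=> /eqP; rewrite subr_eq0 => /eqP.
have kk : k <= k + 1 by lia.
have [r tr] := @exists_transversal F _ _ kk; have [ur ir sr _] := tr.
have scal u : u \in r -> I nu (fun x => g x * psi (2 * z * u * x)) = I nu g.
  move=> /ir hu; rewrite -(I_shift hnu u lg); apply: eqI => x; rewrite /g !indF_win1.
  rewrite (pinv_PF (_ : m <= k) _ hu) ?(pinv_PF mk _ hu); last by lia.
  rewrite -mulrA; congr (_ * _); rewrite -(psiD h1).
  rewrite (_ : z * (x + u) ^+ 2 = (z * x ^+ 2 + 2 * z * u * x) + z * (u * u)); last by ring.
  rewrite (psiD h1 _ (z * (u * u))) (_ : psi (z * (u * u)) = 1) ?mulr1 //.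
  by apply: (psi_triv h1 h2); apply/(PF_mulE _ _ z0); apply: PFW (PFM hu hu); rewrite /k; lia.
have sr0 : (size r)%:R != 0 :> C.
  rewrite pnatr_eq0 size_eq0; apply/negP => /eqP r0.
  by have [t] := sr 0 (PF0 _); rewrite r0.
apply: (mulfI sr0); rewrite mulr0.
have -> : (size r)%:R * I nu g = \sum_(u <- r) I nu (fun x => g x * psi (2 * z * u * x)).
  rewrite (eq_big_seq _ scal) big_const_seq count_predT -Monoid.iteropE /=.
  by rewrite mulr_natl; elim: (size r) => [|i IH] //=; rewrite mulrS IH.
rewrite -cintegral_sum; first last.
- by move=> u tr'; apply: (lc_integrable hnu); exact: lc_psi.
- exact: measurableT.
rewrite (@eqI _ _ nu _ (fun=> 0)) ?cintegral0 // => x.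
rewrite -mulr_sumr; have [hx|hx] := pselect (win m m x); last by rewrite /g indF0 // !mul0r.
have [x0 vx] := hx; have zx0 : 2 * z * x != 0 by rewrite !mulf_neq0.
have vzx : v (2 * z * x) = v z + m by rewrite !valM ?mulf_neq0 //; lia.
rewrite (eq_bigr (fun u => psi (2 * z * x * u))); last by move=> u _; congr psi; ring.
by rewrite (sum_psi hnu h1 h2 kk tr zx0) ?mulr0 // vzx /k; lia.
Qed.

Lemma quadI_stable_le nu psi m m' z : is_haar nu -> nontrivial_addchar psi -> z != 0 ->
  m' <= m -> 2 * m <= addcond psi - v z -> quadI nu psi m' z = quadI nu psi m z.
Proof.
move=> hnu hp z0 mm hm; rewrite (_ : m = m' + (absz (m - m'))%:Z); last by lia.
have : (absz (m - m'))%:Z <= m - m' by lia.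
elim: (absz _) => [|k IH] hk; first by rewrite addr0.
rewrite IH; last by lia.
rewrite (quadI_stable hnu hp z0); last by lia.
by congr (quadI nu psi _ z); lia.
Qed.

Variable mu : (F -> C) -> {measure set (borel F) -> \bar R}.
Hypothesis mu_sd : forall psi', nontrivial_addchar psi' -> self_dual_haar psi' (mu psi').

Lemma mu_haar psi : nontrivial_addchar psi -> is_haar (mu psi).
Proof. by move=> h; have [] := mu_sd h. Qed.

(** The defining sequence is eventually constant, so the limit is attained at any m small enough. *)
Lemma weil_indexE psi m : nontrivial_addchar psi -> 2 * m <= addcond psi ->
  weil_index mu psi = quadI (mu psi) psi m 1.
Proof.
move=> hp hm; rewrite /weil_index.
apply: (@cvg_lim R[i]^o); first exact: norm_hausdorff.
apply: cvg_near_cst; exists (absz m) => // r /= hr.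
rewrite cintegral_setI -(@quadI_stable_le _ _ m (- r%:Z) 1 (mu_haar hp) hp) ?oner_neq0 //.
- by rewrite /quadI; apply: (@eqI _ _ (mu psi)) => x; rewrite mul1r.
- by lia.
- by rewrite val1 subr0.
Qed.

(** The self-dual measure of psi_z is |z|^(1/2) times that of psi; this factor is separated so that
    all twists are computed with one measure. *)
Lemma weil_twist psi z m : nontrivial_addchar psi -> z != 0 -> 2 * m <= addcond psi - v z ->
  weil_index mu (twist z psi) = (sq ^ (- v z))%:C * quadI (mu psi) psi m z.
Proof.
move=> hp z0 hm; have ht := twist_nontriv z0 hp.
rewrite (weil_indexE (m := m) ht); last by rewrite addcond_twist.
rewrite /quadI (vol_ratio (mu_haar hp) (mu_haar ht)); last exact: lc_quad.
rewrite (vol_self_dual 0 ht (mu_sd ht)) (vol_self_dual 0 hp (mu_sd hp)) addcond_twist //.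
rewrite mulr0 !subr0 sqzD mulrAC divff ?expfz_neq0 ?sq_neq0 // mul1r.
by congr (_ * _); apply: (@eqI _ _ (mu psi)) => x; rewrite /twist mul1r.
Qed.

(** Putting x = u + y in the product of psi(z x^2) and psi(-z y^2) leaves psi(z u^2) psi(2 z u y).
    The integral over y confines u to P^(e - m - v z), where psi(z u^2) is 1. *)
Lemma quadI_mul nu psi m z : is_haar nu -> nontrivial_addchar psi -> z != 0 ->
  2 * m <= addcond psi - v z ->
  quadI nu psi m z * quadI nu psi m (- z) = (vol nu m * vol nu (addcond psi - m - v z))%:C.
Proof.
move=> hnu hp z0 hm; have [h1 h2] := hp; have [t0 vt] := v2.
pose f x := indF (PF m) x * psi (z * x ^+ 2).
pose f' x := indF (PF m) x * psi (- z * x ^+ 2).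
have lf : lc f by exact: lc_quad.
have lf' : lc f' by exact: lc_quad.
rewrite /quadI -/(f) -/(f') -[LHS]/(I nu f * I nu f').
pose h y u := f' y * f (u + y).
have hE y u : h y u = f u * (indF (PF m) y * psi (2 * z * u * y)).
  rewrite /h /f /f'; have [hy|hy] := pselect (PF m y); last by rewrite [indF _ y]indF0 // !(mul0r, mulr0).
  rewrite (pinv_PF (lexx m) _ hy) indF1 // !mul1r mulrCA -mulrA -!(psiD h1); congr (_ * psi _); ring.
have l2 : lc2 h.
  have [m1 [M1 [_ s1 p1 s2 p2]]] := lc2P lf lf'.
  exists (Num.min m m1), (Num.max m M1); split.
    move=> x y hxy; rewrite hE.
    have [hx|hx] := pselect (PF m x); last by rewrite [indF _ x]indF0 // mul0r mulr0.
    have hx' : PF (Num.min m m1) x by apply: PFW hx; rewrite ge_min lexx.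
    have hy : ~ PF m y.
      by case: hxy => // hy /(PFW (_ : Num.min m m1 <= m)) => /(_ ltac:(by rewrite ge_min lexx)).
    by rewrite /f indF0 // !mul0r.
  move=> x y a b ha hb.
  have ha' : PF M1 a by apply: PFW ha; rewrite le_max lexx orbT.
  have hb' : PF M1 b by apply: PFW hb; rewrite le_max lexx orbT.
  by rewrite /h (p2 _ _ ha') addrACA (p1 _ _ (PFD hb' ha')).
have := I_fubini hnu l2.
rewrite (@eqI _ _ nu _ (fun y => I nu f * f' y)); last first.
  move=> y; rewrite /h (IZ hnu); last exact: lc_shift.
  by rewrite (I_shift hnu y lf) mulrC.
rewrite (IZ hnu) // => ->.
rewrite (@eqI _ _ nu _ (fun u => (vol nu m)%:C * indF (PF (addcond psi - m - v z)) u)); last first.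
  move=> u; rewrite (@eqI _ _ nu _ (fun y => f u * (indF (PF m) y * psi (2 * z * u * y)))); last by move=> y; exact: hE.
  rewrite (IZ hnu); last by apply: lc_psi => //; exact: lc_PF.
  rewrite (I_psi h1 h2 hnu).
  have zz0 : 2 * z != 0 by rewrite mulf_neq0.
  have E : PF (addcond psi - m) (2 * z * u) <-> PF (addcond psi - m - v z) u.
    by rewrite (PF_mulE _ _ zz0) valM // vt add0r.
  have [hu|hu] := pselect (PF (addcond psi - m - v z) u).
    rewrite indF1; last exact/E.
    rewrite /f indF1; last by apply: PFW hu; lia.
    rewrite (_ : psi (z * u ^+ 2) = 1) ?indF1 //; first by ring.
    by apply: (psi_triv h1 h2); apply/(PF_mulE _ _ z0); apply: PFW (PFM hu hu); lia.
  rewrite [indF (PF (_ - m)) _]indF0; last by move/E.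
  by rewrite indF0 // !mulr0.
rewrite (IZ hnu); last exact: lc_PF.
by rewrite (I_ind nu) rmorphM.
Qed.

Lemma weil_mul psi z : nontrivial_addchar psi -> z != 0 ->
  weil_index mu (twist z psi) * weil_index mu (twist (- z) psi) = 1.
Proof.
move=> hp z0; pose m := - (`|addcond psi| + `|v z|).
have hm : 2 * m <= addcond psi - v z by rewrite /m; lia.
have nz0 : - z != 0 by rewrite oppr_eq0.
rewrite (weil_twist hp z0 hm) (weil_twist hp nz0 (m := m)) ?valN // mulrACA.
rewrite (quadI_mul (mu_haar hp) hp z0 hm) -!rmorphM.
rewrite !(vol_self_dual _ hp (mu_sd hp)) -!sqzD (_ : _ + _ = 0) //; lia.
Qed.

Lemma weil_sq psi z b : nontrivial_addchar psi -> z != 0 -> b != 0 ->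
  weil_index mu (twist (b ^+ 2 * z) psi) = weil_index mu (twist z psi).
Proof.
move=> hp z0 b0; pose m := - (`|addcond psi| + `|v z|).
have hm : 2 * m <= addcond psi - v z by rewrite /m; lia.
have bz0 : b ^+ 2 * z != 0 by rewrite mulf_neq0 // expf_neq0.
have vbz : v (b ^+ 2 * z) = 2 * v b + v z by rewrite expr2 !valM ?mulf_neq0 //; lia.
rewrite (weil_twist hp z0 hm) (weil_twist hp bz0 (m := m - v b)); last by rewrite vbz; lia.
have -> : quadI (mu psi) psi (m - v b) (b ^+ 2 * z) = (q ^ v b)%:C * quadI (mu psi) psi m z.
  rewrite /quadI -(I_scale (mu_haar hp) b0); last exact: lc_quad.
  apply: (@eqI _ _ (mu psi)) => x; congr (_ * _); last by congr psi; ring.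
  rewrite !indFE; congr (_ %:R); congr nat_of_bool.
  by apply/idP/idP => /set_mem h; apply/mem_set; move: h; rewrite /= (PF_mulE _ _ b0).
rewrite mulrA -rmorphM vbz -sqz2 -sqzD; congr (_%:C * _); congr (sq ^ _); lia.
Qed.

(** For m equal to half of e - v z the integral over P^m is already stable and its integrand is 1.
    This is the source of the parity distinctions among the shells. *)
Lemma weil_even psi z (m : int) : nontrivial_addchar psi -> z != 0 ->
  addcond psi - v z = 2 * m -> weil_index mu (twist z psi) = 1.
Proof.
move=> hp z0 hm; have [h1 h2] := hp; rewrite (weil_twist hp z0 (m := m)); last by lia.
rewrite /quadI (@eqI _ _ (mu psi) _ (indF (PF m))); last first.
  move=> x; have [hx|hx] := pselect (PF m x); last by rewrite indF0 // mul0r.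
  rewrite (_ : psi _ = 1) ?mulr1 //; apply: (psi_triv h1 h2); apply/(PF_mulE _ _ z0).
  by apply: PFW (PFM hx hx); lia.
rewrite (I_ind (mu psi)) (vol_self_dual _ hp (mu_sd hp)) -rmorphM -sqzD.
by rewrite (_ : _ + _ = 0) //; lia.
Qed.

(** With m the integer part of (e - v z) / 2 the partial integral is stable, while a perturbation t
    in P^(v z + 1) puts t x^2 in P^e for x in P^m. *)
Lemma weil_uinv psi : nontrivial_addchar psi -> uinv 1 (fun z => weil_index mu (twist z psi)).
Proof.
move=> hp; have [h1 h2] := hp; split=> // z t z0 ht; have [zt0 vzt] := val_uinv (lexx 1) z0 ht.
have [m hm] : exists m, 2 * m <= addcond psi - v z <= 2 * m + 1.
  by exists ((addcond psi - v z) %/ 2)%Z; apply/andP; split; lia.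
rewrite (weil_twist hp z0 (m := m)) ?(weil_twist hp zt0 (m := m)) ?vzt; try by lia.
congr (_ * _); apply: (@eqI _ _ (mu psi)) => x.
have [hx|hx] := pselect (PF m x); last by rewrite indF0 // !mul0r.
rewrite mulrDl (psiD h1) (_ : psi (t * x ^+ 2) = 1) ?mulr1 //.
by apply: (psi_triv h1 h2); apply: PFW (PFM ht (PFM hx hx)); lia.
Qed.

Section Kappa.
Variable psi : F -> C.
Hypothesis hp : nontrivial_addchar psi.
Definition kap z : C := (weil_ratio mu psi z)^-1.

Lemma twist1 : twist 1 psi = psi.
Proof. by apply/funext => x; rewrite /twist mul1r. Qed.

Lemma weil_neq0 z : z != 0 -> weil_index mu (twist z psi) != 0.
Proof. by move=> z0; have := weil_mul hp z0; case: eqP => // ->; rewrite mul0r => /esym/eqP; rewrite oner_eq0. Qed.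

Lemma weil_psi_neg : (weil_index mu (twist (-1) psi))^-1 = weil_index mu psi.
Proof.
have := weil_mul hp (oner_neq0 F); rewrite twist1 => h.
by rewrite -[RHS]mulr1 -(mulfV (weil_neq0 (_ : -1 != 0))) ?oppr_eq0 ?oner_eq0 // mulrA h mul1r.
Qed.

(** Trades an inverse for a Weil index at -z, hence for an integral, so that [kap] can enter a
    double integral. *)
Lemma kapE z : z != 0 -> kap z = weil_index mu psi * weil_index mu (twist (- z) psi).
Proof.
move=> z0; rewrite /kap /weil_ratio invf_div; congr (_ * _).
by rewrite -[LHS]mulr1 -(weil_mul hp z0) mulKf // weil_neq0.
Qed.

Lemma kap_uinv : uinv 1 kap.
Proof.
exact: (uinv_fun (fun c => (c / weil_index mu psi)^-1) (weil_uinv hp)).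
Qed.

Lemma kap_sq b z : z != 0 -> b != 0 -> kap (b ^+ 2 * z) = kap z.
Proof. by move=> z0 b0; rewrite /kap /weil_ratio weil_sq. Qed.

Lemma kap_even z m : z != 0 -> addcond psi - v z = 2 * m -> kap z = weil_index mu psi.
Proof. by move=> z0 h; rewrite /kap /weil_ratio (weil_even hp z0 h) div1r invrK. Qed.

Lemma kap_per (w : F) n z : w != 0 -> ~~ odd n -> z != 0 -> kap (w ^+ n * z) = kap z.
Proof.
move=> w0 en z0; rewrite (_ : n = (n./2 * 2)%N); last by rewrite muln2 even_halfK.
by rewrite exprM kap_sq // expf_neq0.
Qed.

(** By invariance under squares and under 1 + P, [kap] takes finitely many values, indexed by a unit
    residue and the parity of the valuation. *)
Lemma kap_bound : exists2 B : R, 0 <= B & forall z, z != 0 -> normc (kap z) <= B.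
Proof.
have [w [w0 vw]] := @exists_unif F.
have [r [_ ir sr _]] := @exists_transversal F 0 1 ltac:(lia).
pose B := \sum_(a <- r) (normc (kap a) + normc (kap (w * a))).
have B0 : 0 <= B by rewrite sumr_ge0 // => a _; rewrite addr_ge0 // normc_ge0.
exists B => // z z0; have [u [u0 vu] zE] := unit_decomp w0 vw z0.
have [|a ar ha] := sr u; first by right; rewrite vu.
have bB (c : R) : c <= normc (kap a) + normc (kap (w * a)) -> c <= B.
  move=> h; apply: (le_trans h); rewrite /B (big_rem a) // lerDl sumr_ge0 // => b _.
  by rewrite addr_ge0 // normc_ge0.
have au : a = u + (a - u) by rewrite addrC subrK.
have hau : PF (v u + 1) (a - u) by rewrite vu add0r; exact: PF_sub_sym.
have [_ ui] := kap_uinv.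
have [d hd] : exists d, v z = 2 * d \/ v z = 2 * d + 1.
  by exists (v z %/ 2)%Z; lia.
have wd0 : w ^ d != 0 by rewrite expfz_neq0.
have w2d : w ^ (2 * d) = (w ^ d) ^+ 2 by rewrite mulrC -exprz_exp.
case: hd => hd.
  rewrite zE hd w2d kap_sq //; apply: bB.
  by rewrite au ui // lerDl normc_ge0.
rewrite zE hd expfzDr // expr1z w2d -mulrA kap_sq ?mulf_neq0 //; apply: bB.
rewrite [in kap (w * a)]au mulrDr ui ?mulf_neq0 //; last first.
  by have := PFM (PF_val w) hau; rewrite valM // vw vu add0r addr0.
by rewrite lerDr normc_ge0.
Qed.

End Kappa.
End Weil.

(** * Gauss sums and a Jacobi sum as integrals over shells *)

Section Gauss.
Context {R : realType} {F : padicFieldType}.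
Local Notation C := R[i].
Local Notation v := (@pval F).
Local Notation q := ((@residue_card F)%:R : R).
Local Notation sq := (@sq R F).
Implicit Types (x y z a b : F).
Variable nu : {measure set (borel F) -> \bar R}.
Hypothesis hnu : is_haar nu.
Local Notation I f := (cintegral nu setT (f : borel F -> C)).
Variable psi : F -> C.
Hypothesis hp : nontrivial_addchar psi.
Local Notation e := (addcond psi).
Let h1 : is_addchar psi. Proof. by case: hp. Qed.
Let h2 : exists x, psi x != 1. Proof. by case: hp. Qed.

Lemma I_unit_avg (h : F -> C) a (lam : C) : lc h -> a != 0 -> v a = 0 -> lam != 1 ->
  (forall z, h (a * z) = lam * h z) -> I h = 0.
Proof.
move=> lh a0 va l1 hh; have := I_scale hnu a0 lh.
rewrite va expr0z mul1r (eqI nu hh) (IZ hnu) // => /eqP.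
rewrite -subr_eq0 -[X in _ - X]mul1r -mulrBl mulf_eq0 subr_eq0 (negPf l1) /=.
by move/eqP.
Qed.

(** One exchange of integrals for two uses: the polynomial is 1 + y for the product of Gauss sums
    and 1 - y^2 for the Weil kernel. Integrability of the result is recorded too, since scalar
    factors are extracted from it later. *)
Lemma I_quad_fubini (A B : F -> C) c0 c1 c2 : lc A -> lc B ->
  PF 0 c0 -> PF 0 c1 -> PF 0 c2 ->
  lc (fun y => B y * I (fun z => A z * psi ((c0 + c1 * y + c2 * y ^+ 2) * z))) /\
  I (fun z => A z * I (fun y => B y * psi (z * (c0 + c1 * y + c2 * y ^+ 2)))) =
  I (fun y => B y * I (fun z => A z * psi ((c0 + c1 * y + c2 * y ^+ 2) * z))).
Proof.
move=> lA lB h0 hc1 hc2.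
pose g y := c0 + c1 * y + c2 * y ^+ 2.
pose h z y := A z * B y * psi (z * g y).
have [m [M0 [_ sA pA sB pB]]] := lc2P lA lB.
(* For y in P^(-N) the polynomial lies in P^(-2N) and changes by P^(M-N) under y -> y + P^M;
   multiplied by the other variable both losses stay within 2 N. *)
pose N : int := `|m|; pose M : int := `|M0| + `|e| + 3 * N.
have N0 : 0 <= N by rewrite normr_ge0.
have NM : - N <= M by rewrite /M; lia.
have Nm : - N <= m by rewrite /N; lia.
have M0M : M0 <= M by rewrite /M; lia.
have sA' := suppW Nm sA; have sB' := suppW Nm sB.
have gP y : PF (- N) y -> PF (- (2 * N)) (g y).
  move=> hy; apply: PFD; first apply: PFD.
  - by apply: PFW h0; lia.
  - by apply: PFW (PFM hc1 hy); lia.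
  - by apply: PFW (PFM hc2 (PFM hy hy)); lia.
have gD y b : PF (- N) y -> PF M b -> PF (M - N) (g (y + b) - g y).
  move=> hy hb; rewrite (_ : _ - _ = c1 * b + c2 * (y * b *+ 2 + b * b)); last by rewrite /g; ring.
  apply: PFD; first by apply: PFW (PFM hc1 hb); lia.
  apply: PFW (_ : M - N <= 0 + (M - N)) _; first by lia.
  apply: (PFM hc2); apply: PFD; first by apply: PFmulrn; apply: PFW (PFM hy hb); lia.
  by apply: PFW (PFM hb hb); lia.
have l2 : lc2 h.
  exists (- N), M; split.
    by move=> x y [/sA' hx|/sB' hy]; rewrite /h ?hx ?hy // !(mul0r, mulr0).
  move=> z y a b ha hb.
  rewrite /h (pA _ _ (PFW M0M ha)) (pB _ _ (PFW M0M hb)).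
  have [hz|/sA' ->] := pselect (PF (- N) z); last by rewrite !mul0r.
  have [hy|/sB' ->] := pselect (PF (- N) y); last by rewrite !(mulr0, mul0r).
  congr (_ * _).
  rewrite (_ : (z + a) * g (y + b) = z * g y + (a * g (y + b) + z * (g (y + b) - g y))); last by ring.
  rewrite (psiD h1) (_ : psi (a * _ + _) = 1) ?mulr1 //.
  apply: (psi_triv h1 h2); apply: PFD.
    have hyb : PF (- N) (y + b) by apply: PFD => //; apply: PFW hb.
    by apply: PFW (PFM ha (gP _ hyb)); rewrite /M; lia.
  by apply: PFW (PFM hz (gD _ _ hy hb)); rewrite /M; lia.
have := I_fubini hnu l2.
rewrite (@eqI _ _ nu _ (fun z => A z * I (fun y => B y * psi (z * g y)))); last first.
  move=> z; have [z0|z0] := eqVneq (A z) 0.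
    by rewrite z0 mul0r (@eqI _ _ nu _ (fun=> 0)) ?cintegral0 // => y; rewrite /h z0 !mul0r.
  rewrite -(IZ hnu); last first.
    apply: (lc_ext (f := fun y => (A z)^-1 * h z y)); last exact: lcZ (lc2_lcr z l2).
    by move=> y; rewrite /h !mulrA mulVf // mul1r.
  by apply: (@eqI _ _ nu) => y; rewrite /h mulrA.
have E y : I (fun z => h z y) = B y * I (fun z => A z * psi (g y * z)).
  rewrite -(IZ hnu); last exact: lc_psi.
  by apply: (@eqI _ _ nu) => z; rewrite /h (mulrC z) mulrCA mulrA.
have lE := lc2_I nu (lc2_swap l2).
by move=> ->; split; [exact: lc_ext E lE | exact: eqI].
Qed.

Lemma conv_fubini (f g : F -> C) : lc f -> lc g ->
  lc2 (fun u s => f u * g (s - u)) /\ I f * I g = I (fun s => I (fun u => f u * g (s - u))).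
Proof.
move=> lf lg; have [m [M [_ sf pf sg pg]]] := lc2P lf lg.
have l2 : lc2 (fun u s => f u * g (s - u)).
  exists m, M; split.
    move=> u s hus; have [hu|hu] := pselect (PF m u); last by rewrite sf // mul0r.
    rewrite sg ?mulr0 // => hsu; case: hus => // hs; apply: hs.
    by rewrite -(subrK u s); exact: PFD.
  move=> u s a b ha hb; rewrite pf //; congr (_ * _).
  rewrite (_ : s + b - (u + a) = s - u + (b - a)); last by ring.
  by rewrite pg //; exact: PFB.
split=> //; rewrite -(I_fubini hnu l2) mulrC -(IZ hnu) //; apply: (@eqI _ _ nu) => u.
have lgu : lc (fun s => g (s - u)) by exact: lc_shift.
by rewrite (IZ hnu) // (I_shift hnu (- u) lg) mulrC.
Qed.

Lemma lc_shell (chi : F -> C) m j : uinv m chi -> lc (fun x => chi x * indF (win j j) x).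
Proof. exact: lc_win. Qed.

Lemma I_shell_psi j b : I (fun z => indF (win j j) z * psi (b * z)) =
  (vol nu j)%:C * indF (PF (e - j)) b - (vol nu (j + 1))%:C * indF (PF (e - j - 1)) b.
Proof.
rewrite (@eqI _ _ nu _ (fun z => indF (PF j) z * psi (b * z) - indF (PF (j + 1)) z * psi (b * z))); last first.
  by move=> z; rewrite indF_win1 mulrBl.
rewrite (IB hnu); [|apply: lc_psi => //; exact: lc_PF|apply: lc_psi => //; exact: lc_PF].
by rewrite !(I_psi h1 h2 hnu) (_ : e - (j + 1) = e - j - 1) //; ring.
Qed.

(** Conductor exactly c, with minimality replaced by its useful form: a unit a in 1 + P^(c-1) with
    chi a != 1, by which integrals are averaged to 0. For c = 1 any unit is allowed. *)
Definition exact_cond (chi : F -> C) (c : nat) := [/\ (1 <= c)%N, multriv chi c &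
  exists a, [/\ a != 0, v a = 0, PF (c%:Z - 1) (a - 1) & chi a != 1]].

Definition gsum (chi : F -> C) j b : C := I (fun z => chi z * indF (win j j) z * psi (b * z)).

Lemma ind_win_scale a j k x : a != 0 -> indF (win (j + v a) (k + v a)) (a * x) = indF (win j k) x :> C.
Proof.
move=> a0; have [->|x0] := eqVneq x 0; first by rewrite mulr0 !ind_win0.
have ax0 : a * x != 0 by rewrite mulf_neq0.
have vax := valM a0 x0.
rewrite !indFE; congr (_ %:R); congr nat_of_bool.
by apply/idP/idP => /set_mem [h3 h4]; apply/mem_set; split=> //=; move: h4; rewrite vax; lia.
Qed.

Section Ramified.
Variables (chi : F -> C) (c : nat).
Hypothesis hchi : is_mulchar chi.
Hypothesis hc : exact_cond chi c.

Let c1 : (1 <= c)%N. Proof. by case: hc. Qed.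

Lemma exact_uinv : uinv c%:Z chi.
Proof. by case: hc => h3 h4 _; exact: multriv_uinv. Qed.

Let lsh j : lc (fun x => chi x * indF (win j j) x).
Proof. exact: lc_shell exact_uinv. Qed.

Lemma lc_gsum j b : lc (fun z => chi z * indF (win j j) z * psi (b * z)).
Proof. exact: lc_psi. Qed.

Lemma gsum_low j b : b != 0 -> j + v b < e - c%:Z -> gsum chi j b = 0.
Proof.
move=> b0 hb; apply: (I_psi_avg hnu h1 h2 (m := c%:Z) (a := j) (b := j)) => //.
- by apply: uinvM exact_uinv _; apply: (uinv_indV (fun k => j <= k <= j)); lia.
- by rewrite ind_win0 mulr0.
- by move=> y y0 hy; rewrite indF0 ?mulr0 // => -[_]; move: hy; lia.
Qed.

Lemma gsum_high j b : PF (e - c%:Z - j + 1) b -> gsum chi j b = 0.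
Proof.
move=> hb; have [_ _ [a [a0 va ha ca]]] := hc.
apply: (I_unit_avg (lc_gsum j b) a0 va ca) => z.
have [->|z0] := eqVneq z 0; first by rewrite mulr0 ind_win0 !mulr0 !mul0r mulr0.
have -> : indF (win j j) (a * z) = indF (win j j) z :> C by rewrite -[in RHS](ind_win_scale j j z a0) va !addr0.
rewrite ind_winE //; case: eqP => [vz|_]; last by rewrite !(mulr0, mul0r).
rewrite (chiM hchi) // (_ : b * (a * z) = b * z + b * ((a - 1) * z)); last by ring.
rewrite (psiD h1) (_ : psi (b * ((a - 1) * z)) = 1); first by ring.
by apply: (psi_triv h1 h2); apply: PFW (PFM hb (PFM ha (PF_val z))); rewrite vz; lia.
Qed.

Lemma gsum_mid j b : b != 0 -> v b = e - c%:Z - j ->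
  gsum chi j b = (chi b)^-1 * (q ^ v b)%:C * gsum chi (e - c%:Z) 1.
Proof.
move=> b0 vb; have cb := chi_neq0 hchi b0.
rewrite -mulrA -(I_scale hnu b0 (lc_gsum (e - c%:Z) 1)) -(IZ hnu); last first.
  by apply: (@lc_scale _ _ b (fun z => chi z * indF (win (e - c%:Z) (e - c%:Z)) z * psi (1 * z))) => //; exact: lc_gsum.
apply: (@eqI _ _ nu) => z.
have -> : indF (win (e - c%:Z) (e - c%:Z)) (b * z) = indF (win j j) z :> C.
  by rewrite -(ind_win_scale j j z b0) vb; congr (indF (win _ _) _); lia.
have [->|z0] := eqVneq z 0; first by rewrite ind_win0 !(mulr0, mul0r).
by rewrite (chiM hchi) // mul1r !mulrA mulVf // mul1r.
Qed.

(** A ramified Gauss sum survives for a single valuation of b. Below it psi varies on the cosets of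
    1 + P^c where chi is constant; above it psi does not see the unit a on which chi is
    nontrivial. *)
Lemma gsum_case j b : gsum chi j b =
  indF [set z | z != 0 /\ v z = e - c%:Z - j] b * ((chi b)^-1 * (q ^ (e - c%:Z - j))%:C * gsum chi (e - c%:Z) 1).
Proof.
have [[b0 vb]|hb] := pselect (b != 0 /\ v b = e - c%:Z - j).
  by rewrite indF1 // mul1r (gsum_mid b0 vb) vb.
rewrite indF0 // mul0r; have [hb1|/PF_nz [b0 vb]] := pselect (PF (e - c%:Z - j + 1) b).
  exact: gsum_high.
apply: gsum_low => //; have : v b != e - c%:Z - j by apply/eqP => h; apply: hb.
by lia.
Qed.

End Ramified.

Local Notation G chi c := (gsum chi (e - c%:Z) 1).

Lemma exact_cond_inv chi c : is_mulchar chi -> exact_cond chi c -> exact_cond (chexp chi (-1)) c.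
Proof.
move=> hchi [h3 h4 [a [a0 va ha ca]]]; split=> //.
  by move=> x hx; rewrite /chexp h4 // exp1rz.
exists a; split=> //; rewrite /chexp exprN1; apply: contra ca => /eqP h.
by rewrite -[chi a]invrK h invr1.
Qed.

Lemma shell_scaleI (f : F -> C) z : z != 0 -> lc f -> I f = (q ^ (- v z))%:C * I (fun r => f (z * r)).
Proof.
move=> z0 lf; rewrite (I_scale hnu z0 lf) mulrA -rmorphM -expfzDr ?addNr ?expr0z ?mul1r //.
by rewrite gt_eqF // (@q_gt0 R F).
Qed.

(** Rescaling the second variable by z turns the product into a double integral of chi^-1(r) psi(z
    (1 + r)). Integrating over z first leaves the indicators of 1 + r in P^c and in P^(c-1); the
    second is averaged to 0, and on the first chi^-1(r) is chi(-1). *)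
Lemma gauss_mul chi c : is_mulchar chi -> exact_cond chi c ->
  G chi c * G (chexp chi (-1)) c = (q ^ (c%:Z - e) * (vol nu (e - c%:Z) * vol nu c%:Z))%:C * chi (-1).
Proof.
move=> hchi hc; have hci := exact_cond_inv hchi hc; have hchi' := mulchar_exp (-1) hchi.
have [c1 tc [a [a0 va ha ca]]] := hc; have [_ tci [a' [a'0 va' ha' ca']]] := hci.
set chi' := chexp chi (-1) in hci hchi' tci ca' *; set j0 := e - c%:Z.
have uc := exact_uinv hchi hc; have uc' := exact_uinv hchi' hci.
pose B0 r := chi' r * indF (win 0 0) r.
have lB0 : lc B0 by exact: lc_shell uc'.
pose A z : C := (q ^ (- j0))%:C * indF (win j0 j0) z.
have lA : lc A by apply: lcZ; exact: lc_ind_win.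
have o1 : PF 0 (1 : F) by apply/PFE; rewrite ?oner_eq0 ?val1.
have o0 : PF 0 (0 : F) by left.
have E1 z : chi z * indF (win j0 j0) z * psi (1 * z) * G chi' c =
   A z * I (fun r => B0 r * psi (z * (1 + 1 * r + 0 * r ^+ 2))).
  rewrite /A; have [->|z0] := eqVneq z 0; first by rewrite ind_win0 !(mulr0, mul0r).
  rewrite ind_winE //; case: eqP => [vz|_]; last by rewrite !(mulr0, mul0r).
  rewrite !mulr1 {1}/gsum (shell_scaleI z0 (lc_gsum hchi' hci j0 1)) vz mulrCA; congr (_ * _).
  rewrite -(IZ hnu); last first.
    by apply: (@lc_scale _ _ z (fun r => chi' r * indF (win j0 j0) r * psi (1 * r))) => //; exact: (lc_gsum hchi' hci).
  apply: (@eqI _ _ nu) => r; have [->|r0] := eqVneq r 0; first by rewrite mulr0 /B0 !ind_win0 !(mulr0, mul0r).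
  have -> : indF (win j0 j0) (z * r) = indF (win 0 0) r :> C.
    by rewrite -(ind_win_scale 0 0 r z0) vz add0r.
  rewrite (chiM hchi') // /B0 {1}/chi' /chexp exprN1 (_ : z * (1 + _ + _) = 1 * z + 1 * (z * r)); last by ring.
  rewrite (psiD h1).
  by have := chi_neq0 hchi z0; move: (chi z) (psi (1 * z)) (psi _) => b p1 p2 b0; field.
rewrite {1}/gsum -[LHS]mulrC -(IZ hnu); last exact: (lc_gsum hchi hc).
rewrite (@eqI _ _ nu _ (fun z => A z * I (fun r => B0 r * psi (z * (1 + 1 * r + 0 * r ^+ 2))))); last first.
  by move=> z; rewrite -E1 mulrC.
rewrite (proj2 (I_quad_fubini lA lB0 o1 o1 o0)).
have lP k : lc (fun r => indF (PF k) (r + 1) : C) by apply: lc_shift; exact: lc_PF.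
have lT1 : lc (fun r => B0 r * indF (PF c%:Z) (r + 1)) by exact: lcM.
have lT2 : lc (fun r => B0 r * indF (PF (c%:Z - 1)) (r + 1)) by exact: lcM.
rewrite (@eqI _ _ nu _ (fun r => (q ^ (- j0))%:C * ((vol nu j0)%:C * (B0 r * indF (PF c%:Z) (r + 1)) -
   (vol nu (j0 + 1))%:C * (B0 r * indF (PF (c%:Z - 1)) (r + 1))))); last first.
  move=> r; rewrite (@eqI _ _ nu _ (fun z => (q ^ (- j0))%:C * (indF (win j0 j0) z * psi ((r + 1) * z)))); last first.
    by move=> z; rewrite /A -mulrA; congr (_ * (_ * psi _)); ring.
  rewrite (IZ hnu); last by apply: lc_psi => //; exact: lc_ind_win.
  rewrite I_shell_psi (_ : e - j0 = c%:Z); last by rewrite /j0; ring.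
  ring.
rewrite (IZ hnu); last first.
  apply: (lc_ext (f := fun r => (vol nu j0)%:C * (B0 r * indF (PF c%:Z) (r + 1)) +
   (- (vol nu (j0 + 1))%:C) * (B0 r * indF (PF (c%:Z - 1)) (r + 1)))); first by move=> r; rewrite mulNr.
  by apply: lcD; apply: lcZ.
rewrite (IB hnu); [|exact: lcZ|exact: lcZ].
rewrite !(IZ hnu) //.
have -> : I (fun r => B0 r * indF (PF (c%:Z - 1)) (r + 1)) = 0.
  apply: (I_unit_avg lT2 a'0 va' ca') => r; rewrite /B0.
  have [->|r0] := eqVneq r 0; first by rewrite mulr0 !ind_win0 !(mulr0, mul0r).
  have -> : indF (win 0 0) (a' * r) = indF (win 0 0) r :> C by rewrite -[in RHS](ind_win_scale 0 0 r a'0) va' !addr0.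
  rewrite (chiM hchi') // [indF (win 0 0) r]ind_winE //; case: eqP => [vr|_]; last by rewrite !(mulr0, mul0r).
  have -> : indF (PF (c%:Z - 1)) (a' * r + 1) = indF (PF (c%:Z - 1)) (r + 1) :> C.
    rewrite (_ : a' * r + 1 = r + 1 + (a' - 1) * r); last by ring.
    apply: (pinv_PF (lexx _)); rewrite -[c%:Z - 1]addr0; apply: PFM ha' _.
    by rewrite -vr; exact: PF_val.
  by ring.
have n10 : -1 != 0 :> F by rewrite oppr_eq0 oner_eq0.
have cN1 : chi' (-1) = chi (-1).
  rewrite /chi' /chexp exprN1; apply: (mulfI (chi_neq0 hchi n10)).
  by rewrite divff ?(chi_neq0 hchi) // -(chiM hchi) // mulrNN mulr1 (chi1 hchi).
have -> : I (fun r => B0 r * indF (PF c%:Z) (r + 1)) = chi (-1) * (vol nu c%:Z)%:C.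
  rewrite -(I_ind nu) -(I_shift hnu 1 (lc_PF c%:Z)) -(IZ hnu) //.
  apply: (@eqI _ _ nu) => r; have [hr|hr] := pselect (PF c%:Z (r + 1)); last by rewrite [indF _ (r + 1)]indF0 // !mulr0.
  congr (_ * _); have hr' : PF (v (-1 : F) + c%:Z) (r + 1) by rewrite valN1 add0r.
  have rE : r = -1 + (r + 1) by ring.
  have [uc1 uc2] := uc'.
  have [r0 vr] := val_uinv uc1 n10 hr'.
  rewrite /B0 {1}rE uc2 // cN1 indF1 ?mulr1 // rE; split=> //=; rewrite vr valN1; lia.
rewrite mulr0 subr0 (_ : c%:Z - e = - j0); last by rewrite /j0; ring.
by rewrite !rmorphM /=; ring.
Qed.

(** The Jacobi sum of chi with itself in the symmetric variable: for u = s (1 + y) / 2 one has u (s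
    - u) = (s/2)^2 (1 - y^2). *)
Definition jac (chi : F -> C) : C :=
  I (fun y => indF (PF 0) y * (indF unitsF (1 - y ^+ 2) * chi (1 - y ^+ 2))).

(** The square is the integral of psi(s) H(s), H being the additive convolution of chi with itself
    on the shell. On v s = e - c the change u = s (1 + y) / 2 gives H(s) = chi(s/2)^2 jac up to the
    Jacobian; larger v s gives N. Since H(a s) = chi(a)^2 H(s), N vanishes if chi^2 has conductor c.
    If c = 1, then s lies in P^e, where psi s = 1 and chi(s - u) = chi(-u). *)
Lemma gauss_sq chi c : (2 : F) != 0 /\ v 2 = 0 -> is_mulchar chi -> exact_cond chi c ->
  exists2 N : C, G chi c ^+ 2 = (q ^ (c%:Z - e))%:C * (chi 4)^-1 * jac chi * G (chexp chi 2) c + N &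
   (exact_cond (chexp chi 2) c -> N = 0) /\
   (c = 1%N -> N = (vol nu e)%:C * chi (-1) * I (fun u => chi u ^+ 2 * indF (win (e - 1) (e - 1)) u)).
Proof.
move=> [t0 vt] hchi hc; have uc := exact_uinv hchi hc; have [c1 tc _] := hc.
set j0 := e - c%:Z.
pose B x := chi x * indF (win j0 j0) x.
have lB : lc B by exact: lc_shell uc.
pose b x := B x * psi (1 * x).
have lb : lc b by exact: (lc_gsum hchi hc).
have [l2 cE] := conv_fubini lb lb.
pose H s := I (fun u => B u * B (s - u)).
have lBB s : lc (fun u => B u * B (s - u)).
  by have [l2' _] := conv_fubini lB lB; exact: lc2_lcl l2'.
have HE s : I (fun u => b u * b (s - u)) = psi s * H s.
  rewrite -(IZ hnu) //; apply: (@eqI _ _ nu) => u; rewrite /b.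
  have -> : psi s = psi (1 * u) * psi (1 * (s - u)) by rewrite -(psiD h1); congr psi; ring.
  by move: (psi (1 * u)) (psi (1 * (s - u))) (B u) (B (s - u)) => p1 p2 b1 b2; ring.
have lH : lc (fun s => psi s * H s).
  have := lc2_I nu (lc2_swap l2); exact: lc_ext HE.
have H0 s : ~ PF j0 s -> H s = 0.
  move=> hs; rewrite /H (@eqI _ _ nu _ (fun=> 0)) ?cintegral0 // => u.
  have [hu|hu] := pselect (PF j0 u); last first.
    by rewrite /B indF0 ?mulr0 ?mul0r // => -[u0 hv]; apply: hu; apply/PFE => //; lia.
  rewrite /B [indF _ (s - u)]indF0 ?mulr0 // => -[u0 /andP [hv _]]; apply: hs.
  rewrite -(subrK u s); apply: PFD hu; exact/(PFE _ u0).
pose N := I (fun s => psi s * H s * indF (PF (j0 + 1)) s).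
have l3 : lc (fun s => psi s * H s * indF (win j0 j0) s) by apply: lcM => //; exact: lc_ind_win.
have l4 : lc (fun s => psi s * H s * indF (PF (j0 + 1)) s) by apply: lcM => //; exact: lc_PF.
have Has a s : a != 0 -> v a = 0 -> H (a * s) = chi a ^+ 2 * H s.
  move=> a0 va; rewrite /H (shell_scaleI a0 (lBB (a * s))) va oppr0 expr0z mul1r -(IZ hnu) //.
  apply: (@eqI _ _ nu) => u; rewrite -mulrBr.
  have BE z : B (a * z) = chi a * B z.
    rewrite /B; have [->|z0] := eqVneq z 0; first by rewrite mulr0 ind_win0 !mulr0.
    by rewrite (chiM hchi) // -(ind_win_scale j0 j0 z a0) va !addr0 mulrA.
  by rewrite !BE; ring.
exists N; last split.
- rewrite expr2 -[LHS]/(I b * I b) cE (eqI nu HE).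
  rewrite (@eqI _ _ nu _ (fun s => psi s * H s * indF (win j0 j0) s + psi s * H s * indF (PF (j0 + 1)) s)); last first.
    move=> s; rewrite -mulrDr indF_win1 subrK; have [hs|/H0 ->] := pselect (PF j0 s); last by rewrite !(mulr0, mul0r).
    by rewrite indF1 // mulr1.
  rewrite (ID hnu) //; congr (_ + _).
  rewrite {1}/gsum -(IZ hnu); last first.
    have uc2 : uinv c%:Z (chexp chi 2) by exact: (uinv_fun (fun z : C => z ^ 2) uc).
    have lG : lc (fun z => chexp chi 2 z * indF (win j0 j0) z) by exact: lc_shell uc2.
    exact: lc_psi.
  apply: (@eqI _ _ nu) => s; have [->|s0] := eqVneq s 0; first by rewrite ind_win0 !(mulr0, mul0r).
  rewrite ind_winE //; case: eqP => [vs|_]; last by rewrite !(mulr0, mul0r).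
  rewrite !mulr1 mul1r.
  suff -> : H s = (q ^ (c%:Z - e))%:C * (chi 4)^-1 * jac chi * chi s ^+ 2 by rewrite /chexp exprnP; ring.
  have sh0 : s / 2 != 0 by rewrite mulf_neq0 // invr_eq0.
  have vsh : v (s / 2) = j0 by rewrite valM ?invr_eq0 // valV // vt vs subr0.
  rewrite /H (shell_scaleI sh0 (lBB s)) vsh (_ : - j0 = c%:Z - e); last by rewrite /j0; ring.
  rewrite -!mulrA; congr (_ * _).
  have lj : lc (fun u => B (s / 2 * u) * B (s - s / 2 * u)).
    exact: (@lc_scale _ _ (s / 2) (fun u => B u * B (s - u)) sh0 (lBB s)).
  rewrite -(I_shift hnu 1 lj) mulrA.
  have lj' := lc_shift 1 lj.
  pose jf y := indF (PF 0) y * (indF unitsF (1 - y ^+ 2) * chi (1 - y ^+ 2)).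
  have cs0 : chi (s / 2) != 0 by exact: chi_neq0.
  have jE y : B (s / 2 * (y + 1)) * B (s - s / 2 * (y + 1)) = chi (s / 2) ^+ 2 * jf y.
    rewrite (_ : s - s / 2 * (y + 1) = s / 2 * (1 - y)); last by field.
    rewrite /jf /B.
    have -> : indF (win j0 j0) (s / 2 * (y + 1)) = indF (win 0 0) (y + 1) :> C.
      by rewrite -(ind_win_scale 0 0 (y + 1) sh0) vsh add0r.
    have -> : indF (win j0 j0) (s / 2 * (1 - y)) = indF (win 0 0) (1 - y) :> C.
      by rewrite -(ind_win_scale 0 0 (1 - y) sh0) vsh add0r.
    have fac : 1 - y ^+ 2 = (y + 1) * (1 - y) by ring.
    have [hp1|hp0] := pselect (win 0 0 (y + 1)); last first.
      rewrite [indF (win 0 0) (y + 1)]indF0 // !(mulr0, mul0r).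
      have [hy|hy] := pselect (PF 0 y); last by rewrite [indF _ y]indF0 // !(mulr0, mul0r).
      rewrite [indF unitsF _]indF0 ?mul0r ?mulr0 // fac => -[].
      rewrite mulf_eq0 negb_or => /andP [a1 a2]; rewrite valM // => hv.
      have g1 : 0 <= v (y + 1) by apply/(PFE _ a1); apply: PFD => //; apply/PFE; rewrite ?oner_eq0 ?val1.
      have g2 : 0 <= v (1 - y) by apply/(PFE _ a2); apply: PFB => //; apply/PFE; rewrite ?oner_eq0 ?val1.
      by apply: hp0; split=> //; lia.
    have [p0 vp] := hp1.
    have [hm1|hm0] := pselect (win 0 0 (1 - y)); last first.
      rewrite [indF (win 0 0) (1 - y)]indF0 // !(mulr0, mul0r).
      have [hy|hy] := pselect (PF 0 y); last by rewrite [indF _ y]indF0 // !(mulr0, mul0r).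
      rewrite [indF unitsF _]indF0 ?mul0r ?mulr0 // fac => -[].
      rewrite mulf_eq0 negb_or => /andP [a1 a2]; rewrite valM // => hv.
      have g2 : 0 <= v (1 - y) by apply/(PFE _ a2); apply: PFB => //; apply/PFE; rewrite ?oner_eq0 ?val1.
      by apply: hm0; split=> //; lia.
    have [m0 vm] := hm1.
    have hy : PF 0 y.
      rewrite (_ : y = y + 1 - 1); last by ring.
      by apply: PFB; [apply/(PFE _ p0); lia | apply/PFE; rewrite ?oner_eq0 ?val1].
    have hun : unitsF (1 - y ^+ 2) by rewrite fac; split; [rewrite mulf_neq0 | rewrite valM //; lia].
    rewrite (indF1 hp1) (indF1 hm1) (indF1 hy) (indF1 hun) fac.
    rewrite (chiM hchi sh0 p0) (chiM hchi sh0 m0) (chiM hchi p0 m0).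
    by move: (chi (s / 2)) (chi (y + 1)) (chi (1 - y)) => k1 k2 k3; ring.
  have ljf : lc jf.
    apply: (lc_ext (f := fun y => (chi (s / 2) ^+ 2)^-1 * (B (s / 2 * (y + 1)) * B (s - s / 2 * (y + 1))))); last exact: lcZ.
    by move=> y1; rewrite jE mulKf // expf_neq0.
  rewrite (eqI nu jE) (IZ hnu) // -/(jac chi).
  have -> : chi (s / 2) ^+ 2 = (chi 4)^-1 * chi s ^+ 2.
    rewrite (chiM hchi) // ?invr_eq0 // (chiV hchi) // (_ : 4 = 2 * 2); last by ring.
    rewrite (chiM hchi) //.
    by have := chi_neq0 hchi t0; move: (chi s) (chi 2) => k1 k2 k20; field.
  by rewrite !mulrA; move: (jac chi) (chi 4)^-1 (chi s) => k1 k2 k3; ring.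
- move=> [_ _ [a [a0 va ha ca]]].
  apply: (I_unit_avg l4 a0 va ca) => s.
  have -> : indF (PF (j0 + 1)) (a * s) = indF (PF (j0 + 1)) s :> C.
    rewrite !indFE; congr (_ %:R); congr nat_of_bool.
    by apply/idP/idP => /set_mem h; apply/mem_set; move: h; rewrite /= (PF_mulE _ _ a0) va subr0.
  have [hs|hs] := pselect (PF (j0 + 1) s); last by rewrite indF0 // !mulr0.
  rewrite Has // (_ : a * s = s + (a - 1) * s); last by ring.
  rewrite (psiD h1) (_ : psi ((a - 1) * s) = 1) ?mulr1 /chexp ?exprnP; first by ring.
  by apply: (psi_triv h1 h2); apply: PFW (PFM ha hs); rewrite /j0; lia.
- move=> cE1; have j0e : j0 = e - 1 by rewrite /j0 cE1.
  pose K := I (fun u => chi u ^+ 2 * indF (win j0 j0) u).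
  have lK : lc (fun u => chi u ^+ 2 * indF (win j0 j0) u).
    have uc2 : uinv c%:Z (fun z => chi z ^+ 2) by exact: (uinv_fun (fun z : C => z ^+ 2) uc).
    exact: lc_shell uc2.
  have n10 : -1 != 0 :> F by rewrite oppr_eq0 oner_eq0.
  rewrite -j0e -/K -mulrA mulrC -(I_ind nu) -(IZ hnu); last exact: lc_PF.
  apply: (@eqI _ _ nu) => s.
  have -> : e = j0 + 1 by rewrite j0e subrK.
  have [hs|hs] := pselect (PF (j0 + 1) s); last by rewrite indF0 // !mulr0.
  rewrite indF1 // !mulr1 (_ : psi s = 1); last first.
    by apply: (psi_triv h1 h2); apply: PFW hs; lia.
  rewrite mul1r /K -(IZ hnu) //; apply: (@eqI _ _ nu) => u; rewrite /B.
  have [->|u0] := eqVneq u 0; first by rewrite ind_win0 !(mulr0, mul0r).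
  rewrite [indF _ u]ind_winE //; case: eqP => [vu|_]; last by rewrite !(mulr0, mul0r).
  have nu0 : - u != 0 by rewrite oppr_eq0.
  have hs' : PF (v (- u) + 1) s by rewrite valN vu.
  have uc1 : uinv 1 chi by move: uc; rewrite cE1.
  have [su0 vsu] := val_uinv (lexx 1) nu0 hs'.
  rewrite (addrC s) ind_winE // vsu valN vu eqxx !mulr1.
  have [_ ->] := uc1 => //; rewrite -(mulN1r u) (chiM hchi n10 u0).
  by move: (chi u) (chi (-1)) => k1 k2; ring.
Qed.

End Gauss.

(** * Conductors of chi and of its square *)

Section Conductor.
Context {R : realType} {F : padicFieldType}.
Local Notation C := R[i].
Local Notation v := (@pval F).
Implicit Types (chi : F -> C) (x y z a b : F).

Lemma exact_cond_uniq chi c c' : exact_cond chi c -> exact_cond chi c' -> c = c'.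
Proof.
have H d d' : exact_cond chi d -> exact_cond chi d' -> (d' <= d)%N.
  move=> [_ td _] [_ _ [a [a0 va ha ca]]]; rewrite leqNgt; apply/negP => dd.
  move/eqP: ca; apply; rewrite (_ : a = 1 + (a - 1)); last by ring.
  by apply: td; apply: PFW ha; lia.
by move=> h h'; apply/eqP; rewrite eqn_leq !H.
Qed.

Lemma mulcond_exact chi : is_mulchar chi -> ~ unramified chi -> exact_cond chi (mulcond chi).
Proof.
move=> hchi hr; rewrite /mulcond; case: asboolP => // _.
pose P (m : nat) := `[< (1 <= m)%N /\ multriv chi m >].
have exP : exists m, P m.
  by have [M M1 hM] := multriv_ex hchi; exists M; apply/asboolP.
have ex : exists m, [set m | [/\ (1 <= m)%N, multriv chi m &
    forall m', (1 <= m')%N -> multriv chi m' -> (m <= m')%N]] m.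
  case: (ex_minnP exP) => m /asboolP [m1 hm] hmin; exists m; split=> // m' m'1 hm'.
  by apply: hmin; apply/asboolP.
have := @xgetPex _ 0%N _ ex; set c := xget _ _; move=> [c1 tc cmin].
split=> //; have [c2|c2] := leqP 2 c.
  have ntr : ~ multriv chi c.-1.
    by move=> h; have := cmin c.-1 ltac:(lia) h; lia.
  move: ntr => /existsNP [x /not_implyP [hx cx]].
  have [x0 vx] : 1 + x != 0 /\ v (1 + x) = 0 by apply: val_1D; apply: PFW hx; lia.
  exists (1 + x); split=> //; last exact/eqP.
  by rewrite (_ : 1 + x - 1 = x); [apply: PFW hx; lia | ring].
have cE : c = 1%N by lia.
move: hr => /existsNP [x /not_implyP [[x0 vx] cx]].
exists x; split=> //; last exact/eqP.
rewrite cE; apply: PFB; apply/PFE; rewrite ?oner_eq0 ?val1 ?vx //; lia.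
Qed.

Lemma unram_inv chi : unramified (chexp chi (-1)) <-> unramified chi.
Proof.
split=> h x ux; have := h x ux; rewrite /chexp exprN1; last by move=> ->; rewrite invr1.
by move=> hx; rewrite -[chi x]invrK hx invr1.
Qed.

Lemma unram_exp chi k : unramified chi -> unramified (chexp chi k).
Proof. by move=> h x ux; rewrite /chexp h // exp1rz. Qed.

Lemma unramE chi (w x : F) : is_mulchar chi -> unramified chi -> w != 0 -> v w = 1 -> x != 0 ->
  chi x = chi w ^ v x.
Proof.
move=> hchi hu w0 vw x0; have [u [u0 vu] xE] := unit_decomp w0 vw x0.
by rewrite {1}xE (chiM hchi) ?expfz_neq0 // (chiXz hchi) // (hu u (conj u0 vu)) mulr1.
Qed.

Lemma unram_uinv chi : is_mulchar chi -> unramified chi -> uinv 1 chi.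
Proof.
move=> hchi hu; have [w [w0 vw]] := @exists_unif F; split=> // x y x0 hy.
have [xy0 e] := val_uinv (lexx 1) x0 hy.
by rewrite (unramE hchi hu w0 vw xy0) e -(unramE hchi hu w0 vw x0).
Qed.

Hypothesis v2 : (2 : F) != 0 /\ v 2 = 0.

(** An approximate square root: with u = a - 1, (1 + u/2)^2 differs from a by u^2 / 4, which lies in
    P^(2c-2) and hence in P^c as c >= 2. So chi^2(1 + u/2) = chi a. In particular chi^2 can become
    unramified only when c = 1. *)
Lemma exact_cond_sq_wild chi c : is_mulchar chi -> exact_cond chi c -> (2 <= c)%N ->
  exact_cond (chexp chi 2) c.
Proof.
move=> hchi [c1 tc [a [a0 va ha ca]]] c2; split=> //.
  by move=> x hx; rewrite /chexp tc // exp1rz.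
have [t0 vt] := v2; pose u := a - 1.
have hu2 : PF (c%:Z - 1) (u / 2).
  by rewrite mulrC; apply/PF_mulE; rewrite ?invr_eq0 // valV // vt oppr0 subr0.
have hb1 : PF 1 (u / 2) by apply: PFW hu2; lia.
have [b0 vb] := val_1D hb1.
exists (1 + u / 2); split=> //; first by rewrite (_ : 1 + u / 2 - 1 = u / 2); [|ring].
rewrite /chexp -[chi _ ^ 2]/(chi (1 + u / 2) ^+ 2) -(chiX hchi) //.
rewrite (_ : (1 + u / 2) ^+ 2 = a + (u / 2) * (u / 2)); last by rewrite /u; field.
have uc := multriv_uinv hchi c1 tc; have [_ ->] := uc => //.
by rewrite va add0r; apply: PFW (PFM hu2 hu2); lia.
Qed.

Lemma exact_cond_sq chi c : is_mulchar chi -> exact_cond chi c -> ~ unramified (chexp chi 2) ->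
  exact_cond (chexp chi 2) c.
Proof.
move=> hchi hc hr; have [c2|c2] := leqP 2 c; first exact: exact_cond_sq_wild.
have [c1 tc _] := hc; have cE : c = 1%N by lia.
split=> //; first by move=> x hx; rewrite /chexp tc // exp1rz.
move: hr => /existsNP [x /not_implyP [[x0 vx] cx]].
exists x; split=> //; last exact/eqP.
rewrite cE; apply: PFB; apply/PFE; rewrite ?oner_eq0 ?val1 ?vx //; lia.
Qed.

Lemma exact_cond_tame chi c : is_mulchar chi -> exact_cond chi c -> unramified (chexp chi 2) ->
  c = 1%N.
Proof.
move=> hchi hc hu; have [c1 _ _] := hc; have [c2|c2] := leqP 2 c; last by lia.
have [_ _ [a [a0 va _ ca]]] := exact_cond_sq_wild hchi hc c2.
by move: ca; rewrite hu // eqxx.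
Qed.

End Conductor.

(** * Shell integrals of a kernel *)

Section Shells.
Context {R : realType} {F : padicFieldType}.
Local Notation C := R[i].
Local Notation v := (@pval F).
Local Notation q := ((@residue_card F)%:R : R).
Local Notation sq := (@sq R F).
Implicit Types (x y z a b : F).
Variable nu : {measure set (borel F) -> \bar R}.
Hypothesis hnu : is_haar nu.
Local Notation I f := (cintegral nu setT (f : borel F -> C)).
Variable psi : F -> C.
Hypothesis hp : nontrivial_addchar psi.
Local Notation e := (addcond psi).
Let h1 : is_addchar psi. Proof. by case: hp. Qed.
Let h2 : exists x, psi x != 1. Proof. by case: hp. Qed.

(** The coefficient A_j for the kernel kap psi. The form [psi (1 * z)] matches [gsum] and the
    averaging lemma, which carry a twist parameter. *)
Definition ash (kap chi : F -> C) j : C :=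
  (q ^ j)%:C * I (fun z => kap z * chi z * indF (win j j) z * psi (1 * z)).

(** The cut does not affect the coefficients: on the removed shells j < e - m the full integral
    already averages to 0. *)
Lemma shell_cutk (kap chi : F -> C) m j : uinv m kap -> uinv m chi ->
  shell nu chi (cutk psi kap m) j = ash kap chi j.
Proof.
move=> uk uc; rewrite /shell /ash; congr (_ * _).
have m1 : 1 <= m by case: uk.
have [hj|hj] := leP (e - m) j.
  apply: (@eqI _ _ nu) => z; have [->|z0] := eqVneq z 0; first by rewrite !ind_win0 !(mulr0, mul0r).
  rewrite ind_winE //; case: eqP => [vz|_]; last by rewrite !(mulr0, mul0r).
  by rewrite /cutk indF1 /= ?vz // mul1r; ring.
transitivity (0 : C).
  rewrite (@eqI _ _ nu _ (fun=> 0)) ?cintegral0 // => z.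
  have [->|z0] := eqVneq z 0; first by rewrite !ind_win0 !(mulr0, mul0r).
  rewrite ind_winE //; case: eqP => [vz|_]; last by rewrite !(mulr0, mul0r).
  by rewrite /cutk indF0 ?mulr0 ?mul0r //= => -[_]; rewrite vz; lia.
symmetry.
apply: (I_psi_avg hnu h1 h2 (h := fun z => kap z * chi z * indF (win j j) z) (m := m) (a := j) (b := j)).
- by apply: uinvM (uinvM uk uc) _; apply: (uinv_indV (fun k => j <= k <= j)).
- by rewrite ind_win0 mulr0.
- by move=> y y0 hy; rewrite indF0 ?mulr0 // => -[_]; move: hy; lia.
- exact: oner_neq0.
- by rewrite val1; lia.
Qed.

Lemma ash_low (kap chi : F -> C) m j : uinv m kap -> uinv m chi -> j < e - m -> ash kap chi j = 0.
Proof.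
move=> uk uc hj; rewrite -(shell_cutk _ uk uc) /shell (@eqI _ _ nu _ (fun=> 0)) ?cintegral0 ?mulr0 //.
move=> z; have [->|z0] := eqVneq z 0; first by rewrite !ind_win0 !(mulr0, mul0r).
rewrite ind_winE //; case: eqP => [vz|_]; last by rewrite !(mulr0, mul0r).
by rewrite /cutk indF0 ?mulr0 ?mul0r //= => -[_]; rewrite vz; lia.
Qed.

Lemma ash1 (chi : F -> C) j : ash (fun=> 1) chi j = (q ^ j)%:C * gsum nu psi chi j 1.
Proof. by rewrite /ash /gsum; congr (_ * _); apply: (@eqI _ _ nu) => z; rewrite mul1r. Qed.

Lemma gsum_unram (chi : F -> C) w j b : is_mulchar chi -> unramified chi -> w != 0 -> v w = 1 ->
  gsum nu psi chi j b = chi w ^ j * ((vol nu j)%:C * indF (PF (e - j)) b -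
    (vol nu (j + 1))%:C * indF (PF (e - j - 1)) b).
Proof.
move=> hchi hu w0 vw; rewrite -(I_shell_psi hnu hp) -(IZ hnu); last first.
  by apply: lc_psi => //; exact: lc_ind_win.
apply: (@eqI _ _ nu) => z; have [->|z0] := eqVneq z 0; first by rewrite !ind_win0 !(mulr0, mul0r).
rewrite ind_winE //; case: eqP => [vz|_]; last by rewrite !(mulr0, mul0r).
by rewrite (unramE hchi hu w0 vw z0) vz; ring.
Qed.

(* Scaling by a kills the shells on which psi (a z) = psi z. *)
Lemma ash_high (kap chi : F -> C) m (c : nat) a j : is_mulchar chi -> uinv m kap -> uinv m chi ->
  a != 0 -> v a = 0 -> PF (c%:Z - 1) (a - 1) -> chi a != 1 ->
  (forall z, z != 0 -> kap (a * z) = kap z) -> e - c%:Z < j -> ash kap chi j = 0.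
Proof.
move=> hchi uk uc a0 va ha ca hk hj.
have lh : lc (fun z => kap z * chi z * indF (win j j) z * psi (1 * z)).
  by have l0 := lc_win j j (uinvM uk uc); exact: lc_psi.
rewrite /ash (I_unit_avg hnu lh a0 va ca) ?mulr0 // => z.
have [->|z0] := eqVneq z 0; first by rewrite mulr0 ind_win0 !(mulr0, mul0r).
have -> : indF (win j j) (a * z) = indF (win j j) z :> C by rewrite -[in RHS](ind_win_scale j j z a0) va !addr0.
rewrite ind_winE //; case: eqP => [vz|_]; last by rewrite !(mulr0, mul0r).
rewrite hk // (chiM hchi) // (_ : 1 * (a * z) = 1 * z + (a - 1) * z); last by ring.
rewrite (psiD h1) (_ : psi ((a - 1) * z) = 1); first by ring.
by apply: (psi_triv h1 h2); apply: PFW (PFM ha (PF_val z)); rewrite vz; lia.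
Qed.

End Shells.

(** * Shell integrals of the inverse Weil ratio *)

Section KappaShells.
Context {R : realType} {F : padicFieldType}.
Local Notation C := R[i].
Local Notation v := (@pval F).
Local Notation q := ((@residue_card F)%:R : R).
Local Notation sq := (@sq R F).
Implicit Types (x y z a b : F).
Hypothesis v2 : (2 : F) != 0 /\ v 2 = 0.
Variable mu : (F -> C) -> {measure set (borel F) -> \bar R}.
Hypothesis mu_sd : forall psi', nontrivial_addchar psi' -> self_dual_haar psi' (mu psi').
Variable psi : F -> C.
Hypothesis hp : nontrivial_addchar psi.
Local Notation e := (addcond psi).
Local Notation nu := (mu psi).
Local Notation I f := (cintegral nu setT (f : borel F -> C)).
Local Notation gam := (weil_index mu psi).
Local Notation ka := (kap mu psi).
Let h1 : is_addchar psi. Proof. by case: hp. Qed.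
Let h2 : exists x, psi x != 1. Proof. by case: hp. Qed.
Let hnu : is_haar nu. Proof. exact: mu_haar. Qed.

Lemma volS m : vol nu m = sq ^ (e - 2 * m).
Proof. exact: vol_self_dual (mu_sd hp). Qed.

Lemma qzS (k : int) : q ^ k = sq ^ (2 * k).
Proof. by rewrite sqz2. Qed.

Lemma PF01 : PF 0 (1 : F). Proof. by apply/PFE; rewrite ?oner_eq0 ?val1. Qed.

Lemma ash_weil_full (chi : F -> C) m j f : uinv m chi -> 2 * f <= e - j ->
  lc (fun y => indF (PF f) y * gsum nu psi chi j (1 - y ^+ 2)) /\
  ash nu psi ka chi j = (sq ^ j)%:C * gam *
    I (fun y => indF (PF f) y * gsum nu psi chi j (1 - y ^+ 2)).
Proof.
move=> uc hf; have lS : lc (fun z => chi z * indF (win j j) z) by exact: lc_win uc.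
have m1 : PF 0 (-1 : F) by apply: PFN; exact: PF01.
have p0 : PF 0 (0 : F) by left.
have [lg _] := I_quad_fubini hnu hp lS (lc_PF f) PF01 p0 m1.
have E2 y : indF (PF f) y * I (fun z => chi z * indF (win j j) z * psi ((1 + 0 * y + -1 * y ^+ 2) * z)) =
   indF (PF f) y * gsum nu psi chi j (1 - y ^+ 2).
  by congr (_ * _); apply: (@eqI _ _ nu) => z; congr (_ * psi (_ * _)); ring.
have lg' := lc_ext E2 lg; split; first exact: lg'.
have aux (kk : F -> C) (K0 : C) :
    (forall z, z != 0 -> v z = j -> kk z = K0 * quadI nu psi f (- z)) ->
    I (fun z => kk z * chi z * indF (win j j) z * psi (1 * z)) = K0 *
    I (fun y => indF (PF f) y * gsum nu psi chi j (1 - y ^+ 2)).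
  move=> kE.
  have lA : lc (fun z => K0 * (chi z * indF (win j j) z)) by exact: lcZ.
  have [_ E] := I_quad_fubini hnu hp lA (lc_PF f) PF01 p0 m1.
  rewrite -(IZ hnu); last exact: lg'.
  transitivity (I (fun z => K0 * (chi z * indF (win j j) z) * I (fun y => indF (PF f) y * psi (z * (1 + 0 * y + -1 * y ^+ 2))))).
    apply: (@eqI _ _ nu) => z; have [->|z0] := eqVneq z 0.
      by rewrite !ind_win0 mulr0 mul0r !mulr0 mul0r.
    rewrite (ind_winE j z0); case: eqP => [vz|_]; last by rewrite mulr0 mul0r !mulr0 mul0r.
    rewrite (kE z z0 vz) /quadI.
    have -> : I (fun y => indF (PF f) y * psi (z * (1 + 0 * y + -1 * y ^+ 2))) =
       psi (1 * z) * I (fun x => indF (PF f) x * psi (- z * x ^+ 2)).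
      rewrite -(IZ hnu); last exact: lc_quad.
      apply: (@eqI _ _ nu) => y; rewrite [RHS]mulrCA -(psiD h1); congr (_ * psi _); ring.
    by move: (I _) (chi z) (psi (1 * z)) => t1 t2 t3; ring.
  rewrite E; apply: (@eqI _ _ nu) => y; rewrite -E2 [RHS]mulrCA; congr (_ * _).
  rewrite -(IZ hnu); last exact: lc_psi.
  by apply: (@eqI _ _ nu) => z; rewrite !mulrA.
rewrite /ash (aux ka (gam * (sq ^ (- j))%:C)); last first.
  move=> z z0 vz; have nz0 : - z != 0 by rewrite oppr_eq0.
  rewrite (kapE v2 mu_sd hp z0) (weil_twist v2 mu_sd hp nz0 (m := f)); last by rewrite valN vz.
  by rewrite valN vz mulrA.
rewrite mulrA; congr (_ * _); rewrite mulrCA mulrC; congr (_ * _).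
by rewrite -rmorphM qzS -sqzD; congr ((sq ^ _)%:C); ring.
Qed.

(** On the shell e - c with f = 0 only units 1 - y^2 survive in [gsum_case], where the twist
    contributes chi^-1(1 - y^2): exactly the integrand of [jac]. *)
Lemma ash_jac chi c : is_mulchar chi -> exact_cond chi c ->
  ash nu psi ka chi (e - c%:Z) =
    (sq ^ (e - c%:Z))%:C * gam * (gsum nu psi chi (e - c%:Z) 1 * jac nu (chexp chi (-1))).
Proof.
move=> hchi hc; have uc := exact_uinv hchi hc; have [c1 _ _] := hc.
have hf : 2 * 0 <= e - (e - c%:Z) by lia.
have [lg ->] := ash_weil_full uc hf; congr (_ * _).
set g := gsum nu psi chi (e - c%:Z) 1.
pose jf y := indF (PF 0) y * (indF unitsF (1 - y ^+ 2) * chexp chi (-1) (1 - y ^+ 2)).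
have E y : indF (PF 0) y * gsum nu psi chi (e - c%:Z) (1 - y ^+ 2) = g * jf y.
  rewrite (gsum_case hnu hp hchi hc) subrr expr0z mulr1 -/g /jf /chexp exprN1.
  by rewrite -/unitsF; ring.
have [g0|g0] := eqVneq g 0.
  by rewrite g0 mul0r (@eqI _ _ nu _ (fun=> 0)) ?cintegral0 // => y; rewrite E g0 mul0r.
rewrite (eqI nu E) (IZ hnu) //.
apply: (lc_ext (f := fun y => g^-1 * (indF (PF 0) y * gsum nu psi chi (e - c%:Z) (1 - y ^+ 2)))); last exact: lcZ.
by move=> y; rewrite E mulKf.
Qed.

Lemma ash_even (chi : F -> C) m j f : uinv m chi -> e - j = 2 * f ->
  ash nu psi ka chi j = gam * ((q ^ j)%:C * gsum nu psi chi j 1).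
Proof.
move=> uc hj; rewrite mulrCA /ash /gsum; congr (_ * _).
have lS : lc (fun z => chi z * indF (win j j) z) by exact: lc_win uc.
rewrite -(IZ hnu); last exact: lc_psi.
apply: (@eqI _ _ nu) => z; have [->|z0] := eqVneq z 0; first by rewrite !ind_win0 !(mulr0, mul0r).
rewrite ind_winE //; case: eqP => [vz|_]; last by rewrite !(mulr0, mul0r).
by rewrite (kap_even v2 mu_sd hp z0 (m := f)) ?vz //; ring.
Qed.

Section Unramified.
Variables (chi : F -> C) (w : F).
Hypotheses (hchi : is_mulchar chi) (hu : unramified chi) (w0 : w != 0) (vw : v w = 1).

Let uc : uinv 1 chi. Proof. exact: unram_uinv. Qed.

Lemma gsum_unram_high j : e <= j -> (q ^ j)%:C * gsum nu psi chi j 1 =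
  chi w ^ j * (sq ^ e * (1 - q^-1))%:C.
Proof.
move=> hj; rewrite (gsum_unram hnu hp j 1 hchi hu w0 vw) !indF1; first last.
- by apply/PFE; rewrite ?oner_eq0 // val1; lia.
- by apply/PFE; rewrite ?oner_eq0 // val1; lia.
rewrite !mulr1 mulrCA -rmorphB -rmorphM; congr (_ * _%:C).
rewrite !volS qzS mulrBr -!sqzD mulrBr mulr1 -[q^-1]/(q ^ (-1)) qzS -sqzD.
by congr (sq ^ _ - sq ^ _); ring.
Qed.

Lemma ash_unram_even j f : e - j = 2 * f -> f <= 0 ->
  ash nu psi ka chi j = gam * (chi w ^ j * (sq ^ e * (1 - q^-1))%:C).
Proof. by move=> hj hf; rewrite (ash_even uc hj) gsum_unram_high //; lia. Qed.

(** As f <= -1, the element 1 lies in P^(2f+1), so 1 - y^2 lies there exactly when y is in P^(f+1).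
    The two terms then have equal volumes, vol j * vol (f + 1) = vol (j + 1) * vol f, and cancel. *)
Lemma ash_unram_odd j f : e - j = 2 * f + 1 -> f <= -1 -> ash nu psi ka chi j = 0.
Proof.
move=> hj hf; have hf' : 2 * f <= e - j by lia.
have [_ ->] := ash_weil_full uc hf'.
rewrite (@eqI _ _ nu _ (fun y => chi w ^ j * ((vol nu j)%:C * indF (PF (f + 1)) y +
   (- (vol nu (j + 1))%:C) * indF (PF f) y))); last first.
  move=> y; rewrite (gsum_unram hnu hp j _ hchi hu w0 vw) hj addrK.
  have [hy|hy] := pselect (PF f y); last first.
    have hy1 : ~ PF (f + 1) y.
      have ff : f <= f + 1 by lia.
      by move=> /(PFW ff).
    by rewrite (indF0 hy) (indF0 hy1) !mulr0 mul0r addr0 mulr0.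
  have hb : PF (2 * f) (1 - y ^+ 2).
    by apply: PFB; [apply: PFW PF01; lia | apply: PFW (PFM hy hy); lia].
  have hb2 : PF (2 * f + 1) (1 - y ^+ 2) <-> PF (f + 1) y.
    split=> h; last first.
      by apply: PFB; [apply: PFW PF01; lia | apply: PFW (PFM h h); lia].
    have h3 : PF (2 * f + 1) (y ^+ 2).
      rewrite (_ : y ^+ 2 = 1 - (1 - y ^+ 2)); last by ring.
      by apply: PFB h; apply: PFW PF01; lia.
    have [->|y0] := eqVneq y 0; first by left.
    apply/(PFE _ y0); move: h3; rewrite (PFE _ (expf_neq0 2 y0)) expr2 valM //; lia.
  rewrite [indF (PF (2 * f)) _]indF1 // [indF (PF f) _]indF1 //.
  have [h|h] := pselect (PF (f + 1) y); first by rewrite !indF1 //; [ring | exact/hb2].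
  by rewrite [indF _ y]indF0 // indF0; [ring | move/hb2].
have l1 : lc (fun y => (vol nu j)%:C * indF (PF (f + 1)) y) by apply: lcZ; exact: lc_PF.
have l2 : lc (fun y => - (vol nu (j + 1))%:C * indF (PF f) y) by apply: lcZ; exact: lc_PF.
rewrite (IZ hnu); last exact: lcD.
rewrite (ID hnu) // !(IZ hnu); [|exact: lc_PF|exact: lc_PF].
rewrite !(I_ind nu) mulNr -!rmorphM -rmorphB (_ : _ - _ = 0) ?mulr0 //.
rewrite !volS -!sqzD; apply/eqP; rewrite subr_eq0; apply/eqP; congr (sq ^ _); lia.
Qed.

(** Here 1 - y^2 is in P exactly on the classes y = 1 and y = -1, which are distinct because 2 is a
    unit. Each of them contributes vol (e - 1) * vol 1 = 1, and vol e * vol 0 = 1 is subtracted. *)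
Lemma ash_unram_m1 : ash nu psi ka chi (e - 1) = gam * (chi w ^ (e - 1) * (sq ^ (e - 1))%:C).
Proof.
have hf : 2 * 0 <= e - (e - 1) by lia.
have [t0 vt] := v2.
have [_ ->] := ash_weil_full uc hf.
have lP k : lc (fun y => indF (PF 1) (y + k) : C) by apply: lc_shift; exact: lc_PF.
rewrite (@eqI _ _ nu _ (fun y => chi w ^ (e - 1) * ((vol nu (e - 1))%:C * (indF (PF 1) (y + (-1)) + indF (PF 1) (y + 1)) +
   (- (vol nu e)%:C) * indF (PF 0) y))); last first.
  move=> y; rewrite (gsum_unram hnu hp _ _ hchi hu w0 vw).
  have e1 : e - (e - 1) = 1 by ring.
  rewrite e1 subrr (subrK 1 e).
  have np : ~ PF 1 (2 : F) by move/(PFE _ t0); rewrite vt.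
  have [hy|hy] := pselect (PF 0 y); last first.
    have hn k : PF 0 k -> ~ PF 1 (y + k).
      move=> hk h; apply: hy; rewrite (_ : y = y + k - k); last by ring.
      by apply: PFB => //; apply: PFW h.
    have hn1 : ~ PF 1 (y + -1) by apply: hn; apply: PFN; exact: PF01.
    have hn2 : ~ PF 1 (y + 1) by apply: hn; exact: PF01.
    by rewrite (indF0 hy) (indF0 hn1) (indF0 hn2) mul0r addr0 !mulr0 addr0 mulr0.
  have hb : PF 0 (1 - y ^+ 2) by apply: PFB; [exact: PF01 | rewrite expr2; have := PFM hy hy; rewrite addr0].
  rewrite (indF1 hy) (indF1 hb).
  have fac : 1 - y ^+ 2 = - ((y + (-1)) * (y + 1)) by ring.
  have hm : PF 0 (y + -1) by apply: PFD => //; apply: PFN; exact: PF01.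
  have hpl : PF 0 (y + 1) by apply: PFD => //; exact: PF01.
  have [a1|a1] := pselect (PF 1 (y + -1)).
    have b1 : ~ PF 1 (y + 1).
      by move=> b1; apply: np; rewrite (_ : 2 = (y + 1) - (y + -1)); [exact: PFB | ring].
    rewrite (indF1 a1) (indF0 b1) indF1; first by ring.
    by rewrite fac; apply: PFN; rewrite -[1]addr0; exact: PFM.
  have [b1|b1] := pselect (PF 1 (y + 1)).
    rewrite (indF0 a1) (indF1 b1) indF1; first by ring.
    by rewrite fac; apply: PFN; rewrite -[1]add0r; exact: PFM.
  rewrite (indF0 a1) (indF0 b1) indF0; first by ring.
  rewrite fac => /PFN; rewrite opprK.
  have [a0 va] := PF_nz a1; have [b0 vb] := PF_nz b1.
  rewrite PFE ?mulf_neq0 // valM //.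
  by move: hm hpl; rewrite (PFE _ a0) (PFE _ b0); lia.
have lPP : lc (fun y => indF (PF 1) (y + (-1)) + indF (PF 1) (y + 1) : C) by exact: lcD.
have l1 : lc (fun y => (vol nu (e - 1))%:C * (indF (PF 1) (y + (-1)) + indF (PF 1) (y + 1))) by exact: lcZ.
have l2 : lc (fun y => - (vol nu e)%:C * indF (PF 0) y) by apply: lcZ; exact: lc_PF.
rewrite (IZ hnu); last exact: lcD.
rewrite (ID hnu) // !(IZ hnu) //; last exact: lc_PF.
rewrite (ID hnu) // (I_shift hnu (-1) (lc_PF 1)) (I_shift hnu 1 (lc_PF 1)) !(I_ind nu).
have E1 : (vol nu (e - 1))%:C * (vol nu 1)%:C = 1 :> C.
  rewrite -rmorphM !volS -sqzD (_ : e - 2 * (e - 1) + (e - 2 * 1) = 0) ?expr0z //; ring.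
have E2 : (vol nu e)%:C * (vol nu 0)%:C = 1 :> C.
  rewrite -rmorphM !volS -sqzD (_ : e - 2 * e + (e - 2 * 0) = 0) ?expr0z //; ring.
rewrite mulNr E2 [(vol nu (e - 1))%:C * _]mulrDr !E1.
by move: gam (chi w ^ (e - 1)) (sq ^ (e - 1))%:C => t1 t2 t3; ring.
Qed.

End Unramified.

Section Tame.
Variables (chi : F -> C) (w : F).
Hypotheses (hchi : is_mulchar chi) (hc : exact_cond chi 1) (hu2 : unramified (chexp chi 2)).
Hypotheses (w0 : w != 0) (vw : v w = 1).

Let uc : uinv 1 chi. Proof. exact: (exact_uinv hchi hc). Qed.
Let hchi2 : is_mulchar (chexp chi 2). Proof. exact: mulchar_exp. Qed.
Let n10 : -1 != 0 :> F. Proof. by rewrite oppr_eq0 oner_eq0. Qed.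
Local Notation G := (gsum nu psi chi (e - 1%:Z) 1).

Lemma chi_neg1 : (chi (-1))^-1 = chi (-1).
Proof.
apply: (mulfI (chi_neq0 hchi n10)).
by rewrite divff ?(chi_neq0 hchi) // -(chiM hchi) // mulrNN mulr1 (chi1 hchi).
Qed.

Lemma chi_sqE z : z != 0 -> chi z ^+ 2 = (chi w ^+ 2) ^ v z.
Proof. by move=> z0; have := unramE hchi2 hu2 w0 vw z0. Qed.

Lemma ash_tame_even j f : e - j = 2 * f -> f <= 0 -> ash nu psi ka chi j = 0.
Proof.
move=> hj hf; rewrite (ash_even uc hj) (gsum_high hnu hp hchi hc) ?mulr0 //.
by apply/PFE; rewrite ?oner_eq0 // val1; lia.
Qed.

(** Only v y = f matters. There 1 - y^2 is -y^2 up to 1 + P, so chi(1 - y^2) is chi(-1) times a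
    power of chi(w)^2, because chi^2 is unramified. *)
Lemma ash_tame_odd j f : e - j = 2 * f + 1 -> f <= -1 ->
  ash nu psi ka chi j =
   gam * chi (-1) * (chi w ^+ 2) ^ (- f) * G * (sq ^ (2 * e - 1) * (1 - q^-1))%:C.
Proof.
move=> hj hf; have hf' : 2 * f <= e - j by lia.
have [_ ->] := ash_weil_full uc hf'.
pose c0 := chi (-1) * (chi w ^+ 2) ^ (- f) * (q ^ (2 * f))%:C * G.
rewrite (@eqI _ _ nu _ (fun y => c0 * indF (win f f) y)); last first.
  move=> y; rewrite (gsum_case hnu hp hchi hc) (_ : e - 1%:Z - j = 2 * f); last by lia.
  have [->|y0] := eqVneq y 0.
    have nb : ~ [set z : F | z != 0 /\ v z = 2 * f] (1 - 0 ^+ 2).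
      by move=> [_]; rewrite expr2 mulr0 subr0 val1; lia.
    by rewrite (indF0 nb) ind_win0 mul0r !mulr0.
  rewrite ind_winE //; case: eqP => [vy|hvy].
    have y20 : - y ^+ 2 != 0 by rewrite oppr_eq0 expf_neq0.
    have vy2 : v (- y ^+ 2) = 2 * f by rewrite valN expr2 valM // vy; lia.
    have h11 : PF (v (- y ^+ 2) + 1) (1 : F) by rewrite vy2; apply: PFW PF01; lia.
    have [b0 vb] := val_uinv (lexx 1) y20 h11.
    have cb : chi (1 - y ^+ 2) = chi (- y ^+ 2) by rewrite addrC; case: uc => _; apply.
    rewrite (addrC 1) in cb *; rewrite indF1 /=; last by apply/PFE; rewrite ?vy.
    rewrite indF1 /=; last by split=> //; rewrite vb vy2.
    rewrite cb -(mulN1r (y ^+ 2)) (chiM hchi) ?expf_neq0 // (chiX hchi) // chi_sqE // vy.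
    by rewrite invfM chi_neg1 invr_expz /c0; ring.
  rewrite mulr0; have [hy|hy] := pselect (PF f y); last by rewrite indF0 // mul0r.
  have nb : ~ [set z : F | z != 0 /\ v z = 2 * f] (1 - y ^+ 2); last by rewrite (indF0 nb) mul0r mulr0.
  move=> [b0 vb].
  have hy' : PF (f + 1) y by apply/(PFE _ y0); move: hy; rewrite (PFE _ y0); lia.
  have : PF (2 * f + 1) (1 - y ^+ 2).
    by apply: PFB; [apply: PFW PF01; lia | apply: PFW (PFM hy' hy'); lia].
  by rewrite (PFE _ b0); lia.
rewrite (IZ hnu); last exact: lc_ind_win.
rewrite (I_win1 hnu) /c0.
have E : sq ^ j * (q ^ (2 * f) * (vol nu f - vol nu (f + 1))) = sq ^ (2 * e - 1) * (1 - q^-1).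
  rewrite !volS !qzS -[q^-1]/(q ^ (-1)) qzS !mulrBr mulr1 -!sqzD.
  by congr (sq ^ _ - sq ^ _); lia.
by rewrite -E !rmorphM; ring.
Qed.

(** Solved from [gauss_sq] at c = 1, where everything else is explicit: G(chi^-1) is a multiple of
    G(chi), so its square is known from [gauss_mul]; G(chi^-2) is an unramified shell integral; and
    the error term integrates an unramified character. *)
Lemma jac_tame : jac nu (chexp chi (-1)) = - (chi (-1) * (sq ^ (e - 2))%:C).
Proof.
have hchi' := mulchar_exp (-1) hchi; have hc' := exact_cond_inv hchi hc.
have [t0 vt] := v2.
have [N EN [_ /(_ erefl) NE]] := gauss_sq hnu hp v2 hchi' hc'.
set chi' := chexp chi (-1) in hchi' hc' EN NE *.
have E1 := gauss_mul hnu hp hchi hc; rewrite -/chi' in E1.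
pose X2 : C := (chi' w ^+ 2) ^ (e - 1).
have X20 : X2 != 0 by rewrite expfz_neq0 // expf_neq0 // (chi_neq0 hchi').
have hu2' : unramified (chexp chi' 2).
  move=> x ux; have := hu2 ux; rewrite /chi' /chexp exprN1 => h.
  by rewrite exprz_inv -invr_expz h invr1.
have hchi2' := mulchar_exp 2 hchi'.
have sqE z : z != 0 -> chi' z ^+ 2 = (chi' w ^+ 2) ^ v z.
  by move=> z0; have := unramE hchi2' hu2' w0 vw z0.
have c4 : chi' 4 = 1.
  rewrite (_ : 4 = 2 ^+ 2); last by ring.
  by rewrite (chiX hchi') // sqE // vt expr0z.
have cm : chi' (-1) = chi (-1) by rewrite /chi' /chexp exprN1 chi_neg1.
have EG : gsum nu psi chi' (e - 1%:Z) 1 = X2 * G.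
  rewrite /gsum -(IZ hnu); last exact: (lc_gsum hp hchi hc).
  apply: (@eqI _ _ nu) => z; have [->|z0] := eqVneq z 0; first by rewrite !ind_win0 !(mulr0, mul0r).
  rewrite ind_winE //; case: eqP => [vz|_]; last by rewrite !(mulr0, mul0r).
  have -> : chi' z = X2 * chi z.
    rewrite /X2 -vz -sqE // expr2 -mulrA (_ : chi' z * chi z = 1) ?mulr1 //.
    by rewrite /chi' /chexp exprN1 mulVf // (chi_neq0 hchi).
  by rewrite !mulrA.
have n11 : ~ PF 1 (1 : F) by move/(PFE _ (oner_neq0 F)); rewrite val1.
have EG2 : gsum nu psi (chexp chi' 2) (e - 1%:Z) 1 = X2 * - (vol nu e)%:C.
  rewrite (gsum_unram hnu hp _ _ hchi2' hu2' w0 vw).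
  have e1 : e - (e - 1) = 1 by ring.
  rewrite e1 subrr (subrK 1 e) (indF0 n11) (indF1 PF01) mulr0 mulr1 sub0r.
  by congr (_ * _).
have EI : I (fun u => chi' u ^+ 2 * indF (win (e - 1) (e - 1)) u) = X2 * (vol nu (e - 1) - vol nu e)%:C.
  have -> : (vol nu (e - 1) - vol nu e)%:C = I (indF (win (e - 1) (e - 1))).
    by rewrite (I_win1 hnu) (subrK 1 e).
  rewrite -(IZ hnu); last exact: lc_ind_win.
  apply: (@eqI _ _ nu) => z; have [->|z0] := eqVneq z 0; first by rewrite !ind_win0 !(mulr0, mul0r).
  rewrite ind_winE //; case: eqP => [vz|_]; last by rewrite !(mulr0, mul0r).
  by rewrite sqE // vz.
move: EN; rewrite NE c4 cm EI EG2 EG invr1 mulr1.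
have -> : (X2 * G) ^+ 2 = X2 * (G * (X2 * G)) by ring.
rewrite -EG E1.
pose a : C := (sq ^ (- e))%:C; pose b : C := (sq ^ (2 - e))%:C; pose u : C := (sq ^ (e - 2))%:C.
have vV1 : vol nu (e - 1) = sq ^ (2 - e) by rewrite volS; congr (sq ^ _); ring.
have vVe : vol nu e = sq ^ (- e) by rewrite volS; congr (sq ^ _); ring.
have vv1 : vol nu 1%:Z = sq ^ (e - 2) by rewrite volS; congr (sq ^ _).
have bu : b * u = 1.
  rewrite -rmorphM -sqzD (_ : 2 - e + (e - 2) = 0); last by ring.
  by rewrite expr0z.
have a0 : a != 0.
  by rewrite /a (_ : 0 = 0%:C) // (inj_eq (@complexI R)) expfz_neq0 // sq_neq0.
have qE : (q ^ (1 - e))%:C = a * b by rewrite -rmorphM -sqzD qzS; congr ((sq ^ _)%:C); ring.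
rewrite vv1 vVe vV1 !rmorphM rmorphB /= qE -/a -/b -/u bu.
clear qE; move: (jac nu chi') (chi (-1)) X20 a0 bu; clearbody X2 a b u; move=> j k x0 a0 bu H.
have b0 : b != 0 by apply/eqP => b0; move: bu; rewrite b0 mul0r => /esym/eqP; rewrite oner_eq0.
have n0 : a * a * X2 * b != 0 by rewrite !mulf_neq0.
apply: (mulfI n0).
have -> : a * a * X2 * b * - (k * u) = - (a * a * X2 * k) * (b * u) by ring.
rewrite bu mulr1; apply/eqP; rewrite -subr_eq0; apply/eqP.
transitivity (X2 * (a * b * 1 * k) - (a * b * j * (X2 * - a) + a * k * (X2 * (b - a)))); first by ring.
by rewrite H subrr.
Qed.

End Tame.
End KappaShells.

(** * The functional equation with abstract coefficients *)

Section FunctionalEquation.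
Context {R : realType} {F : padicFieldType}.
Local Notation C := R[i].
Local Notation v := (@pval F).
Local Notation q := ((@residue_card F)%:R : R).
Local Notation Q := (@Q R F).
Implicit Types (x y z a b : F) (phi chi : F -> C).

Lemma dnear_all (r : seq nat) (P : nat -> C -> Prop) (s0 : C) :
  (forall i, \forall s \near s0^', P i s) -> \forall s \near s0^', forall i, i \in r -> P i s.
Proof.
move=> h; elim: r => [|i r IH]; first by apply: dnearC_true.
apply: dnearC2 (h i) IH => s /= hi hr j; rewrite in_cons => /orP [/eqP -> //|]; exact: hr.
Qed.

Lemma dnear_and (P P' : C -> Prop) (s0 : C) : (\forall s \near s0^', P s) ->
  (\forall s \near s0^', P' s) -> \forall s \near s0^', P s /\ P' s.
Proof. by move=> h h'; apply: dnearC2 h h' => s. Qed.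

Lemma chexpK chi : chexp (chexp chi (-1)) (-1) = chi.
Proof. by apply/funext => x; rewrite /chexp !exprN1 invrK. Qed.

Lemma mero_eq_1sub (f g : C -> C) : mero_eq f g ->
  mero_eq (fun s => f (1 - s)) (fun s => g (1 - s)).
Proof.
move=> h; have n1 : (-1 : C) != 0 by rewrite oppr_eq0 oner_eq0.
have E (k : C -> C) : (fun s => k (1 - s)) = (fun s => k (-1 * s + 1)).
  by apply/funext => s; congr k; ring.
by rewrite !E; exact: mero_eq_affine.
Qed.

Variables (w : F) (n : nat).
Hypotheses (w0 : w != 0) (vw : v w = 1) (n0 : (0 < n)%N).

Lemma Dn_near chi s0 : is_mulchar chi -> \forall s \near s0^', Dn w n chi s != 0.
Proof. by move=> hchi; have [_ _] := Dn_admissible w0 vw n0 chi; apply. Qed.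

Lemma Dn_near1 chi s0 : is_mulchar chi -> \forall s \near s0^', Dn w n chi (1 - s) != 0.
Proof.
move=> hchi; have n1 : (-1 : C) != 0 by rewrite oppr_eq0 oner_eq0.
have H := @dnear_affine R (fun s => is_true (Dn w n chi s != 0)) (-1) 1 s0 n1 (@Dn_near chi _ hchi).
have H' := H.
by apply: dnearC2 H H' => s /= h _; rewrite (_ : 1 - s = -1 * s + 1) //; ring.
Qed.

Variable nu : {measure set (borel F) -> \bar R}.
Hypothesis hnu : is_haar nu.
Local Notation J f := (cintegral nu Fstar (f : borel F -> C)).
Variable psi : F -> C.
Hypothesis hp : nontrivial_addchar psi.

Definition dash (kap chi : F -> C) j := ash nu psi kap chi j - chi w ^+ n * ash nu psi kap chi (j - n%:Z).

(** In [zeta_conv] the numerator of phi at 1 - s is rewritten by [zeta_nice] as [Dn] times its zeta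
    function, and this [Dn] cancels one of the two denominators, off its zeros. The transform T is
    prescribed on F^* only, which is all that [zeta] sees. *)
Lemma functional_equation (kap chi phi T : F -> C) (mk : int) (B : R) (k : int) (S : seq int) :
  is_mulchar chi -> uinv mk kap -> 0 <= B -> (forall z, z != 0 -> normc (kap z) <= B) ->
  (forall z, z != 0 -> kap (w ^+ n * z) = kap z) -> lc phi ->
  (forall x, x != 0 -> T x = J (fun y => phi y * (kap (x * y) * psi (x * y)))) ->
  uniq S -> (forall j, j \notin S -> dash kap chi j = 0) ->
  mero_eq (fun s => Dn w n chi s * zeta nu s chi (fun x => T x * bet n k x))
   (fun s => \sum_(0 <= i < n) (\sum_(j <- S) (j == i%:Z %[mod n%:Z])%Z%:R * (Q s ^ j * dash kap chi j)) *
     zeta nu (1 - s) (chexp chi (-1)) (fun x => phi x * bet n (i%:Z - k) x)).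
Proof.
move=> hchi uk B0 bk pk lphi hT uS hS; have [h1 h2] := hp.
have [mc mc1 uc] := uinv_chi hchi.
have [m0 [j1 [E1 [B1 nphi]]]] := lc_nice n w0 vw lphi.
pose m := Num.max m0 (Num.max mk mc).
have mm0 : m0 <= m by rewrite le_max lexx.
have mmk : mk <= m by rewrite !le_max lexx !orbT.
have mmc : mc <= m by rewrite !le_max lexx !orbT.
have ukm := uinvW mmk uk; have ucm := uinvW mmc uc.
have nK := cutk_nice h1 h2 w0 vw n0 ukm B0 bk pk.
have nP := nphi m mm0.
have hchi' := mulchar_exp (-1) hchi.
have Z1 := zeta_conv hnu w0 vw n0 hchi nP nK ucm k.
have Z2 l := mero_eq_1sub (zeta_nice hnu w0 vw n0 hchi' l nP).
have TE s : zeta nu s chi (fun x => T x * bet n k x) =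
    zeta nu s chi (fun x => conv nu phi (cutk psi kap m) x * bet n k x).
  apply: zeta_ext => // x x0; congr (_ * _).
  by rewrite hT // (conv_cutk hnu h1 h2 w0 vw n0 ukm B0 bk pk nP x0).
have PE i s : Pz nu w n chi (cutk psi kap m) i s =
    \sum_(j <- S) (j == i %[mod n%:Z])%Z%:R * (Q s ^ j * dash kap chi j).
  have dE j : dshell nu w n chi (cutk psi kap m) j = dash kap chi j.
    by rewrite /dshell /dash !(shell_cutk hnu hp _ ukm ucm).
  rewrite (Pz_shells hnu w0 vw n0 hchi i s nK uS); last by move=> j /hS; rewrite dE.
  by apply: eq_bigr => j _; rewrite dE.
move=> s0; have Z3 := @dnear_all (index_iota 0 n) _ s0 (fun i => Z2 (i%:Z - k) s0).
have Z4 := Dn_near1 s0 hchi'.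
have Z5 := dnear_and (Z1 s0) Z3.
apply: dnearC2 Z4 Z5 => s /= d0 [e1 e2].
apply: (mulIf d0); rewrite TE mulrAC -[Dn w n (chexp chi (-1)) (1 - s)]/(1 - _) in e1 *.
rewrite e1 mulr_suml; apply: eq_big_seq => i hi.
by rewrite -PE -mulrA; congr (_ * _); rewrite -(e2 i hi) mulrC.
Qed.

End FunctionalEquation.

(** * The Tate gamma factor *)

Section TateFactor.
Context {R : realType} {F : padicFieldType}.
Local Notation C := R[i].
Local Notation v := (@pval F).
Local Notation q := ((@residue_card F)%:R : R).
Local Notation Q := (@Q R F).
Local Notation sq := (@sq R F).
Implicit Types (x y z a b : F).
Hypothesis v2 : (2 : F) != 0 /\ v 2 = 0.
Variable mu : (F -> C) -> {measure set (borel F) -> \bar R}.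
Hypothesis mu_sd : forall psi', nontrivial_addchar psi' -> self_dual_haar psi' (mu psi').
Variable psi : F -> C.
Hypothesis hp : nontrivial_addchar psi.
Local Notation e := (addcond psi).
Local Notation nu := (mu psi).
Variables (w : F) (chi : F -> C).
Hypotheses (w0 : w != 0) (vw : v w = 1) (hchi : is_mulchar chi).
Local Notation chi' := (chexp chi (-1)).
Local Notation one := (fun=> 1 : C).
Let hnu : is_haar nu. Proof. exact: mu_haar. Qed.
Let hchi' : is_mulchar chi'. Proof. exact: mulchar_exp. Qed.

Definition PT (S : seq int) s : C := \sum_(j <- S) Q s ^ j * dash w 1 nu psi one chi' j.

Lemma bet_1 l x : x != 0 -> bet 1 l x = 1 :> C.
Proof. by move=> x0; rewrite betE // modz1 modz1 eqxx. Qed.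

Lemma uinv_one : uinv 1 (one : F -> C). Proof. by split. Qed.

Lemma tate_fe (S : seq int) phi : uniq S -> (forall j, j \notin S -> dash w 1 nu psi one chi' j = 0) ->
  schwartz phi ->
  mero_eq (fun s => Dn w 1 chi' (1 - s) * zeta nu (1 - s) chi' (fourier nu psi phi))
    (fun s => PT S (1 - s) * zeta nu s chi phi).
Proof.
move=> uS hS /schwartz_lc lphi; have [h1 h2] := hp.
have n0 : (0 < 1)%N by [].
have b1 z : z != 0 -> normc (one z : C) <= 1 by rewrite normc1.
have hT x : x != 0 -> fourier nu psi phi x =
    cintegral nu Fstar (fun y : borel F => phi y * (one (x * (y : F)) * psi (x * (y : F)))).
  move=> x0; rewrite /fourier -[LHS]/(cintegral nu setT ((fun y => phi y * psi (x * y)) : borel F -> C)).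
  rewrite (I_J hnu); last exact: lc_psi.
  by apply: eq_cintegral => y _; rewrite mul1r.
have := functional_equation w0 vw n0 hnu hp 0 hchi' uinv_one ler01 b1 (fun _ _ => erefl) lphi hT uS hS.
move/mero_eq_1sub => H s0; apply: dnearC2 (H s0) (H s0) => s /= E _.
move: E; rewrite big_nat1 => E.
rewrite (zeta_ext nu (chi' := chi') (g := fun x => fourier nu psi phi x * bet 1 0 x)) //; last first.
  by move=> x x0; rewrite bet_1 // mulr1.
rewrite E; congr (_ * _).
  by apply: eq_bigr => j _; rewrite !modz1 eqxx mul1r.
rewrite chexpK (_ : 1 - (1 - s) = s); last by ring.
by apply: zeta_ext => // x x0; rewrite bet_1 // mulr1.
Qed.

(** The indicator of 1 + P^m, with chi trivial there, has constant nonzero zeta function: evaluating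
    a functional equation on it isolates the gamma factor. *)
Lemma tate_test : exists phi0, schwartz phi0 /\ exists2 c : C, c != 0 &
  mero_eq (fun s => zeta nu s chi phi0) (fun=> c).
Proof.
have [m m1 uc] := uinv_chi hchi.
pose phi0 : F -> C := fun x => indF (PF m) (x + (-1)).
have l0 : lc phi0 by apply: lc_shift; exact: lc_PF.
exists phi0; split; first exact: lc_schwartz.
have v0 : (vol nu m)%:C != 0 :> C.
  by rewrite (_ : 0 = 0%:C) // (inj_eq (@complexI R)) gt_eqF // (vol_gt0 hnu).
exists (vol nu m)%:C => //.
have n0 : (0 < 1)%N by [].
have [m0 [j1 [E1 [B1 nphi]]]] := lc_nice 1 w0 vw l0.
have nP := nphi m0 (lexx _).
have shE j : shell nu chi phi0 j = (j == 0)%:R * (vol nu m)%:C.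
  have lsu x : PF m (x + -1) -> x != 0 /\ v x = 0.
    move=> hx; rewrite (_ : x = 1 + (x + -1)); last by ring.
    by apply: val_1D; apply: PFW hx.
  rewrite /shell; have [->|j0] := eqVneq j 0; last first.
    rewrite mul0r (@eqI _ _ nu _ (fun=> 0)) ?cintegral0 ?mulr0 // => x.
    have [/lsu [x0 vx]|hx] := pselect (PF m (x + -1)); last by rewrite /phi0 indF0 // !mul0r.
    by rewrite ind_winE // vx eq_sym (negPf j0) mulr0.
  rewrite expr0z mul1r mul1r -(I_ind nu) -(I_shift hnu (-1) (lc_PF m)).
  apply: (@eqI _ _ nu) => x.
  have [hx|hx] := pselect (PF m (x + -1)); last by rewrite /phi0 indF0 // !mul0r.
  have [x0 vx] := lsu x hx; rewrite ind_winE // vx eqxx mulr1 (_ : chi x = 1) ?mulr1 //.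
  rewrite (_ : x = 1 + (x + -1)); last by ring.
  have [_ ->] := uc; rewrite ?oner_neq0 ?val1 ?add0r //; exact: (chi1 hchi).
have dsE j : dshell nu w 1 chi phi0 j = ((j == 0)%:R - chi w * (j == 1)%:R) * (vol nu m)%:C.
  rewrite /dshell !shE expr1 (_ : (j - 1%:Z == 0) = (j == 1)); last by lia.
  ring.
have uS : uniq [:: (0 : int); 1] by [].
have hS j : j \notin [:: (0 : int); 1] -> dshell nu w 1 chi phi0 j = 0.
  by rewrite !inE negb_or dsE => /andP [/negPf -> /negPf ->]; rewrite mulr0 subr0 mul0r.
have Z := zeta_nice hnu w0 vw n0 hchi 0 nP.
move=> s0; apply: dnearC2 (Dn_near w0 vw n0 s0 hchi) (Z s0) => s /= d0 E.
apply: (mulfI d0).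
rewrite (zeta_ext nu (chi' := chi) (g := fun x => phi0 x * bet 1 0 x)) //; last first.
  by move=> x x0; rewrite bet_1 // mulr1.
rewrite E (Pz_shells hnu w0 vw n0 hchi 0 s nP uS hS) !big_cons big_nil !dsE !modz1 !eqxx.
by rewrite /Dn expr1 expr0z expr1z /=; ring.
Qed.

(** The explicit quotient satisfies all the functional equations, so the choice in [tate_gamma] is
    not the default; any two solutions agree off a discrete set by [tate_test]. *)
Lemma tate_gammaE (S : seq int) : uniq S -> (forall j, j \notin S -> dash w 1 nu psi one chi' j = 0) ->
  mero_eq (fun s => tate_gamma mu s chi psi) (fun s => PT S (1 - s) / Dn w 1 chi' (1 - s)).
Proof.
move=> uS hS; have n0 : (0 < 1)%N by [].
pose g0 s := PT S (1 - s) / Dn w 1 chi' (1 - s).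
have hg0 phi : schwartz phi ->
   mero_eq (fun s => zeta nu (1 - s) chi' (fourier nu psi phi)) (fun s => g0 s * zeta nu s chi phi).
  move=> hphi s0; apply: dnearC2 (Dn_near1 w0 vw n0 s0 hchi') (tate_fe uS hS hphi s0) => s /= d0 E.
  by apply: (mulfI d0); rewrite E /g0 mulrA mulrCA divff // mulr1.
have mg0 : meromorphic g0.
  have aff (k : C -> C) : (fun s => k (1 - s)) = (fun s => k (-1 * s + 1)).
    by apply/funext => s; congr k; ring.
  have sz : simple_zeros (fun s => 1 - chi' w * (q%:C)^-1 * Q s ^ (-1)) by exact: simple_zeros_Q.
  have sE : (fun s => (1 - chi' w * (q%:C)^-1 * Q s ^ (-1))^-1) = (fun s => (Dn w 1 chi' (1 - s))^-1).
    by apply/funext => s; rewrite /Dn expr1 Q_sub1 exprN1 mulrA.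
  have := meromorphicV sz; rewrite sE => mD.
  have eP : entire (fun s => PT S (1 - s)).
    rewrite (aff (PT S)); apply: (@entire_affine R (PT S)).
    apply: (@entire_sum R _ S (fun j s => Q s ^ j * dash w 1 nu psi one chi' j)) => j s.
    by apply: (@cderivableM R (fun s => Q s ^ j) (fun=> _)); [exact: (@entire_Qz R F) | exact: (@entire_cst R)].
  exact: meromorphicM (meromorphic_entire eP) mD.
have ex : exists g, [set g | meromorphic g /\ forall phi, schwartz phi ->
    mero_eq (fun s => zeta (mu psi) (1 - s) chi' (fourier (mu psi) psi phi))
      (fun s => g s * zeta (mu psi) s chi phi)] g by exists g0; split.
have := @xgetPex _ (fun=> 0) _ ex; rewrite -/(tate_gamma mu _ chi psi).
set g := xget _ _; move=> [_ hg].
have [phi0 [sp0 [c c0 hc]]] := tate_test.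
move=> s0; have Z5 := dnear_and (hg phi0 sp0 s0) (hg0 phi0 sp0 s0).
apply: dnearC2 (hc s0) Z5 => s /= E [E1 E2].
apply: (mulIf c0); rewrite -E; move: E1; rewrite E2 => E1.
by rewrite -[LHS]/(g s * _) -E1.
Qed.

End TateFactor.

(** * Coefficients that are periodic outside a short window *)

Definition window (n : nat) (a : int) : seq int := [:: a - 1, a + n%:Z & [seq a + i%:Z | i <- iota 0 n]].

Lemma window_uniq n a : uniq (window n a).
Proof.
rewrite /window /= !inE map_inj_uniq ?iota_uniq ?andbT; last by move=> i j; lia.
have h1 : a - 1 \notin [seq a + i%:Z | i <- iota 0 n] by apply/mapP => -[i _]; lia.
have h2 : a + n%:Z \notin [seq a + i%:Z | i <- iota 0 n].
  by apply/mapP => -[ i ]; rewrite mem_iota; lia.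
by rewrite negb_or h1 h2 !andbT; lia.
Qed.

Section Window.
Context {C : fieldType}.
Variables (A : int -> C) (n : nat) (a : int) (cw b : C).
Hypotheses (n0 : (0 < n)%N) (b0 : b != 0).
Hypothesis low : forall j, j < a - 1 -> A j = 0.
Hypothesis per : forall j, a < j -> A (j + n%:Z) = cw ^+ n * A j.

Local Notation window := (window n a).

Definition dshift j := A j - cw ^+ n * A (j - n%:Z).

(** The window is one period a, ..., a + n - 1 with one index added on each side: a - 1, where an
    isolated coefficient is allowed, and a + n, because periodicity is assumed for j > a only. In
    the case of ramified chi^2 the coefficient at a is the only nonzero one, so periodicity does
    fail at j = a. *)
Lemma window_out j : j \notin window -> dshift j = 0.
Proof.
rewrite /window !inE !negb_or => /and3P [j1 j2 j3]; rewrite /dshift.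
have j4 : ~ (a <= j < a + n%:Z).
  move=> h; move/mapP: j3; apply; exists (absz (j - a)); rewrite ?mem_iota; lia.
have [h|h] := ltP j (a - 1); first by rewrite !low ?mulr0 ?subr0 //; lia.
have E := per (j := j - n%:Z); rewrite subrK in E; rewrite E ?subrr //.
by lia.
Qed.

Lemma modP (x y : int) : - (n%:Z) < x - y < n%:Z -> (x == y %[mod n%:Z])%Z = (x == y).
Proof.
move=> h; rewrite eqz_mod_dvd; apply/idP/eqP => [|->]; last by rewrite subrr dvdz0.
move=> /dvdzP [k hk]; have nz : 0 < n%:Z by lia.
have k0 : k = 0 by nia.
by apply/eqP; rewrite -subr_eq0 hk k0 mul0r.
Qed.

Lemma modS (x y : int) : (x == y %[mod n%:Z])%Z = (x + n%:Z == y %[mod n%:Z])%Z.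
Proof. by rewrite modzDr. Qed.

(** The class of a + m meets the window in a + m itself, in a - 1 when m = n - 1, and in a + n when
    m = 0. The isolated coefficient reappears with opposite sign at a + n - 1, which produces the
    factor 1 - (cw b)^n. *)
Lemma window_sum (m : nat) : (m < n)%N ->
  \sum_(j <- window) (j == m%:Z + a %[mod n%:Z])%Z%:R * (b ^ j * dshift j) =
  b ^ (a + m%:Z) * A (a + m%:Z) + (m == n.-1)%:R * (b ^ (a - 1) * A (a - 1) * (1 - (cw * b) ^+ n))
  + (m == 0%N)%:R * (b ^ (a + n%:Z) * (A (a + n%:Z) - cw ^+ n * A a)).
Proof.
move=> mn; rewrite /window !big_cons big_map.
have -> : (a - 1 == m%:Z + a %[mod n%:Z])%Z = (m == n.-1).
  by rewrite modS modP; lia.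
have -> : (a + n%:Z == m%:Z + a %[mod n%:Z])%Z = (m == 0%N).
  by rewrite -modS modP; lia.
rewrite (bigD1_seq m) ?mem_iota ?iota_uniq //= big1_seq ?addr0; last first.
  move=> i /andP [im]; rewrite mem_iota => hi; rewrite modP; last by lia.
  by rewrite (_ : (_ == _) = false) ?mul0r //; lia.
rewrite modP; last by lia.
rewrite (addrC m%:Z) eqxx mul1r.
have D1 : dshift (a - 1) = A (a - 1) by rewrite /dshift (low (j := a - 1 - n%:Z)) ?mulr0 ?subr0 //; lia.
have D2 : dshift (a + m%:Z) = A (a + m%:Z) - (m == n.-1)%:R * (cw ^+ n * A (a - 1)).
  rewrite /dshift; have [mE|mE] := eqVneq m n.-1.
    by rewrite mul1r (_ : a + m%:Z - n%:Z = a - 1) //; lia.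
  by rewrite mul0r (low (j := a + m%:Z - n%:Z)) ?mulr0 //; lia.
have D3 : dshift (a + n%:Z) = A (a + n%:Z) - cw ^+ n * A a by rewrite /dshift addrK.
rewrite D1 D2 D3 (exprMn n cw); have [mE|mE] := eqVneq m n.-1; last first.
  rewrite !mul0r subr0 !add0r addr0.
  by move: (b ^ _ * A (a + m%:Z)) (_ * _) => t1 t2; rewrite addrC ?addrA.
have -> : b ^ (a + m%:Z) = b ^ (a - 1) * b ^+ n.
  by rewrite -[b ^+ n]/(b ^ n%:Z) -expfzDr //; congr (b ^ _); lia.
rewrite !mul1r; move: (b ^ (a - 1)) (b ^+ n) (A (a - 1)) (cw ^+ n) (A (a + m%:Z)) => t1 t2 t3 t4 t5.
by move: (_%:R * _) => t6; ring.
Qed.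

Lemma window_periodic (g : int -> C) (k : int) : (forall i, g (i + n%:Z) = g i) ->
  \sum_(0 <= i < n) g i%:Z = \sum_(0 <= i < n) g (i%:Z + k).
Proof.
move=> hg; have step0 l (p : nat) : \sum_(0 <= i < p) g (i%:Z + (l + 1)) =
    \sum_(0 <= i < p) g (i%:Z + l) + g (p%:Z + l) - g l.
  elim: p => [|p IH]; first by rewrite !big_geq // add0r add0r subrr.
  rewrite !big_nat_recr //= IH (_ : p%:Z + (l + 1) = p.+1%:Z + l); last by lia.
  ring.
have step l : \sum_(0 <= i < n) g (i%:Z + l) = \sum_(0 <= i < n) g (i%:Z + (l + 1)).
  by rewrite step0 (addrC n%:Z l) hg addrK.
have up l (i : nat) : \sum_(0 <= j < n) g (j%:Z + l) = \sum_(0 <= j < n) g (j%:Z + (l + i%:Z)).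
  elim: i => [|i ->]; first by rewrite addr0.
  by rewrite step; apply: eq_bigr => j _; congr g; lia.
have -> : \sum_(0 <= i < n) g i%:Z = \sum_(0 <= i < n) g (i%:Z + 0) by apply: eq_bigr => i _; rewrite addr0.
have [h|h] := leP 0 k; first by rewrite (up 0 (absz k)); apply: eq_bigr => j _; congr g; lia.
by rewrite [RHS](up k (absz k)); apply: eq_bigr => j _; congr g; lia.
Qed.

End Window.

(** * Half-integral powers of q *)

Section QLemmas.
Context {R : realType} {F : padicFieldType}.
Local Notation C := R[i].
Local Notation q := ((@residue_card F)%:R : R).
Local Notation Q := (@Q R F).
Local Notation sq := (@sq R F).

Lemma sqE : sq = expR (ln q / 2).
Proof.
have q0 := @q_gt0 R F.
apply/eqP; rewrite -(@eqrXn2 _ 2) ?expR_ge0 ?(ltW (@sq_gt0 R F)) //.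
by rewrite sq2 expr2 -expRD -splitr lnK.
Qed.

Lemma sqC : sq%:C = cexp ((ln q)%:C / 2) :> C.
Proof.
rewrite sqE (_ : (ln q)%:C / 2 = (ln q / 2)%:C) ?cexpR //.
by rewrite rmorphM rmorphV ?rmorph_nat //= unitfE.
Qed.

Lemma Q_half s : Q (s + 2^-1) = Q s * (sq%:C)^-1.
Proof. by rewrite !QE sqC -cexpN -cexpD; congr cexp; ring. Qed.

Lemma Q_nat (n : nat) s : Q (n%:R * s) = Q s ^+ n.
Proof. by rewrite !QE cexpX; congr cexp; ring. Qed.

Lemma cpow_half : cpow q (- 2^-1) = (sq%:C)^-1 :> C.
Proof. by rewrite cpowE sqC -cexpN; congr cexp; ring. Qed.

Lemma cpow_s s : cpow q s = (Q s)^-1.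
Proof. by rewrite cpowE QE -cexpN; congr cexp; ring. Qed.

Lemma szE (k : int) : (sq ^ k)%:C = (sq%:C) ^ k :> C.
Proof.
case: k => k; first by rewrite -!exprnP rmorphXn.
by rewrite !NegzE -!exprnN rmorphV ?rmorphXn //= unitfE expf_neq0 // sq_neq0.
Qed.

Lemma qC : q%:C = (sq%:C) ^+ 2 :> C.
Proof. by rewrite -rmorphXn sq2. Qed.

Lemma sqC_neq0 : sq%:C != 0 :> C.
Proof. by rewrite sqC cexp_neq0. Qed.

End QLemmas.

(** * Explicit epsilon factors *)

Section Epsilon.
Context {R : realType} {F : padicFieldType}.
Local Notation C := R[i].
Local Notation v := (@pval F).
Local Notation q := ((@residue_card F)%:R : R).
Local Notation Q := (@Q R F).
Local Notation sq := (@sq R F).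
Implicit Types (x y z : F).
Hypothesis v2 : (2 : F) != 0 /\ v 2 = 0.
Variable mu : (F -> C) -> {measure set (borel F) -> \bar R}.
Hypothesis mu_sd : forall psi', nontrivial_addchar psi' -> self_dual_haar psi' (mu psi').
Variable psi : F -> C.
Hypothesis hp : nontrivial_addchar psi.
Local Notation e := (addcond psi).
Local Notation nu := (mu psi).
Variables (w : F) (chi : F -> C).
Hypotheses (w0 : w != 0) (vw : v w = 1) (hchi : is_mulchar chi).
Local Notation chi' := (chexp chi (-1)).
Local Notation one := (fun=> 1 : C).
Let hnu : is_haar nu. Proof. exact: mu_haar. Qed.
Let hchi' : is_mulchar chi'. Proof. exact: mulchar_exp. Qed.
Let n01 : (0 < 1)%N. Proof. by []. Qed.
Let cw0 : chi w != 0. Proof. exact: chi_neq0. Qed.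

(** From e on the coefficients are geometric, so only those at e - 1 and e remain after
    multiplication by [Dn]. They combine to a monomial times 1 - chi(w) q^-s, which the L-factor in
    the definition of epsilon cancels. *)
Lemma eps_unram : unramified chi ->
  mero_eq (fun s => tate_epsilon mu w s chi psi)
    (fun s => (sq ^ (- e))%:C * (chi w * Q s) ^ (- e)).
Proof.
move=> hu; have hu' : unramified chi' by apply/unram_inv.
pose A j := ash nu psi one chi' j.
have A_low j : j < e - 1 -> A j = 0.
  exact: (ash_low hnu hp (@uinv_one R F) (unram_uinv hchi' hu')).
have A_high j : e <= j -> A j = chi' w ^ j * (sq ^ e * (1 - q^-1))%:C.
  by move=> h; rewrite /A ash1 (gsum_unram_high v2 mu_sd hp hchi' hu' w0 vw h).
have n11 : ~ PF 1 (1 : F) by move/(PFE _ (oner_neq0 F)); rewrite val1.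
have A_m1 : A (e - 1) = - (chi' w ^ (e - 1) * (sq ^ e * q^-1)%:C).
  rewrite /A ash1 (gsum_unram hnu hp _ _ hchi' hu' w0 vw).
  have e1 : e - (e - 1) = 1 by ring.
  rewrite e1 subrr (subrK 1 e) (indF0 n11) (indF1 (@PF01 F)) mulr0 mulr1 sub0r.
  have -> : (sq ^ e * q^-1)%:C = (q ^ (e - 1))%:C * (vol nu e)%:C :> C.
    rewrite -rmorphM (vol_self_dual e hp (mu_sd hp)).
    by rewrite -[q^-1]/(q ^ (-1)) !qzS -!sqzD; congr ((sq ^ _)%:C); ring.
  by ring.
have cz0 : chi' w != 0 by exact: chi_neq0.
have dE j : dash w 1 nu psi one chi' j = A j - chi' w * A (j - 1) by rewrite /dash expr1.
have D0 : dash w 1 nu psi one chi' (e - 1) = A (e - 1).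
  by rewrite dE (A_low (e - 1 - 1)) ?mulr0 ?subr0 //; lia.
have zS (z : C) (k : int) : z != 0 -> z ^ (k - 1) = z ^ k / z.
  by move=> z0; rewrite expfzDr // exprN1.
have D1 : dash w 1 nu psi one chi' e = chi' w ^ e * (sq ^ e)%:C.
  rewrite dE A_m1 A_high // (zS _ _ cz0) !rmorphM rmorphB /= rmorph1.
  by move: (chi' w ^ e) (chi' w) cz0 (sq ^ e)%:C (q^-1)%:C => t1 t2 t20 t3 t4; field.
have hS j : j \notin [:: e - 1; e] -> dash w 1 nu psi one chi' j = 0.
  rewrite !inE negb_or dE => /andP [j1 j2]; have [h|h] := ltP j e.
    by rewrite !A_low ?mulr0 ?subr0 //; lia.
  have h' : e <= j - 1 by lia.
  rewrite (A_high j h) (A_high (j - 1) h') (zS _ _ cz0).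
  by move: (chi' w ^ j) (chi' w) cz0 (_%:C) => t1 t2 t20 t3; field.
have uS : uniq [:: e - 1; e] by rewrite /= inE andbT; lia.
move=> s0; have G := tate_gammaE v2 mu_sd hp w0 vw hchi uS hS s0.
have N1 := Dn_near w0 vw n01 s0 hchi; have N2 := Dn_near1 w0 vw n01 s0 hchi'.
apply: dnearC2 G (dnear_and N1 N2) => s /= GE [d1 d2].
rewrite /tate_epsilon GE /tateL; case: asboolP => // _; case: asboolP => // _.
rewrite -/(Q s) -/(Q (1 - s)); move: d1 d2; rewrite /Dn !expr1 => d1 d2.
rewrite invrK /PT !big_cons big_nil addr0 D0 D1 A_m1 Q_sub1.
rewrite Q_sub1 in d2.
have -> : chi' w = (chi w)^-1 by rewrite /chexp exprN1.
rewrite /chexp exprN1 in d2.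
have hb := @Q_neq0 R F s; move: (Q s) hb d1 d2 => b b0 d1 d2.
have p0 : q%:C != 0 :> C by rewrite qC expf_neq0 // sqC_neq0.
have -> : (sq ^ e * q^-1)%:C = (sq ^ e)%:C * (q%:C)^-1 :> C.
  by rewrite rmorphM rmorphV //= unitfE gt_eqF // (@q_gt0 R F).
pose y : C := (chi w)^-1 * (q%:C^-1 / b).
have y0 : y != 0 by rewrite !mulf_neq0 ?invr_eq0.
have E1 k : (q%:C^-1 / b) ^ k * (chi w)^-1 ^ k = y ^ k by rewrite -expfzMl mulrC.
have E2 : (sq ^ (- e))%:C * (chi w * b) ^ (- e) = (sq ^ e)%:C * y ^ e.
  have -> : y = (q%:C * (chi w * b))^-1 by rewrite /y !invfM; ring.
  rewrite exprz_inv (expfzMl q%:C) mulrA; congr (_ * _).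
  rewrite qC -[sq%:C ^+ 2]/(sq%:C ^ 2%:Z) exprz_exp !szE -expfzDr ?sqC_neq0 //.
  by congr (_ ^ _); ring.
rewrite E2 (_ : _ + _ = (sq ^ e)%:C * y ^ e * (1 - chi w * b)); last first.
  transitivity (((q%:C^-1 / b) ^ e * (chi w)^-1 ^ e) * (sq ^ e)%:C - ((q%:C^-1 / b) ^ (e - 1) * (chi w)^-1 ^ (e - 1)) * ((sq ^ e)%:C * (q%:C)^-1)).
    move: ((q%:C^-1 / b) ^ e) ((chi w)^-1 ^ e) (sq ^ e)%:C ((q%:C^-1 / b) ^ (e - 1)) ((chi w)^-1 ^ (e - 1)) (q%:C)^-1.
    by move=> t1 t2 t3 t4 t5 t6; ring.
  rewrite !E1 (zS _ _ y0) /y; move: (sq ^ e)%:C (_ ^ e) => k1 k2.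
  by move: (chi w) (q%:C) cw0 p0 => k3 k4 h3 h4; field; rewrite h3 h4 b0.
move: d1 d2; set A1 := 1 - chi w * b; set A2 := 1 - (chi w)^-1 * _.
by move: (sq ^ e)%:C (y ^ e) A1 A2 => k1 k2 A1 A2 d1 d2; field; rewrite ?d1 ?d2.
Qed.

(** Only the shell e - c is nonzero. Multiplication by [Dn] gives two coefficients whose sum is that
    one times [Dn], so the quotient is a single monomial. *)
Lemma eps_ram c : exact_cond chi c -> ~ unramified chi ->
  mero_eq (fun s => tate_epsilon mu w s chi psi)
    (fun s => gsum nu psi chi' (e - c%:Z) 1 * Q s ^ (c%:Z - e)).
Proof.
move=> hc hr; have hc' := exact_cond_inv hchi hc.
set G' := gsum _ _ _ _ _; pose j0 : int := e - c%:Z.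
have AE j : ash nu psi one chi' j = (j == j0)%:R * ((q ^ j)%:C * G').
  rewrite ash1 (gsum_case hnu hp hchi' hc'); have [->|hj] := eqVneq j j0.
    by rewrite subrr expr0z indF1 /= ?(chi1 hchi') ?invr1 ?mul1r //; split; rewrite ?oner_neq0 ?val1.
  rewrite indF0 ?mul0r ?mulr0 //= => -[_]; rewrite val1 => h.
  by move/eqP: hj; apply; rewrite /j0; lia.
have dE j : dash w 1 nu psi one chi' j = (j == j0)%:R * ((q ^ j)%:C * G') -
    chi' w * ((j == j0 + 1)%:R * ((q ^ (j - 1))%:C * G')).
  by rewrite /dash expr1 !AE (_ : (j - 1%:Z == j0) = (j == j0 + 1)) //; lia.
have hS j : j \notin [:: j0; j0 + 1] -> dash w 1 nu psi one chi' j = 0.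
  by rewrite !inE negb_or dE => /andP [/negPf -> /negPf ->]; rewrite !mul0r mulr0 subr0.
have uS : uniq [:: j0; j0 + 1] by rewrite /= inE andbT; lia.
move=> s0; have G := tate_gammaE v2 mu_sd hp w0 vw hchi uS hS s0.
have N2 := Dn_near1 w0 vw n01 s0 hchi'.
apply: dnearC2 G N2 => s /= GE d2.
have hr' : ~ unramified chi' by move/unram_inv.
rewrite /tate_epsilon GE /tateL; case: asboolP => // _; case: asboolP => // _.
rewrite mulr1 divr1 /PT !big_cons big_nil addr0 !dE eqxx.
have -> : (j0 == j0 + 1) = false by lia.
have -> : (j0 + 1 == j0) = false by lia.
rewrite eqxx addrK; move: d2; rewrite /Dn expr1 Q_sub1 => d2.
have hb := @Q_neq0 R F s; move: (Q s) hb d2 => b b0 d2.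
have p0 : q%:C != 0 :> C by rewrite qC expf_neq0 // sqC_neq0.
have qz : (q ^ j0)%:C = q%:C ^ j0 :> C by rewrite qzS szE qC -[sq%:C ^+ 2]/(sq%:C ^ 2%:Z) exprz_exp.
have u0 : q%:C^-1 / b != 0 by rewrite mulf_neq0 ?invr_eq0.
have -> : c%:Z - e = - j0 by rewrite /j0; ring.
have -> : (q%:C^-1 / b) ^ (j0 + 1) = (q%:C^-1 / b) ^ j0 * (q%:C^-1 / b) by rewrite expfzDr // expr1z.
have E : (q%:C^-1 / b) ^ j0 * (q ^ j0)%:C = b ^ (- j0).
  by rewrite qz -expfzMl -exprz_inv; congr (_ ^ _); rewrite mulrAC mulVf // mul1r.
rewrite -E /= !mul1r !mul0r !mulr0 subr0 sub0r.
move: ((q%:C^-1 / b) ^ j0) (q ^ j0)%:C (q%:C^-1 / b) (chi' w) d2 => t1 t2 t3 t4 d2.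
by field.
Qed.

End Epsilon.

(** For the shell j = e + i with i odd, the f with e - j = 2 f + 1 is -(i./2) - 1, and -2 f = i + 1
    is the power of chi(w) that appears. *)
Lemma odd_half_shift (e : int) (i : nat) : odd i ->
  [/\ e - (e + i%:Z) = 2 * (- (i./2)%:Z - 1) + 1, - (i./2)%:Z - 1 <= -1,
    - (- (i./2)%:Z - 1) = (i./2.+1)%:Z & (2 * i./2.+1)%N = i.+1].
Proof. by move=> oi; split; lia. Qed.

Lemma even_half_shift (e : int) (i : nat) : ~~ odd i ->
  e - (e + i%:Z) = 2 * - (i./2)%:Z /\ - (i./2)%:Z <= 0.
Proof. by move=> oi; split; lia. Qed.

Lemma odd_predn (n m : nat) : ~~ odd n -> (0 < n)%N -> m = n.-1 ->
  [/\ odd m, m.+1 = n & (m == 0%N) = false].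
Proof. by move=> en n0 ->; split; lia. Qed.

(** * Comparison with the coefficients theta, case by case *)

Section Assembly.
Context {R : realType} {F : padicFieldType}.
Local Notation C := R[i].
Local Notation v := (@pval F).
Local Notation q := ((@residue_card F)%:R : R).
Local Notation Q := (@Q R F).
Local Notation sq := (@sq R F).
Implicit Types (x y z : F).

Lemma mero_eq_aff (f g l : C -> C) (a b : C) : a != 0 -> (forall s, l s = a * s + b) ->
  mero_eq f g -> mero_eq (fun s => f (l s)) (fun s => g (l s)).
Proof.
move=> a0 hl h; rewrite (_ : l = fun s => a * s + b); last exact/funext.
exact: mero_eq_affine.
Qed.

Lemma zeta_nkE nu n l s (chi f : F -> C) :
  zeta_nk nu n l s chi f = zeta nu s chi (fun x => f x * bet n l x).
Proof.
apply: zeta_ext => // x x0; congr (_ * _).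
by rewrite /bet indFE indicE.
Qed.

Lemma uniformizer_val (w : F) : uniformizer w -> w != 0 /\ v w = 1.
Proof.
move=> hw; have [u [u0 vu]] := @exists_unif F.
have hu : PF 1 u by apply/PFE; rewrite ?vu.
have hw1 : PF 1 w.
  by rewrite hw; exists 1; rewrite ?mulr1 //; exact: PF01.
move: hu; rewrite hw => -[x hx E].
have w0 : w != 0 by apply: contraNneq u0 => w0; rewrite -E w0 mul0r.
have x0 : x != 0 by apply: contraNneq u0 => x0; rewrite -E x0 mulr0.
split=> //; move: vu; rewrite -E valM //.
by move: hw1 hx; rewrite (PFE _ w0) (PFE _ x0); lia.
Qed.

Hypothesis v2 : (2 : F) != 0 /\ v 2 = 0.
Variable mu : (F -> C) -> {measure set (borel F) -> \bar R}.
Hypothesis mu_sd : forall psi', nontrivial_addchar psi' -> self_dual_haar psi' (mu psi').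
Variable psi : F -> C.
Hypothesis hp : nontrivial_addchar psi.
Local Notation e := (addcond psi).
Local Notation nu := (mu psi).
Local Notation gam := (weil_index mu psi).
Local Notation ka := (kap mu psi).
Variables (w : F) (chi : F -> C) (n : nat).
Hypotheses (w0 : w != 0) (vw : v w = 1) (hchi : is_mulchar chi).
Hypotheses (n0 : (0 < n)%N) (en : ~~ odd n).
Local Notation chi' := (chexp chi (-1)).
Local Notation chi2 := (chexp chi 2).
Local Notation psi2 := (twist 2 psi).
Let hnu : is_haar nu. Proof. exact: mu_haar. Qed.
Let hchi2 : is_mulchar chi2. Proof. exact: mulchar_exp. Qed.
Let hp2 : nontrivial_addchar psi2. Proof. by apply: twist_nontriv => //; case: v2. Qed.
Let e2 : addcond psi2 = e. Proof. by have [t0 vt] := v2; rewrite addcond_twist // vt subr0. Qed.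
Let cw0 : chi w != 0. Proof. exact: chi_neq0. Qed.
Local Notation A j := (ash nu psi ka chi j).
Local Notation D := (Dn w n chi).

Definition Fm (a : int) (m : nat) s : C :=
  Q s ^ (a + m%:Z) * A (a + m%:Z) + (m == n.-1)%:R * (Q s ^ (a - 1) * A (a - 1) * (1 - (chi w * Q s) ^+ n))
  + (m == 0%N)%:R * (Q s ^ (a + n%:Z) * (A (a + n%:Z) - chi w ^+ n * A a)).

(** Reduces each case to vanishing below a - 1, periodicity above a, and the identity D * theta_m =
    [Fm a m] off a discrete set. *)
Lemma assemble (a k : int) (phi : F -> C) : cond psi chi2 = a -> schwartz phi ->
  (forall j, j < a - 1 -> A j = 0) -> (forall j, a < j -> A (j + n%:Z) = chi w ^+ n * A j) ->
  (forall m, (m < n)%N -> forall s0, \forall s \near s0^', D s * theta mu w n m s chi psi = Fm a m s) ->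
  mero_eq (fun s => zeta_nk nu n k s chi (tilde mu psi phi))
    (fun s => \sum_(0 <= m < n) theta mu w n m s chi psi *
       zeta_nk nu n (m%:Z + cond psi chi2 - k) (1 - s) chi' phi).
Proof.
move=> ca /schwartz_lc lphi low per key.
have [B B0 bk] := kap_bound v2 mu_sd hp.
have hT x : x != 0 -> tilde mu psi phi x = cintegral nu Fstar
    (fun y : borel F => phi y * (ka (x * (y : F)) * psi (x * (y : F)))).
  by move=> x0; rewrite /tilde; apply: eq_cintegral => y _; rewrite mulrA.
have pk z : z != 0 -> ka (w ^+ n * z) = ka z by move=> z0; exact: (kap_per v2 mu_sd hp w0 en z0).
have uW := window_uniq n a.
have oW := window_out n0 (@Q_neq0 R F 0) low per.
have uk := kap_uinv v2 mu_sd hp.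
have H := functional_equation w0 vw n0 hnu hp k hchi uk B0 bk pk lphi hT uW oW.
have key' s0 : \forall s \near s0^', forall m, m \in index_iota 0 n ->
   ((m < n)%N -> D s * theta mu w n m s chi psi = Fm a m s).
  apply: dnear_all => m; have [mn|mn] := ltnP m n; last by apply: dnearC_true.
  by have K := key m mn s0; have K' := K; apply: dnearC2 K K' => s /= h _ _.
move=> s0; have Z5 := dnear_and (H s0) (key' s0).
apply: dnearC2 (Dn_near w0 vw n0 s0 hchi) Z5 => s /= d0 [E K].
apply: (mulfI d0); rewrite zeta_nkE E.
pose g (i : int) := (\sum_(j <- window n a) (j == i %[mod n%:Z])%Z%:R * (Q s ^ j * dash w n nu psi ka chi j)) *
     zeta nu (1 - s) chi' (fun x => phi x * bet n (i - k) x).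
have gp i : g (i + n%:Z) = g i.
  rewrite /g; congr (_ * _); first by apply: eq_bigr => j _; rewrite modzDr.
  apply: zeta_ext => // x x0; congr (_ * _); rewrite !betE //.
  by rewrite (_ : i + n%:Z - k = i - k + n%:Z) ?modzDr //; ring.
(* The sum over classes i mod n is restarted at i = m + a, so that phi is taken in the class m +
   e(psi, chi^2) - k. *)
have WP := window_periodic n0 (@Q_neq0 R F 0) a gp.
rewrite -[LHS]/(\sum_(0 <= i < n) g i%:Z) WP mulr_sumr.
apply: eq_big_seq => m hm; have mn : (m < n)%N by move: hm; rewrite mem_index_iota.
rewrite mulrA (K m hm mn) zeta_nkE ca /g; congr (_ * _).
have W := window_sum (chi w) n0 (@Q_neq0 R F s) low mn.
by rewrite /Fm -W; apply: eq_bigr => j _; rewrite /dash /dshift.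
Qed.

Local Notation X s := (chi w * Q s).

Lemma LnE s : unramified (chexp chi n%:Z) -> tateL w (n%:R * s) (chexp chi n%:Z) = (D s)^-1.
Proof.
move=> hu; rewrite /tateL; case: asboolP => // _.
by rewrite -/(Q _) Q_nat /Dn (exprMn n (chi w)).
Qed.

Lemma Lninv s : unramified (chexp chi n%:Z) ->
  (tateL w (1 - n%:R * s) (chexp chi (- n%:Z)))^-1 = 1 - (q%:C)^-1 * (X s ^+ n)^-1.
Proof.
move=> hu; have hu' : unramified (chexp chi (- n%:Z)).
  by move=> x ux; rewrite /chexp -invr_expz -[_ ^ _]/(chexp chi n%:Z x) hu // invr1.
rewrite /tateL; case: asboolP => // _.
rewrite -/(Q _) Q_sub1 Q_nat invrK /chexp -invr_expz -[chi w ^ n%:Z]/(chi w ^+ n) (exprMn n (chi w)) invfM.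
by congr (1 - _); ring.
Qed.

Lemma X_neq0 s : X s != 0.
Proof. by rewrite mulf_neq0 // Q_neq0. Qed.

Lemma n_half : exists h : nat, (0 < h)%N /\ n = (2 * h)%N.
Proof. by exists n./2; lia. Qed.

Lemma mul1_affine s : s + 2^-1 = 1 * s + 2^-1 :> C. Proof. by rewrite mul1r. Qed.

Lemma mul2_affine s : 2 * s = 2 * s + 0 :> C. Proof. by rewrite addr0. Qed.

Lemma c2_neq0 : (2 : C) != 0. Proof. by rewrite pnatr_eq0. Qed.

Lemma eps2_unram : unramified chi2 -> mero_eq (fun s => tate_epsilon mu w (2 * s) chi2 psi2)
  (fun s => (sq ^ (- e))%:C * (X s ^+ 2) ^ (- e)).
Proof.
move=> hu; have h := mero_eq_aff c2_neq0 mul2_affine (eps_unram v2 mu_sd hp2 w0 vw hchi2 hu).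
move=> s0; have h3 := h s0; have h4 := h s0; apply: dnearC2 h3 h4 => s /= -> _.
rewrite e2 (Q_nat 2) /chexp -[chi w ^ 2]/(chi w ^+ 2) -(exprMn 2 (chi w)) //.
Qed.

Let cst s : C := (weil_index mu (twist (-1) psi))^-1 *
    (tate_epsilon mu w (2 * s) chi2 psi2)^-1 * tate_epsilon mu w (s + 2^-1) chi psi.

Lemma zz (z : C) (k : int) : z != 0 -> (z ^+ 2) ^ k = z ^ k * z ^ k.
Proof. by move=> z0; rewrite expr2 expfzMl. Qed.

(** The factor 1 / gam(psi_-1) is gam(psi), the constant in front of every A_j. In the epsilon
    factor at s + 1/2 the half shift cancels the volume factor, leaving X^-e. *)
Lemma cst_unram : unramified chi ->
  mero_eq cst (fun s => gam * (sq ^ e)%:C * X s ^ e).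
Proof.
move=> hu; have hu2 := @unram_exp R F chi 2 hu.
have h1 := mero_eq_aff (oner_neq0 C) mul1_affine (eps_unram v2 mu_sd hp w0 vw hchi hu).
have h2 := eps2_unram hu2.
move=> s0; apply: dnearC2 (h1 s0) (h2 s0) => s /= E1 E2.
rewrite /cst E1 E2 (weil_psi_neg v2 mu_sd hp) Q_half (zz _ (X_neq0 s)) mulrA (expfzMl (X s)).
rewrite exprz_inv opprK !szE -!invr_expz.
have s0' : sq%:C ^ e != 0 :> C by rewrite expfz_neq0 // sqC_neq0.
have x0 : X s ^ e != 0 by rewrite expfz_neq0 // X_neq0.
by move: gam (sq%:C ^ e) (X s ^ e) s0' x0 => t1 t2 t3 h3 h4; field; rewrite h3 h4.
Qed.

Lemma unram_per (h1 : unramified chi) j : e < j -> A (j + n%:Z) = chi w ^+ n * A j.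
Proof.
move=> hj; have [h [h0 nE]] := n_half.
have [t [ht|ht]] : exists t, e - j = 2 * t \/ e - j = 2 * t + 1 by exists ((e - j) %/ 2)%Z; lia.
  rewrite (ash_unram_even v2 mu_sd hp hchi h1 w0 vw ht); last by lia.
  rewrite (ash_unram_even v2 mu_sd hp hchi h1 w0 vw (f := t - h%:Z)); try by lia.
  by rewrite expfzDr // -[chi w ^ n%:Z]/(chi w ^+ n); ring.
rewrite (ash_unram_odd v2 mu_sd hp hchi h1 w0 vw ht); last by lia.
by rewrite (ash_unram_odd v2 mu_sd hp hchi h1 w0 vw (f := t - h%:Z)) ?mulr0 //; lia.
Qed.

(** For m = n - 1, which is odd, the shell e + m vanishes and the entry comes from the shell e - 1
    alone; the factor 1 - X^n in front of it is [Dn], so no L-factor remains. For m = 0 the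
    correction is zero because here periodicity holds at j = e too. *)
Lemma case_unram (k : int) (phi : F -> C) : unramified chi -> schwartz phi ->
  mero_eq (fun s => zeta_nk nu n k s chi (tilde mu psi phi))
    (fun s => \sum_(0 <= m < n) theta mu w n m s chi psi *
       zeta_nk nu n (m%:Z + cond psi chi2 - k) (1 - s) chi' phi).
Proof.
move=> hu hphi; have hu2 := @unram_exp R F chi 2 hu; have hun := @unram_exp R F chi n%:Z hu.
have [h [h0 nE]] := n_half.
apply: (@assemble e) => //.
- by rewrite /cond /mulcond; case: asboolP => // _; rewrite subr0.
- move=> j hj; apply: (ash_low hnu hp (kap_uinv v2 mu_sd hp) (unram_uinv hchi hu) hj).
- exact: unram_per.
move=> m mn s0; apply: dnearC2 (Dn_near w0 vw n0 s0 hchi) (cst_unram hu s0) => s /= d0 cE.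
have x0 := X_neq0 s; have b0 := @Q_neq0 R F s.
have hX (j : int) : Q s ^ j * chi w ^ j = X s ^ j by rewrite mulrC -expfzMl.
have thE : theta mu w n m s chi psi = cst s *
    (if m == n.-1 then cpow q (- 2^-1) * cpow q s * (chi w)^-1
         else if ~~ odd m then (1 - (q^-1)%:C) * X s ^+ m * (D s)^-1 else 0).
  rewrite /theta (asboolT hu) -/(cst s) (LnE s hun).
  by rewrite -/(Q s) (mulrC (Q s)).
rewrite thE cE /Fm; have [mE|mE] := eqVneq m n.-1.
  have [om _ ->] := odd_predn en n0 mE; have [f1 f2 _ _] := odd_half_shift e om.
  rewrite (ash_unram_odd v2 mu_sd hp hchi hu w0 vw f1 f2).
  rewrite (ash_unram_m1 v2 mu_sd hp hchi hu w0 vw) mulr0 mul0r addr0 add0r mul1r cpow_half cpow_s.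
  have -> : Q s ^ (e - 1) * (gam * (chi w ^ (e - 1) * (sq ^ (e - 1))%:C)) =
     gam * (Q s ^ (e - 1) * chi w ^ (e - 1)) * (sq ^ (e - 1))%:C.
    by move: gam (Q s ^ (e - 1)) (chi w ^ (e - 1)) (sq ^ (e - 1))%:C => t1 t2 t3 t4; ring.
  rewrite hX !szE !expfzDr ?sqC_neq0 // !exprN1 /Dn.
  move: gam (X s ^ e) (sq%:C ^ e) ((chi w * Q s) ^+ n) => t1 t2 t3 t4.
  have := @sqC_neq0 R F; move: (sq%:C) (chi w) (Q s) cw0 b0 => t5 t6 t7 k1 k2 k3.
  by field; rewrite k1 k2 k3.
have [om|om] := boolP (odd m) => /=.
  have -> : (m == 0%N) = false by case: (m) om.
  have [f1 f2 _ _] := odd_half_shift e om.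
  rewrite (ash_unram_odd v2 mu_sd hp hchi hu w0 vw f1 f2).
  by rewrite !mulr0 !mul0r !addr0.
have [f1 f2] := even_half_shift e om; have [f3 f4] := even_half_shift e en.
have f5 : e - e = 2 * 0 by rewrite subrr mulr0.
rewrite (ash_unram_even v2 mu_sd hp hchi hu w0 vw f1 f2).
rewrite (ash_unram_even v2 mu_sd hp hchi hu w0 vw f3 f4).
rewrite (ash_unram_even v2 mu_sd hp hchi hu w0 vw f5 (lexx 0)).
have -> : chi w ^ (e + n%:Z) = chi w ^+ n * chi w ^ e by rewrite expfzDr // mulrC.
have -> : gam * (chi w ^+ n * chi w ^ e * (sq ^ e * (1 - q^-1))%:C) -
   chi w ^+ n * (gam * (chi w ^ e * (sq ^ e * (1 - q^-1))%:C)) = 0.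
  by move: gam (chi w ^+ n) (chi w ^ e) (sq ^ e * (1 - q^-1))%:C => t1 t2 t3 t4; ring.
rewrite mul0r !mulr0 !addr0.
have -> : Q s ^ (e + m%:Z) * (gam * (chi w ^ (e + m%:Z) * (sq ^ e * (1 - q^-1))%:C)) =
   gam * (Q s ^ (e + m%:Z) * chi w ^ (e + m%:Z)) * (sq ^ e * (1 - q^-1))%:C.
  by move: gam (Q s ^ (e + m%:Z)) (chi w ^ (e + m%:Z)) (sq ^ e * (1 - q^-1))%:C => t1 t2 t3 t4; ring.
rewrite hX expfzDr // -[X s ^ m%:Z]/(X s ^+ m) rmorphM rmorphB /= rmorph1.
by move: gam (sq ^ e)%:C (X s ^ e) (X s ^+ m) (q^-1)%:C (D s) d0 => t1 t2 t3 t4 t5 t6 k1; field.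
Qed.

(** On the shell v z = e - 1 the characters chi and chi^-1 differ by the constant chi(w)^(2(e-1)),
    which relates the Gauss sum in epsilon to the one in A_j. *)
Lemma cst_tame : exact_cond chi 1 -> ~ unramified chi -> unramified chi2 ->
  mero_eq (fun s => cst s * chi (-1)) (fun s => gam * chi (-1) * gsum nu psi chi (e - 1%:Z) 1 *
    (sq ^ (2 * e - 1))%:C * Q s ^ (e - 1) * X s ^+ 2).
Proof.
move=> hc hr hu2.
have h1 := mero_eq_aff (oner_neq0 C) mul1_affine (eps_ram v2 mu_sd hp w0 vw hchi hc hr).
have h2 := eps2_unram hu2.
have GE : gsum nu psi chi (e - 1%:Z) 1 = (chi w ^+ 2) ^ (e - 1) * gsum nu psi chi' (e - 1%:Z) 1.
  rewrite /gsum -(IZ hnu); last exact: (lc_gsum hp (mulchar_exp (-1) hchi) (exact_cond_inv hchi hc)).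
  apply: (@eqI _ _ nu) => z; have [->|z0] := eqVneq z 0; first by rewrite !ind_win0 !(mulr0, mul0r).
  rewrite (ind_winE _ z0); case: eqP => [vz|_]; last by rewrite !(mulr0, mul0r).
  rewrite -vz -(chi_sqE hchi hu2 w0 vw z0) /chexp exprN1.
  have := chi_neq0 hchi z0; move: (chi z) (psi _) => t1 t2 t10; by field.
move=> s0; apply: dnearC2 (h1 s0) (h2 s0) => s /= E1 E2.
rewrite /cst E1 E2 (weil_psi_neg v2 mu_sd hp) Q_half GE.
have x0 := X_neq0 s; have b0 := @Q_neq0 R F s; have u0 := @sqC_neq0 R F.
have -> : (X s ^+ 2) ^ (- e) = ((X s ^ e) * (X s ^ e))^-1 by rewrite -invr_expz (zz _ x0).
have -> : (Q s * (sq%:C)^-1) ^ (1%:Z - e) = (Q s ^ (e - 1))^-1 * (sq%:C) ^ (e - 1).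
  rewrite -opprB -invr_expz expfzMl invfM; congr (_ * _).
  by rewrite exprz_inv -invr_expz invrK.
have -> : (sq ^ (- e))%:C = (sq%:C ^ e)^-1 :> C by rewrite szE -invr_expz.
have -> : (sq ^ (2 * e - 1))%:C = sq%:C ^ e * sq%:C ^ (e - 1) :> C.
  by rewrite szE -expfzDr //; congr (_ ^ _); ring.
have -> : X s ^ e = X s ^ (e - 1) * X s by rewrite -[in LHS](subrK 1 e) expfzDr // expr1z.
have -> : X s ^ (e - 1) = chi w ^ (e - 1) * Q s ^ (e - 1) by rewrite expfzMl.
rewrite (zz _ cw0).
have k1 : sq%:C ^ e != 0 :> C by rewrite expfz_neq0.
have k2 : Q s ^ (e - 1) != 0 by rewrite expfz_neq0.
have k3 : chi w ^ (e - 1) != 0 by rewrite expfz_neq0.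
move: gam (chi (-1)) (gsum _ _ _ _ _) (sq%:C ^ e) (sq%:C ^ (e - 1)) (Q s ^ (e - 1)) (chi w ^ (e - 1)) k1 k2 k3.
move: (X s) x0 => x x0 t1 t2 t3 t4 t5 t6 t7 k1 k2 k3.
by field; rewrite ?k1 ?k2 ?k3 ?x0.
Qed.

Lemma tame_per (hc : exact_cond chi 1) (hu2 : unramified chi2) j : e < j ->
  A (j + n%:Z) = chi w ^+ n * A j.
Proof.
move=> hj; have [h [h0 nE]] := n_half.
have [t [ht|ht]] : exists t, e - j = 2 * t \/ e - j = 2 * t + 1 by exists ((e - j) %/ 2)%Z; lia.
  rewrite (ash_tame_even v2 mu_sd hp hchi hc w0 vw ht); last by lia.
  by rewrite (ash_tame_even v2 mu_sd hp hchi hc w0 vw (f := t - h%:Z)) ?mulr0 //; lia.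
rewrite (ash_tame_odd v2 mu_sd hp hchi hc hu2 w0 vw ht); last by lia.
rewrite (ash_tame_odd v2 mu_sd hp hchi hc hu2 w0 vw (f := t - h%:Z)); try by lia.
have -> : (chi w ^+ 2) ^ (- (t - h%:Z)) = (chi w ^+ 2) ^ (- t) * chi w ^+ n.
  rewrite opprB addrC expfzDr ?expf_neq0 //; congr (_ * _).
  by rewrite nE exprM.
ring.
Qed.

Lemma case_tame (k : int) (phi : F -> C) : ~ unramified chi -> unramified chi2 -> schwartz phi ->
  mero_eq (fun s => zeta_nk nu n k s chi (tilde mu psi phi))
    (fun s => \sum_(0 <= m < n) theta mu w n m s chi psi *
       zeta_nk nu n (m%:Z + cond psi chi2 - k) (1 - s) chi' phi).
Proof.
move=> hr hu2 hphi; have hc := mulcond_exact hchi hr.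
have cE1 := exact_cond_tame v2 hchi hc hu2; rewrite cE1 in hc.
have [h [h0 nE]] := n_half.
have hun : unramified (chexp chi n%:Z).
  move=> x ux; rewrite /chexp -[_ ^ _]/(chi x ^+ n) nE exprM.
  by have -> : chi x ^+ 2 = 1 by [exact: hu2 x ux]; rewrite expr1n.
apply: (@assemble e) => //.
- by rewrite /cond /mulcond; case: asboolP => // _; rewrite subr0.
- move=> j hj; apply: (ash_low hnu hp (kap_uinv v2 mu_sd hp) (exact_uinv hchi hc) hj).
- exact: tame_per.
move=> m mn s0; apply: dnearC2 (Dn_near w0 vw n0 s0 hchi) (cst_tame hc hr hu2 s0) => s /= d0 cE.
have x0 := X_neq0 s; have b0 := @Q_neq0 R F s; have u0 := @sqC_neq0 R F.
pose K0 : C := gam * chi (-1) * gsum nu psi chi (e - 1%:Z) 1 * (sq ^ (2 * e - 1))%:C.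
have p0 : q%:C != 0 :> C by rewrite qC expf_neq0.
have qV : (q^-1)%:C = (q%:C)^-1 :> C by rewrite rmorphV //= unitfE gt_eqF // (@q_gt0 R F).
have qS : (1 - q^-1)%:C = 1 - (q%:C)^-1 :> C by rewrite -qV; exact: (rmorphB (real_complex R) 1 q^-1).
have thE : theta mu w n m s chi psi = (cst s * chi (-1)) * X s ^ (m%:Z - 1) * (D s)^-1 *
    (if m == n.-1 then 1 - (q%:C)^-1 * (X s ^+ n)^-1 else if odd m then 1 - (q^-1)%:C else 0).
  rewrite /theta (asboolF hr) (asboolT hu2) -/(cst s) (LnE s hun) (Lninv s hun).
  by rewrite -/(Q s) (mulrC (Q s)).
have AO (i : nat) : odd i -> A (e + i%:Z) = K0 * chi w ^+ i.+1 * (1 - q^-1)%:C.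
  move=> oi; have [f1 f2 f3 f4] := odd_half_shift e oi.
  rewrite (ash_tame_odd v2 mu_sd hp hchi hc hu2 w0 vw f1 f2).
  have -> : (chi w ^+ 2) ^ (- (- (i./2)%:Z - 1)) = chi w ^+ i.+1.
    by rewrite f3 -[_ ^ _]/((chi w ^+ 2) ^+ _) -exprM f4.
  by rewrite rmorphM /K0; ring.
have AEv (i : nat) : ~~ odd i -> A (e + i%:Z) = 0.
  move=> oi; have [f1 f2] := even_half_shift e oi.
  exact: (ash_tame_even v2 mu_sd hp hchi hc w0 vw f1 f2).
have AE0 : A e = 0 by rewrite -[e]addr0; exact: (AEv 0%N isT).
have XE : X s ^ (m%:Z - 1) = X s ^+ m / X s by rewrite expfzDr // exprN1.
have bE (i : nat) : Q s ^ (e + i%:Z) = Q s ^ (e - 1) * Q s ^+ i.+1.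
  by rewrite -[Q s ^+ i.+1]/(Q s ^ i.+1%:Z) -expfzDr // intS addrA subrK.
rewrite thE cE -/K0 XE /Fm (AEv n en) AE0 mulr0 subrr !mulr0 addr0.
have [mE|mE] := eqVneq m n.-1.
  have [om nS _] := odd_predn en n0 mE.
  (* With this value the class n - 1 gives K0 times X^n (1 - q^-1) - q^-1 (1 - X^n) = X^n (1 - q^-1
     X^-n), up to Q^(e-1): the origin of the factor L^-1(1 - ns, chi^-n). *)
  have A1 : A (e - 1) = - (K0 * (q%:C)^-1).
    rewrite (ash_jac v2 mu_sd hp hchi hc) (jac_tame v2 mu_sd hp hchi hc hu2 w0 vw) /K0.
    have E : (sq ^ (2 * e - 1))%:C * (q%:C)^-1 = (sq ^ (e - 1%:Z))%:C * (sq ^ (e - 2))%:C :> C.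
      rewrite -rmorphM -sqzD -qV -rmorphM -[q^-1]/(q ^ (-1)) qzS -sqzD.
      by congr ((sq ^ _)%:C); ring.
    transitivity (- (gam * chi (-1) * gsum nu psi chi (e - 1%:Z) 1 * ((sq ^ (2 * e - 1))%:C * (q%:C)^-1))).
      rewrite E; move: gam (chi (-1)) (gsum _ _ _ _ _) (sq ^ (e - 1%:Z))%:C (sq ^ (e - 2))%:C => t1 t2 t3 t4 t5.
      ring.
    by move: gam (chi (-1)) (gsum _ _ _ _ _) (sq ^ _)%:C (q%:C)^-1 => t1 t2 t3 t4 t5; ring.
  rewrite (AO m om) A1 bE nS mul1r !(exprMn _ (chi w)) /Dn (exprMn n (chi w)) qS.
  have -> : chi w ^+ n = chi w ^+ m * chi w by rewrite -nS exprSr.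
  have -> : Q s ^+ n = Q s ^+ m * Q s by rewrite -nS exprSr.
  move: d0; rewrite /Dn (exprMn n (chi w)) -nS !exprSr => d0.
  have k1 : chi w ^+ m != 0 by rewrite expf_neq0.
  have k2 : Q s ^+ m != 0 by rewrite expf_neq0.
  clear AO A1; clearbody K0; clear cE thE XE bE AEv AE0.
  move: d0 k1 k2; move: K0 (Q s ^ (e - 1)) (chi w ^+ m) (Q s ^+ m) (chi w) (Q s) (q%:C) cw0 b0 p0.
  move=> t1 t2 t3 t4 t5 t6 t7 l1 l2 l3 d0 k1 k2.
  by field; rewrite ?l1 ?l2 ?l3 ?k1 ?k2 ?d0.
rewrite mul0r addr0; have [om|om] := boolP (odd m); last by rewrite (AEv m om) !mulr0.
rewrite (AO m om) bE qS qV (exprMn m (chi w)) (exprSr (Q s)) (exprSr (chi w)).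
clear AO; clearbody K0; clear cE thE XE bE AEv AE0.
move: (D s) d0 K0 (Q s ^ (e - 1)) (chi w ^+ m) (Q s ^+ m) (chi w) (Q s) (q%:C)^-1 cw0 b0.
move=> t0 d0 t1 t2 t3 t4 t5 t6 t7 l1 l2.
by field; rewrite ?l1 ?l2 ?d0.
Qed.

(** The single coefficient A_a is a multiple of G(chi) jac(chi^-1), while the epsilon factors
    contain G(chi^-1) and chi(4) G(chi^-2). They are linked by G(chi) G(chi^-1) = q^(c-e) chi(-1)
    and by [gauss_sq] for chi^-1, whose error vanishes as chi^-2 has the same conductor. *)
Lemma cst_wild : ~ unramified chi -> ~ unramified chi2 -> let a := e - (mulcond chi)%:Z in
  mero_eq (fun s => cst s * chi (-1)) (fun s => Q s ^ a * A a).
Proof.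
move=> hr hr2 a; have hc := mulcond_exact hchi hr.
set c := mulcond chi in a hc *; have hc2 := exact_cond_sq v2 hchi hc hr2.
have hchi' := mulchar_exp (-1) hchi; have hc' := exact_cond_inv hchi hc.
have h1 := mero_eq_aff (oner_neq0 C) mul1_affine (eps_ram v2 mu_sd hp w0 vw hchi hc hr).
have h2 := mero_eq_aff c2_neq0 mul2_affine (eps_ram v2 mu_sd hp2 w0 vw hchi2 hc2 hr2).
have [t0 vt] := v2.
have cE2 : chexp chi2 (-1) = chexp chi' 2.
  apply/funext => x; rewrite /chexp !exprN1.
  by rewrite exprz_inv -invr_expz.
have hr2' : ~ unramified (chexp chi' 2) by rewrite -cE2 => /unram_inv.
have hc2' := exact_cond_sq v2 hchi' hc' hr2'.
have hchi2' := mulchar_exp 2 hchi'.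
rewrite e2 cE2 in h2.
(* Since 2 is a unit, psi_2 and psi have the same self-dual measure. Twisting by 2 only multiplies
   the sum by chi(2)^2 = chi(4), the very constant of [gauss_sq]: this is why epsilon is taken at
   psi_2. *)
have G2E : gsum (mu psi2) psi2 (chexp chi' 2) a 1 = chi 4 * gsum nu psi (chexp chi' 2) a 1.
  have l2 : lc (fun z => chexp chi' 2 z * indF (win a a) z * psi (2 * z)).
    exact: (lc_gsum hp hchi2' hc2' a 2).
  have -> : gsum (mu psi2) psi2 (chexp chi' 2) a 1 = gsum nu psi (chexp chi' 2) a 2.
    rewrite /gsum -(@eqI _ _ (mu psi2) (fun z => chexp chi' 2 z * indF (win a a) z * psi (2 * z))); last first.
      by move=> z; rewrite /twist mul1r.
    rewrite (vol_ratio hnu (mu_haar mu_sd hp2) l2).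
    rewrite (vol_self_dual 0 hp2 (mu_sd hp2)) (vol_self_dual 0 hp (mu_sd hp)) e2 divff ?mul1r //.
    by rewrite expfz_neq0 // sq_neq0.
  rewrite (gsum_mid hnu hp hchi2' hc2') //; last by rewrite vt /a subrr.
  rewrite vt expr0z mulr1; congr (_ * _).
  rewrite /chexp exprN1 exprz_inv -invr_expz invrK -[chi 2 ^ 2]/(chi 2 ^+ 2) -(chiX hchi) //.
  by congr chi; ring.
have GG := gauss_mul hnu hp hchi hc.
have [N GS [/(_ hc2') N0 _]] := gauss_sq hnu hp v2 hchi' hc'.
rewrite N0 addr0 in GS.
have vv : vol nu (e - c%:Z) * vol nu c%:Z = 1.
  by rewrite !(vol_self_dual _ hp (mu_sd hp)) -sqzD (_ : _ + _ = 0) //; ring.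
rewrite vv mulr1 in GG.
have c4 : (chi' 4)^-1 = chi 4 by rewrite /chexp exprN1 invrK.
rewrite c4 in GS.
have n10 : -1 != 0 :> F by rewrite oppr_eq0 oner_eq0.
have cm0 := chi_neq0 hchi n10.
have qa0 : (q ^ (c%:Z - e))%:C != 0 :> C := qz_neq0 _.
(* Nonvanishing comes from the product formula for Gauss sums, and then from the square formula for
   chi^-2, which has G(chi^-1)^2 as a multiple. *)
have G0 : gsum nu psi chi' a 1 != 0.
  apply: contra_neq (mulf_neq0 qa0 cm0) => G0; by rewrite -GG G0 mulr0.
have Gs0 : chi 4 * gsum nu psi (chexp chi' 2) a 1 != 0.
  apply: contraNneq (expf_neq0 2 G0) => H.
  by rewrite GS -mulrA [jac _ _ * _]mulrC mulrA -[_ * chi 4 * _]mulrA H mulr0 mul0r.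
have key : chi (-1) * gsum nu psi chi' a 1 = gsum nu psi chi a 1 * jac nu chi' * (chi 4 * gsum nu psi (chexp chi' 2) a 1).
  apply: (mulfI (mulf_neq0 qa0 G0)).
  transitivity (((q ^ (c%:Z - e))%:C * chi (-1)) * gsum nu psi chi' a 1 ^+ 2); first by ring.
  by rewrite -GG GS -/a; ring.
move=> s0; apply: dnearC2 (h1 s0) (h2 s0) => s /= E1 E2.
rewrite /cst E1 E2 (weil_psi_neg v2 mu_sd hp) (ash_jac v2 mu_sd hp hchi hc) Q_half -/c -/a G2E (Q_nat 2).
have b0 := @Q_neq0 R F s; have u0 := @sqC_neq0 R F.
have ca : c%:Z - e = - a by rewrite /a; ring.
have -> : (Q s * (sq%:C)^-1) ^ (c%:Z - e) = (Q s ^ a)^-1 * (sq%:C) ^ a.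
  by rewrite ca -invr_expz expfzMl invfM exprz_inv -invr_expz invrK.
have -> : (Q s ^+ 2) ^ (c%:Z - e) = (Q s ^ a * Q s ^ a)^-1 by rewrite ca -invr_expz (zz _ b0).
rewrite szE; have k1 : Q s ^ a != 0 by rewrite expfz_neq0.
move: key Gs0; set Gs := chi 4 * _; set G' := gsum nu psi chi' a 1; set G := gsum nu psi chi a 1.
move: Gs G' G (jac nu chi') (chi (-1)) gam (Q s ^ a) (sq%:C ^ a) k1 => t1 t2 t3 t4 t5 t6 t7 t8 k1 key k2.
transitivity (t6 * t7 * t8 * (t5 * t2) / t1); first by field; rewrite k1 k2.
by rewrite key; field.
Qed.

Lemma case_wild (k : int) (phi : F -> C) : ~ unramified chi -> ~ unramified chi2 -> schwartz phi ->
  mero_eq (fun s => zeta_nk nu n k s chi (tilde mu psi phi))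
    (fun s => \sum_(0 <= m < n) theta mu w n m s chi psi *
       zeta_nk nu n (m%:Z + cond psi chi2 - k) (1 - s) chi' phi).
Proof.
move=> hr hr2 hphi; have hc := mulcond_exact hchi hr.
have cw := cst_wild hr hr2; set c := mulcond chi in hc cw.
have hc2 := exact_cond_sq v2 hchi hc hr2.
have uk := kap_uinv v2 mu_sd hp; have [c1 tc [a1 [a10 va1 ha1 ca1]]] := hc.
have uc := exact_uinv hchi hc.
have c1' : 1 <= c%:Z by lia.
have ukc := uinvW c1' uk.
have Alow j : j < e - c%:Z -> A j = 0 by move=> hj; exact: (ash_low hnu hp ukc uc hj).
have Ahigh j : e - c%:Z < j -> A j = 0.
  (* For c >= 2 the witness a1 lies in 1 + P, under which [kap] is invariant. For c = 1 it may be
     any unit, so a square b^2 is used instead: [kap] is invariant under squares, and chi(b^2) != 1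
     for some unit b because chi^2 is ramified. *)
  move=> hj; have [c2|c2] := leqP 2 c.
    have hk z : z != 0 -> ka (a1 * z) = ka z.
      move=> z0; rewrite (_ : a1 * z = z + (a1 - 1) * z); last by ring.
      have [_ ->] := uk => //; rewrite addrC; apply: PFM (PF_val z); apply: PFW ha1; lia.
    exact: (ash_high hnu hp hchi ukc uc a10 va1 ha1 ca1 hk hj).
  have cE : c = 1%N by lia.
  have [_ _ [b [b0 vb _ cb]]] := hc2.
  have bb0 : b ^+ 2 != 0 by rewrite expf_neq0.
  have vbb : v (b ^+ 2) = 0 by rewrite expr2 valM // vb.
  have hb : PF (c%:Z - 1) (b ^+ 2 - 1).
    by rewrite cE subrr; apply: PFB; [apply/(PFE _ bb0); rewrite vbb | exact: PF01].
  have cbb : chi (b ^+ 2) != 1 by rewrite (chiX hchi).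
  have hk z : z != 0 -> ka (b ^+ 2 * z) = ka z by move=> z0; exact: (kap_sq v2 mu_sd hp).
  exact: (ash_high hnu hp hchi ukc uc bb0 vbb hb cbb hk hj).
have [h [h0 nE]] := n_half.
apply: (@assemble (e - c%:Z)) => //.
- by rewrite /cond (exact_cond_uniq (mulcond_exact hchi2 hr2) hc2).
- by move=> j hj; apply: Alow; lia.
- by move=> j hj; rewrite !Ahigh ?mulr0 //; lia.
move=> m mn s0; have H := cw s0; have H' := cw s0; apply: dnearC2 H H' => s /= cE _.
have thE : theta mu w n m s chi psi = if m == 0%N then cst s * chi (-1) else 0.
  by rewrite /theta; case: asboolP => // _; case: asboolP.
rewrite thE /Fm [A (e - c%:Z - 1)]Alow; last by lia.
rewrite mulr0 mul0r mulr0 addr0 [A (e - c%:Z + n%:Z)]Ahigh; last by lia.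
have [->|m0] := eqVneq m 0%N.
  have -> : Q s ^ (e - c%:Z + n%:Z) = Q s ^ (e - c%:Z) * Q s ^+ n by rewrite expfzDr ?Q_neq0.
  rewrite addr0 cE /Dn (exprMn n (chi w)) mul1r.
  by move: (Q s ^ _) (Q s ^+ n) (chi w ^+ n) (A _) => t1 t2 t3 t4; ring.
by rewrite Ahigh ?mulr0 ?mul0r ?addr0 //; lia.
Qed.

End Assembly.

Theorem theorem3p2 (R : realType) (F : padicFieldType) (p n : nat)
    (varpi : F) (mu : (F -> R[i]) -> {measure set (borel F) -> \bar R})
    (chi psi phi : F -> R[i]) (k : nat)
    (p_residual : residual_char (F := F) p)
    (p_coprime_n : coprime p n)
    (n_ge1 : (1 <= n)%N)
    (roots_of_unity : exists z : F, n.-primitive_root z)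
    (varpi_generator : uniformizer varpi)
    (mu_self_dual : forall psi' : F -> R[i],
       nontrivial_addchar psi' -> self_dual_haar psi' (mu psi'))
    (n_even : ~~ odd n)
    (chi_char : is_mulchar chi)
    (psi_char : nontrivial_addchar psi)
    (phi_schwartz : schwartz phi)
    (k_lt_n : (0 <= k < n)%N) :
  mero_eq
    (fun s => zeta_nk (mu psi) n k%:Z s chi (tilde mu psi phi))
    (fun s => \sum_(0 <= m < n)
       theta mu varpi n m s chi psi *
       zeta_nk (mu psi) n (m%:Z + cond psi (chexp chi 2) - k%:Z)
         (1 - s) (chexp chi (-1)) phi).
Proof.
(* As 2 divides n and p is prime to n, p is odd; hence 2 is a unit, on which all the computations
   with the Weil index rest. *)
have podd : odd p.
  apply/negPn/negP => pe.
  have : (2 %| gcdn p n)%N by rewrite dvdn_gcd !dvdn2 pe n_even.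
  by rewrite (eqP p_coprime_n).
have v2 := val_2 p_residual podd.
have [w0 vw] := uniformizer_val varpi_generator.
have [hu|hr] := pselect (unramified chi); first exact: case_unram.
have [hu2|hr2] := pselect (unramified (chexp chi 2)); first exact: case_tame.
exact: case_wild.
Qed.
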